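(* Let $l_0,l_1>0$ and $l_2,l_3$ be real numbers with $l_0\ge\frac12$ or $l_1\ge\frac12$. Let $\tilde\alpha_2\in\{-l_2,l_2+1\}$ and $\tilde\alpha_3\in\{-l_3,l_3+1\}$, and assume $d=-\frac{l_0+l_1}{2}-1-\frac{\tilde\alpha_2+\tilde\alpha_3}{2}\in\mathbb{Z}_{\ge0}$. Then for $-1<p<1$ the set of eigenvalues of the gauge-transformed Hamiltonian $H(p)$ on the finite dimensional space $\tilde V_{l_0+1,l_1+1,\tilde\alpha_2,\tilde\alpha_3}$ coincides with the set of small eigenvalues of $H(p)$ on the Hilbert space $\mathbf{H}$ from the bottom. In other words, the $m$-th smallest eigenvalue of $H(p)$ on $\mathbf{H}$ is also an eigenvalue of $H(p)$ on $\tilde V_{l_0+1,l_1+1,\tilde\alpha_2,\tilde\alpha_3}$ if and only if $m\le d+1$.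
   Context: Let $\Phi(x)=(\sin\pi x)^{l_0+1}(\cos\pi x)^{l_1+1}$. $\mathbf{H}$ is the Hilbert space of measurable $f:\mathbb{R}\to\mathbb{C}$ (modulo a.e. equality) with $f(x+1)=f(x)$, $f(-x)=f(x)$ a.e. and $\int_0^1|f|^2|\Phi|^2dx<\infty$, with inner product $\langle f,g\rangle_\Phi=\int_0^1\overline{f}g|\Phi|^2dx$. $H(p)=\Phi^{-1}\circ\big(-\frac{d^2}{dx^2}+\sum_{i=0}^3l_i(l_i+1)\wp(x+\omega_i)\big)\circ\Phi$, where $\wp$ is the Weierstrass function with periods $(1,\tau)$, $p=e^{\pi\sqrt{-1}\tau}$ (for real $p$: $\tau\in\sqrt{-1}\,\mathbb{R}_{>0}$ if $p>0$ and $\tau\in1+\sqrt{-1}\,\mathbb{R}_{>0}$ if $p<0$; $p=0$ is understood as the limit), $\omega_0=0,\ \omega_1=\frac12,\ \omega_2=\frac{1+\tau}2,\ \omega_3=\frac\tau2$. At $p=0$, $\wp(x)$, $\wp(x+\frac12)$, $\wp(x+\omega_2)$, $\wp(x+\omega_3)$ become $\frac{\pi^2}{\sin^2\pi x}-\frac{\pi^2}3$, $\frac{\pi^2}{\cos^2\pi x}-\frac{\pi^2}3$, $-\frac{\pi^2}3$, $-\frac{\pi^2}3$. $H(p)$ with domain $\mathbf{H}\cap C^\infty(\mathbb{R})$ is essentially selfadjoint for $-1<p<1$, and its eigenvalues on $\mathbf{H}$ are those of its closure, a selfadjoint operator that is bounded below and has discrete spectrum. Finite dimensional space. Let $e_i=\wp(\omega_i)$,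 and let $\sigma_i(x)/\sigma(x)$ $(i=1,2,3)$ be the meromorphic functions with $(\sigma_i/\sigma)^2=\wp-e_i$ and $\sigma_i(x)/\sigma(x)\sim1/x$ at $x=0$ ($\sigma$ the Weierstrass sigma function, $\sigma_i$ the co-sigma functions). For $\tilde\alpha_0=l_0+1$, $\tilde\alpha_1=l_1+1$ and $d=-\sum_{i=0}^3\tilde\alpha_i/2\in\mathbb{Z}_{\ge0}$, $V_{\tilde\alpha_0,\tilde\alpha_1,\tilde\alpha_2,\tilde\alpha_3}$ is the span of $(\sigma_1/\sigma)^{\tilde\alpha_1}(\sigma_2/\sigma)^{\tilde\alpha_2}(\sigma_3/\sigma)^{\tilde\alpha_3}\wp^n$, $n=0,\dots,d$, and $\tilde V_{\tilde\alpha_0,\tilde\alpha_1,\tilde\alpha_2,\tilde\alpha_3}=\{f/\Phi: f\in V_{\tilde\alpha_0,\tilde\alpha_1,\tilde\alpha_2,\tilde\alpha_3}\}$. Branches are chosen compatibly, so that explicitly $\tilde V_{l_0+1,l_1+1,\tilde\alpha_2,\tilde\alpha_3}$ is the span of $$(\sin\pi x)^{2d}\,g_1(x)^{l_1+1}g_2(x)^{\tilde\alpha_2}g_3(x)^{\tilde\alpha_3}\wp(x)^n,\quad n=0,\dots,d,$$ with $g_1=\frac{\sigma_1\sin\pi x}{\sigma\cos\pi x}$, $g_2=\frac{\sigma_2}{\sigma}\sin\pi x$, $g_3=\frac{\sigma_3}{\sigma}\sin\pi x$, which are positive, even, $1$-periodic and real-analytic on $\mathbb{R}$ (all equal to the constant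 $\pi$ at $p=0$). This space has dimension $d+1$, is contained in $\mathbf{H}$, and is preserved by $H(p)$. *)

(* Defs.v *)
From HB Require Import structures.
From mathcomp Require Import all_boot all_order all_algebra.
From mathcomp Require Import complex.
From mathcomp Require Import all_classical all_reals all_analysis.

Set Implicit Arguments.
Unset Strict Implicit.
Unset Printing Implicit Defensive.

Import Order.TTheory GRing.Theory Num.Theory.
Import numFieldNormedType.Exports.

Local Open Scope classical_set_scope.
Local Open Scope complex_scope.
Local Open Scope ring_scope.

(* R[i] is not a normed module over R in the library: limits and derivatives of
   complex-valued functions are taken componentwise. *)

Section Complex.
Variable R : realType.
Implicit Types f : R -> R[i].

Definition clim (u : nat -> R[i]) : R[i] :=
  (limn (fun n => complex.Re (u n))) +i* (limn (fun n => complex.Im (u n))).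

Definition cderive1 f (x : R) : R[i] :=
  derive1 (fun t => complex.Re (f t)) x +i* derive1 (fun t => complex.Im (f t)) x.

Definition smooth (g : R -> R) : Prop :=
  forall (n : nat) (x : R), derivable (derive1n n g) x 1.

Definition csmooth f : Prop :=
  smooth (fun x => complex.Re (f x)) /\ smooth (fun x => complex.Im (f x)).

Definition cmeasurable f : Prop :=
  measurable_fun setT (fun x => complex.Re (f x)) /\
  measurable_fun setT (fun x => complex.Im (f x)).

Definition sqnormc (z : R[i]) : R := (complex.Re z) ^+ 2 + (complex.Im z) ^+ 2.

Definition ae_eq_fun (f g : R -> R[i]) : Prop :=
  {ae (@lebesgue_measure R), forall x, f x = g x}.

End Complex.

Section Elliptic.
Variable R : realType.

(* The period m + n tau with m = i - N and n = j - N. *)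
Definition lattice_pt (tau : R[i]) (N i j : nat) : R[i] :=
  (i%:R - N%:R) + (j%:R - N%:R) * tau.

(* The lattice series converges absolutely, so it may be summed over the squares
   |m|, |n| <= N. *)
Definition weierstrass_p (tau z : R[i]) : R[i] :=
  z ^- 2 +
  clim (fun N => \sum_(i < N.*2.+1) \sum_(j < N.*2.+1 | ~~ ((i == N :> nat) && (j == N :> nat)))
                   ((z - lattice_pt tau N i j) ^- 2 - (lattice_pt tau N i j) ^- 2)).

(* For p <> 0, p = exp(pi i tau) with tau purely imaginary if p > 0 and
   tau in 1 + i R if p < 0. *)
Definition tau_of (p : R) : R[i] :=
  (if 0 < p then 0 else 1) +i* (- ln `|p| / pi).

Definition half_period (tau : R[i]) (k : nat) : R[i] :=
  match k with
  | 0 => 0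
  | 1 => 1 / 2
  | 2 => (1 + tau) / 2
  | _ => tau / 2
  end.

(* wp p k x is the trigonometric limit of wp (x + omega_k) if p = 0, and
   wp (x + omega_k) otherwise; for real x and the above tau this is a real number,
   since x + omega_k is congruent to its conjugate modulo the lattice. *)
Definition wp (p : R) (k : nat) (x : R) : R :=
  if p == 0 then
    match k with
    | 0 => pi ^+ 2 / (sin (pi * x)) ^+ 2 - pi ^+ 2 / 3
    | 1 => pi ^+ 2 / (cos (pi * x)) ^+ 2 - pi ^+ 2 / 3
    | _ => - (pi ^+ 2 / 3)
    end
  else complex.Re (weierstrass_p (tau_of p) (x%:C + half_period (tau_of p) k)).

Definition wp_e (p : R) (k : nat) : R := wp p k 0.

(* sigma_k / sigma restricted to the real line: the square root of wp - e_k which is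
   equivalent to 1 / x at 0 and changes sign exactly at its simple poles, the
   integers, and, for k = 1, at its simple zeros, the half-integers.  (For p = 0
   these are pi / tan (pi x) and pi / sin (pi x).)  The values at the zeros of
   sin (pi x) cos (pi x) are irrelevant below, where functions are only compared
   almost everywhere. *)
Definition sigma_ratio (p : R) (k : nat) (x : R) : R :=
  Num.sg (sin (pi * x) * (if k == 1%N then cos (pi * x) else 1)) *
  Num.sqrt (wp p 0 x - wp_e p k).

Definition g1 (p x : R) : R := sigma_ratio p 1 x * sin (pi * x) / cos (pi * x).
Definition g2 (p x : R) : R := sigma_ratio p 2 x * sin (pi * x).
Definition g3 (p x : R) : R := sigma_ratio p 3 x * sin (pi * x).

End Elliptic.

Section Hamiltonian.
Variables (R : realType) (l0 l1 l2 l3 p : R).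
Implicit Types (f g : R -> R[i]) (z : R[i]) (E : R) (m : nat).

Local Notation mu := (@lebesgue_measure R).

(* This is |Phi|.  Between consecutive zeros of sin (pi x) cos (pi x) it differs
   from Phi by a constant phase, which cancels both in |Phi|^2 and in the
   conjugation by Phi. *)
Definition gauge (x : R) : R :=
  `|sin (pi * x)| `^ (l0 + 1) * `|cos (pi * x)| `^ (l1 + 1).

Definition potential (x : R) : R :=
  l0 * (l0 + 1) * wp p 0 x + l1 * (l1 + 1) * wp p 1 x +
  l2 * (l2 + 1) * wp p 2 x + l3 * (l3 + 1) * wp p 3 x.

(* The value at the zeros of the gauge factor is a dummy one. *)
Definition hamiltonian f (x : R) : R[i] :=
  (gauge x)^-1%:C *
  (- cderive1 (cderive1 (fun t => (gauge t)%:C * f t)) x +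
   (potential x)%:C * ((gauge x)%:C * f x)).

Definition sqnormH f : \bar R :=
  (\int[mu]_(x in `[0%R, 1%R]) (sqnormc (f x) * gauge x ^+ 2)%R%:E)%E.

Definition inH f : Prop :=
  [/\ cmeasurable f,
      ae_eq_fun (fun x => f (x + 1)) f,
      ae_eq_fun (fun x => f (- x)) f
    & (sqnormH f < +oo)%E].

Definition ham_dom f : Prop := inH f /\ csmooth f.

(* (f, g) is in the graph of the closure of H(p) with domain ham_dom *)
Definition ham_closure f g : Prop :=
  [/\ inH f, inH g &
    exists u : nat -> R -> R[i],
      [/\ forall n, ham_dom (u n),
          (fun n => sqnormH (fun x => u n x - f x)) @ \oo --> (0 : \bar R)%E
        & (fun n => sqnormH (fun x => hamiltonian (u n) x - g x)) @ \oo -->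
            (0 : \bar R)%E]].

Definition eigenfunH z f : Prop :=
  ~ ae_eq_fun f (fun=> 0) /\ ham_closure f (fun x => z * f x).

Definition lin_indep m (F : 'I_m -> R -> R[i]) : Prop :=
  forall c : 'I_m -> R[i],
    ae_eq_fun (fun x => \sum_(i < m) c i * F i x) (fun=> 0) -> forall i, c i = 0.

(* The total multiplicity of the eigenvalues of H(p) on the Hilbert space
   satisfying P is at least m. *)
Definition mult_ge (P : R -> Prop) m : Prop :=
  exists (E : 'I_m -> R) (F : 'I_m -> R -> R[i]),
    (forall i, P (E i) /\ eigenfunH (E i)%:C (F i)) /\ lin_indep F.

(* Eigenvalues are numbered from m = 1 on, in increasing order and repeated
   according to multiplicity. *)
Definition mth_eigenvalueH m E : Prop :=
  mult_ge (fun E' => E' <= E) m /\ ~ mult_ge (fun E' => E' < E) m.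

Definition tV_basis (a2 a3 : R) (d n : nat) (x : R) : R :=
  (sin (pi * x)) ^+ (2 * d) * g1 p x `^ (l1 + 1) * g2 p x `^ a2 * g3 p x `^ a3 *
  wp p 0 x ^+ n.

Definition in_tV (a2 a3 : R) (d : nat) f : Prop :=
  exists c : 'I_d.+1 -> R[i],
    forall x, f x = \sum_(n < d.+1) c n * (tV_basis a2 a3 d n x)%:C.

Definition eigenvalue_tV (a2 a3 : R) (d : nat) z : Prop :=
  exists f, [/\ in_tV a2 a3 d f, ~ ae_eq_fun f (fun=> 0)
              & ae_eq_fun (hamiltonian f) (fun x => z * f x)].

End Hamiltonian.

(* Main.v *)
(** By Lambert series, the four functions wp (x + omega_k) are Moebius functions of a
    single even 1-periodic real-analytic function t, which increases from 0 to 1 / a on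
    [0, 1/2] and satisfies t'^2 = 4 t (1 - a t) (1 - b t).  There is a positive smooth
    function hh, even and 1-periodic, such that f = hh w turns H(p) into
    w |-> G^-1 (- (G w')' + G q w) with G = (Phi hh)^2, and turns the finite dimensional
    space into the polynomials in t of degree at most d.  On these the operator is
    symmetric, hence diagonalized by polynomials F_0, ..., F_d.

    Let F be an eigenpolynomial for the largest eigenvalue E_top; it has at most d zeros.
    Given w orthogonal to all polynomials of degree at most d, subtract from w the
    interpolation polynomial with the same values at the zeros of F: Picone's identity
    bounds the quadratic form of the difference below by E_top, and the form of the
    interpolation polynomial is at most E_top, so the form of w is at least E_top.

    For an eigenfunction f of the closure with eigenvalue E <= E_top, take a sequence w_m
    approximating f in the graph norm.  If E is none of the E_i, then the lower bound
    (applied between E and E_top) forces w_m to 0.  If E = E_i, then Gronwall's inequality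
    for the Cauchy problem shows that w_m converges to a multiple of F_i.  So the spectrum
    up to E_top is exactly E_0, ..., E_d, and the theorem follows by counting. *)
Require Import Defs.
From HB Require Import structures.
From mathcomp Require Import all_boot all_order all_algebra.
From mathcomp Require Import complex.
From mathcomp Require Import all_classical all_reals all_analysis.
From mathcomp Require Import measurable_realfun ring lra zify.

Set Implicit Arguments.
Unset Strict Implicit.
Unset Printing Implicit Defensive.

Import Order.TTheory GRing.Theory Num.Theory.
Import numFieldNormedType.Exports.
Import Normc.

Local Open Scope classical_set_scope.
Local Open Scope complex_scope.
Local Open Scope ring_scope.

(** * Differential calculus of one real variable *)

(** The uniformizer is 1 / (wp - e_2), with a = e_1 - e_2 and b = e_3 - e_2. Taking e_2 as base
    point sends the singularity at omega_2 to t = infinity, so that H(p) becomes a Heun operator in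
    t; the relation that defines d says that its degree-raising coefficient vanishes on t^d. The
    facts on wp are not drawn from Liouville's theorem: the lattice series over squares is summed
    row by row through pi^2 / sin^2, the half-period shift comes from multiplying two of the
    resulting series, and the differential equation from the duplication formula. On [0, 1/2] the
    weight G vanishes at both ends, so smooth functions satisfy Green's identity without boundary
    conditions; but 1 / G is singular there, and residuals are controlled on compact subintervals
    only. An eigenfunction of the closure is given as an almost everywhere class and satisfies no
    differential equation a priori; therefore every estimate is made on smooth approximants, and
    only their limit is compared with f. *)

(* A wrapper around the class [is_derive], so that instance resolution does not
   interfere with explicit applications. *)
Definition der (R : realType) (x : R) (f : R -> R) (d : R) : Prop :=
  is_derive x (1 : R) f d.

Section Calculus.
Variable R : realType.
Implicit Types (f g : R -> R) (x : R).

Lemma isd_eq f x d e : der x f d -> d = e -> der x f e.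
Proof. by move=> h <-. Qed.

Lemma isdC (k : R) x : der x (fun=> k) 0.
Proof. exact: is_derive_cst. Qed.

Lemma isdI x : der x (fun t => t) 1.
Proof. exact: is_derive_id. Qed.

Lemma isdD f g x d e : der x f d -> der x g e ->
  der x (fun t => f t + g t) (d + e).
Proof. exact: is_deriveD. Qed.

Lemma isdN f x d : der x f d -> der x (fun t => - f t) (- d).
Proof. exact: is_deriveN. Qed.

Lemma isdB f g x d e : der x f d -> der x g e ->
  der x (fun t => f t - g t) (d - e).
Proof. exact: is_deriveB. Qed.

Lemma isdM f g x d e : der x f d -> der x g e ->
  der x (fun t => f t * g t) (d * g x + f x * e).
Proof.
move=> df dg; have h : der x _ _ := @is_deriveM R R f g x 1 d e df dg.
by apply: isd_eq h _; rewrite /GRing.scale /= addrC [g x * d]mulrC.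
Qed.

Lemma isdX f n x d : der x f d ->
  der x (fun t => f t ^+ n) (n%:R * f x ^+ n.-1 * d).
Proof.
move=> df; have h := @is_deriveX R R f n x 1 d df.
apply: isd_eq; last by rewrite -/(GRing.scale (n%:R * f x ^+ n.-1) (d : R^o)).
suff -> : (fun t => f t ^+ n) = f ^+ n by [].
by apply/funext => t; rewrite !fctE.
Qed.

Lemma isdV f x d : f x != 0 -> der x f d ->
  der x (fun t => (f t)^-1) (- d / f x ^+ 2).
Proof.
move=> fx df; have h : der x _ _ := is_deriveV fx df.
by apply: isd_eq h _; rewrite /GRing.scale /= mulNr mulNr mulrC.
Qed.

Lemma isd_comp f g x d e : der x g e -> der (g x) f d ->
  der x (fun t => f (g t)) (d * e).
Proof.
move=> dg df; apply: DeriveDef.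
  apply/derivable1_diffP; apply: differentiable_comp; apply/derivable1_diffP.
    exact: (@ex_derive _ _ _ _ _ _ _ dg).
  exact: (@ex_derive _ _ _ _ _ _ _ df).
rewrite -derive1E (_ : (fun t => f (g t)) = f \o g)// derive1_comp.
- by rewrite !derive1E (@derive_val _ _ _ _ _ _ _ dg) (@derive_val _ _ _ _ _ _ _ df).
- exact: (@ex_derive _ _ _ _ _ _ _ dg).
- exact: (@ex_derive _ _ _ _ _ _ _ df).
Qed.

Lemma isd_cont f x d : der x f d -> {for x, continuous f}.
Proof.
move=> df; apply: differentiable_continuous; apply/derivable1_diffP.
exact: (@ex_derive _ _ _ _ _ _ _ df).
Qed.

Lemma isd_uniq f x d e : der x f d -> der x f e -> d = e.
Proof.
by move=> df de; rewrite -(@derive_val _ _ _ _ _ _ _ df) (@derive_val _ _ _ _ _ _ _ de).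
Qed.

Lemma isd_near f g x d : (\near x, f x = g x) -> der x f d ->
  der x g d.
Proof. exact: near_eq_is_derive. Qed.

Lemma isd_derive1 f x d : der x f d -> derive1 f x = d.
Proof. by move=> df; rewrite derive1E (@derive_val _ _ _ _ _ _ _ df). Qed.

Lemma derivable_isd f x : derivable f x 1 -> der x f (derive1 f x).
Proof. by rewrite derive1E; exact: derivableP. Qed.

Lemma isd_derivable f x d : der x f d -> derivable f x 1.
Proof. by move=> h; exact: (@ex_derive _ _ _ _ _ _ _ h). Qed.

Lemma isd_powR f x d (al : R) : 0 < f x -> der x f d ->
  der x (fun t => f t `^ al) (al * f x `^ (al - 1) * d).
Proof.
by move=> f0 df; apply: (isd_comp (f := fun y => y `^ al) df); exact: is_derive1_powR.
Qed.

Lemma isd_shift f x d (k : R) : der (x + k) f d ->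
  der x (fun t => f (t + k)) d.
Proof.
move=> df; have h := isd_comp (f := f) (g := fun t => t + k) (isdD (isdI x) (isdC k x)) df.
by apply: isd_eq h _; rewrite addr0 mulr1.
Qed.

Lemma isd_sin_lin (k x : R) : der x (fun t => sin (k * t)) (k * cos (k * x)).
Proof.
have h := isd_comp (f := sin) (isdM (isdC k x) (isdI x)) (is_derive_sin (k * x)).
by apply: isd_eq h _; rewrite mul0r add0r mulr1 mulrC.
Qed.

Lemma isd_cos_lin (k x : R) : der x (fun t => cos (k * t)) (- (k * sin (k * x))).
Proof.
have h := isd_comp (f := cos) (isdM (isdC k x) (isdI x)) (is_derive_cos (k * x)).
by apply: isd_eq h _; rewrite mul0r add0r mulr1 mulrC mulrN.
Qed.

(** Serves to differentiate series term by term: a quadratic remainder that is uniform in the index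
    can be summed, which gives the derivative of the sum directly. *)
Lemma isd_of_quad f x d (K e : R) : 0 < e ->
  (forall h, `|h| < e -> `|f (x + h) - f x - h * d| <= K * h ^+ 2) ->
  der x f d.
Proof.
move=> e0 hf.
suff H : (fun h => h^-1 *: (f (h *: 1 + x) - f x)) @ (0 : R)^' --> d.
  apply: DeriveDef; first by apply/cvg_ex; exists d; exact: H.
  exact: cvg_lim H.
apply/cvgrPdist_le => eps eps0; near=> h.
have h0 : h != 0 by near: h; exact: nbhs_dnbhs_neq.
have he : `|h| < e.
  near: h; apply: dnbhs0_lt => //.
have hK : `|h| < eps / (`|K| + 1).
  by near: h; apply: dnbhs0_lt; rewrite divr_gt0// ltr_pwDr.
have -> : d - h^-1 *: (f (h *: 1 + x) - f x) = - h^-1 * (f (x + h) - f x - h * d).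
  rewrite /GRing.scale /= mulr1 [h + x]addrC.
  by field.
rewrite normrM normrN normfV.
apply: (le_trans (ler_wpM2l _ (hf h he))); first by rewrite invr_ge0.
rewrite -real_normK ?num_real// expr2.
apply: (@le_trans _ _ (`|K| * `|h|)).
  rewrite mulrCA; rewrite [_^-1 * _]mulrA mulVf ?normr_eq0// mul1r.
  by rewrite ler_wpM2r// ler_norm.
rewrite ltr_pdivlMr ?ltr_pwDr// in hK.
by apply: le_trans (ltW hK); rewrite mulrC ler_wpM2l// lerDl.
Unshelve. all: by end_near. Qed.

End Calculus.

(** * Closure properties of smooth functions *)

Section Smooth.
Variable R : realType.
Implicit Types (f g : R -> R) (x : R).

(* [kdiff] peels derivatives off at the inner end, which suits induction. *)
Fixpoint kdiff (n : nat) (f : R -> R) : Prop :=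
  match n with
  | 0%N => True
  | n'.+1 => (forall x, derivable f x 1) /\ kdiff n' (derive1 f)
  end.

Lemma derive1nSr' n f : derive1n n.+1 f = derive1n n (derive1 f).
Proof. by rewrite /derive1n iterSr. Qed.

Lemma smooth_kdiff f : smooth f <-> forall n, kdiff n f.
Proof.
split.
  move=> sf n; elim: n f sf => //= n IH f sf; split; first exact: (sf 0%N).
  by apply: IH => m x; rewrite -derive1nSr'; exact: sf.
move=> h n; elim: n f h => [|n IH] f h x; first exact: (h 1%N).1.
by rewrite derive1nSr'; apply: IH => m; exact: (h m.+1).2.
Qed.

Lemma kdiff_ext f g n : f =1 g -> kdiff n f -> kdiff n g.
Proof. by move=> /funext ->. Qed.

Lemma kdiffS n f : kdiff n.+1 f -> kdiff n f.
Proof. by elim: n f => //= n IH f [h1 h2]; split => //; exact: IH. Qed.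

Lemma kdiff_cst n (k : R) : kdiff n (fun=> k).
Proof.
elim: n k => //= n IH k; split; first by move=> x; exact: derivable_cst.
by rewrite (_ : derive1 _ = fun=> 0); [exact: IH|apply/funext => x; exact: derive1_cst].
Qed.

Lemma kdiffD n f g : kdiff n f -> kdiff n g -> kdiff n (fun x => f x + g x).
Proof.
elim: n f g => //= n IH f g [f1 f2] [g1 g2]; split.
  by move=> x; exact: (isd_derivable (isdD (derivable_isd (f1 x)) (derivable_isd (g1 x)))).
apply: kdiff_ext (IH _ _ f2 g2) => x; apply/esym/isd_derive1.
exact: (isdD (derivable_isd (f1 x)) (derivable_isd (g1 x))).
Qed.

Lemma kdiffM n f g : kdiff n f -> kdiff n g -> kdiff n (fun x => f x * g x).
Proof.
elim: n f g => //= n IH f g [f1 f2] [g1 g2]; split.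
  by move=> x; exact: (isd_derivable (isdM (derivable_isd (f1 x)) (derivable_isd (g1 x)))).
have h : kdiff n (fun x => derive1 f x * g x + f x * derive1 g x).
  by apply: kdiffD; apply: IH => //; apply: kdiffS.
apply: kdiff_ext h => x; apply/esym/isd_derive1.
exact: (isdM (derivable_isd (f1 x)) (derivable_isd (g1 x))).
Qed.

Lemma kdiff_comp_shift n f (k : R) : kdiff n f -> kdiff n (fun x => f (x + k)).
Proof.
elim: n f => //= n IH f [f1 f2]; split.
  by move=> x; exact: (isd_derivable (isd_shift (derivable_isd (f1 (x + k))))).
apply: kdiff_ext (IH _ f2) => x; apply/esym/isd_derive1.
exact: (isd_shift (derivable_isd (f1 (x + k)))).
Qed.

Lemma kdiff_powR n f (al : R) : (forall x, 0 < f x) -> kdiff n f ->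
  kdiff n (fun x => f x `^ al).
Proof.
move=> f0; elim: n al => //= n IH al [f1 f2].
have d x := isd_powR al (f0 x) (derivable_isd (f1 x)).
split; first by move=> x; exact: (isd_derivable (d x)).
have h : kdiff n (fun x => al * f x `^ (al - 1) * derive1 f x).
  apply: kdiffM => //; apply: kdiffM; first exact: kdiff_cst.
  by apply: IH; apply: kdiffS.
by apply: kdiff_ext h => x; rewrite (isd_derive1 (d x)).
Qed.

Lemma kdiff_sincos n (k : R) :
  kdiff n (fun x => sin (k * x)) /\ kdiff n (fun x => cos (k * x)).
Proof.
elim: n => //= n [IHs IHc]; split; split.
- by move=> x; exact: isd_derivable (isd_sin_lin k x).
- have h : kdiff n (fun x => k * cos (k * x)) by apply: kdiffM => //; exact: kdiff_cst.
  by apply: kdiff_ext h => x; rewrite (isd_derive1 (isd_sin_lin k x)).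
- by move=> x; exact: isd_derivable (isd_cos_lin k x).
- have h : kdiff n (fun x => (- k) * sin (k * x)).
    by apply: kdiffM => //; exact: kdiff_cst.
  by apply: kdiff_ext h => x; rewrite (isd_derive1 (isd_cos_lin k x)) mulNr.
Qed.

Lemma smooth_cst (k : R) : smooth (fun=> k).
Proof. by apply/smooth_kdiff => n; exact: kdiff_cst. Qed.

Lemma smoothD f g : smooth f -> smooth g -> smooth (fun x => f x + g x).
Proof.
by move=> /smooth_kdiff f1 /smooth_kdiff g1; apply/smooth_kdiff => n; exact: kdiffD.
Qed.

Lemma smoothM f g : smooth f -> smooth g -> smooth (fun x => f x * g x).
Proof.
by move=> /smooth_kdiff f1 /smooth_kdiff g1; apply/smooth_kdiff => n; exact: kdiffM.
Qed.

Lemma smoothZ f (k : R) : smooth f -> smooth (fun x => k * f x).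
Proof. by move=> ?; apply: smoothM => //; exact: smooth_cst. Qed.

Lemma smoothN f : smooth f -> smooth (fun x => - f x).
Proof.
move=> sf; have := @smoothZ f (-1) sf; rewrite (_ : (fun x => - f x) = (fun x => -1 * f x))//.
by apply/funext => x; rewrite mulN1r.
Qed.

Lemma smoothB f g : smooth f -> smooth g -> smooth (fun x => f x - g x).
Proof. by move=> f1 g1; apply: smoothD => //; exact: smoothN. Qed.

Lemma smoothX f n : smooth f -> smooth (fun x => f x ^+ n).
Proof.
move=> sf; elim: n => [|n IH]; first exact: smooth_cst.
rewrite (_ : (fun x => _) = (fun x => f x * f x ^+ n)); first exact: smoothM.
by apply/funext => x; rewrite exprS.
Qed.

Lemma smooth_shift f (k : R) : smooth f -> smooth (fun x => f (x + k)).
Proof. by move=> /smooth_kdiff f1; apply/smooth_kdiff => n; exact: kdiff_comp_shift. Qed.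

Lemma smooth_powR f (al : R) : (forall x, 0 < f x) -> smooth f ->
  smooth (fun x => f x `^ al).
Proof. by move=> f0 /smooth_kdiff f1; apply/smooth_kdiff => n; exact: kdiff_powR. Qed.

Lemma smoothV f : (forall x, 0 < f x) -> smooth f -> smooth (fun x => (f x)^-1).
Proof.
move=> f0 sf; have := @smooth_powR f (-1) f0 sf; rewrite (_ : (fun x => (f x)^-1) = (fun x => f x `^ (-1)))//.
by apply/funext => x; rewrite powR_inv1// ltW.
Qed.

Lemma smooth_sin (k : R) : smooth (fun x => sin (k * x)).
Proof. by apply/smooth_kdiff => n; exact: (kdiff_sincos n k).1. Qed.

Lemma smooth_cos (k : R) : smooth (fun x => cos (k * x)).
Proof. by apply/smooth_kdiff => n; exact: (kdiff_sincos n k).2. Qed.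

Lemma smooth_sum n (F : 'I_n -> R -> R) : (forall i, smooth (F i)) ->
  smooth (fun x => \sum_(i < n) F i x).
Proof.
elim: n F => [|n IH] F hF.
  by rewrite (_ : (fun x => _) = fun=> 0); [exact: smooth_cst|apply/funext => x; rewrite big_ord0].
rewrite (_ : (fun x => _) =
  (fun x => \sum_(i < n) F (widen_ord (leqnSn n) i) x + F ord_max x)); last first.
  by apply/funext => x; rewrite big_ord_recr.
by apply: smoothD => //; apply: IH.
Qed.

Lemma smooth_isd f x : smooth f -> der x f (derive1 f x).
Proof. by move=> sf; exact: derivable_isd (sf 0%N x). Qed.

Lemma smooth_derive1 f : smooth f -> smooth (derive1 f).
Proof. by move=> sf n x; rewrite -derive1nSr'; exact: sf. Qed.

Lemma smooth_cont f : smooth f -> continuous f.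
Proof. by move=> sf x; exact: isd_cont (smooth_isd x sf). Qed.

End Smooth.

(** * Trigonometric expansions of the Weierstrass function *)

Section ComplexNorm.
Variable R : realType.
Implicit Types (z u v w : R[i]).

Lemma normcE z : normc z = Num.sqrt (complex.Re z ^+ 2 + complex.Im z ^+ 2).
Proof. by case: z. Qed.

Lemma normc_ge0 z : 0 <= normc z.
Proof. by rewrite normcE sqrtr_ge0. Qed.

Lemma normc_sqr z : normc z ^+ 2 = complex.Re z ^+ 2 + complex.Im z ^+ 2.
Proof. by rewrite normcE sqr_sqrtr// addr_ge0 ?sqr_ge0. Qed.

Lemma normc_eq0 z : (normc z == 0) = (z == 0).
Proof. by apply/eqP/eqP => [/eq0_normc//|->]; exact: normc0. Qed.

Lemma normc_gt0 z : (0 < normc z) = (z != 0).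
Proof. by rewrite lt_neqAle normc_ge0 andbT eq_sym normc_eq0. Qed.

Lemma normcX z n : normc (z ^+ n) = normc z ^+ n.
Proof. by elim: n => [|n IH]; rewrite ?expr0 ?normc1// !exprS normcM IH. Qed.

Lemma normc_real (x : R) : normc x%:C = `|x|.
Proof. by rewrite /= expr0n /= addr0 sqrtr_sqr. Qed.

Lemma normc_Re z : `|complex.Re z| <= normc z.
Proof. by rewrite normcE -sqrtr_sqr ler_wsqrtr// lerDl sqr_ge0. Qed.

Lemma normc_Im z : `|complex.Im z| <= normc z.
Proof. by rewrite normcE -sqrtr_sqr ler_wsqrtr// lerDr sqr_ge0. Qed.

Lemma normc_le_ReIm z : normc z <= `|complex.Re z| + `|complex.Im z|.
Proof.
rewrite normcE -[leRHS]ger0_norm ?addr_ge0// -sqrtr_sqr ler_wsqrtr//.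
rewrite sqrrD !real_normK ?num_real// addrAC lerDl.
by rewrite mulrn_wge0// mulr_ge0.
Qed.

Lemma normcB_le z w : normc (z - w) <= normc z + normc w.
Proof. by rewrite -(normcN w); exact: le_normcD. Qed.

Lemma normc_distr z w : normc z - normc w <= normc (z - w).
Proof.
rewrite lerBlDr; apply: le_trans (le_normcD _ _).
by rewrite subrK.
Qed.

Lemma normc_sum (I : Type) (r : seq I) (P : pred I) (F : I -> R[i]) :
  normc (\sum_(i <- r | P i) F i) <= \sum_(i <- r | P i) normc (F i).
Proof.
elim/big_rec2: _ => [|i x y _ h]; first by rewrite normc0.
by apply: le_trans (le_normcD _ _) _; rewrite lerD2l.
Qed.

Lemma Re_sum (I : Type) (r : seq I) (P : pred I) (F : I -> R[i]) :
  complex.Re (\sum_(i <- r | P i) F i) = \sum_(i <- r | P i) complex.Re (F i).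
Proof.
elim/big_rec2: _ => [//|i x y _ <-]; by case: (F i) y => ? ? [? ?].
Qed.

Lemma ReD z w : complex.Re (z + w) = complex.Re z + complex.Re w.
Proof. by case: z w => ? ? []. Qed.

Lemma ReB z w : complex.Re (z - w) = complex.Re z - complex.Re w.
Proof. by case: z w => ? ? []. Qed.

Lemma ReZ (k : R) z : complex.Re (k%:C * z) = k * complex.Re z.
Proof. by case: z => a b /=; rewrite mul0r subr0. Qed.

Lemma ImD z w : complex.Im (z + w) = complex.Im z + complex.Im w.
Proof. by case: z w => ? ? []. Qed.

Lemma ImB z w : complex.Im (z - w) = complex.Im z - complex.Im w.
Proof. by case: z w => ? ? []. Qed.

Lemma ImZ (k : R) z : complex.Im (k%:C * z) = k * complex.Im z.
Proof. by case: z => a b /=; rewrite mul0r addr0. Qed.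

Lemma natc (n : nat) : n%:R = (n%:R : R)%:C.
Proof. by rewrite rmorph_nat. Qed.

End ComplexNorm.

(** * Explicit Taylor bounds for sin, cos, sinh and cosh *)

Section ElementaryBounds.
Variable R : realType.

Lemma ge0_of_derive (f df : R -> R) (b : R) :
  (forall x, der x f (df x)) -> 0 <= f 0 ->
  (forall x, 0 <= x <= b -> 0 <= df x) -> forall x, 0 <= x <= b -> 0 <= f x.
Proof.
move=> fd f0 df0 x /andP[x0 xb].
have [c /[!in_itv]/= /andP[c0 cx] e] : exists2 c, c \in `[0, x]%R & f x - f 0 = df c * (x - 0).
  apply: MVT_segment => //.
  - by move=> y _; exact: fd.
  - by apply: continuous_subspaceT => y; exact: isd_cont (fd y).
rewrite -[f x](subrK (f 0)) e subr0 addr_ge0// mulr_ge0// df0//.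
by rewrite c0 (le_trans cx).
Qed.

Lemma sin_le_id (x : R) : 0 <= x -> sin x <= x.
Proof.
move=> x0; rewrite -subr_ge0.
have D : forall y : R, der y (fun x => x - sin x) ((fun x => 1 - cos x) y).
  by move=> y; apply: isdB; [exact: isdI|exact: is_derive_sin].
apply: (ge0_of_derive (b := x) D) => //.
- by rewrite sin0 subrr.
- by rewrite x0 lexx.
Qed.

Lemma cos_ge_quad (x : R) : 0 <= x -> 1 - x ^+ 2 / 2 <= cos x.
Proof.
move=> x0; rewrite -subr_ge0.
have D : forall y : R, der y (fun x => cos x - (1 - x ^+ 2 / 2)) ((fun x => x - sin x) y).
  move=> y; apply: isd_eq.
    apply: isdB; first exact: is_derive_cos.
    apply: isdB; first exact: isdC.
    by apply: isdM; [apply: isdX; exact: isdI|exact: isdC].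
  by rewrite /=; field.
apply: (ge0_of_derive (b := x) D) => //.
- by rewrite cos0 expr0n /= mul0r subr0 subrr.
- by move=> y /andP[y0 _]; rewrite subr_ge0 sin_le_id.
- by rewrite x0 lexx.
Qed.

Lemma sin_ge_cubic (x : R) : 0 <= x -> x - x ^+ 3 / 6 <= sin x.
Proof.
move=> x0; rewrite -subr_ge0.
have D : forall y : R, der y (fun x => sin x - (x - x ^+ 3 / 6)) ((fun x => cos x - (1 - x ^+ 2 / 2)) y).
  move=> y; apply: isd_eq.
    apply: isdB; first exact: is_derive_sin.
    apply: isdB; first exact: isdI.
    by apply: isdM; [apply: isdX; exact: isdI|exact: isdC].
  by rewrite /=; field.
apply: (ge0_of_derive (b := x) D) => //.
- by rewrite sin0 expr0n /= mul0r subr0 subrr.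
- by move=> y /andP[y0 _]; rewrite subr_ge0 cos_ge_quad.
- by rewrite x0 lexx.
Qed.

Lemma sin_sub_id (x : R) : `|sin x - x| <= `|x| ^+ 3.
Proof.
wlog x0 : x / 0 <= x.
  move=> h; have [|x0] := leP 0 x; first exact: h.
  have := h (- x); rewrite oppr_ge0 (ltW x0) sinN -opprD !normrN; exact.
have h1 := sin_le_id x0; have h2 := sin_ge_cubic x0.
rewrite (ger0_norm x0); have h3 : 0 <= x ^+ 3 by exact: exprn_ge0.
by rewrite ler_norml; apply/andP; split; lra.
Qed.

Lemma sin_lower (x : R) : `|x| <= 2 -> `|x| / 3 <= `|sin x|.
Proof.
wlog x0 : x / 0 <= x.
  move=> h; have [|x0] := leP 0 x; first exact: h.
  have := h (- x); rewrite oppr_ge0 (ltW x0) sinN !normrN; exact.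
rewrite (ger0_norm x0) => x2; have h2 := sin_ge_cubic x0.
apply: le_trans (ler_norm _); apply: le_trans h2.
have : 0 <= x * (4 - x ^+ 2) by rewrite mulr_ge0// subr_ge0; nra.
by nra.
Qed.

Definition ch (x : R) := (expR x + expR (- x)) / 2.
Definition sh (x : R) := (expR x - expR (- x)) / 2.

Lemma ch_ge1 x : 1 <= ch x.
Proof.
rewrite /ch expRN; have e0 := expR_gt0 x; set e := expR x in e0 *.
rewrite ler_pdivlMr// mul1r -subr_ge0.
have -> : e + e^-1 - 2 = (e - 1) ^+ 2 / e by field; rewrite gt_eqF.
by rewrite divr_ge0 ?sqr_ge0 ?ltW.
Qed.

Lemma shN x : sh (- x) = - sh x.
Proof. by rewrite /sh opprK -mulNr opprB. Qed.

Lemma ch2sh2 x : ch x ^+ 2 - sh x ^+ 2 = 1.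
Proof.
rewrite /ch /sh expRN; have e0 := expR_gt0 x; set e := expR x in e0 *.
by field; rewrite gt_eqF.
Qed.

Lemma is_derive_expRN (x : R) : der x (fun t => expR (- t)) (- expR (- x)).
Proof.
have := isd_comp (f := @expR R) (isdN (isdI x)) (is_derive_expR (- x)).
by move/isd_eq; apply; ring.
Qed.

Lemma is_derive_sh (x : R) : der x sh (ch x).
Proof.
apply: isd_eq.
  apply: isdM; last exact: isdC.
  by apply: isdB; [exact: is_derive_expR|exact: is_derive_expRN].
by rewrite /ch mulr0 addr0 opprK.
Qed.

Lemma ch_upper x : `|x| <= 2^-1 -> ch x <= 1 + 2 * x ^+ 2.
Proof.
move=> x2; have [h1 h2] : - 2^-1 <= x /\ x <= 2^-1.
  by move: x2; rewrite ler_norml => /andP[].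
have a1 : expR x <= (1 - x)^-1.
  rewrite -[x in expR x]opprK expRN lef_pV2 ?posrE ?expR_gt0//; last lra.
  by have := expR_ge1Dx (- x).
have a2 : expR (- x) <= (1 + x)^-1.
  by rewrite expRN lef_pV2 ?posrE ?expR_gt0//; [exact: expR_ge1Dx|lra].
apply: (@le_trans _ _ (((1 - x)^-1 + (1 + x)^-1) / 2)).
  by rewrite /ch ler_pM2r ?invr_gt0// lerD.
have p1 : 0 < 1 - x by lra.
have p2 : 0 < 1 + x by lra.
have -> : ((1 - x)^-1 + (1 + x)^-1) / 2 = 1 / (1 - x ^+ 2).
  field.
  by rewrite (_ : 1 - x ^+ 2 = (1 - x) * (1 + x)) ?mulf_neq0 ?gt_eqF//; ring.
rewrite ler_pdivrMr; last by nra.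
have : x ^+ 2 <= 4^-1 by nra.
have := sqr_ge0 x; nra.
Qed.

Lemma sh_bounds x : 0 <= x <= 2^-1 -> x <= sh x <= x + 2 * x ^+ 3.
Proof.
move=> x2; rewrite -subr_ge0 -[X in _ && X]subr_ge0; apply/andP; split.
  have D : forall y : R, der y (fun x => sh x - x) ((fun x => ch x - 1) y).
    by move=> y; apply: isdB; [exact: is_derive_sh|exact: isdI].
  apply: (ge0_of_derive (b := (2^-1)) D) => //.
  - by rewrite /sh oppr0 subrr mul0r ?subr0 ?addr0.
  - by move=> y _; rewrite subr_ge0 ch_ge1.
have D : forall y : R, der y (fun x => x + 2 * x ^+ 3 - sh x) ((fun x => 1 + 6 * x ^+ 2 - ch x) y).
  move=> y; apply: isd_eq.
    apply: isdB; last exact: is_derive_sh.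
    apply: isdD; first exact: isdI.
    by apply: isdM; [exact: isdC|apply: isdX; exact: isdI].
  by rewrite /=; ring.
apply: (ge0_of_derive (b := (2^-1)) D) => //.
- by rewrite /sh oppr0 subrr mul0r ?subr0 ?addr0 expr0n /= mulr0 addr0.
- move=> y /andP[y0 y2]; rewrite subr_ge0; apply: le_trans (ch_upper _) _.
    by rewrite ger0_norm.
  by have := sqr_ge0 y; lra.
Qed.

Lemma sh_sub_id x : `|x| <= 2^-1 -> `|sh x - x| <= 2 * `|x| ^+ 3.
Proof.
wlog x0 : x / 0 <= x.
  move=> h; have [|x0] := leP 0 x; first exact: h.
  have := h (- x); rewrite oppr_ge0 (ltW x0) shN -opprD !normrN; exact.
rewrite (ger0_norm x0) => x2; have /sh_bounds /andP[] : 0 <= x <= 2^-1 by rewrite x0.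
have h3 : 0 <= x ^+ 3 by exact: exprn_ge0.
by move=> h1 h2; rewrite ler_norml; apply/andP; split; lra.
Qed.

Lemma sh_lower x : `|x| <= `|sh x|.
Proof.
wlog x0 : x / 0 <= x.
  move=> h; have [|x0] := leP 0 x; first exact: h.
  have := h (- x); rewrite oppr_ge0 (ltW x0) shN !normrN; exact.
rewrite (ger0_norm x0); apply: le_trans (ler_norm _); rewrite -subr_ge0.
have D : forall y : R, der y (fun x => sh x - x) ((fun x => ch x - 1) y).
  by move=> y; apply: isdB; [exact: is_derive_sh|exact: isdI].
apply: (ge0_of_derive (b := x) D) => //.
- by rewrite /sh oppr0 subrr mul0r ?subr0 ?addr0.
- by move=> y _; rewrite subr_ge0 ch_ge1.
- by rewrite x0 lexx.
Qed.

End ElementaryBounds.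

(** * The function (pi / sin (pi z))^2 and its pole at 0 *)

Section RowSums.
Variable R : realType.
Local Notation C := R[i].
Implicit Types (z u v w : C) (N k : nat).

(** This is exp (2 pi i z), written in real and imaginary parts. *)
Definition wexp z : C :=
  (expR (- (2 * pi * complex.Im z)) * cos (2 * pi * complex.Re z)) +i*
  (expR (- (2 * pi * complex.Im z)) * sin (2 * pi * complex.Re z)).

Lemma wexpD z w : wexp (z + w) = wexp z * wexp w.
Proof.
rewrite /wexp ImD ReD !mulrDr opprD expRD cosD sinD.
by apply/eqP; rewrite eq_complex; apply/andP; split; apply/eqP => /=; ring.
Qed.

Lemma wexp0 : wexp 0 = 1.
Proof.
by rewrite /wexp /= !mulr0 oppr0 expR0 cos0 sin0 mulr0 mulr1.
Qed.

Lemma wexp_neq0 z : wexp z != 0.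
Proof.
apply/eqP => h; have := wexpD z (- z); rewrite subrr wexp0 h mul0r.
by move/eqP; rewrite oner_eq0.
Qed.

Lemma wexpN z : wexp (- z) = (wexp z)^-1.
Proof.
have := wexpD z (- z); rewrite subrr wexp0 => h.
by apply: (mulfI (wexp_neq0 z)); rewrite -h divff ?wexp_neq0.
Qed.

Lemma wexp_nat z k : wexp (k%:R * z) = wexp z ^+ k.
Proof.
elim: k => [|k IH]; first by rewrite mul0r wexp0.
by rewrite -natr1 mulrDl mul1r wexpD IH exprSr.
Qed.

Lemma wexp_real_half : wexp (1 / 2) = -1.
Proof.
rewrite (_ : 1 / 2 = (2^-1)%:C); last by rewrite mul1r fmorphV rmorph_nat.
rewrite /wexp /= !mulr0 oppr0 expR0 !mul1r mulrAC mulfV ?pnatr_eq0// mul1r.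
by rewrite cospi sinpi; apply/eqP; rewrite eq_complex /= oppr0 !eqxx.
Qed.

Lemma wexp1 : wexp 1 = 1.
Proof.
have := wexpD (1 / 2) (1 / 2); rewrite wexp_real_half (_ : 1 / 2 + 1 / 2 = 1 :> C); last by field.
by move=> ->; rewrite mulrN1 opprK.
Qed.

Lemma wexp_half z : wexp (z / 2) ^+ 2 = wexp z.
Proof. by rewrite expr2 -wexpD; congr wexp; field. Qed.

Lemma wexp_half1 z : wexp ((z + 1) / 2) = - wexp (z / 2).
Proof. by rewrite mulrDl wexpD wexp_real_half mulrN1. Qed.

Lemma wexpD1 z : wexp (z + 1) = wexp z.
Proof. by rewrite wexpD wexp1 mulr1. Qed.

Lemma wexp_half_neq1 z : wexp z != 1 -> wexp (z / 2) != 1 /\ wexp ((z + 1) / 2) != 1.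
Proof.
move=> h; split; apply: contra h => /eqP.
  by move=> e; rewrite -wexp_half e expr1n.
by rewrite wexp_half1 => e; rewrite -wexp_half -sqrrN e expr1n.
Qed.

Definition rr (K : fieldType) (u : K) : K := u / (1 - u) ^+ 2.

(** This is (pi / sin (pi z))^2, since sin^2 (pi z) = - (1 - w)^2 / (4 w) for w = [wexp z]. In this
    form a shift of z by a period is a multiplication of w. *)
Definition csq z : C := - (4 * (pi ^+ 2)%:C) * rr (wexp z).

Lemma csqD1 z : csq (z + 1) = csq z.
Proof. by rewrite /csq wexpD1. Qed.

Lemma csq_double z : wexp z != 1 -> csq (z / 2) + csq ((z + 1) / 2) = 4 * csq z.
Proof.
move=> h; have [h1 h2] := wexp_half_neq1 h.
rewrite /csq /rr -(wexp_half z) wexp_half1; move: h2; rewrite wexp_half1.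
set u := wexp (z / 2) in h1 * => h2.
have n1 : 1 - u != 0 by rewrite subr_eq0 eq_sym.
have n2 : 1 + u != 0 by rewrite -[u]opprK subr_eq0 eq_sym.
field; rewrite (_ : 1 - u ^+ 2 = (1 - u) * (1 + u)); last by ring.
by rewrite opprK mulf_neq0 ?n1 ?n2.
Qed.

(* sin (pi z) *)
Definition sn z : C :=
  (sin (pi * complex.Re z) * ch (pi * complex.Im z)) +i*
  (cos (pi * complex.Re z) * sh (pi * complex.Im z)).

Lemma wexp_sn z : 2 * 'i * sn z = wexp (z / 2) - wexp (- (z / 2)).
Proof.
have -> : z / 2 = (complex.Re z / 2) +i* (complex.Im z / 2).
  case: z => x y /=; rewrite -[2^-1]/((2 : C)^-1) natc -fmorphV.
  by apply/eqP; rewrite eq_complex /= !mulr0 subr0 add0r !eqxx.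
rewrite /wexp /sn /= /ch /sh.
have e1 (a : R) : 2 * pi * (a / 2) = pi * a by field.
have e2 (a : R) : 2 * pi * - (a / 2) = - (pi * a) by field.
rewrite !e1 !e2 cosN sinN !opprK natc.
by apply/eqP; rewrite eq_complex /=; apply/andP; split; apply/eqP; field.
Qed.

Lemma normc_sn z : normc (sn z) ^+ 2 =
  sin (pi * complex.Re z) ^+ 2 + sh (pi * complex.Im z) ^+ 2.
Proof.
rewrite normc_sqr /=.
move: (ch2sh2 (pi * complex.Im z)) (cos2Dsin2 (pi * complex.Re z)) => h1 h2.
rewrite [LHS](_ : _ = sin (pi * complex.Re z) ^+ 2 * (ch (pi * complex.Im z) ^+ 2 - sh (pi * complex.Im z) ^+ 2) +
  (cos (pi * complex.Re z) ^+ 2 + sin (pi * complex.Re z) ^+ 2) * sh (pi * complex.Im z) ^+ 2).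
  by rewrite h1 h2; ring.
by ring.
Qed.

Lemma pi_lt4 : pi < 4 :> R.
Proof. by have := @pihalf_lt2 R; lra. Qed.

(** The factor 2 / 3 comes from pi >= 2 and |sin y| >= |y| / 3 for |y| <= 2, a range that contains
    pi * Re z because pi < 4. *)
Lemma sn_lower z : `|complex.Re z| <= 2^-1 -> 2 / 3 * normc z <= normc (sn z).
Proof.
move=> hx; rewrite -(@ler_pXn2r _ 2) ?nnegrE ?mulr_ge0 ?normc_ge0//.
rewrite exprMn normc_sn normc_sqr mulrDr lerD//.
  have p2 := @pi_ge2 R; have p4 := pi_lt4.
  rewrite -[leRHS]real_normK ?num_real// -[X in _ * X]real_normK ?num_real// -exprMn.
  rewrite ler_pXn2r ?nnegrE ?mulr_ge0//.
  apply: le_trans (sin_lower _); rewrite normrM (ger0_norm (pi_ge0 R)).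
    by have := normr_ge0 (complex.Re z); nra.
  by have := normr_ge0 (complex.Re z); nra.
have p2 := @pi_ge2 R.
rewrite -[leRHS]real_normK ?num_real// -[X in _ * X]real_normK ?num_real// -exprMn.
rewrite ler_pXn2r ?nnegrE ?mulr_ge0//.
apply: le_trans (sh_lower _); rewrite normrM (ger0_norm (pi_ge0 R)).
by have := normr_ge0 (complex.Im z); nra.
Qed.

Lemma sn_upper z : normc z <= 8^-1 -> normc (sn z - pi%:C * z) <= 800 * normc z ^+ 3.
Proof.
move=> hz; apply: le_trans (normc_le_ReIm _) _.
have p2 := @pi_ge2 R; have p4 := pi_lt4.
rewrite ReB ImB ReZ ImZ /=.
have hx := normc_Re z; have hy := normc_Im z; have n0 := normc_ge0 z.
set x := complex.Re z in hx *; set y := complex.Im z in hy *; set n := normc z in hz hx hy n0 *.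
have nx : 0 <= `|x| by []. have ny : 0 <= `|y| by [].
have npx : `|pi * x| <= 4 * n by rewrite normrM (ger0_norm (pi_ge0 R)); nra.
have npy : `|pi * y| <= 4 * n by rewrite normrM (ger0_norm (pi_ge0 R)); nra.
have npy2 : `|pi * y| <= 2^-1 by apply: le_trans npy _; lra.
have s1 : `|sin (pi * x) - pi * x| <= 64 * n ^+ 3.
  apply: le_trans (sin_sub_id _) _; apply: (@le_trans _ _ ((4 * n) ^+ 3)).
    by rewrite lerXn2r ?nnegrE ?mulr_ge0.
  by rewrite exprMn; lra.
have s2 : `|sh (pi * y) - pi * y| <= 128 * n ^+ 3.
  apply: le_trans (sh_sub_id npy2) _; apply: (@le_trans _ _ (2 * (4 * n) ^+ 3)).
    by rewrite ler_pM2l// lerXn2r ?nnegrE ?mulr_ge0.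
  by rewrite exprMn; lra.
have sq1 : (pi * y) ^+ 2 <= 16 * n ^+ 2.
  rewrite -real_normK ?num_real//; apply: (@le_trans _ _ ((4 * n) ^+ 2)).
    by rewrite lerXn2r ?nnegrE ?mulr_ge0.
  by rewrite exprMn; lra.
have sq2 : (pi * x) ^+ 2 <= 16 * n ^+ 2.
  rewrite -real_normK ?num_real//; apply: (@le_trans _ _ ((4 * n) ^+ 2)).
    by rewrite lerXn2r ?nnegrE ?mulr_ge0.
  by rewrite exprMn; lra.
have c1 : `|ch (pi * y) - 1| <= 32 * n ^+ 2.
  rewrite ger0_norm ?subr_ge0 ?ch_ge1//; have := ch_upper npy2; lra.
have c2 : `|cos (pi * x) - 1| <= 8 * n ^+ 2.
  rewrite distrC ger0_norm ?subr_ge0 ?cos_le1//.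
  have := cos_ge_quad (normr_ge0 (pi * x)); rewrite cos_norm real_normK ?num_real//.
  lra.
have n64 : n ^+ 2 <= 64^-1 by nra.
have ch2 : `|ch (pi * y)| <= 2.
  by rewrite ger0_norm ?(le_trans ler01 (ch_ge1 _))//; have := ler_norm (ch (pi * y) - 1); lra.
have t1 : `|sin (pi * x) * ch (pi * y) - pi * x| <= 64 * n ^+ 3 * 2 + 4 * n * (32 * n ^+ 2).
  rewrite [X in `|X|](_ : _ = (sin (pi * x) - pi * x) * ch (pi * y) + pi * x * (ch (pi * y) - 1)); last by ring.
  by apply: le_trans (ler_normD _ _) _; rewrite !normrM lerD// ler_pM// -normrM.
have t2 : `|cos (pi * x) * sh (pi * y) - pi * y| <= 1 * (128 * n ^+ 3) + 8 * n ^+ 2 * (4 * n).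
  rewrite [X in `|X|](_ : _ = cos (pi * x) * (sh (pi * y) - pi * y) + (cos (pi * x) - 1) * (pi * y)); last by ring.
  apply: le_trans (ler_normD _ _) _; rewrite !normrM lerD// ler_pM//; last by rewrite -normrM.
  exact: cos_max.
apply: le_trans (lerD t1 t2) _.
rewrite [leLHS](_ : _ = 416 * n ^+ 3); last by ring.
by have := exprn_ge0 3 n0; lra.
Qed.

Lemma sn_neq0 z : wexp z != 1 -> sn z != 0.
Proof.
apply: contra => /eqP h; have := wexp_sn z; rewrite h mulr0 => /esym/eqP.
rewrite subr_eq0 wexpN => /eqP e; rewrite -wexp_half expr2 {1}e mulVf//.
exact: wexp_neq0.
Qed.

Lemma csq_sn z : wexp z != 1 -> csq z = (pi%:C / sn z) ^+ 2.
Proof.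
move=> h; have s0 := sn_neq0 h.
have e : (1 - wexp z) ^+ 2 = - 4 * sn z ^+ 2 * wexp z.
  have := wexp_sn z; rewrite wexpN -(wexp_half z).
  have w0 := wexp_neq0 (z / 2); set u := wexp (z / 2) in w0 * => su.
  have -> : 1 - u ^+ 2 = - (u * (u - u^-1)) by field.
  by rewrite -su sqrrN !exprMn sqr_i; ring.
rewrite /csq /rr e rmorphXn /=; field.
by rewrite s0 wexp_neq0.
Qed.

(** For |z| > 1 / 8 both terms are bounded. For |z| <= 1 / 8 the difference factors as (pi z -
    sn)(pi z + sn) / (z^2 sn^2), and the cubic bound [sn_upper] on the first factor compensates the
    denominator of order four. *)
Lemma csq_pole : exists2 K : R, 0 <= K & forall z, wexp z != 1 ->
  `|complex.Re z| <= 2^-1 -> normc (csq z - z ^- 2) <= K.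
Proof.
pose K : R := 800 * 24 * (9 / 4) + (16 * (9 / 4) * 64 + 64).
exists K; first by rewrite /K; lra.
move=> z h hx; have s0 := sn_neq0 h; have p2 := @pi_ge2 R; have p4 := pi_lt4.
have z0 : z != 0 by apply: contraNneq h => ->; rewrite wexp0.
have n0 : 0 < normc z by rewrite normc_gt0.
have m0 : 0 < normc (sn z) by rewrite normc_gt0.
have low := sn_lower hx.
rewrite (csq_sn h); have [hz|hz] := leP (normc z) 8^-1.
  have up := sn_upper hz.
  rewrite [X in normc X](_ : _ = (pi%:C * z - sn z) * (pi%:C * z + sn z) / (z ^+ 2 * sn z ^+ 2)); last first.
    by field; rewrite z0 s0.
  rewrite normcM normcM normcV normcM !normcX ler_pdivrMr ?mulr_gt0 ?exprn_gt0//.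
  have b1 : normc (pi%:C * z - sn z) <= 800 * normc z ^+ 3 by rewrite -opprB normcN.
  have b2 : normc (pi%:C * z + sn z) <= 24 * normc z.
    have -> : pi%:C * z + sn z = (sn z - pi%:C * z) + (2 * pi)%:C * z.
      by rewrite rmorphM rmorph_nat; ring.
    apply: le_trans (le_normcD _ _) _; rewrite normcM normc_real ger0_norm; last lra.
    have : normc z ^+ 3 <= 64^-1 * normc z.
      by rewrite exprS mulrC ler_pM2r//; nra.
    by nra.
  apply: (@le_trans _ _ (800 * normc z ^+ 3 * (24 * normc z))).
    by rewrite ler_pM ?normc_ge0.
  have sq : 4 / 9 * normc z ^+ 2 <= normc (sn z) ^+ 2.
    rewrite (_ : 4 / 9 * _ = (2 / 3 * normc z) ^+ 2); last by field.
    by rewrite lerXn2r ?nnegrE ?normc_ge0// mulr_ge0// ltW.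
  have q0 : 0 < normc z ^+ 2 by rewrite exprn_gt0.
  apply: (@le_trans _ _ ((800 * 24 * (9 / 4)) * (normc z ^+ 2 * (4 / 9 * normc z ^+ 2)))).
    by rewrite le_eqVlt; apply/orP; left; apply/eqP; field.
  apply: ler_pM; [lra|by rewrite mulr_ge0 ?ltW// mulr_gt0|rewrite /K; lra|].
  by rewrite ler_pM2l.
apply: le_trans (normcB_le _ _) _.
rewrite normcX normcV normcX normcM normcV normc_real ger0_norm ?pi_ge0//.
apply: (@le_trans _ _ (16 * (9 / 4) * 64 + 64)); last by rewrite /K; lra.
have i1 : (normc z)^-1 <= 8.
  by rewrite -[leRHS]invrK lef_pV2 ?posrE ?invr_gt0// ltW.
have i2 : pi / normc (sn z) <= 4 * (3 / 2 * 8).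
  apply: ler_pM; rewrite ?pi_ge0 ?invr_ge0 ?normc_ge0 ?(ltW p4)//.
  apply: (@le_trans _ _ (2 / 3 * normc z)^-1); first by rewrite lef_pV2 ?posrE ?mulr_gt0.
  by rewrite invfM ler_pM ?invr_ge0 ?normc_ge0//; lra.
have j1 : 0 <= (normc z)^-1 by rewrite invr_ge0 ltW.
have j2 : 0 <= pi / normc (sn z) by rewrite divr_ge0 ?pi_ge0 ?ltW.
rewrite -exprVn; apply: lerD; last by nra.
apply: (@le_trans _ _ ((4 * (3 / 2 * 8)) ^+ 2)); first by rewrite lerXn2r ?nnegrE//; lra.
by lra.
Qed.

End RowSums.

(** * Partial fractions of (pi / sin (pi z))^2 by Herglotz's trick *)

Section RowLimit.
Variable R : realType.
Local Notation C := R[i].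
Implicit Types (z u v w : C) (N k : nat).

Definition rowsum z N : C :=
  z ^- 2 + \sum_(k < N) ((z - k.+1%:R) ^- 2 + (z + k.+1%:R) ^- 2).

Lemma rowsumS z N : rowsum z N.+1 =
  rowsum z N + ((z - N.+1%:R) ^- 2 + (z + N.+1%:R) ^- 2).
Proof. by rewrite /rowsum big_ord_recr /= addrA. Qed.

Lemma rowsum0 z : rowsum z 0 = z ^- 2.
Proof. by rewrite /rowsum big_ord0 addr0. Qed.

Lemma inv_half_sqr u : (u / 2) ^- 2 = 4 * u ^- 2.
Proof.
by rewrite expr_div_n invfM invrK mulrC -natrX.
Qed.

(** The poles of the two halves are the even and the odd integers, so the partial sums obey the
    duplication formula [csq_double] up to one unpaired term at the boundary. *)
Lemma rowsum_double z N :
  rowsum (z / 2) N + rowsum ((z + 1) / 2) N = 4 * (rowsum z (2 * N) + (z + (2 * N).+1%:R) ^- 2).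
Proof.
elim: N => [|N IH].
  by rewrite muln0 !rowsum0 !inv_half_sqr mulrDr.
have e1 : (2 * N.+1 = (2 * N).+2)%N by rewrite mulnS.
rewrite e1 !rowsumS [LHS]addrACA IH.
have h k u : (u / 2 - k%:R) = (u - (2 * k)%:R) / 2 :> C by rewrite natrM; field.
have h' k u : (u / 2 + k%:R) = (u + (2 * k)%:R) / 2 :> C by rewrite natrM; field.
rewrite !h !h' !inv_half_sqr e1.
have -> : z + 1 - (2 * N).+2%:R = z - (2 * N).+1%:R.
  by rewrite -[(2 * N).+2%:R]natr1; ring.
have -> : z + 1 + (2 * N).+2%:R = z + (2 * N).+3%:R.
  by rewrite -[(2 * N).+3%:R]natr1; ring.
by ring.
Qed.

Lemma rowsum_shift z N :
  rowsum (z + 1) N = rowsum z N - (z - N%:R) ^- 2 + (z + N.+1%:R) ^- 2.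
Proof.
elim: N => [|N IH]; first by rewrite !rowsum0 subr0 subrr add0r.
rewrite !rowsumS IH.
have -> : z + 1 - N.+1%:R = z - N%:R by rewrite -natr1; ring.
have -> : z + 1 + N.+1%:R = z + N.+2%:R by rewrite -[N.+2%:R]natr1; ring.
by ring.
Qed.

Lemma normc_invsqr_le z (K : R) : 0 < K -> K <= normc z -> normc (z ^- 2) <= K ^- 2.
Proof.
move=> K0 Kz; have n0 := lt_le_trans K0 Kz.
by rewrite normcV normcX lef_pV2 ?posrE ?exprn_gt0// lerXn2r ?nnegrE ?(ltW K0) ?(ltW n0).
Qed.

(** Herglotz's trick: as [csq] and the partial sums share the duplication formula, passing from 2^i
    to 2^(i+1) replaces the error by a quarter of the sum of two earlier errors, so it is about
    halved. The strip |Re z| <= 1 is preserved by z / 2 and (z + 1) / 2. *)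
Lemma rowsum_csq_pow2 : exists2 K : R, 0 <= K & forall z i, wexp z != 1 ->
  `|complex.Re z| <= 1 -> normc (csq z - rowsum z (2 ^ i)) <= K / 2 ^+ i.
Proof.
have [K K0 hK] := csq_pole R.
pose B := K + 8.
exists (B + 1) => [|z i]; first by rewrite /B; lra.
(* The subtracted 1 / 4 ^+ i makes the induction close: what it gains at each step pays exactly for
   the boundary term of [rowsum_double], which is at most 1 / 4 ^+ i.+1. *)
suff H : forall i z, wexp z != 1 -> `|complex.Re z| <= 1 ->
    normc (csq z - rowsum z (2 ^ i)) <= (B + 1) / 2 ^+ i - 1 / 4 ^+ i.
  move=> h1 h2; apply: le_trans (H _ _ h1 h2) _.
  by rewrite gerBl divr_ge0// exprn_ge0.
move=> {z}{}i; elim: i => [|i IH] z hz hx.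
  rewrite expn0 !expr0 !divr1 rowsumS rowsum0.
  have four w : 2^-1 <= `|complex.Re w| -> normc (w ^- 2) <= 4.
    move=> h; apply: le_trans (normc_invsqr_le (K := 2^-1) _ _) _ => //.
      exact: le_trans (normc_Re _).
    by rewrite -exprVn invrK; lra.
  (* Either z itself or its integer shift v satisfies |Re| <= 1 / 2, where [csq_pole] applies; the
     two other terms of [rowsum z 1] are then at distance at least 1 / 2 from their poles. *)
  suff [e|e] : normc (csq z - z ^- 2) <= K /\ 2^-1 <= `|complex.Re (z - 1)| /\ 2^-1 <= `|complex.Re (z + 1)| \/
     (exists v, [/\ normc (csq z - v ^- 2) <= K & exists a b, [/\ 2^-1 <= `|complex.Re a|, 2^-1 <= `|complex.Re b| & z ^- 2 + ((z - 1) ^- 2 + (z + 1) ^- 2) = v ^- 2 + (a ^- 2 + b ^- 2)]]).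
  - have [e1 [e2 e3]] := e.
    rewrite (_ : _ - _ = (csq z - z ^- 2) - ((z - 1) ^- 2 + (z + 1) ^- 2)); last by ring.
    apply: le_trans (normcB_le _ _) _.
    have := le_normcD ((z - 1) ^- 2) ((z + 1) ^- 2).
    have := four _ e2; have := four _ e3; rewrite /B; lra.
  - have [v [e1 [a [b [e2 e3 e4]]]]] := e.
    rewrite e4 (_ : _ - _ = (csq z - v ^- 2) - (a ^- 2 + b ^- 2)); last by ring.
    apply: le_trans (normcB_le _ _) _.
    have := le_normcD (a ^- 2) (b ^- 2).
    have := four _ e2; have := four _ e3; rewrite /B; lra.
  have R1 : complex.Re (1 : C) = 1 by [].
  have [h|h] := leP (`|complex.Re z|) 2^-1.
    left; split; first exact: hK.
    move: h; rewrite ReB ReD R1 ler_norml => /andP[h1 h2].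
    by split; [rewrite ler0_norm; lra|rewrite ger0_norm; lra].
  right; have [x0|x0] := leP 0 (complex.Re z).
    rewrite ger0_norm// in h hx; exists (z - 1); split.
      rewrite (_ : csq z = csq (z - 1)); last by rewrite -[RHS]csqD1 subrK.
      apply: hK; first by rewrite -wexpD1 subrK.
      by rewrite ReB R1 ler_norml; lra.
    exists z, (z + 1); split; last by ring.
      by rewrite ger0_norm// ltW.
    by rewrite ReD R1 ger0_norm; lra.
  rewrite ltr0_norm// in h hx; exists (z + 1); split.
    rewrite -csqD1; apply: hK; first by rewrite wexpD1.
    by rewrite ReD R1 ler_norml; lra.
  exists z, (z - 1); split; last by ring.
    by rewrite ltr0_norm// ltW.
  by rewrite ReB R1 ltr0_norm; lra.
have [h1 h2] := wexp_half_neq1 hz.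
have Rh u : complex.Re (u / 2) = complex.Re u / 2.
  by case: u => a b; rewrite -[2^-1]/((2 : C)^-1) natc -fmorphV /= mulr0 subr0.
have R1 : complex.Re (1 : C) = 1 by [].
have b1 := IH _ h1; rewrite Rh normrM [`|2^-1|]ger0_norm// in b1.
have {}b1 := b1 ltac:(lra).
have b2 : `|complex.Re ((z + 1) / 2)| <= 1.
  by move: hx; rewrite Rh ReD R1 !ler_norml; lra.
have {}b2 := IH _ h2 b2.
have d := rowsum_double z (2 ^ i); rewrite -expnS in d.
set M := (2 ^ i.+1)%N in d *.
have e : csq z - rowsum z M = 4^-1 * ((csq (z / 2) - rowsum (z / 2) (2 ^ i)) +
   (csq ((z + 1) / 2) - rowsum ((z + 1) / 2) (2 ^ i))) + (z + M.+1%:R) ^- 2.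
  have -> : (csq (z / 2) - rowsum (z / 2) (2 ^ i)) +
   (csq ((z + 1) / 2) - rowsum ((z + 1) / 2) (2 ^ i)) = 4 * csq z -
    4 * (rowsum z M + (z + M.+1%:R) ^- 2).
    by rewrite -d -csq_double//; ring.
  by move: (rowsum z M) ((z + M.+1%:R) ^- 2) (csq z) => r X c; field.
rewrite e; apply: le_trans (le_normcD _ _) _.
have b3 : normc ((z + M.+1%:R) ^- 2) <= (2 ^+ i.+1) ^- 2.
  apply: normc_invsqr_le; first by rewrite exprn_gt0.
  apply: le_trans (normc_Re _); rewrite ReD natc /=.
  rewrite -[M.+1%:R]natr1 /M natrX; apply: le_trans (ler_norm _).
  by move: hx; rewrite ler_norml; lra.
have b4 : normc (4^-1 : C) = 4^-1.
  by rewrite normcV natc normc_real ger0_norm.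
rewrite normcM b4.
have b5 := le_normcD (csq (z / 2) - rowsum (z / 2) (2 ^ i)) (csq ((z + 1) / 2) - rowsum ((z + 1) / 2) (2 ^ i)).
have f : (2 ^+ i.+1) ^- 2 = 4^-1 / 4 ^+ i :> R.
  by rewrite -exprM mulnC exprM exprS invfM -natrX.
rewrite f in b3.
rewrite (_ : (B + 1) / 2 ^+ i.+1 = 2^-1 * ((B + 1) / 2 ^+ i)); last by rewrite exprS invfM mulrCA.
rewrite (_ : 1 / 4 ^+ i.+1 = 4^-1 / 4 ^+ i); last by rewrite exprS invfM mul1r.
rewrite div1r in b1 b2.
move: b1 b2 b3 b5; set P := (B + 1) / _; set Q := (4 ^+ i)^-1.
by move=> *; lra.
Qed.

End RowLimit.

(** * Rate of convergence of the row sums *)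

Section LatticeSum.
Variable R : realType.
Local Notation C := R[i].
Implicit Types (z u v w : C) (N k m : nat).

Lemma normc_nat m : normc (m%:R : C) = m%:R.
Proof. by rewrite natc normc_real ger0_norm. Qed.

Definition tends0 (u : nat -> R) :=
  forall e : R, 0 < e -> exists i0, forall i, (i0 <= i)%N -> `|u i| <= e.

Lemma tends0_le (u v : nat -> R) i1 : (forall i, (i1 <= i)%N -> `|u i| <= `|v i|) ->
  tends0 v -> tends0 u.
Proof.
move=> uv v0 e e0; have [i0 h] := v0 e e0; exists (maxn i0 i1) => i.
rewrite geq_max => /andP[h0 h1]; apply: le_trans (h i h0); exact: uv.
Qed.

Lemma tends0D (u v : nat -> R) : tends0 u -> tends0 v -> tends0 (fun i => u i + v i).
Proof.
move=> u0 v0 e e0; have e2 : 0 < e / 2 by rewrite divr_gt0.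
have [i0 h0] := u0 _ e2; have [i1 h1] := v0 _ e2; exists (maxn i0 i1) => i.
rewrite geq_max => /andP[/h0 a /h1 b]; apply: le_trans (ler_normD _ _) _; lra.
Qed.

Lemma tends0Z (u : nat -> R) (K : R) : tends0 u -> tends0 (fun i => K * u i).
Proof.
move=> u0 e e0; have e2 : 0 < e / (`|K| + 1) by rewrite divr_gt0// ltr_pwDr.
have [i0 h0] := u0 _ e2; exists i0 => i /h0.
rewrite ler_pdivlMr ?ltr_pwDr// normrM mulrDr mulr1 mulrC => h.
by apply: le_trans h; rewrite mulrC lerDl.
Qed.

Lemma tends0_cvg (u : nat -> R) : tends0 u <-> u @ \oo --> 0.
Proof.
split => [h|/cvgrPdist_le h].
  apply/cvgrPdist_le => e e0; have [i0 h0] := h e e0.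
  by exists i0 => // i /= hi; rewrite sub0r normrN; exact: h0.
move=> e e0; have [i0 _ h0] := h e e0; exists i0 => i hi.
by have := h0 i hi; rewrite sub0r normrN.
Qed.

Lemma tends0_invS : tends0 (fun i => (i.+1%:R)^-1).
Proof. by apply/tends0_cvg; exact: cvg_harmonic. Qed.

Lemma tends0_inv : tends0 (fun i => (i%:R)^-1).
Proof.
move=> e e0; have [i0 h] := tends0_invS e0; exists i0.+1 => -[//|i] hi.
exact: h.
Qed.

Lemma natr_leS n : (n%:R : R) <= n.+1%:R. Proof. by rewrite ler_nat. Qed.

Lemma tends0_inv_pow2 : tends0 (fun i => (2 ^+ i)^-1).
Proof.
apply: (@tends0_le _ (fun i => (i%:R)^-1) 1%N); last exact: tends0_inv.
move=> i i0; rewrite !ger0_norm ?invr_ge0 ?exprn_ge0//.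
by rewrite lef_pV2 ?posrE ?exprn_gt0 ?ltr0n// -natrX ler_nat ltnW// ltn_expl.
Qed.

Lemma normc_inv_far z M : (0 < M)%N -> 2 * normc z <= M%:R ->
  normc ((z - M%:R) ^- 2) <= 4 / M%:R ^+ 2 /\ normc ((z + M%:R) ^- 2) <= 4 / M%:R ^+ 2.
Proof.
move=> M0 hM; have Mp : 0 < (M%:R : R) by rewrite ltr0n.
have e : 4 / M%:R ^+ 2 = (M%:R / 2 : R) ^- 2 by field; rewrite gt_eqF.
have d := normc_distr M%:R z; have d' := normc_distr M%:R (- z).
rewrite normc_nat in d; rewrite normc_nat normcN in d'.
rewrite e; split; apply: normc_invsqr_le; rewrite ?divr_gt0//.
  by rewrite -normcN opprB; lra.
by rewrite addrC -[z in _ + z]opprK; lra.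
Qed.

(** A shift of z by 1 changes a partial sum by two boundary terms that tend to 0, so the limit
    spreads from the strip to all z. Powers of 2 suffice, because the tail bounds below reach every
    N. *)
Lemma rowsum_csq_cvg z : wexp z != 1 ->
  tends0 (fun i => normc (csq z - rowsum z (2 ^ i))).
Proof.
have stepb v : tends0 (fun i => normc (- (v - (2 ^ i)%:R) ^- 2 + (v + (2 ^ i).+1%:R) ^- 2)).
  apply: (@tends0_le _ (fun i => 8 * (2 ^+ i)^-1) (Num.trunc (2 * normc v)).+1).
    move=> i hi; have hM : 2 * normc v <= (2 ^ i)%:R.
      apply: ltW; apply: lt_le_trans (truncnS_gt _) _; rewrite ler_nat.
      by apply: leq_trans hi _; rewrite ltnW// ltn_expl.
    have M0 : (0 < 2 ^ i)%N by rewrite expn_gt0.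
    have [h1 _] := normc_inv_far M0 hM.
    have [_ h2] := @normc_inv_far v (2 ^ i).+1 isT (le_trans hM (natr_leS _)).
    rewrite ger0_norm ?normc_ge0// ger0_norm ?mulr_ge0 ?invr_ge0 ?exprn_ge0//.
    apply: le_trans (le_normcD _ _) _; rewrite normcN.
    have p1 : 1 <= (2 ^ i)%:R :> R by rewrite ler1n.
    have p2 : (2 ^ i)%:R <= (2 ^ i).+1%:R :> R by exact: natr_leS.
    rewrite (_ : 2 ^+ i = (2 ^ i)%:R :> R); last by rewrite natrX.
    set P : R := (2 ^ i)%:R in h1 p1 p2 *.
    set Q : R := (2 ^ i).+1%:R in h2 p2 *.
    have P0 : 0 < P by lra.
    have q1 : (P ^+ 2)^-1 <= P^-1.
      by rewrite lef_pV2 ?posrE ?exprn_gt0// expr2 ler_peMl// ltW.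
    have Q0 : 0 < Q by lra.
    have q2 : (Q ^+ 2)^-1 <= P^-1.
      rewrite lef_pV2 ?posrE ?exprn_gt0//; apply: le_trans p2 _.
      by rewrite expr2 ler_peMl ?(ltW Q0)//; lra.
    apply: le_trans (lerD h1 h2) _; 
    have -> : 8 / P = 4 / P + 4 / P by rewrite -mulrDl; congr (_ / _); ring.
    by apply: lerD; rewrite ler_pM2l.
  by apply: tends0Z; exact: tends0_inv_pow2.
have up v : wexp v != 1 -> tends0 (fun i => normc (csq v - rowsum v (2 ^ i))) ->
    tends0 (fun i => normc (csq (v + 1) - rowsum (v + 1) (2 ^ i))).
  move=> hv h0; apply: (tends0_le (i1 := 0%N) _ (tends0D h0 (stepb v))) => i _.
  rewrite !ger0_norm ?addr_ge0 ?normc_ge0// rowsum_shift csqD1.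
  rewrite -[normc (- _ + _)]normcN; apply: le_trans (le_normcD _ _).
  rewrite le_eqVlt; apply/orP; left; apply/eqP; congr normc.
  by move: (rowsum v _) => r; ring.
have dn v : wexp v != 1 -> tends0 (fun i => normc (csq v - rowsum v (2 ^ i))) ->
    tends0 (fun i => normc (csq (v - 1) - rowsum (v - 1) (2 ^ i))).
  move=> hv h0; apply: (tends0_le (i1 := 0%N) _ (tends0D h0 (stepb (v - 1)))) => i _.
  rewrite !ger0_norm ?addr_ge0 ?normc_ge0//.
  have e : v = (v - 1) + 1 by rewrite subrK.
  rewrite {3 4}e rowsum_shift csqD1.
  apply: le_trans (le_normcD _ _).
  rewrite le_eqVlt; apply/orP; left; apply/eqP; congr normc.
  by move: (rowsum (v - 1) _) => r; ring.
have base v : wexp v != 1 -> `|complex.Re v| <= 1 ->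
    tends0 (fun i => normc (csq v - rowsum v (2 ^ i))).
  have [K K0 hK] := rowsum_csq_pow2 R.
  move=> hv rv; apply: (@tends0_le _ (fun i => K * (2 ^+ i)^-1) 0).
    move=> i _; rewrite ger0_norm ?normc_ge0//; apply: le_trans (hK _ _ hv rv) _.
    exact: ler_norm.
  by apply: tends0Z; exact: tends0_inv_pow2.
have wn m v : wexp (v + m%:R) = wexp v.
  by elim: m => [|m IH]; rewrite ?addr0// -natr1 addrA wexpD1.
have ups m v : wexp v != 1 -> tends0 (fun i => normc (csq v - rowsum v (2 ^ i))) ->
    tends0 (fun i => normc (csq (v + m%:R) - rowsum (v + m%:R) (2 ^ i))).
  move=> hv h; elim: m => [|m IH]; first by rewrite addr0.
  by rewrite -natr1 addrA; apply: up => //; rewrite wn.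
have wn' m v : wexp (v - m%:R) = wexp v by rewrite -(wn m) subrK.
have dns m v : wexp v != 1 -> tends0 (fun i => normc (csq v - rowsum v (2 ^ i))) ->
    tends0 (fun i => normc (csq (v - m%:R) - rowsum (v - m%:R) (2 ^ i))).
  move=> hv h; elim: m => [|m IH]; first by rewrite subr0.
  by rewrite -natr1 opprD addrA; apply: dn => //; rewrite wn'.
move=> hz; have [x0|x0] := leP 0 (complex.Re z).
  pose n := Num.trunc (complex.Re z).
  rewrite -[z](subrK n%:R); apply: ups; first by rewrite wn'.
  apply: base; first by rewrite wn'.
  rewrite ReB natc /=; have := truncn_le (complex.Re z); have := truncnS_gt (complex.Re z).
  by rewrite x0 -/n -natr1 => a b; rewrite ger0_norm; lra.
pose n := Num.trunc (- complex.Re z).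
rewrite -[z](addrK n%:R); apply: dns; first by rewrite wn.
apply: base; first by rewrite wn.
rewrite ReD natc /=; have := truncn_le (- complex.Re z); have := truncnS_gt (- complex.Re z).
by rewrite oppr_ge0 (ltW x0) -/n -natr1 => a b; rewrite ler0_norm; lra.
Qed.

Lemma rowsum_tail_cmp z w N (A : R) : (0 < N)%N -> 0 <= A ->
  (forall m, (N < m)%N -> normc ((z - m%:R) ^- 2 - (w - m%:R) ^- 2) <= A / m%:R ^+ 3 /\
     normc ((z + m%:R) ^- 2 - (w + m%:R) ^- 2) <= A / m%:R ^+ 3) ->
  forall M, (N <= M)%N ->
  normc ((rowsum z M - rowsum w M) - (rowsum z N - rowsum w N)) <=
    A * (N%:R ^- 2 - M%:R ^- 2).
Proof.
move=> N0 A0 h; elim=> [|M IH]; first by rewrite leqNgt N0.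
rewrite leq_eqVlt => /orP[/eqP <-|]; first by rewrite !subrr normc0 mulr0.
rewrite ltnS => NM; have := IH NM; rewrite !rowsumS.
have [h1 h2] := h M.+1 NM.
set a := (_ - M.+1%:R) ^- 2; set b := (_ + M.+1%:R) ^- 2.
set a' := (_ - M.+1%:R) ^- 2; set b' := (_ + M.+1%:R) ^- 2.
rewrite -/a -/b -/a' -/b' in h1 h2.
move: (rowsum z M) (rowsum w M) (rowsum z N) (rowsum w N) => r1 r2 r3 r4 ih.
rewrite (_ : _ - _ = (r1 - r2 - (r3 - r4)) + ((a - a') + (b - b'))); last by ring.
apply: le_trans (le_normcD _ _) _.
have h3 := le_normcD (a - a') (b - b').
have Mp : 0 < (M%:R : R) by rewrite ltr0n (leq_trans N0).
have Mp' : 0 < (M.+1%:R : R) by rewrite ltr0n.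
have key : 2 / M.+1%:R ^+ 3 <= M%:R ^- 2 - M.+1%:R ^- 2 :> R.
  rewrite -subr_ge0 -natr1.
  rewrite (_ : _ - _ = (3 * M%:R + 1) / (M%:R ^+ 2 * (M%:R + 1) ^+ 3)); last first.
    by field; rewrite gt_eqF//= gt_eqF// ltr_pwDr.
  by rewrite divr_ge0 ?mulr_ge0 ?exprn_ge0//; lra.
have := ler_wpM2l A0 key; set x := N%:R ^- 2 in ih *; set y := M%:R ^- 2 in ih *.
set t := M.+1%:R ^- 2; rewrite (_ : A * (2 / _) = 2 * (A / M.+1%:R ^+ 3)); last by ring.
set s := A / _ in h1 h2 *; move=> k.
move: ih k; rewrite !mulrBr => ih k.
by lra.
Qed.

(** A single row cut at N has an error of order 1 / N, too large to be added over about 2 N rows. In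
    the difference of two rows the terms are of order m^-3, so the error is of order N^-2 and the
    sum over all rows still tends to 0. *)
Lemma rowsum_csq_cmp z w N (A : R) : wexp z != 1 -> wexp w != 1 -> (0 < N)%N -> 0 <= A ->
  (forall m, (N < m)%N -> normc ((z - m%:R) ^- 2 - (w - m%:R) ^- 2) <= A / m%:R ^+ 3 /\
     normc ((z + m%:R) ^- 2 - (w + m%:R) ^- 2) <= A / m%:R ^+ 3) ->
  normc ((csq z - csq w) - (rowsum z N - rowsum w N)) <= A / N%:R ^+ 2.
Proof.
move=> hz hw N0 A0 h; apply/ler_addgt0Pr => e e0.
have e2 : 0 < e / 2 by rewrite divr_gt0.
have [i0 h0] := rowsum_csq_cvg hz e2; have [i1 h1] := rowsum_csq_cvg hw e2.
pose i := (i0 + i1 + N)%N; pose M := (2 ^ i)%N.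
have NM : (N <= M)%N.
  by rewrite (leq_trans (ltnW (ltn_expl N (isT : 1 < 2)%N)))// leq_pexp2l// leq_addl.
have {}h := rowsum_tail_cmp N0 A0 h NM.
have := h0 i; rewrite {1}/i -addnA leq_addr => /(_ isT); rewrite ger0_norm ?normc_ge0// => {}h0.
have := h1 i; rewrite {1}/i addnAC leq_addl => /(_ isT); rewrite ger0_norm ?normc_ge0// => {}h1.
rewrite -/M in h0 h1; move: h h0 h1.
move: (rowsum z M) (rowsum w M) (rowsum z N) (rowsum w N) => r1 r2 r3 r4 h h0 h1.
rewrite (_ : _ - _ = (r1 - r2 - (r3 - r4)) + ((csq z - r1) - (csq w - r2))); last by ring.
apply: le_trans (le_normcD _ _) _.
have h3 := normcB_le (csq z - r1) (csq w - r2).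
have : 0 <= A * M%:R ^- 2 by rewrite mulr_ge0// invr_ge0 exprn_ge0.
by move: h; rewrite mulrBr; lra.
Qed.

Lemma rowsum_tail z N : (0 < N)%N -> 2 * normc z <= N%:R -> forall M, (N <= M)%N ->
  normc (rowsum z M - rowsum z N) <= 8 * (N%:R^-1 - M%:R^-1).
Proof.
move=> N0 hN; elim=> [|M IH]; first by rewrite leqNgt N0.
rewrite leq_eqVlt => /orP[/eqP <-|]; first by rewrite !subrr normc0 mulr0.
rewrite ltnS => NM; have := IH NM; rewrite !rowsumS.
have hM : 2 * normc z <= M.+1%:R.
  by apply: le_trans hN _; rewrite ler_nat (leq_trans NM).
have [h1 h2] := normc_inv_far (isT : 0 < M.+1)%N hM.
set a := (_ - M.+1%:R) ^- 2 in h1 *; set b := (_ + M.+1%:R) ^- 2 in h2 *.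
move: (rowsum z M) (rowsum z N) => r1 r2 ih.
rewrite (_ : _ - _ = (r1 - r2) + (a + b)); last by ring.
apply: le_trans (le_normcD _ _) _.
have h3 := le_normcD a b.
have Mp : 0 < (M%:R : R) by rewrite ltr0n (leq_trans N0).
have key : (M.+1%:R ^+ 2)^-1 <= M%:R ^-1 - M.+1%:R ^-1 :> R.
  rewrite -subr_ge0 -natr1.
  rewrite (_ : _ - _ = 1 / (M%:R * (M%:R + 1) ^+ 2)); last first.
    by field; rewrite gt_eqF//= gt_eqF// ltr_pwDr.
  by rewrite divr_ge0 ?mulr_ge0 ?exprn_ge0//; lra.
move: key h1 h2 ih h3; move: (M.+1%:R ^- 2 : R) (M.+1%:R^-1 : R) (M%:R^-1 : R) (N%:R^-1 : R).
by move=> *; lra.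
Qed.

Lemma rowsum_csq_far z N : wexp z != 1 -> (0 < N)%N -> 2 * normc z <= N%:R ->
  normc (csq z - rowsum z N) <= 8 / N%:R.
Proof.
move=> hz N0 hN; apply/ler_addgt0Pr => e e0.
have [i0 h0] := rowsum_csq_cvg hz e0.
pose i := (i0 + N)%N; pose M := (2 ^ i)%N.
have NM : (N <= M)%N.
  by rewrite (leq_trans (ltnW (ltn_expl N (isT : 1 < 2)%N)))// leq_pexp2l// leq_addl.
have h := rowsum_tail N0 hN NM.
have := h0 i; rewrite {1}/i leq_addr => /(_ isT); rewrite ger0_norm ?normc_ge0// => {}h0.
rewrite -/M in h0; move: h h0.
move: (rowsum z M) (rowsum z N) => r1 r2 h h0.
rewrite (_ : csq z - r2 = (r1 - r2) + (csq z - r1)); last by ring.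
apply: le_trans (le_normcD _ _) _.
have : 0 <= (M%:R : R)^-1 by rewrite invr_ge0.
by move: h; lra.
Qed.

Lemma sum_centered (V : nmodType) (F : nat -> V) N :
  \sum_(i < N.*2.+1) F i = F N + \sum_(k < N) (F (N - k.+1)%N + F (N + k.+1)%N).
Proof.
rewrite big_split /= addrCA -(big_mkord xpredT F).
rewrite (_ : N.*2.+1 = (N + N.+1)%N); last by rewrite addnS addnn.
rewrite (@big_cat_nat _ _ _ N) //=; last by rewrite leq_addr.
congr (_ + _).
  rewrite big_mkord (reindex_inj rev_ord_inj) /=.
  by apply: eq_bigr => k _.
rewrite -{1}[N]add0n big_addn addKn big_mkord big_ord_recl add0n.
by congr (_ + _); apply: eq_bigr => k _; rewrite addnC.
Qed.

End LatticeSum.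

(** * The Weierstrass lattice series summed by rows *)

Section WeierstrassRows.
Variable R : realType.
Local Notation C := R[i].
Implicit Types (z u v w : C) (N k m : nat).

Definition latsum (tau z : C) N : C :=
  \sum_(i < N.*2.+1) \sum_(j < N.*2.+1 | ~~ ((i == N :> nat) && (j == N :> nat)))
    ((z - lattice_pt tau N i j) ^- 2 - (lattice_pt tau N i j) ^- 2).

Definition rowdiff (z u : C) N : C := rowsum (z - u) N - rowsum (- u) N.

Lemma sum_row v N (F : nat -> C) :
  (forall i, F i = (v - (i%:R - N%:R)) ^- 2) -> \sum_(i < N.*2.+1) F i = rowsum v N.
Proof.
move=> hF; rewrite (sum_centered F) /rowsum hF subrr subr0; congr (_ + _).
apply: eq_bigr => k _; rewrite addrC !hF; congr (_ + _).
  by rewrite natrD; congr (_ ^- 2); ring.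
by rewrite natrB//; congr (_ ^- 2); ring.
Qed.

Lemma latsumE tau z N : z ^- 2 + latsum tau z N = rowdiff z 0 N +
  \sum_(k < N) (rowdiff z (k.+1%:R * tau) N + rowdiff z (- (k.+1%:R * tau)) N).
Proof.
pose G (i j : nat) : C := (z - lattice_pt tau N i j) ^- 2 - (lattice_pt tau N i j) ^- 2.
(* Since 0 ^- 2 = 0, the summand of the lattice point 0 is exactly z ^- 2, and the double sum needs
   no exclusion. *)
have e0 : z ^- 2 = G N N.
  by rewrite /G /lattice_pt !subrr mul0r addr0 subr0 expr0n /= invr0 subr0.
have -> : z ^- 2 + latsum tau z N = \sum_(i < N.*2.+1) \sum_(j < N.*2.+1) G i j.
  have hN : (N < N.*2.+1)%N by rewrite ltnS -addnn leq_addr.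
  pose o := Ordinal hN.
  rewrite e0 /latsum pair_big_dep pair_big /= [RHS](bigD1 (o, o)) //=; congr (_ + _).
rewrite exchange_big /=.
pose H j : C := rowdiff z ((j%:R - N%:R) * tau) N.
rewrite (eq_bigr (fun j : 'I_N.*2.+1 => H j)); last first.
  move=> j _; rewrite /G sumrB /H /rowdiff; congr (_ - _).
    apply: (@sum_row _ N (fun i => (z - lattice_pt tau N i j) ^- 2)) => i.
    by congr (_ ^- 2); rewrite /lattice_pt; ring.
  apply: (@sum_row _ N (fun i => lattice_pt tau N i j ^- 2)) => i.
  by rewrite /lattice_pt -sqrrN; congr (_ ^- 2); ring.
rewrite (sum_centered H) /H subrr mul0r; congr (_ + _).
apply: eq_bigr => k _; rewrite addrC natrD natrB//; congr (_ + _); congr rowdiff; ring.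
Qed.

Lemma inv_sqr_sub_le z w (r : R) : 0 < r -> r <= normc w -> 2 * normc z <= r ->
  normc ((z - w) ^- 2 - w ^- 2) <= 10 * normc z / r ^+ 3.
Proof.
move=> r0 rw zr; have nz := normc_ge0 z.
have w0 : 0 < normc w by exact: lt_le_trans rw.
have d : normc w / 2 <= normc (z - w).
  by have := normc_distr w z; rewrite -[normc (w - z)]normcN opprB; lra.
have zw : z - w != 0 by rewrite -normc_gt0; apply: lt_le_trans d; lra.
rewrite (_ : _ - _ = z * (2 * w - z) / (w ^+ 2 * (z - w) ^+ 2)); last first.
  by field; rewrite zw -normc_gt0 w0.
rewrite !(normcM, normcV, normcX).
have t : normc (2 * w - z) <= 5 / 2 * normc w.
  by apply: le_trans (normcB_le _ _) _; rewrite normcM natc normc_real ger0_norm//; lra.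
apply: (@le_trans _ _ (normc z * (5 / 2 * normc w) / (normc w ^+ 2 * (normc w / 2) ^+ 2))).
  apply: ler_pM; rewrite ?mulr_ge0 ?invr_ge0 ?mulr_ge0 ?exprn_ge0 ?normc_ge0//.
    by rewrite ler_wpM2l.
  rewrite lef_pV2 ?posrE ?mulr_gt0 ?exprn_gt0//; last 2 first.
    by rewrite normc_gt0.
    by lra.
  by rewrite ler_wpM2l ?exprn_ge0 ?normc_ge0// lerXn2r ?nnegrE ?normc_ge0//; lra.
rewrite [leLHS](_ : _ = 10 * normc z * (normc w ^+ 3)^-1); last by field; rewrite gt_eqF.
rewrite ler_wpM2l ?mulr_ge0// lef_pV2 ?posrE ?exprn_gt0//.
by rewrite lerXn2r ?nnegrE ?(ltW r0) ?(ltW w0).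
Qed.

Section Lattice.
Variable tau : C.
Hypothesis tau_gt0 : 0 < complex.Im tau.

Let c : R := 1 / (1 + `|complex.Re tau| / complex.Im tau).

Let c_gt0 : 0 < c.
Proof. by rewrite divr_gt0// ltr_pwDl// divr_ge0// ltW. Qed.

(** The constant does not depend on y, so one bound serves all the rows y * tau at once. *)
Lemma lattice_lower (x y : R) : c * `|x| <= normc (x%:C + y%:C * tau).
Proof.
set w := x%:C + y%:C * tau.
have hx : `|complex.Re w| <= normc w := normc_Re w.
have hy : `|complex.Im w| <= normc w := normc_Im w.
rewrite /w ReD ReZ ImD ImZ /= add0r in hx hy; rewrite -/w in hx hy.
have t0 := tau_gt0; set t := complex.Im tau in t0 hy *.
set a := complex.Re tau in hx *.
rewrite /c -/t -/a mulrAC mul1r ler_pdivrMr; last by rewrite ltr_pwDl// divr_ge0// ltW.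
have -> : x = (x + y * a) - (y * a) by ring.
apply: le_trans (ler_normB _ _) _; rewrite mulrDr mulr1 lerD// normrM.
rewrite normrM (gtr0_norm t0) in hy.
by rewrite mulrA ler_pdivlMr// mulrAC ler_wpM2r.
Qed.

Lemma rowdiff_csq z (y : R) N : (0 < N)%N -> 2 * normc z <= c * N%:R ->
  wexp (z - y%:C * tau) != 1 -> wexp (- (y%:C * tau)) != 1 ->
  normc ((csq (z - y%:C * tau) - csq (- (y%:C * tau))) - rowdiff z (y%:C * tau) N) <=
    (10 * normc z / c ^+ 3) / N%:R ^+ 2.
Proof.
move=> N0 hN h1 h2; apply: rowsum_csq_cmp => //.
  apply: divr_ge0; first by apply: mulr_ge0 => //; exact: normc_ge0.
  exact/exprn_ge0/ltW.
move=> m hm.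
have m0 : 0 < (m%:R : R) by rewrite ltr0n (leq_ltn_trans _ hm).
have r0 : 0 < c * m%:R by rewrite mulr_gt0.
have zr : 2 * normc z <= c * m%:R.
  by apply: le_trans hN _; rewrite ler_pM2l// ler_nat ltnW.
have l1 := lattice_lower m%:R y; have l2 := lattice_lower (- m%:R) y.
rewrite normrN !(ger0_norm (ltW m0)) rmorphN rmorph_nat in l1 l2.
rewrite rmorph_nat in l2.
have -> : 10 * normc z / c ^+ 3 / m%:R ^+ 3 = 10 * normc z / (c * m%:R) ^+ 3.
  by field; rewrite (gt_eqF m0) (gt_eqF c_gt0).
split.
  rewrite [X in normc X](_ : _ = (z - (m%:R + y%:C * tau)) ^- 2 - (m%:R + y%:C * tau) ^- 2).
    exact: inv_sqr_sub_le.
  by congr (_ ^- 2 - _); [ring|rewrite -sqrrN; congr (_ ^- 2); ring].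
rewrite [X in normc X](_ : _ = (z - (- m%:R + y%:C * tau)) ^- 2 - (- m%:R + y%:C * tau) ^- 2).
  exact: inv_sqr_sub_le.
by congr (_ ^- 2 - _); [ring|rewrite -sqrrN; congr (_ ^- 2); ring].
Qed.

Definition csqpart z N : R := complex.Re (csq z) +
  \sum_(k < N) complex.Re (csq (z - k.+1%:R * tau) + csq (z + k.+1%:R * tau)).

(** The row through 0 cannot be replaced by a value of [csq], which has a pole there; its partial
    sum without the pole (0 ^- 2 = 0) is kept instead. *)
Definition csqconst N : R := complex.Re (rowsum 0 N) +
  \sum_(k < N) complex.Re (csq (- (k.+1%:R * tau)) + csq (k.+1%:R * tau)).

(** The central row costs O(1 / N) and each of the 2 N other rows O(1 / N^2), so replacing truncated
    rows by [csq] costs O(1 / N) in total. *)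
Lemma latsum_csqpart z : wexp z != 1 ->
  (forall k, wexp (z - k.+1%:R * tau) != 1 /\ wexp (z + k.+1%:R * tau) != 1) ->
  (forall k, wexp (k.+1%:R * tau) != 1) ->
  tends0 (fun N => complex.Re (z ^- 2 + latsum tau z N) - (csqpart z N - csqconst N)).
Proof.
move=> hz hk hq.
pose A := 10 * normc z / c ^+ 3.
have A0 : 0 <= A.
  apply: divr_ge0; first by apply: mulr_ge0 => //; exact: normc_ge0.
  exact/exprn_ge0/ltW.
apply: (@tends0_le _ _ (fun N => (8 + 2 * A) * (N%:R)^-1) (Num.trunc (2 * normc z / c + 2 * normc z)).+1); last first.
  by apply: tends0Z; exact: tends0_inv.
move=> N hN; have N0 : (0 < N)%N by exact: leq_ltn_trans hN.
have Np : 0 < (N%:R : R) by rewrite ltr0n.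
have hN' : 2 * normc z / c + 2 * normc z <= N%:R.
  by apply: ltW; apply: lt_le_trans (truncnS_gt _) _; rewrite ler_nat.
have nz := normc_ge0 z.
have hc : 2 * normc z <= c * N%:R.
  by rewrite [c * _]mulrC -ler_pdivrMr//; apply: le_trans hN'; lra.
have hf : 2 * normc z <= N%:R.
  apply: le_trans hN'; rewrite lerDr; apply: divr_ge0; first exact: mulr_ge0.
  exact: ltW.
rewrite latsumE /csqpart /csqconst.
set Fs := fun k : nat => csq (z - k.+1%:R * tau) + csq (z + k.+1%:R * tau).
set Gs := fun k : nat => csq (- (k.+1%:R * tau)) + csq (k.+1%:R * tau).
have -> : complex.Re (rowdiff z 0 N +
     \sum_(k < N) (rowdiff z (k.+1%:R * tau) N + rowdiff z (- (k.+1%:R * tau)) N)) -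
   (complex.Re (csq z) + \sum_(k < N) complex.Re (Fs k) -
    (complex.Re (rowsum 0 N) + \sum_(k < N) complex.Re (Gs k))) =
  - complex.Re ((csq z - rowsum z N) + \sum_(k < N) (
     ((csq (z - k.+1%:R * tau) - csq (- (k.+1%:R * tau))) - rowdiff z (k.+1%:R * tau) N) +
     ((csq (z + k.+1%:R * tau) - csq (k.+1%:R * tau)) - rowdiff z (- (k.+1%:R * tau)) N))).
  rewrite -!Re_sum.
  rewrite [X in - complex.Re (_ + X)](_ : _ = \sum_(k < N) Fs k - \sum_(k < N) Gs k -
    \sum_(k < N) (rowdiff z (k.+1%:R * tau) N + rowdiff z (- (k.+1%:R * tau)) N)); last first.
    by rewrite -!sumrB; apply: eq_bigr => k _; rewrite /Fs /Gs; ring.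
  rewrite {1}/rowdiff subr0 oppr0.
  move: (\sum_(k < N) Fs k) (\sum_(k < N) Gs k) (\sum_(k < N) (rowdiff _ _ _ + _)) => S1 S2 S3.
  move: (rowsum z N) (rowsum 0 N) (csq z) => [x1 y1] [x2 y2] [x3 y3].
  by case: S1 S2 S3 => [x4 y4] [x5 y5] [x6 y6] /=; ring.
rewrite normrN; apply: le_trans (normc_Re _) _.
apply: le_trans (le_normcD _ _) _.
rewrite [leRHS]ger0_norm ?mulr_ge0 ?invr_ge0//; last lra.
rewrite mulrDl; apply: lerD; first exact: rowsum_csq_far.
apply: le_trans (normc_sum _ _ _) _.
apply: (@le_trans _ _ (\sum_(k < N) 2 * (A / N%:R ^+ 2))).
  apply: ler_sum => k _; apply: le_trans (le_normcD _ _) _.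
  have -> : 2 * (A / N%:R ^+ 2) = A / N%:R ^+ 2 + A / N%:R ^+ 2 by ring.
  have [h1 h2] := hk k; have h3 := hq k.
  have cn : k.+1%:R = (k.+1%:R : R)%:C by rewrite natc.
  apply: lerD.
    rewrite cn; apply: rowdiff_csq => //; rewrite -?cn//.
    by rewrite wexpN; apply: contra h3 => /eqP /(congr1 GRing.inv); rewrite invrK invr1 => ->.
  have e u : u + k.+1%:R * tau = u - (- k.+1%:R)%:C * tau.
    by rewrite rmorphN rmorph_nat; ring.
  have e1 : - (k.+1%:R * tau) = (- k.+1%:R)%:C * tau.
    by rewrite rmorphN rmorph_nat; ring.
  have e2 : k.+1%:R * tau = - ((- k.+1%:R)%:C * tau).
    by rewrite rmorphN rmorph_nat; ring.
  rewrite e1 e [X in csq _ - csq X]e2; apply: rowdiff_csq => //; first by rewrite -e.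
  by rewrite -e2.
rewrite sumr_const card_ord -[leLHS]mulr_natl le_eqVlt; apply/orP; left; apply/eqP.
by field; rewrite gt_eqF.
Qed.

Lemma weierstrass_p_csq z (L K : R) : wexp z != 1 ->
  (forall k, wexp (z - k.+1%:R * tau) != 1 /\ wexp (z + k.+1%:R * tau) != 1) ->
  (forall k, wexp (k.+1%:R * tau) != 1) ->
  csqpart z @ \oo --> L -> csqconst @ \oo --> K ->
  complex.Re (weierstrass_p tau z) = L - K.
Proof.
move=> hz hk hq hL hK; rewrite /weierstrass_p ReD /clim /=.
have h0 := (tends0_cvg _).1 (latsum_csqpart hz hk hq).
have e : (fun n => complex.Re (latsum tau z n)) @ \oo --> L - K - complex.Re (z ^- 2).
  have -> : L - K - complex.Re (z ^- 2) = (0 + (L - K)) - complex.Re (z ^- 2) by rewrite add0r.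
  rewrite (_ : (fun n => complex.Re (latsum tau z n)) = (fun N =>
    (complex.Re (z ^- 2 + latsum tau z N) - (csqpart z N - csqconst N)) +
    (csqpart z N - csqconst N) - complex.Re (z ^- 2))).
    apply: cvgB; last exact: cvg_cst.
    by apply: cvgD => //; apply: cvgB.
  apply/funext => n.
  by move: (z ^- 2) (latsum tau z n) => [x1 y1] [x2 y2] /=; ring.
by rewrite -/(latsum tau z) (cvg_lim _ e)//; ring.
Qed.

End Lattice.
End WeierstrassRows.

(** * Series dominated by a geometric series *)

Section GeometricSums.
Variable R : realType.
Implicit Types (u v : nat -> R) (r A c h : R) (n N j : nat).

Definition gbound r u := exists A, forall n, `|u n| <= A * r ^+ n.

Definition gsum u : R := limn (series u).

Lemma series_ord u N : series u N = \sum_(k < N) u k.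
Proof. by rewrite /series /= big_mkord. Qed.

Lemma gbound_cvg r u : 0 <= r < 1 -> gbound r u -> series u @ \oo --> gsum u.
Proof.
move=> /andP[r0 r1] [A hA]; apply: (@normed_cvg _ R^o).
apply: (@series_le_cvg _ _ (geometric A r)) => [n|n|n|].
- exact: normr_ge0.
- exact: le_trans (normr_ge0 _) (hA n).
- exact: hA.
- by apply: is_cvg_geometric_series; rewrite ger0_norm.
Qed.

Lemma gsumP r u (l : R) : 0 <= r < 1 -> gbound r u -> series u @ \oo --> l -> gsum u = l.
Proof. by move=> _ _ h; apply/cvg_lim. Qed.

Lemma gboundD r u v : gbound r u -> gbound r v -> gbound r (fun n => u n + v n).
Proof.
move=> [A hA] [B hB]; exists (A + B) => n.
by apply: le_trans (ler_normD _ _) _; rewrite mulrDl lerD.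
Qed.

Lemma gboundZ r u (k : R) : gbound r u -> gbound r (fun n => k * u n).
Proof.
move=> [A hA]; exists (`|k| * A) => n.
by rewrite normrM -mulrA ler_wpM2l.
Qed.

Lemma gboundM r u v (B : R) : gbound r u -> (forall n, `|v n| <= B) -> gbound r (fun n => u n * v n).
Proof.
move=> [A hA] hB; exists (A * B) => n; rewrite normrM mulrAC.
by apply: ler_pM.
Qed.

Lemma gsumD r u v : 0 <= r < 1 -> gbound r u -> gbound r v ->
  gsum (fun n => u n + v n) = gsum u + gsum v.
Proof.
move=> hr hu hv; apply: (gsumP hr (gboundD hu hv)).
have -> : series (fun n => u n + v n) = (fun N => series u N + series v N).
  by apply/funext => N; rewrite /series /= big_split.
by apply: cvgD; [exact: gbound_cvg hu|exact: gbound_cvg hv].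
Qed.

Lemma gsumZ r u (k : R) : 0 <= r < 1 -> gbound r u -> gsum (fun n => k * u n) = k * gsum u.
Proof.
move=> hr hu; apply: (gsumP hr (gboundZ k hu)).
have -> : series (fun n => k * u n) = (fun N => k * series u N).
  by apply/funext => N; rewrite /series /= mulr_sumr.
by apply: (@cvgM _ _ _ _ (fun=> k) (series u)); [exact: cvg_cst|exact: gbound_cvg hu].
Qed.

Lemma gsum_le r u A : 0 <= r < 1 -> (forall n, `|u n| <= A * r ^+ n) ->
  `|gsum u| <= A / (1 - r).
Proof.
move=> hr hA; have hb : gbound r u by exists A.
have h := gbound_cvg hr hb; have /andP[r0 r1] := hr.
have h2 : (fun N => `|series u N|) @ \oo --> `|gsum u| by exact: cvg_norm.
rewrite -(cvg_lim _ h2)//; apply: limr_le; first by apply/cvg_ex; exists `|gsum u|.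
near=> N; apply: le_trans (ler_norm_sum _ _ _) _.
apply: (@le_trans _ _ (\sum_(0 <= k < N) A * r ^+ k)); first exact: ler_sum.
have := geometric_seriesE A (negbT (lt_eqF r1)) => /(congr1 (fun f => f N)) /= e.
rewrite /series /= in e; rewrite e.
have A0 : 0 <= A by have := hA 0%N; rewrite expr0 mulr1; exact: le_trans.
rewrite ler_pM2r ?invr_gt0 ?subr_gt0// ler_piMr//.
by rewrite gerBl exprn_ge0.
Unshelve. all: by end_near. Qed.

End GeometricSums.

(** * Series in c = cos (2 pi x) and their smoothness *)

Section PoissonSeries.
Variable R : realType.
Implicit Types (a rho : nat -> R) (c h x : R) (n N j : nat).

(** For real q and w on the unit circle with real part c, this is |1 - q w|^2. *)
Definition den (q c : R) : R := 1 - 2 * q * c + q ^+ 2.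

(** Twice the real part of [rr (q * w)] for |w| = 1 and Re w = c; for |q| < 1 and c = cos th it is 2
    times the sum over n of n q^n cos (n th). *)
Definition Xr (q c : R) : R := 2 * q * ((1 + q ^+ 2) * c - 2 * q) / den q c ^+ 2.

Lemma Xr1 c : c != 1 -> Xr 1 c = - (1 - c)^-1.
Proof.
move=> c1; have h : 1 - c != 0 by rewrite subr_eq0 eq_sym.
rewrite /Xr /den (_ : 1 - 2 * 1 * c + 1 ^+ 2 = 2 * (1 - c)); last by ring.
by field.
Qed.

(** Reflects rr (u^-1) = rr u; it identifies the contributions of the rows below the real axis with
    those above. *)
Lemma XrV (q c : R) : q != 0 -> Xr q^-1 c = Xr q c.
Proof.
move=> q0; rewrite /Xr.
have e : den q^-1 c = den q c / q ^+ 2 by rewrite /den; field.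
rewrite e expr_div_n; have [->|d0] := eqVneq (den q c) 0.
  by rewrite !(expr0n, mul0r, invr0, mulr0).
by field; rewrite d0 q0.
Qed.

Section Fixed.
Variables (r : R).
Hypothesis r01 : 0 <= r < 1.

(** A margin beyond [-1, 1] on which [den] stays bounded below, so that two-sided derivatives in c
    exist at c = 1 and c = -1 as well. *)
Let dl : R := (1 - r) ^+ 2 / 4.
Let B : R := 2 / (1 - r) ^+ 2.

Let r1 : 0 < 1 - r. Proof. by case/andP: r01 => _; rewrite subr_gt0. Qed.

Lemma den_lower q c : `|q| <= r -> `|c| <= 1 + dl -> B^-1 <= den q c.
Proof.
move=> qr cd; have r0 := r1; have /andP[r00 _] := r01.
have h : `|q * c| <= r * (1 + dl) by rewrite normrM; apply: ler_pM.
have hq : q ^+ 2 = `|q| ^+ 2 by rewrite real_normK ?num_real.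
have q0 := normr_ge0 q.
have d0 : 0 <= dl by rewrite divr_ge0// sqr_ge0.
have h2 : q * c <= `|q| * (1 + dl).
  by apply: le_trans (ler_norm _) _; rewrite normrM ler_wpM2l.
rewrite /den hq; have -> : B^-1 = (1 - r) ^+ 2 / 2 by rewrite /B invf_div.
have h3 : (1 - r) ^+ 2 <= (1 - `|q|) ^+ 2 by rewrite ler_pXn2r ?nnegrE//; lra.
have h4 : `|q| * dl <= dl by rewrite ler_piMl//; lra.
have h5 : dl = (1 - r) ^+ 2 / 4 by [].
by nra.
Qed.

Lemma B_gt0 : 0 < B. Proof. by rewrite divr_gt0// exprn_gt0// r1. Qed.

Lemma dl_gt0 : 0 < dl. Proof. by rewrite divr_gt0// exprn_gt0// r1. Qed.

Lemma den_gt0 q c : `|q| <= r -> `|c| <= 1 + dl -> 0 < den q c.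
Proof.
by move=> h1 h2; apply: lt_le_trans (den_lower h1 h2); rewrite invr_gt0 B_gt0.
Qed.

Lemma denV_le q c : `|q| <= r -> `|c| <= 1 + dl -> `|(den q c)^-1| <= B.
Proof.
move=> h1 h2; have d0 := den_gt0 h1 h2.
rewrite ger0_norm ?invr_ge0 ?(ltW d0)// -[leRHS]invrK lef_pV2 ?posrE ?invr_gt0 ?B_gt0//.
exact: den_lower.
Qed.

(** The constant is uniform in q, hence in the index of the series; this is what allows the
    remainders to be summed in [der_zsum]. *)
Lemma den_pow_taylor j : exists K, forall q c h, `|q| <= r -> `|c| <= 1 + dl ->
  `|c + h| <= 1 + dl ->
  `|(den q (c + h))^-1 ^+ j - (den q c)^-1 ^+ j - h * (j%:R * (2 * q) * (den q c)^-1 ^+ j.+1)|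
    <= K * h ^+ 2.
Proof.
elim: j => [|j [K IH]].
  by exists 0 => q c h _ _ _; rewrite !expr0 !mul0r mulr0 subrr subr0 normr0.
exists (B * K + 4 * j.+1%:R * B ^+ j.+3) => q c h hq hc hch.
have := IH q c h hq hc hch.
have d0 := den_gt0 hq hc; have d1 := den_gt0 hq hch.
have u0 := denV_le hq hc; have u1 := denV_le hq hch.
have e : (den q (c + h))^-1 - (den q c)^-1 = 2 * q * h * (den q c)^-1 * (den q (c + h))^-1.
  have -> : den q (c + h) = den q c - 2 * q * h by rewrite /den; ring.
  have : den q c - 2 * q * h != 0.
    by rewrite (_ : _ - _ = den q (c + h)) ?gt_eqF// /den; ring.
  by move=> nz; field; rewrite nz (gt_eqF d0).
move: u0 u1 e; set u := (den q c)^-1; set v := (den q (c + h))^-1 => u0 u1 e ih.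
have ev : v = u + 2 * q * h * u * v by rewrite -e addrC subrK.
have -> : v ^+ j.+1 - u ^+ j.+1 - h * (j.+1%:R * (2 * q) * u ^+ j.+2) =
  v * (v ^+ j - u ^+ j - h * (j%:R * (2 * q) * u ^+ j.+1)) +
  4 * j.+1%:R * (q * h) ^+ 2 * (u ^+ j.+2 * v).
  apply/eqP; rewrite -subr_eq0 !exprS -natr1; set U := u ^+ j.
  rewrite [X in X == 0](_ : _ = U * ((v - u) - 2 * q * h * u * v) * (1 + 2 * q * h * (j%:R + 1) * u)).
    by rewrite e subrr mulr0 mul0r.
  by ring.
apply: le_trans (ler_normD _ _) _; rewrite [leRHS]mulrDl; apply: lerD.
  by rewrite normrM -[leRHS]mulrA; apply: ler_pM.
rewrite normrM normrM (ger0_norm (_ : 0 <= 4 * j.+1%:R)) ?mulr_ge0//.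
rewrite (ger0_norm (sqr_ge0 _)) exprMn -[leLHS]mulrA -[leRHS]mulrA ler_wpM2l ?mulr_ge0//.
have q1 : q ^+ 2 <= 1.
  by rewrite -real_normK ?num_real// expr_le1//; have /andP[] := r01; lra.
have hB : `|u ^+ j.+2 * v| <= B ^+ j.+3.
  rewrite normrM normrX [leRHS]exprSr; apply: ler_pM => //.
  by apply: lerXn2r => //; rewrite nnegrE (ltW B_gt0).
rewrite [leLHS]mulrAC ler_wpM2r ?sqr_ge0//.
by apply: le_trans hB; rewrite ler_piMl.
Qed.

(** This family is stable under d/dc: the exponent j grows by one and the new coefficients are again
    geometrically bounded. Smoothness of all orders therefore follows from one differentiation
    lemma. *)
Definition zsum a rho j c : R := gsum (fun n => a n * (den (rho n) c)^-1 ^+ j).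

Lemma zsum_bound a rho j c : gbound r a -> (forall n, `|rho n| <= r) ->
  `|c| <= 1 + dl -> gbound r (fun n => a n * (den (rho n) c)^-1 ^+ j).
Proof.
move=> ha hr hc; apply: (gboundM (B := B ^+ j)) => // n.
by rewrite normrX lerXn2r ?nnegrE ?(ltW B_gt0)// denV_le.
Qed.

Lemma zsum_coef a rho j : gbound r a -> (forall n, `|rho n| <= r) ->
  gbound r (fun n => j%:R * 2 * rho n * a n).
Proof.
move=> ha hr.
rewrite (_ : (fun n => _) = (fun n => a n * (j%:R * 2 * rho n))); last first.
  by apply/funext => n; ring.
apply: (gboundM (B := j%:R * 2)) => // n.
rewrite normrM ger0_norm ?mulr_ge0// ler_piMr ?mulr_ge0//.
by apply: le_trans (hr n) _; have /andP[] := r01; lra.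
Qed.

Lemma der_zsum a rho j c : gbound r a -> (forall n, `|rho n| <= r) -> `|c| <= 1 ->
  der c (zsum a rho j) (zsum (fun n => j%:R * 2 * rho n * a n) rho j.+1 c).
Proof.
move=> ha hr hc; have [K hK] := den_pow_taylor j; have [A hA] := ha.
have A0 : 0 <= A by have := hA 0%N; rewrite expr0 mulr1; exact: le_trans.
have ha' := zsum_coef j ha hr.
have hc' : `|c| <= 1 + dl by have := dl_gt0; lra.
apply: (@isd_of_quad _ _ _ _ (`|K| * A / (1 - r)) dl); first exact: dl_gt0.
move=> h hd; have hch : `|c + h| <= 1 + dl.
  by apply: le_trans (ler_normD _ _) _; lra.
rewrite /zsum; set f1 := fun n => _; set f0 := fun n => _; set f2 := fun n => _.
have b1 : gbound r f1 by exact: zsum_bound.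
have b0 : gbound r f0 by exact: zsum_bound.
have b2 : gbound r f2 by exact: zsum_bound.
rewrite (_ : _ - _ = gsum (fun n => f1 n + -1 * f0 n + -1 * (h * f2 n))); last first.
  rewrite (gsumD r01 (gboundD b1 (gboundZ (-1) b0)) (gboundZ (-1) (gboundZ h b2))).
  rewrite (gsumD r01 b1 (gboundZ (-1) b0)) (gsumZ (-1) r01 b0).
  by rewrite (gsumZ (-1) r01 (gboundZ h b2)) (gsumZ h r01 b2); ring.
rewrite mulrAC; apply: gsum_le => // n.
rewrite /f1 /f0 /f2 (_ : _ + _ = a n * ((den (rho n) (c + h))^-1 ^+ j - (den (rho n) c)^-1 ^+ j -
  h * (j%:R * (2 * rho n) * (den (rho n) c)^-1 ^+ j.+1))); last by ring.
rewrite normrM mulrC; apply: (@le_trans _ _ ((`|K| * h ^+ 2) * (A * r ^+ n))).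
  apply: ler_pM => //; apply: le_trans (hK _ _ _ (hr n) hc' hch) _.
  by rewrite ler_wpM2r ?sqr_ge0// ler_norm.
by rewrite le_eqVlt; apply/orP; left; apply/eqP; ring.
Qed.

Lemma smooth_zsum a rho j : gbound r a -> (forall n, `|rho n| <= r) ->
  smooth (fun x => zsum a rho j (cos (2 * pi * x))).
Proof.
move=> ha hr; apply/smooth_kdiff => n; elim: n a ha j => //= n IH a ha j.
have D x : der x (fun x => zsum a rho j (cos (2 * pi * x)))
   (zsum (fun n => j%:R * 2 * rho n * a n) rho j.+1 (cos (2 * pi * x)) *
    (- (2 * pi * sin (2 * pi * x)))).
  apply: (isd_comp (f := zsum a rho j) (isd_cos_lin _ _)); apply: der_zsum => //.
  exact: cos_max.
split=> [x|]; first exact: isd_derivable (D x).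
apply: kdiff_ext (fun x => esym (isd_derive1 (D x))) _.
apply: kdiffM.
  by apply: IH; exact: zsum_coef.
by apply: (smooth_kdiff _).1; apply: smoothN; apply: smoothZ; exact: smooth_sin.
Qed.

Lemma Xr_bound (rho : nat -> R) c : (forall n, `|rho n| <= r) -> gbound r rho ->
  `|c| <= 1 -> gbound r (fun n => Xr (rho n) c).
Proof.
move=> hr hb hc; have hc' : `|c| <= 1 + dl by have := dl_gt0; lra.
have -> : (fun n => Xr (rho n) c) =
  (fun n => rho n * (2 * ((1 + rho n ^+ 2) * c - 2 * rho n) * (den (rho n) c)^-1 ^+ 2)).
  by apply/funext => n; rewrite /Xr exprVn; ring.
apply: (gboundM (B := 8 * B ^+ 2)) => // n.
have h1 : `|rho n| <= 1 by apply: le_trans (hr n) _; have /andP[] := r01; lra.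
rewrite normrM ler_pM//; last first.
  by rewrite normrX lerXn2r ?nnegrE ?(ltW B_gt0)// denV_le.
have h2 : rho n ^+ 2 <= 1 by rewrite -real_normK ?num_real// expr_le1.
have /andP[c1 c2] : -1 <= c <= 1 by rewrite -ler_norml.
have /andP[q1 q2] : -1 <= rho n <= 1 by rewrite -ler_norml.
by rewrite ler_norml; have := sqr_ge0 (rho n); move=> ?; apply/andP; split; nra.
Qed.

Lemma Xr_zsum rho c : (forall n, `|rho n| <= r) -> gbound r rho -> `|c| <= 1 ->
  gsum (fun n => Xr (rho n) c) =
  c * zsum (fun n => 2 * rho n * (1 + rho n ^+ 2)) rho 2 c + zsum (fun n => - 4 * rho n ^+ 2) rho 2 c.
Proof.
move=> hr hb hc; have hc' : `|c| <= 1 + dl by have := dl_gt0; lra.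
have rho1 n : `|rho n| <= 1 by apply: le_trans (hr n) _; have /andP[] := r01; lra.
have rho2 n : rho n ^+ 2 <= 1 by rewrite -real_normK ?num_real// expr_le1.
have b1 : gbound r (fun n => 2 * rho n * (1 + rho n ^+ 2)).
  rewrite (_ : (fun n => _) = (fun n => rho n * (2 * (1 + rho n ^+ 2)))); last by apply/funext => n; ring.
  apply: (gboundM (B := 4)) => // n; have h1 := rho2 n; have h2 := sqr_ge0 (rho n).
  by rewrite ger0_norm; lra.
have b2 : gbound r (fun n => - 4 * rho n ^+ 2).
  rewrite (_ : (fun n => _) = (fun n => rho n * (- 4 * rho n))); last by apply/funext => n; ring.
  apply: (gboundM (B := 4)) => // n; have h1 := rho1 n.
  by rewrite normrM normrN [`|4|]ger0_norm//; lra.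
rewrite /zsum -(gsumZ c r01 (zsum_bound 2 b1 hr hc')).
rewrite -(gsumD r01 (gboundZ _ (zsum_bound 2 b1 hr hc')) (zsum_bound 2 b2 hr hc')).
congr gsum; apply/funext => n; rewrite /Xr exprVn; ring.
Qed.

Lemma smooth_gsum_Xr rho : (forall n, `|rho n| <= r) -> gbound r rho ->
  smooth (fun x => gsum (fun n => Xr (rho n) (cos (2 * pi * x)))).
Proof.
move=> hr hb.
have rho1 n : `|rho n| <= 1 by apply: le_trans (hr n) _; have /andP[] := r01; lra.
have rho2 n : rho n ^+ 2 <= 1 by rewrite -real_normK ?num_real// expr_le1.
have b1 : gbound r (fun n => 2 * rho n * (1 + rho n ^+ 2)).
  rewrite (_ : (fun n => _) = (fun n => rho n * (2 * (1 + rho n ^+ 2)))); last by apply/funext => n; ring.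
  apply: (gboundM (B := 4)) => // n; have h1 := rho2 n; have h2 := sqr_ge0 (rho n).
  by rewrite ger0_norm; lra.
have b2 : gbound r (fun n => - 4 * rho n ^+ 2).
  rewrite (_ : (fun n => _) = (fun n => rho n * (- 4 * rho n))); last by apply/funext => n; ring.
  apply: (gboundM (B := 4)) => // n; have h1 := rho1 n.
  by rewrite normrM normrN [`|4|]ger0_norm//; lra.
rewrite (_ : (fun x => _) = (fun x => cos (2 * pi * x) *
   zsum (fun n => 2 * rho n * (1 + rho n ^+ 2)) rho 2 (cos (2 * pi * x)) +
   zsum (fun n => - 4 * rho n ^+ 2) rho 2 (cos (2 * pi * x)))); last first.
  by apply/funext => x; rewrite Xr_zsum// cos_max.
apply: smoothD; last exact: smooth_zsum.
by apply: smoothM; [exact: smooth_cos|exact: smooth_zsum].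
Qed.

End Fixed.
End PoissonSeries.

(** * Rows of the lattice in terms of the nome *)

Section WpSeries.
Variable R : realType.
Local Notation C := R[i].
Implicit Types (x p : R) (N k m : nat) (z : C).

Lemma half_complex z : z / 2 = (complex.Re z / 2) +i* (complex.Im z / 2).
Proof.
case: z => x y /=; rewrite -[2^-1]/((2 : C)^-1) natc -fmorphV.
by apply/eqP; rewrite eq_complex /= !mulr0 subr0 add0r !eqxx.
Qed.

Lemma tau_gt0 p : p != 0 -> -1 < p < 1 -> 0 < complex.Im (tau_of p).
Proof.
move=> p0 /andP[h1 h2]; rewrite /tau_of /= divr_gt0 ?pi_gt0// oppr_gt0 ln_lt0//.
by rewrite normr_gt0 p0 ltr_norml h1 h2.
Qed.

Lemma wexp_half_tau p : p != 0 -> wexp (tau_of p / 2) = p%:C.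
Proof.
move=> p0; rewrite half_complex /tau_of /wexp /=.
have -> : - (2 * pi * (- ln `|p| / pi / 2)) = ln `|p|.
  by move: (pi_gt0 R); move: (pi : R) (ln `|p|) => P L P0; field; exact: lt0r_neq0.
rewrite lnK ?posrE ?normr_gt0//.
have -> (a : R) : 2 * pi * (a / 2) = pi * a by field.
case: ifPn => hp.
  by rewrite mulr0 cos0 sin0 mulr0 mulr1 gtr0_norm.
rewrite mulr1 cospi sinpi mulr0 ltr0_norm ?mulrN1 ?opprK// lt_neqAle p0 /=.
by rewrite leNgt.
Qed.

Lemma wexp_tau p : p != 0 -> wexp (tau_of p) = (p ^+ 2)%:C.
Proof. by move=> p0; rewrite -wexp_half wexp_half_tau// rmorphXn. Qed.

(** The value of exp (2 pi i omega_k). *)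
Definition kap p k : R := match k with 0 => 1 | 1 => -1 | 2 => - p | _ => p end.

Lemma wexp_half_period p k : p != 0 -> wexp (half_period (tau_of p) k) = (kap p k)%:C.
Proof.
move=> p0; case: k => [|[|[|k]]] /=.
- by rewrite wexp0.
- by rewrite wexp_real_half rmorphN1.
- by rewrite mulrDl wexpD wexp_real_half wexp_half_tau// mulN1r rmorphN.
- exact: wexp_half_tau.
Qed.

Lemma wexp_real x : wexp x%:C = cos (2 * pi * x) +i* sin (2 * pi * x).
Proof. by rewrite /wexp /= mulr0 oppr0 expR0 !mul1r. Qed.

Lemma normc_wexp_real x : normc (wexp x%:C) = 1.
Proof. by rewrite wexp_real /= cos2Dsin2 sqrtr1. Qed.

Lemma real_wexp_neq1 (rho x : R) : `|rho| != 1 -> rho%:C * wexp x%:C != 1.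
Proof.
apply: contra => /eqP /(congr1 (@normc R)).
by rewrite normcM normc_wexp_real mulr1 normc_real normc1 => ->.
Qed.

Lemma Re_rr (rho x : R) : rho%:C * wexp x%:C != 1 ->
  complex.Re (rr (rho%:C * wexp x%:C)) = 2^-1 * Xr rho (cos (2 * pi * x)).
Proof.
rewrite wexp_real; have := cos2Dsin2 (2 * pi * x).
move: (cos _) (sin _) => c s cs h.
have denE : den rho c = (1 - rho * c) ^+ 2 + (rho * s) ^+ 2.
  rewrite (_ : (1 - rho * c) ^+ 2 + (rho * s) ^+ 2 =
    1 - 2 * rho * c + rho ^+ 2 * (c ^+ 2 + s ^+ 2)); last by ring.
  by rewrite cs mulr1.
have m0 : den rho c != 0.
  apply: contra h => /eqP m0.
  have e : (1 - rho * c) ^+ 2 + (rho * s) ^+ 2 = 0.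
    by rewrite -denE.
  have e1 : 1 - rho * c = 0.
    by apply/eqP; rewrite -sqrf_eq0 eq_le sqr_ge0 andbT -e lerDl sqr_ge0.
  have e2 : rho * s = 0.
    by apply/eqP; rewrite -sqrf_eq0 eq_le sqr_ge0 andbT -e lerDr sqr_ge0.
  rewrite eq_complex /= !mul0r subr0 addr0 e2 eqxx andbT.
  by apply/eqP; lra.
have -> : rr (rho%:C * (c +i* s)) =
   (rho%:C * (c +i* s)) * (1 - rho%:C * (c -i* s)) ^+ 2 / ((den rho c) ^+ 2)%:C.
  have nz : 1 - rho%:C * (c +i* s) != 0 by rewrite subr_eq0 eq_sym.
  have mC : (den rho c)%:C != 0 by rewrite eq_complex /= eqxx andbT.
  have e : (den rho c)%:C = (1 - rho%:C * (c +i* s)) * (1 - rho%:C * (c -i* s)).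
    apply/eqP; rewrite eq_complex /=; apply/andP; split; apply/eqP; last by ring.
    by rewrite denE; ring.
  have nz' : 1 - rho%:C * (c -i* s) != 0.
    by apply: contraNneq mC => e'; rewrite e e' mulr0.
  by rewrite /rr rmorphXn /= e; field; rewrite nz nz'.
rewrite mulrC -fmorphV ReZ /Xr.
rewrite (_ : complex.Re _ = rho * ((1 + rho ^+ 2) * c - 2 * rho)); last first.
  rewrite /=.
  have -> : rho * ((1 + rho ^+ 2) * c - 2 * rho) =
    rho * c - 2 * rho ^+ 2 * (c ^+ 2 + s ^+ 2) + rho ^+ 3 * c * (c ^+ 2 + s ^+ 2).
    by rewrite cs; ring.
  by ring.
by field.
Qed.

Lemma Re_csq_rr z : complex.Re (csq z) = - (4 * pi ^+ 2) * complex.Re (rr (wexp z)).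
Proof.
by rewrite /csq -ReZ (natc R 4) -rmorphM -rmorphN.
Qed.

Section Nonzero.
Variable p : R.
Hypotheses (p0 : p != 0) (p1 : -1 < p < 1).

Let q := p ^+ 2.

Let absp1 : `|p| < 1. Proof. by rewrite ltr_norml. Qed.

Let q_gt0 : 0 < q. Proof. by rewrite exprn_even_gt0. Qed.
Let q_lt1 : q < 1. Proof. by rewrite /q -real_normK ?num_real// expr_lt1. Qed.

Let qk_lt1 k : q ^+ k.+1 < 1.
Proof. by rewrite exprn_ilt1// ltW. Qed.

Let qk_gt0 k : 0 < q ^+ k.+1.
Proof. exact: exprn_gt0. Qed.

Lemma wexp_shift_tau z k :
  wexp (z - k.+1%:R * tau_of p) = ((q ^+ k.+1)^-1)%:C * wexp z /\
  wexp (z + k.+1%:R * tau_of p) = (q ^+ k.+1)%:C * wexp z.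
Proof.
by split; rewrite wexpD ?wexpN wexp_nat wexp_tau// -rmorphXn -?fmorphV mulrC.
Qed.

Lemma Re_csq_rho (rho x : R) z : wexp z = rho%:C * wexp x%:C -> wexp z != 1 ->
  complex.Re (csq z) = - (4 * pi ^+ 2) * (2^-1 * Xr rho (cos (2 * pi * x))).
Proof. by move=> e h; rewrite Re_csq_rr e Re_rr// -e. Qed.

Lemma csqpart_Xr (x kp : R) z N : wexp z = kp%:C * wexp x%:C ->
  wexp z != 1 -> (forall k, `|kp * q ^+ k.+1| != 1 /\ `|kp / q ^+ k.+1| != 1) ->
  csqpart (tau_of p) z N = - (4 * pi ^+ 2) * (2^-1 * (Xr kp (cos (2 * pi * x)) +
    \sum_(k < N) (Xr (kp / q ^+ k.+1) (cos (2 * pi * x)) + Xr (kp * q ^+ k.+1) (cos (2 * pi * x))))).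
Proof.
move=> e h hk; rewrite /csqpart (Re_csq_rho e h).
rewrite [X in _ + X = _](_ : _ = - (4 * pi ^+ 2) * (2^-1 * \sum_(k < N)
    (Xr (kp / q ^+ k.+1) (cos (2 * pi * x)) + Xr (kp * q ^+ k.+1) (cos (2 * pi * x))))).
  by rewrite -[LHS]mulrDr -mulrDr.
rewrite !mulr_sumr.
apply: eq_bigr => k _; have [e1 e2] := wexp_shift_tau z k; have [h1 h2] := hk k.
have f1 : wexp (z - k.+1%:R * tau_of p) = (kp / q ^+ k.+1)%:C * wexp x%:C.
  by rewrite e1 e mulrA -rmorphM [_ * kp]mulrC.
have f2 : wexp (z + k.+1%:R * tau_of p) = (kp * q ^+ k.+1)%:C * wexp x%:C.
  by rewrite e2 e mulrA -rmorphM [_ * kp]mulrC.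
rewrite ReD (Re_csq_rho f1) ?(Re_csq_rho f2) ?f1 ?f2 ?real_wexp_neq1//.
by rewrite -[LHS]mulrDr -mulrDr.
Qed.

(** Convergence is all that matters: the limit is an additive constant common to wp (x + omega_k)
    for every k, and later formulas involve only differences from [wp_e p 2]. *)
Lemma csqconst_cvg : cvgn (csqconst (tau_of p)).
Proof.
have -> : csqconst (tau_of p) = (fun N => complex.Re (rowsum (0 : C) N) +
   - (4 * pi ^+ 2) * series (fun k => Xr (q ^+ k.+1) 1) N).
  apply/funext => N; rewrite /csqconst; congr (_ + _).
  rewrite series_ord mulr_sumr; apply: eq_bigr => k _.
  have [e1 e2] := wexp_shift_tau 0 k; rewrite sub0r in e1; rewrite add0r in e2.
  have nq : `|q ^+ k.+1| != 1 by rewrite ger0_norm ?ltW// lt_eqF.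
  have nq' : `|(q ^+ k.+1)^-1| != 1.
    by rewrite normfV; apply: contra nq => /eqP h; rewrite -[X in X == _]invrK h invr1.
  rewrite ReD (@Re_csq_rho (q ^+ k.+1)^-1 0) ?e1 ?real_wexp_neq1//.
  rewrite (@Re_csq_rho (q ^+ k.+1) 0) ?e2 ?real_wexp_neq1//.
  by rewrite mulr0 cos0 XrV ?gt_eqF//; field.
have rs (N : nat) : complex.Re (rowsum (0 : C) N.+1) =
   complex.Re (rowsum (0 : C) N) + 2 * (N.+1%:R) ^- 2.
  rewrite rowsumS ReD sub0r add0r sqrrN -mulr2n -[_ *+ 2]mulr_natl natc.
  by rewrite (natc R N.+1) -rmorphXn -fmorphV -rmorphM.
apply: is_cvgD.
  apply: nondecreasing_is_cvgn.
    apply/nondecreasing_seqP => N; rewrite rs lerDl mulr_ge0// invr_ge0 exprn_ge0//.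
  exists (complex.Re (rowsum (0 : C) 1) + 8) => _ [N _ <-].
  have [N0|N0] := leqP 1 N; last first.
    move: N0; rewrite ltnS leqn0 => /eqP ->; rewrite rs.
    by have : 0 <= (1%:R : R) ^- 2 := ltac:(rewrite invr_ge0 exprn_ge0//); lra.
  have h : 2 * normc (0 : C) <= 1%:R by rewrite normc0 mulr0.
  have := rowsum_tail (isT : 0 < 1)%N h N0.
  move=> b; have := normc_Re (rowsum (0 : C) N - rowsum (0 : C) 1); rewrite (ReB (rowsum (0 : C) N)) => a.
  have : 0 <= (N%:R : R)^-1 by rewrite invr_ge0.
  by move: (ler_norm (complex.Re (rowsum (0 : C) N) - complex.Re (rowsum (0 : C) 1))); lra.
apply: is_cvgM; first exact: is_cvg_cst.
have r01 : 0 <= `|p| < 1 by rewrite normr_ge0.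
apply/cvg_ex; exists (gsum (fun k => Xr (q ^+ k.+1) 1)); apply: (gbound_cvg r01).
have hb n : `|q ^+ n.+1| <= `|p| * `|p| ^+ n.
  rewrite -exprS /q -exprM normrX; apply: ler_wiXn2l; rewrite ?(ltW absp1)//.
  by rewrite mul2n -addnn leq_addl.
apply: (Xr_bound r01); rewrite ?normr1//.
  move=> n; apply: le_trans (hb n) _; rewrite ler_piMr// exprn_ile1//; exact: ltW.
by exists `|p|.
Qed.

End Nonzero.
End WpSeries.

(** * Lambert series for wp at the half-period shifts *)

Section WpFormulas.
Variable R : realType.
Local Notation C := R[i].
Implicit Types (x p c : R) (N k m : nat).

(** [evens] collects the rows at k tau for k >= 1, and [odds] the rows at (k + 1/2) tau for k >= 0,
    seen from the real axis. *)
Definition evens p c : R := gsum (fun n => Xr ((p ^+ 2) ^+ n.+1) c).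
Definition odds p c : R := gsum (fun n => Xr (p ^+ (2 * n).+1) c).

Section Bounds.
Variables (p : R) (p1 : -1 < p < 1).

Lemma normp_lt1 : 0 <= `|p| < 1.
Proof. by rewrite normr_ge0 ltr_norml. Qed.

Lemma even_bound n : `|(p ^+ 2) ^+ n.+1| <= 1 * `|p| ^+ n /\ `|(p ^+ 2) ^+ n.+1| <= `|p|.
Proof.
have /andP[h0 h1] := normp_lt1.
split; rewrite -exprM normrX ?mul1r.
  by apply: ler_wiXn2l; rewrite ?(ltW h1)// mul2n -addnn (leq_trans (leqnSn n))// leq_addr.
by rewrite -[leRHS]expr1; apply: ler_wiXn2l; rewrite ?(ltW h1).
Qed.

Lemma odd_bound n : `|p ^+ (2 * n).+1| <= 1 * `|p| ^+ n /\ `|p ^+ (2 * n).+1| <= `|p|.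
Proof.
have /andP[h0 h1] := normp_lt1.
split; rewrite normrX ?mul1r.
  apply: ler_wiXn2l; rewrite ?(ltW h1)//.
  by rewrite mul2n -addnn ltnW// ltnS leq_addr.
by rewrite -[leRHS]expr1; apply: ler_wiXn2l; rewrite ?(ltW h1).
Qed.

Lemma smooth_evens : smooth (fun x => evens p (cos (2 * pi * x))).
Proof.
apply: (smooth_gsum_Xr normp_lt1) => [n|]; first exact: (even_bound n).2.
by exists 1 => n; exact: (even_bound n).1.
Qed.

Lemma evens_cvg c : `|c| <= 1 ->
  series (fun n => Xr ((p ^+ 2) ^+ n.+1) c) @ \oo --> evens p c.
Proof.
move=> hc; apply: (gbound_cvg normp_lt1); apply: (Xr_bound normp_lt1) => [n||//].
  exact: (even_bound n).2.
by exists 1 => n; exact: (even_bound n).1.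
Qed.

Lemma odds_cvg c : `|c| <= 1 ->
  series (fun n => Xr (p ^+ (2 * n).+1) c) @ \oo --> odds p c.
Proof.
move=> hc; apply: (gbound_cvg normp_lt1); apply: (Xr_bound normp_lt1) => [n||//].
  exact: (odd_bound n).2.
by exists 1 => n; exact: (odd_bound n).1.
Qed.

End Bounds.

Lemma Xr0 c : Xr 0 c = 0.
Proof. by rewrite /Xr mulr0 mul0r mul0r. Qed.

Lemma gsum0 : gsum (fun=> 0 : R) = 0.
Proof.
apply/cvg_lim => //; rewrite (_ : series _ = cst 0); first exact: cvg_cst.
by apply/funext => N; rewrite series_ord big1.
Qed.

Lemma cos_double_sin x : 1 - cos (2 * pi * x) = 2 * sin (pi * x) ^+ 2.
Proof.
have -> : 2 * pi * x = (pi * x) *+ 2 by rewrite -mulrA mulr_natl.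
by rewrite cos_mulr2n sin2cos2 -mulr_natl; ring.
Qed.

Lemma cos_neq1 x : (cos (2 * pi * x) != 1) = (sin (pi * x) != 0).
Proof.
rewrite -[in LHS]subr_eq0 -oppr_eq0 opprB cos_double_sin mulf_eq0 pnatr_eq0 /=.
by rewrite expf_eq0.
Qed.

Lemma wp_1 p x : wp p 1 x = wp p 0 (x + 2^-1).
Proof.
rewrite /wp; case: ifP => _.
  rewrite mulrDr sinDpihalf //.
congr (complex.Re (weierstrass_p _ _)); rewrite /= addr0 rmorphD /=; congr (_ + _).
by rewrite mul1r fmorphV rmorph_nat.
Qed.

Lemma wp_csqpart p k x (L K : R) : p != 0 -> -1 < p < 1 ->
  wexp (x%:C + half_period (tau_of p) k) != 1 ->
  (forall j, `|kap p k * (p ^+ 2) ^+ j.+1| != 1 /\ `|kap p k / (p ^+ 2) ^+ j.+1| != 1) ->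
  (fun N => 2^-1 * (Xr (kap p k) (cos (2 * pi * x)) +
    \sum_(j < N) (Xr (kap p k / (p ^+ 2) ^+ j.+1) (cos (2 * pi * x)) +
                  Xr (kap p k * (p ^+ 2) ^+ j.+1) (cos (2 * pi * x))))) @ \oo --> L ->
  csqconst (tau_of p) @ \oo --> K -> 
  wp p k x = - K - 4 * pi ^+ 2 * L.
Proof.
move=> p0 p1 hz hk hL hK; rewrite /wp (negbTE p0).
set z := x%:C + _ in hz *.
have ez : wexp z = (kap p k)%:C * wexp x%:C by rewrite wexpD wexp_half_period// mulrC.
have p2 : `|p ^+ 2| < 1.
  by rewrite normrX expr_lt1// ltr_norml.
have q0 : p ^+ 2 != 0 by rewrite expf_neq0.
rewrite (@weierstrass_p_csq _ (tau_of p) (tau_gt0 p0 p1) z (- (4 * pi ^+ 2) * L) K) => //.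
- by rewrite mulNr addrC.
- move=> j; have [e1 e2] := wexp_shift_tau p0 z j; have [h1 h2] := hk j.
  rewrite e1 e2 ez !mulrA -!rmorphM; split; apply: real_wexp_neq1.
    by rewrite mulrC.
  by rewrite mulrC.
- move=> j; have [_ e2] := wexp_shift_tau p0 0 j.
  rewrite add0r in e2; rewrite e2; apply: real_wexp_neq1.
  by rewrite normrX lt_eqF// exprn_ilt1.
- rewrite (_ : csqpart _ _ = (fun N => - (4 * pi ^+ 2) * (2^-1 * (Xr (kap p k) (cos (2 * pi * x)) +
    \sum_(j < N) (Xr (kap p k / (p ^+ 2) ^+ j.+1) (cos (2 * pi * x)) +
                  Xr (kap p k * (p ^+ 2) ^+ j.+1) (cos (2 * pi * x))))))); last first.
    by apply/funext => N; rewrite (csqpart_Xr p0 N ez hz hk).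
  by apply: (@cvgM _ _ _ _ (fun=> _)) => //; exact: cvg_cst.
Qed.

(** By [XrV] the rows at (j + 1/2) tau and - (j + 1/2) tau contribute equally. The symmetric
    truncation keeps N.+1 of the first and N of the second, whence the mean of two consecutive
    partial sums. *)
Lemma wp_odd_aux p k x (K : R) : p != 0 -> -1 < p < 1 -> 
  kap p k ^+ 2 = p ^+ 2 -> csqconst (tau_of p) @ \oo --> K ->
  wp p k x = - K - 4 * pi ^+ 2 * odds (kap p k) (cos (2 * pi * x)).
Proof.
move=> p0 p1 ek hK; set kp := kap p k in ek *; set c := cos _.
have kp0 : kp != 0 by rewrite -sqrf_eq0 ek sqrf_eq0.
have nkp : `|kp| = `|p|.
  by apply/eqP; rewrite -(@eqrXn2 _ 2)// -!normrX ek.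
have kp1 : -1 < kp < 1 by rewrite -ltr_norml nkp ltr_norml.
have np1 : `|p| < 1 by rewrite ltr_norml.
have np0 : 0 < `|p| by rewrite normr_gt0.
have powlt j : `|kp| ^+ j.+1 < 1 by rewrite nkp exprn_ilt1// ltW.
have e1 j : kp * (p ^+ 2) ^+ j.+1 = kp ^+ (2 * j.+1).+1 by rewrite -ek -exprM -exprS.
have e2 j : kp / (p ^+ 2) ^+ j.+1 = (kp ^+ (2 * j).+1)^-1.
  rewrite -ek -exprM mulnS exprD [in RHS]exprS; field.
  by rewrite kp0 expf_neq0.
have hk j : `|kp * (p ^+ 2) ^+ j.+1| != 1 /\ `|kp / (p ^+ 2) ^+ j.+1| != 1.
  rewrite e1 e2 normfV !normrX; split; first by rewrite lt_eqF.
  by rewrite gt_eqF// invf_gt1 ?exprn_gt0 ?nkp// -nkp.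
apply: (wp_csqpart p0 p1) => //.
  rewrite wexpD wexp_half_period// mulrC; apply: real_wexp_neq1.
  by rewrite -/kp nkp lt_eqF.
rewrite -/kp -/c.
have h := @odds_cvg kp kp1 c (cos_max _).
have h' : (fun N => series (fun n => Xr (kp ^+ (2 * n).+1) c) N.+1) @ \oo --> odds kp c.
  by rewrite (cvg_shiftS (series _)).
have -> : odds kp c = 2^-1 * (odds kp c + odds kp c) by field.
rewrite (_ : (fun N => _) = (fun N => 2^-1 * (series (fun n => Xr (kp ^+ (2 * n).+1) c) N +
  series (fun n => Xr (kp ^+ (2 * n).+1) c) N.+1))).
  apply: (@cvgM _ _ _ _ (fun=> _)) => //; first exact: cvg_cst.
  exact: cvgD.
apply/funext => N; congr (_ * _); rewrite !series_ord big_ord_recl muln0 expr1 addrCA; congr (_ + _).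
rewrite -big_split; apply: eq_bigr => j _ /=; rewrite e1 e2 XrV ?expf_neq0//.
Qed.

Lemma wp_series p : -1 < p < 1 -> exists K, forall x,
  [/\ sin (pi * x) != 0 -> wp p 0 x = K + pi ^+ 2 / sin (pi * x) ^+ 2 -
        4 * pi ^+ 2 * evens p (cos (2 * pi * x)),
      wp p 2 x = K - 4 * pi ^+ 2 * odds (- p) (cos (2 * pi * x)) &
      wp p 3 x = K - 4 * pi ^+ 2 * odds p (cos (2 * pi * x))].
Proof.
move=> p1; have [->|p0] := eqVneq p 0.
  exists (- (pi ^+ 2 / 3)) => x.
  have z1 : odds 0 (cos (2 * pi * x)) = 0.
    by rewrite -[RHS]gsum0; congr gsum; apply/funext => n; rewrite expr0n Xr0.
  have z2 : evens 0 (cos (2 * pi * x)) = 0.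
    by rewrite -[RHS]gsum0; congr gsum; apply/funext => n; rewrite !expr0n Xr0.
  by rewrite oppr0 z1 z2 !mulr0 !subr0 /wp eqxx; split => // _; rewrite addrC.
have /cvg_ex [K hK] := csqconst_cvg p0 p1.
exists (- K) => x; split; last 2 first.
- have := @wp_odd_aux p 2 x K p0 p1 _ hK; rewrite /= sqrrN; exact.
- have := @wp_odd_aux p 3 x K p0 p1 _ hK; exact.
move=> s0; set c := cos _; have c1 : c != 1 by rewrite cos_neq1.
have hc : - 4 * pi ^+ 2 * (2^-1 * Xr 1 c) = pi ^+ 2 / sin (pi * x) ^+ 2.
  rewrite Xr1// cos_double_sin; move: (pi : R) s0 => P; move: (sin _) => s s0.
  by field.
have q0 : 0 < p ^+ 2 by rewrite exprn_even_gt0.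
have q1 : p ^+ 2 < 1 by rewrite -real_normK ?num_real// expr_lt1// ltr_norml.
have qk j : (p ^+ 2) ^+ j.+1 < 1 by rewrite exprn_ilt1// ltW.
have qp j : 0 < (p ^+ 2) ^+ j.+1 by rewrite exprn_gt0.
rewrite (@wp_csqpart p 0 x (2^-1 * Xr 1 c + evens p c) K) => //.
- by rewrite mulrDr -hc; ring.
- rewrite /= addr0 wexp_real; by apply: contra c1 => /eqP [h _]; rewrite /c h eqxx.
- move=> j; rewrite /= !mul1r normfV ger0_norm ?ltW//; split; first by rewrite lt_eqF.
  by rewrite gt_eqF// invf_gt1.
- rewrite /= -/c.
  rewrite (_ : (fun N => _) = (fun N => 2^-1 * Xr 1 c + series (fun n => Xr ((p ^+ 2) ^+ n.+1) c) N)).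
    by apply: cvgD; [exact: cvg_cst|exact: evens_cvg p1 _ (cos_max _)].
  apply/funext => N; rewrite mulrDr; congr (_ + _); rewrite series_ord mulr_sumr.
  by apply: eq_bigr => j _; rewrite !mul1r XrV ?gt_eqF//; field.
Qed.

End WpFormulas.

(** * The product of the series of wp (x) and wp (x + tau / 2) *)

Section DoubleSum.
Variable R : realType.
Implicit Types (c p : R) (N n m l : nat) (f : int -> R).

(** [Gr u] is u times the derivative of [rr] at u, and [Pk] is the Poisson kernel; they enter as the
    simple-pole part of the partial fractions in [Xr_mul]. *)
Definition Gr (u : R) : R := u * (1 + u) / (1 - u) ^+ 3.
Definition Pk (q c : R) : R := (1 - q ^+ 2) / den q c.

(* Partial fractions in [w], written in terms of [c = (w + w^-1) / 2]. *)
Lemma Xr_mul (al be c : R) : al != be -> al * be != 1 -> be != 0 ->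
  den al c != 0 -> den be c != 0 ->
  Xr al c * Xr be c = (rr (al / be) + rr (al * be)) * (Xr al c + Xr be c) +
    Gr (al / be) * (Pk al c - Pk be c) + Gr (al * be) * (Pk al c + Pk be c).
Proof.
move=> h1 h2 h3; rewrite /Xr /rr /Gr /Pk /den => h4 h5.
have h6 : be - al != 0 by rewrite subr_eq0 eq_sym.
have h7 : 1 - al * be != 0 by rewrite subr_eq0 eq_sym.
by field; rewrite h3 h4 h5 h6 h7.
Qed.

(** After [Xr_mul] is applied to each product of an even and an odd term, [aF] is the coefficient of
    the n-th even term and [bF] that of the m-th odd term. Increasing n or m by one only shifts the
    window of summation, so the change consists of end terms that decay with N: in the limit the
    coefficients no longer depend on n and m. *)
Definition aF f N n : R := \sum_(m < N) (f (n.*2%:Z - (m.*2.+1)%:Z) + f (n.*2%:Z + (m.*2.+1)%:Z)).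
Definition bF f N m : R := f (m.*2.+1)%:Z +
  \sum_(n < N) (f ((m.*2.+1)%:Z + (n.+1.*2)%:Z) + f ((m.*2.+1)%:Z - (n.+1.*2)%:Z)).

Lemma aF_step f N n : aF f N n.+1 - aF f N n =
  f (n.*2.+1%:Z + N.*2%:Z) - f (n.*2.+1%:Z - N.*2%:Z).
Proof.
rewrite /aF -sumrB; elim: N => [|N IH]; first by rewrite big_ord0 (_ : _ - 0.*2%:Z = n.*2.+1%:Z + 0.*2%:Z) ?subrr//; lia.
rewrite big_ord_recr /= IH.
rewrite (_ : n.+1.*2%:Z - (N.*2.+1)%:Z = n.*2.+1%:Z - N.*2%:Z); last lia.
rewrite (_ : n.+1.*2%:Z + (N.*2.+1)%:Z = n.*2.+1%:Z + N.+1.*2%:Z); last lia.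
rewrite (_ : n.*2%:Z - (N.*2.+1)%:Z = n.*2.+1%:Z - N.+1.*2%:Z); last lia.
rewrite (_ : n.*2%:Z + (N.*2.+1)%:Z = n.*2.+1%:Z + N.*2%:Z); last lia.
by ring.
Qed.

Lemma bF_step f N m : bF f N m.+1 - bF f N m =
  f ((m.*2.+3)%:Z + N.*2%:Z) - f ((m.*2.+1)%:Z - N.*2%:Z).
Proof.
rewrite /bF; elim: N => [|N IH]; first by rewrite !big_ord0 !addr0; congr (f _ - f _); lia.
rewrite !big_ord_recr /=; move: IH; set S1 := \sum_(n < N) _; set S2 := \sum_(n < N) _.
rewrite (_ : (m.+1.*2.+1)%:Z + N.+1.*2%:Z = (m.*2.+3)%:Z + N.+1.*2%:Z); last lia.
rewrite (_ : (m.+1.*2.+1)%:Z - N.+1.*2%:Z = (m.*2.+1)%:Z - N.*2%:Z); last lia.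
rewrite (_ : (m.*2.+1)%:Z + N.+1.*2%:Z = (m.*2.+3)%:Z + N.*2%:Z); last lia.
set x1 := f _; set x2 := f _; set x3 := f _; set x4 := f _; set x5 := f _; set x6 := f _.
by move=> h; lra.
Qed.

Lemma aF_sum f N n : aF f N n = aF f N 0 + 
  \sum_(l < n) (f (l.*2.+1%:Z + N.*2%:Z) - f (l.*2.+1%:Z - N.*2%:Z)).
Proof.
elim: n => [|n IH]; first by rewrite big_ord0 addr0.
by rewrite big_ord_recr /= addrA -IH -aF_step addrC subrK.
Qed.

Lemma bF_sum f N m : bF f N m = bF f N 0 + 
  \sum_(l < m) (f (l.*2.+3%:Z + N.*2%:Z) - f (l.*2.+1%:Z - N.*2%:Z)).
Proof.
elim: m => [|m IH]; first by rewrite big_ord0 addr0.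
by rewrite big_ord_recr /= addrA -IH -bF_step addrC subrK.
Qed.

Section Tails.
Variables (f : int -> R) (K r : R).
Hypotheses (K0 : 0 <= K) (r01 : 0 <= r < 1).
Hypothesis hf : forall n, `|f n.+1%:Z| <= K * r ^+ n.+1 /\ `|f (- n.+1%:Z)| <= K * r ^+ n.+1.

Let rpow n m : (n <= m)%N -> r ^+ m <= r ^+ n.
Proof. by case/andP: r01 => r0 r1 h; apply: ler_wiXn2l => //; exact: ltW. Qed.

Let fle n k : (n <= k.+1)%N -> `|f k.+1%:Z| <= K * r ^+ n /\ `|f (- k.+1%:Z)| <= K * r ^+ n.
Proof.
move=> h; have [h1 h2] := hf k.
by split; [apply: le_trans h1 _|apply: le_trans h2 _]; rewrite ler_wpM2l// rpow.
Qed.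

Lemma aF_tail N n : (n <= N)%N ->
  `|aF f N n - aF f N 0| <= n%:R * (2 * (K * r ^+ (N.*2.+1 - n.*2))).
Proof.
move=> nN; rewrite aF_sum addrAC subrr add0r.
apply: le_trans (ler_norm_sum _ _ _) _.
apply: (@le_trans _ _ (\sum_(l < n) 2 * (K * r ^+ (N.*2.+1 - n.*2)))).
  apply: ler_sum => l _; have ln := ltn_ord l.
  apply: le_trans (ler_normB _ _) _.
  have -> : l.*2.+1%:Z + N.*2%:Z = (l.*2 + N.*2).+1%:Z by lia.
  have -> : l.*2.+1%:Z - N.*2%:Z = - (N.*2 - l.*2.+2).+1%:Z by lia.
  have [h1 _] := @fle (N.*2.+1 - n.*2) (l.*2 + N.*2) ltac:(lia).
  have [_ h2] := @fle (N.*2.+1 - n.*2) (N.*2 - l.*2.+2) ltac:(lia).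
  by lra.
by rewrite sumr_const card_ord -[leLHS]mulr_natl.
Qed.

Lemma bF_tail N m : (m < N)%N ->
  `|bF f N m - bF f N 0| <= m%:R * (2 * (K * r ^+ (N.*2.+1 - m.*2))).
Proof.
move=> nN; rewrite bF_sum addrAC subrr add0r.
apply: le_trans (ler_norm_sum _ _ _) _.
apply: (@le_trans _ _ (\sum_(l < m) 2 * (K * r ^+ (N.*2.+1 - m.*2)))).
  apply: ler_sum => l _; have ln := ltn_ord l.
  apply: le_trans (ler_normB _ _) _.
  have -> : l.*2.+3%:Z + N.*2%:Z = (l.*2 + N.*2).+3%:Z by lia.
  have -> : l.*2.+1%:Z - N.*2%:Z = - (N.*2 - l.*2.+2).+1%:Z by lia.
  have [h1 _] := @fle (N.*2.+1 - m.*2) (l.*2 + N.*2).+2 ltac:(lia).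
  have [_ h2] := @fle (N.*2.+1 - m.*2) (N.*2 - l.*2.+2) ltac:(lia).
  by lra.
by rewrite sumr_const card_ord -[leLHS]mulr_natl.
Qed.

End Tails.

(** The total truncation error of the double sum has this size: N terms, each with a tail bound
    proportional to N and a geometric factor of exponent 2 N. *)
Lemma tends0_sqr_pow (P : R) : 0 <= P < 1 -> tends0 (fun N => N%:R ^+ 2 * P ^+ N.*2).
Proof.
move=> /andP[P0 P1]; pose s := Num.sqrt P.
have s0 : 0 <= s by exact: sqrtr_ge0.
have s1 : s < 1 by rewrite /s -[1]sqrtr1 ltr_sqrt.
have sP : s ^+ 2 = P by rewrite sqr_sqrtr.
have hb N : N%:R * s ^+ N <= (1 - s)^-1.
  have e : series (geometric 1 s) N = 1 * (1 - s ^+ N) / (1 - s).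
    by rewrite geometric_seriesE ?lt_eqF.
  rewrite series_ord mul1r in e.
  apply: (@le_trans _ _ (\sum_(k < N) s ^+ k)).
    rewrite mulr_natl -[X in _ *+ X]card_ord -sumr_const; apply: ler_sum => k _.
    by apply: ler_wiXn2l; rewrite ?(ltW s1) ?s0// ltnW.
  rewrite (eq_bigr (fun k : 'I_N => geometric 1 s k)) => [|k _]; last by rewrite /= mul1r.
  rewrite e -[leRHS]mul1r ler_pM2r ?invr_gt0 ?subr_gt0//.
  by rewrite gerBl exprn_ge0.
have h : tends0 (fun N => (1 - s)^-1 ^+ 2 * (s ^+ 2) ^+ N).
  apply: tends0Z; apply/tends0_cvg.
  rewrite sP (_ : GRing.exp P = geometric 1 P); first by apply: cvg_geometric; rewrite ger0_norm.
  by apply/funext => N /=; rewrite mul1r.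
apply: (tends0_le (i1 := 0%N) _ h) => N _.
rewrite !ger0_norm ?mulr_ge0 ?exprn_ge0 ?invr_ge0 ?subr_ge0 ?(ltW s1)//.
have -> : N%:R ^+ 2 * P ^+ N.*2 = (N%:R * s ^+ N) ^+ 2 * (s ^+ 2) ^+ N.
  have e1 : s ^+ N ^+ 2 = P ^+ N by rewrite -exprM mulnC exprM sP.
  have e2 : P ^+ N.*2 = P ^+ N * P ^+ N by rewrite -exprD addnn.
  by rewrite exprMn e1 e2 sP mulrA.
rewrite ler_wpM2r ?exprn_ge0// lerXn2r ?nnegrE ?mulr_ge0 ?exprn_ge0 ?invr_ge0 ?subr_ge0 ?(ltW s1)//.
Qed.

Section Fixed.
Variable p : R.
Hypotheses (p0 : p != 0) (p1 : -1 < p < 1).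

Let r := `|p|.
Let r01 : 0 <= r < 1. Proof. exact: normp_lt1. Qed.

Let Rk (k : int) : R := rr (p ^ k).
Let Gk (k : int) : R := Gr (p ^ k).

Let pow_lt n : `|p ^+ n.+1| <= r.
Proof.
have /andP[h0 h1] := r01.
by rewrite normrX -[leRHS]expr1; apply: ler_wiXn2l => //; exact: ltW.
Qed.

Let r1 : 0 < 1 - r. Proof. by case/andP: r01 => _; rewrite subr_gt0. Qed.

Let onem_pow n : 1 - r <= `|1 - p ^+ n.+1|.
Proof.
apply: le_trans (_ : 1 - `|p ^+ n.+1| <= _); first by rewrite lerB// pow_lt.
by rewrite -{1}(normr1 R); exact: lerB_dist.
Qed.

Let onem_neq0 n : 1 - p ^+ n.+1 != 0.
Proof. by rewrite -normr_gt0; apply: lt_le_trans (onem_pow n). Qed.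

Let RkN k : Rk (- k) = Rk k.
Proof.
rewrite /Rk -invr_expz; move: (p ^ k) (expfz_neq0 k p0) => u u0.
have [->|u1] := eqVneq u 1; first by rewrite invr1.
have v1 : 1 - u != 0 by rewrite subr_eq0 eq_sym.
rewrite /rr; field; rewrite u0 v1 /=.
by rewrite -opprB oppr_eq0.
Qed.

Let GkN k : Gk (- k) = - Gk k.
Proof.
rewrite /Gk -invr_expz; move: (p ^ k) (expfz_neq0 k p0) => u u0.
have [->|u1] := eqVneq u 1.
  by rewrite invr1 /Gr subrr expr0n /= invr0 !mulr0 oppr0.
have v1 : 1 - u != 0 by rewrite subr_eq0 eq_sym.
rewrite /Gr; field; rewrite u0 v1 /=.
by rewrite -opprB oppr_eq0.
Qed.

Let K := 2 / (1 - r) ^+ 3.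
Let K0 : 0 <= K. Proof. by rewrite divr_ge0// exprn_ge0// ltW. Qed.

Let Rk_bound n : `|Rk n.+1%:Z| <= K * r ^+ n.+1 /\ `|Rk (- n.+1%:Z)| <= K * r ^+ n.+1.
Proof.
suff h : `|Rk n.+1%:Z| <= K * r ^+ n.+1 by rewrite RkN.
have h := onem_pow n; have rr1 := r1; have /andP[r0 _] := r01.
rewrite /Rk /rr -exprnP normrM normfV !normrX mulrC ler_wpM2r ?exprn_ge0//.
apply: (@le_trans _ _ ((1 - r) ^- 2)).
  by rewrite lef_pV2 ?posrE ?exprn_gt0 ?(lt_le_trans rr1 h)// lerXn2r ?nnegrE// ltW.
rewrite /K (_ : (1 - r) ^- 2 = (1 - r) / (1 - r) ^+ 3).
  by rewrite ler_wpM2r ?invr_ge0 ?exprn_ge0 ?(ltW rr1)//; lra.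
by field; rewrite gt_eqF.
Qed.

Let Gk_bound n : `|Gk n.+1%:Z| <= K * r ^+ n.+1 /\ `|Gk (- n.+1%:Z)| <= K * r ^+ n.+1.
Proof.
suff h : `|Gk n.+1%:Z| <= K * r ^+ n.+1 by rewrite GkN normrN.
have h := onem_pow n; have rr1 := r1; have /andP[r0 _] := r01.
have h2 : `|1 + p ^+ n.+1| <= 2.
  by apply: le_trans (ler_normD _ _) _; rewrite normr1; have := pow_lt n; lra.
rewrite /Gk /Gr -exprnP !normrM normfV [`|(1 - p ^+ n.+1) ^+ 3|]normrX [`|p ^+ _|]normrX -mulrA mulrC.
rewrite ler_wpM2r ?exprn_ge0// /K; apply: ler_pM; rewrite ?invr_ge0 ?exprn_ge0//.
by rewrite lef_pV2 ?posrE ?exprn_gt0 ?(lt_le_trans rr1 h)// lerXn2r ?nnegrE// ltW.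
Qed.

Section OnePoint.
Variable c : R.
Hypothesis c1 : -1 <= c < 1.

Let X (i : nat) := Xr (p ^+ i) c.
Let P (i : nat) := Pk (p ^+ i) c.

Let cn : `|c| <= 1.
Proof. by case/andP: c1 => a b; rewrite ler_norml a ltW. Qed.

Let den_neq0 i : den (p ^+ i) c != 0.
Proof.
case: i => [|i].
  rewrite expr0 /den (_ : _ + _ = 2 * (1 - c)); last by ring.
  by case/andP: c1 => _ h; rewrite mulf_neq0 ?pnatr_eq0// subr_eq0 gt_eqF.
rewrite gt_eqF//; apply: (den_gt0 r01 (pow_lt i)).
by have := dl_gt0 r01; move: cn; lra.
Qed.

Definition evenpart N := 2^-1 * Xr 1 c + \sum_(n < N) Xr (p ^+ n.+1.*2) c.
Definition oddpart N := \sum_(m < N) Xr (p ^+ m.*2.+1) c.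

Let XX n m : X n.*2 * X m.*2.+1 =
  (Rk (n.*2%:Z - m.*2.+1%:Z) + Rk (n.*2%:Z + m.*2.+1%:Z)) * (X n.*2 + X m.*2.+1) +
  Gk (n.*2%:Z - m.*2.+1%:Z) * (P n.*2 - P m.*2.+1) +
  Gk (n.*2%:Z + m.*2.+1%:Z) * (P n.*2 + P m.*2.+1).
Proof.
have e1 : p ^ (n.*2%:Z - m.*2.+1%:Z) = p ^+ n.*2 / p ^+ m.*2.+1.
  by rewrite expfzDr// -invr_expz.
have e2 : p ^ (n.*2%:Z + m.*2.+1%:Z) = p ^+ n.*2 * p ^+ m.*2.+1 by rewrite expfzDr.
rewrite /Rk /Gk e1 e2; apply: Xr_mul; rewrite ?den_neq0 ?expf_neq0//.
  apply/eqP => e.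
  have [h|h] := leqP m.*2.+1 n.*2.
    have e3 : p ^+ n.*2 = p ^+ m.*2.+1 * p ^+ (n.*2 - m.*2.+1) by rewrite -exprD subnKC.
    have : p ^+ (n.*2 - m.*2.+1) = 1.
      by apply: (mulfI (expf_neq0 m.*2.+1 p0)); rewrite -e3 e mulr1.
    have -> : (n.*2 - m.*2.+1 = (n.*2 - m.*2.+2).+1)%N by lia.
    by move=> e4; have := onem_neq0 (n.*2 - m.*2.+2); rewrite e4 subrr eqxx.
  have e3 : p ^+ m.*2.+1 = p ^+ n.*2 * p ^+ (m.*2.+1 - n.*2) by rewrite -exprD subnKC// ltnW.
  have : p ^+ (m.*2.+1 - n.*2) = 1.
    by apply: (mulfI (expf_neq0 n.*2 p0)); rewrite -e3 e mulr1.
  have -> : (m.*2.+1 - n.*2 = (m.*2 - n.*2).+1)%N by lia.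
  by move=> e4; have := onem_neq0 (m.*2 - n.*2); rewrite e4 subrr eqxx.
rewrite -exprD addnS; have := onem_neq0 (n.*2 + m.*2).
by apply: contra => /eqP ->; rewrite subrr.
Qed.

(** The first line is the main part, with coefficients taken at n = 0 and m = 0. The second line
    collects the deviations of the coefficients, and the third the Poisson kernels, which need not
    become small. *)
Lemma partial_product N : evenpart N * oddpart N =
  aF Rk N 0 * evenpart N + bF Rk N 0 * oddpart N +
  (\sum_(n < N) (aF Rk N n.+1 - aF Rk N 0) * X n.+1.*2 + \sum_(m < N) (bF Rk N m - bF Rk N 0) * X m.*2.+1) +
  (\sum_(n < N) aF Gk N n.+1 * P n.+1.*2 + \sum_(m < N) bF Gk N m * P m.*2.+1).
Proof.
have P0' : P 0 = 0 by rewrite /P /Pk expr0 expr1n subrr mul0r.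
have X0' : X 0 = Xr 1 c by [].
have base m : 2^-1 * X 0 * X m.*2.+1 = Rk m.*2.+1%:Z * (X 0 + X m.*2.+1) + Gk m.*2.+1%:Z * P m.*2.+1.
  have := XX 0 m; rewrite double0 sub0r add0r RkN GkN P0' => h.
  by rewrite -mulrA h; field.
have lhs : evenpart N * oddpart N = \sum_(m < N) (Rk m.*2.+1%:Z * (X 0 + X m.*2.+1) + Gk m.*2.+1%:Z * P m.*2.+1) +
  \sum_(n < N) \sum_(m < N) X n.+1.*2 * X m.*2.+1.
  rewrite /evenpart mulrDl; congr (_ + _).
    by rewrite /oddpart mulr_sumr; apply: eq_bigr => m _; rewrite -base.
  by rewrite mulr_suml; apply: eq_bigr => n _; rewrite /oddpart mulr_sumr.
have dbl : \sum_(n < N) \sum_(m < N) X n.+1.*2 * X m.*2.+1 =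
  \sum_(n < N) (aF Rk N n.+1 * X n.+1.*2 + aF Gk N n.+1 * P n.+1.*2) +
  \sum_(m < N) ((bF Rk N m - Rk m.*2.+1%:Z) * X m.*2.+1 + (bF Gk N m - Gk m.*2.+1%:Z) * P m.*2.+1).
  have e1 : \sum_(m < N) ((bF Rk N m - Rk m.*2.+1%:Z) * X m.*2.+1 + (bF Gk N m - Gk m.*2.+1%:Z) * P m.*2.+1) =
     \sum_(n < N) \sum_(m < N) ((Rk (n.+1.*2%:Z - m.*2.+1%:Z) + Rk (n.+1.*2%:Z + m.*2.+1%:Z)) * X m.*2.+1 +
        (Gk (n.+1.*2%:Z + m.*2.+1%:Z) - Gk (n.+1.*2%:Z - m.*2.+1%:Z)) * P m.*2.+1).
    rewrite exchange_big /=; apply: eq_bigr => m _.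
    rewrite /bF addrAC subrr add0r addrAC subrr add0r !mulr_suml -big_split /=.
    apply: eq_bigr => n _; congr (_ * _ + _ * _).
      by rewrite addrC -RkN opprB [X in _ + Rk X = _]addrC.
    by rewrite -GkN opprB [n.+1.*2%:Z + _]addrC.
  rewrite e1 -big_split /=; apply: eq_bigr => n _.
  rewrite /aF !mulr_suml -!big_split /=; apply: eq_bigr => m _.
  by rewrite XX; ring.
rewrite lhs dbl.
have a0 : aF Rk N 0 * evenpart N = \sum_(m < N) Rk m.*2.+1%:Z * X 0 + \sum_(n < N) aF Rk N 0 * X n.+1.*2.
  rewrite /evenpart mulrDr mulr_sumr; congr (_ + _).
  rewrite /aF mulr_suml; apply: eq_bigr => m _.
  by rewrite double0 sub0r add0r RkN -X0'; field.
rewrite a0.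
transitivity (\sum_(n < N) (aF Rk N n.+1 * X n.+1.*2 + aF Gk N n.+1 * P n.+1.*2) +
  \sum_(m < N) (Rk m.*2.+1%:Z * X 0 + bF Rk N m * X m.*2.+1 + bF Gk N m * P m.*2.+1)).
  rewrite addrCA; congr (_ + _); rewrite -big_split /=.
  by apply: eq_bigr => m _; ring.
have b0 : bF Rk N 0 * oddpart N = \sum_(m < N) bF Rk N 0 * X m.*2.+1.
  by rewrite /oddpart mulr_sumr.
rewrite b0.
set S1 := \sum_(m < N) Rk _ * X 0; set S2 := \sum_(n < N) aF Rk N 0 * _.
set S3 := \sum_(m < N) bF Rk N 0 * _; set S4 := \sum_(n < N) (_ - _) * X _.*2.
set S5 := \sum_(m < N) (_ - _) * X _.+1; set S6 := \sum_(n < N) aF Gk N _ * _.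
set S7 := \sum_(m < N) bF Gk N _ * _.
rewrite [RHS](_ : _ = (S2 + S4 + S6) + (S1 + S3 + S5 + S7)); last by ring.
by congr (_ + _); rewrite -!big_split /=; apply: eq_bigr => m _; ring.
Qed.
End OnePoint.

Let sum_small (u : nat -> nat -> R) (B : R) : 0 <= B ->
  (forall N n, (n < N)%N -> `|u N n| <= B * (N%:R * r ^+ N.*2)) ->
  tends0 (fun N => \sum_(n < N) u N n).
Proof.
move=> B0 hu; apply: (tends0_le (i1 := 0%N) _ (tends0Z B (tends0_sqr_pow r01))) => N _.
apply: le_trans (ler_norm_sum _ _ _) _.
apply: (@le_trans _ _ (\sum_(n < N) B * (N%:R * r ^+ N.*2))).
  by apply: ler_sum => n _; exact: hu.
rewrite sumr_const card_ord -[leLHS]mulr_natl ger0_norm; last first.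
  by rewrite !mulr_ge0 ?exprn_ge0//; case/andP: r01.
by rewrite le_eqVlt; apply/orP; left; apply/eqP; ring.
Qed.

Let Xr_small c : `|c| <= 1 -> exists2 A, 0 <= A & forall k, `|Xr (p ^+ k.+1) c| <= A * r ^+ k.
Proof.
move=> hc; have [|A hA] := Xr_bound r01 pow_lt _ hc.
  by exists r => n; rewrite normrX exprS.
exists A => //; have := hA 0%N; rewrite expr0 mulr1; exact: le_trans.
Qed.

Let Pk_small c c' : `|c| <= 1 -> `|c'| <= 1 ->
  exists2 A, 0 <= A & forall k, `|Pk (p ^+ k.+1) c - Pk (p ^+ k.+1) c'| <= A * r ^+ k.
Proof.
move=> hc hc'; have dl0 := dl_gt0 r01; have B0 := B_gt0 r01.
set B := 2 / (1 - r) ^+ 2 in B0.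
exists (4 * B ^+ 2); first by rewrite mulr_ge0// exprn_ge0// ltW.
move=> k; have hk := pow_lt k; set q := p ^+ k.+1 in hk *.
have d1 := den_gt0 r01 hk (_ : `|c| <= 1 + (1 - r) ^+ 2 / 4).
have d2 := den_gt0 r01 hk (_ : `|c'| <= 1 + (1 - r) ^+ 2 / 4).
have i1 := denV_le r01 hk (_ : `|c| <= 1 + (1 - r) ^+ 2 / 4).
have i2 := denV_le r01 hk (_ : `|c'| <= 1 + (1 - r) ^+ 2 / 4).
have h1 : `|c| <= 1 + (1 - r) ^+ 2 / 4 by lra.
have h2 : `|c'| <= 1 + (1 - r) ^+ 2 / 4 by lra.
have {}d1 := d1 h1. have {}d2 := d2 h2. have {}i1 := i1 h1. have {}i2 := i2 h2.
have -> : Pk q c - Pk q c' = (1 - q ^+ 2) * (2 * (c - c')) * q * ((den q c)^-1 * (den q c')^-1).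
  move: (lt0r_neq0 d1) (lt0r_neq0 d2); rewrite /Pk /den => n1 n2.
  by field; rewrite n1 n2.
have q1 : `|q| <= 1 by apply: le_trans hk _; case/andP: r01 => _ /ltW.
have a1 : `|1 - q ^+ 2| <= 1.
  have := sqr_ge0 q; have : q ^+ 2 <= 1 by rewrite -real_normK ?num_real// expr_le1.
  by move=> u v; rewrite ger0_norm; lra.
have a2 : `|2 * (c - c')| <= 4.
  by rewrite normrM ger0_norm//; have := ler_normB c c'; lra.
have a3 : `|q| <= r ^+ k.
  rewrite /q normrX; apply: ler_wiXn2l => //; case/andP: r01 => // _ /ltW //.
rewrite normrM [`|_ * q|]normrM [`|(1 - _) * _|]normrM [`|_^-1 * _|]normrM.
rewrite [leRHS](_ : _ = 1 * 4 * r ^+ k * (B * B)); last by ring.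
by apply: ler_pM; rewrite ?mulr_ge0//; apply: ler_pM; rewrite ?mulr_ge0//; apply: ler_pM.
Qed.

Let aG0 N : aF Gk N 0 = 0.
Proof.
by rewrite /aF big1// => m _; rewrite double0 sub0r add0r GkN addNr.
Qed.

Let bG0 N : bF Gk N 0 = Gk N.*2.+1%:Z.
Proof.
elim: N => [|N IH]; first by rewrite /bF big_ord0 addr0.
rewrite /bF big_ord_recr /= addrA -/(bF Gk N 0) IH.
have -> : 0.*2.+1%:Z - N.+1.*2%:Z = - N.*2.+1%:Z by lia.
rewrite GkN addrCA subrr addr0; congr Gk; lia.
Qed.

Let r_ge0 : 0 <= r. Proof. by case/andP: r01. Qed.
Let r_le1 : r <= 1. Proof. by case/andP: r01 => _ /ltW. Qed.

Let pow_even N n : (n < N)%N -> r ^+ (N.*2.+1 - n.+1.*2) * r ^+ n.*2.+1 = r ^+ N.*2.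
Proof. by move=> h; rewrite -exprD; congr (_ ^+ _); lia. Qed.

Let pow_odd N m : (m < N)%N -> r ^+ (N.*2.+1 - m.*2) * r ^+ m.*2 <= r ^+ N.*2.
Proof. by move=> h; rewrite -exprD; apply: ler_wiXn2l => //; lia. Qed.

Let KA A : 0 <= A -> 0 <= 2 * K * A.
Proof. by move=> h; apply: mulr_ge0 => //; apply: mulr_ge0. Qed.

Let KR n : 0 <= 2 * (K * r ^+ n).
Proof. by apply: mulr_ge0 => //; apply: mulr_ge0 => //; exact: exprn_ge0. Qed.

Let coef_even f (A : R) (y : nat -> R) : 0 <= A ->
  (forall n, `|f n.+1%:Z| <= K * r ^+ n.+1 /\ `|f (- n.+1%:Z)| <= K * r ^+ n.+1) ->
  (forall k, `|y k.+1| <= A * r ^+ k) ->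
  tends0 (fun N => \sum_(n < N) (aF f N n.+1 - aF f N 0) * y n.+1.*2).
Proof.
move=> A0 hf hy; apply: (@sum_small (fun N n => (aF f N n.+1 - aF f N 0) * y n.+1.*2) (2 * K * A)).
  exact: KA.
move=> N n nN; rewrite normrM.
apply: (@le_trans _ _ ((N%:R * (2 * (K * r ^+ (N.*2.+1 - n.+1.*2)))) * (A * r ^+ n.*2.+1))).
  apply: ler_pM => //; last exact: hy.
  apply: le_trans (aF_tail K0 r01 hf nN) _.
  by apply: ler_wpM2r; [exact: KR|rewrite ler_nat].
rewrite -(pow_even nN) le_eqVlt; apply/orP; left; apply/eqP.
by move: (r ^+ (_ - _)) (r ^+ n.*2.+1) => x1 x2; ring.
Qed.

Let coef_odd f (A : R) (y : nat -> R) : 0 <= A ->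
  (forall n, `|f n.+1%:Z| <= K * r ^+ n.+1 /\ `|f (- n.+1%:Z)| <= K * r ^+ n.+1) ->
  (forall k, `|y k.+1| <= A * r ^+ k) ->
  tends0 (fun N => \sum_(m < N) (bF f N m - bF f N 0) * y m.*2.+1).
Proof.
move=> A0 hf hy; apply: (@sum_small (fun N m => (bF f N m - bF f N 0) * y m.*2.+1) (2 * K * A)).
  exact: KA.
move=> N m nN; rewrite normrM.
apply: (@le_trans _ _ ((N%:R * (2 * (K * r ^+ (N.*2.+1 - m.*2)))) * (A * r ^+ m.*2))).
  apply: ler_pM => //.
  apply: le_trans (bF_tail K0 r01 hf nN) _.
  by apply: ler_wpM2r; [exact: KR|rewrite ler_nat ltnW].
have h := pow_odd nN.
rewrite [leLHS](_ : _ = 2 * K * A * (N%:R * (r ^+ (N.*2.+1 - m.*2) * r ^+ m.*2))).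
  by apply: ler_wpM2l; [exact: KA|rewrite ler_wpM2l].
by move: (r ^+ (_ - _)) (r ^+ m.*2) => x1 x2; ring.
Qed.

(** At c = 1 one has [Xr q 1] = 2 [rr q], which identifies the limiting coefficient as
    [odds p 1]. *)
Lemma odds1 N : \sum_(m < N) Xr (p ^+ m.*2.+1) 1 = aF Rk N 0.
Proof.
apply: eq_bigr => m _; rewrite double0 sub0r add0r RkN /Rk -exprnP.
have := onem_neq0 m.*2; move: (p ^+ _) => u u1.
rewrite /Xr /rr /den (_ : 1 - 2 * u * 1 + u ^+ 2 = (1 - u) ^+ 2); last by ring.
by field.
Qed.

Lemma bF_aF N : bF Rk N 0 = 2^-1 * (aF Rk N 0 + aF Rk N.+1 0).
Proof.
rewrite /bF /aF big_ord_recr /=.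
have e N' : \sum_(m < N') (Rk (0.*2%:Z - m.*2.+1%:Z) + Rk (0.*2%:Z + m.*2.+1%:Z)) =
  2 * \sum_(m < N') Rk m.*2.+1%:Z.
  by rewrite mulr_sumr; apply: eq_bigr => m _; rewrite double0 sub0r add0r RkN; ring.
rewrite e double0 sub0r add0r RkN.
suff -> : \sum_(n < N) (Rk (1%:Z + n.+1.*2%:Z) + Rk (1%:Z - n.+1.*2%:Z)) =
   2 * \sum_(m < N) Rk m.*2.+1%:Z + Rk N.*2.+1%:Z - Rk 1 by field.
elim: N => [|N IH]; first by rewrite !big_ord0 mulr0 add0r subrr.
rewrite !big_ord_recr /= IH.
have -> : 1%:Z - N.+1.*2%:Z = - N.*2.+1%:Z by lia.
have -> : 1%:Z + N.+1.*2%:Z = N.+1.*2.+1%:Z by lia.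
by rewrite RkN; ring.
Qed.

Lemma evenpart_cvg c : `|c| <= 1 -> evenpart c @ \oo --> 2^-1 * Xr 1 c + evens p c.
Proof.
move=> hc; rewrite (_ : evenpart c = (fun N => 2^-1 * Xr 1 c + series (fun n => Xr ((p ^+ 2) ^+ n.+1) c) N)).
  by apply: cvgD; [exact: cvg_cst|exact: evens_cvg].
apply/funext => N; rewrite series_ord; congr (_ + _); apply: eq_bigr => n _.
by rewrite -exprM mul2n.
Qed.

Lemma oddpart_cvg c : `|c| <= 1 -> oddpart c @ \oo --> odds p c.
Proof.
move=> hc; rewrite (_ : oddpart c = series (fun n => Xr (p ^+ (2 * n).+1) c)).
  exact: odds_cvg.
by apply/funext => N; rewrite series_ord; apply: eq_bigr => n _; rewrite mul2n.
Qed.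

(** Up to constants this says that (wp (x) - e_3)(wp (x + omega_3) - e_3) does not depend on x. Two
    points are compared because the Poisson kernels tend to 1, not to 0, as their index grows; only
    the differences [Pk _ c - Pk _ c'] decay and make the error terms vanish in the limit. *)
Lemma even_odd_product c c' : -1 <= c < 1 -> -1 <= c' < 1 ->
  let T0 x := 2^-1 * Xr 1 x + evens p x in let A := odds p 1 in
  T0 c * odds p c - A * T0 c - A * odds p c = T0 c' * odds p c' - A * T0 c' - A * odds p c'.
Proof.
move=> hc hc' T0 A.
have n1 : `|c| <= 1 by case/andP: hc => a b; rewrite ler_norml a ltW.
have n2 : `|c'| <= 1 by case/andP: hc' => a b; rewrite ler_norml a ltW.
have hA : (fun N => aF Rk N 0) @ \oo --> A.
  rewrite (_ : (fun N => _) = oddpart 1); first by apply: oddpart_cvg; rewrite normr1.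
  by apply/funext => N; rewrite -odds1.
have hA' : (fun N => bF Rk N 0) @ \oo --> A.
  have -> : A = 2^-1 * (A + A) by field.
  rewrite (_ : (fun N => _) = (fun N => 2^-1 * (aF Rk N 0 + aF Rk N.+1 0))).
    apply: (@cvgM _ _ _ _ (fun=> _)) => //; first exact: cvg_cst.
    apply: cvgD => //; by rewrite (cvg_shiftS (fun N => aF Rk N 0)).
  by apply/funext => N; rewrite bF_aF.
pose D x N := evenpart x N * oddpart x N - aF Rk N 0 * evenpart x N - bF Rk N 0 * oddpart x N.
have hD x : `|x| <= 1 -> D x @ \oo --> T0 x * odds p x - A * T0 x - A * odds p x.
  move=> hx; have e := evenpart_cvg hx; have o := oddpart_cvg hx.
  by apply: cvgB; [apply: cvgB|]; apply: cvgM.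
apply/eqP; rewrite -subr_eq0; apply/eqP.
have h1 : (fun N => D c N - D c' N) @ \oo -->
  (T0 c * odds p c - A * T0 c - A * odds p c) - (T0 c' * odds p c' - A * T0 c' - A * odds p c').
  by apply: cvgB; exact: hD.
rewrite -(cvg_lim _ h1)//; apply/cvg_lim => //; apply/tends0_cvg.
have [A1 A10 hA1] := Xr_small n1; have [A2 A20 hA2] := Xr_small n2.
have [A3 A30 hA3] := Pk_small n1 n2.
have t1 := tends0D (coef_even (y := fun k => Xr (p ^+ k) c) A10 Rk_bound hA1)
  (coef_odd (y := fun k => Xr (p ^+ k) c) A10 Rk_bound hA1).
have t2 := tends0D (coef_even (y := fun k => Xr (p ^+ k) c') A20 Rk_bound hA2)
  (coef_odd (y := fun k => Xr (p ^+ k) c') A20 Rk_bound hA2).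
have t3 := tends0D (coef_even (y := fun k => Pk (p ^+ k) c - Pk (p ^+ k) c') A30 Gk_bound hA3)
  (coef_odd (y := fun k => Pk (p ^+ k) c - Pk (p ^+ k) c') A30 Gk_bound hA3).
have t4 : tends0 (fun N => \sum_(m < N) Gk N.*2.+1%:Z * (Pk (p ^+ m.*2.+1) c - Pk (p ^+ m.*2.+1) c')).
  apply: (@sum_small (fun N m => Gk N.*2.+1%:Z * (Pk (p ^+ m.*2.+1) c - Pk (p ^+ m.*2.+1) c')) (K * A3)).
    exact: mulr_ge0.
  move=> N m nN; rewrite normrM.
  rewrite [leRHS](_ : _ = (K * r ^+ N.*2) * (N%:R * A3)); last by move: K; move=> k; ring.
  apply: ler_pM => //.
    apply: le_trans (Gk_bound N.*2).1 _; rewrite ler_wpM2l// exprS ler_piMl// exprn_ge0//.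
  apply: le_trans (hA3 m.*2) _; rewrite mulrC ler_wpM2r//.
  apply: (@le_trans _ _ 1); first by rewrite exprn_ile1.
  by rewrite ler1n (leq_ltn_trans _ nN).
have t := tends0D (tends0D t1 (tends0Z (-1) t2)) (tends0D t3 t4).
apply: (tends0_le (i1 := 0%N) _ t) => N _.
rewrite le_eqVlt; apply/orP; left; apply/eqP; congr (`|_|).
rewrite /D (partial_product hc N) (partial_product hc' N).
have gsplit x : \sum_(n < N) aF Gk N n.+1 * Pk (p ^+ n.+1.*2) x + \sum_(m < N) bF Gk N m * Pk (p ^+ m.*2.+1) x =
  \sum_(n < N) (aF Gk N n.+1 - aF Gk N 0) * Pk (p ^+ n.+1.*2) x +
  \sum_(m < N) (bF Gk N m - bF Gk N 0) * Pk (p ^+ m.*2.+1) x + \sum_(m < N) Gk N.*2.+1%:Z * Pk (p ^+ m.*2.+1) x.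
  rewrite aG0 bG0 -addrA; congr (_ + _); first by apply: eq_bigr => m _; rewrite subr0.
  by rewrite -big_split /=; apply: eq_bigr => m _; ring.
rewrite !gsplit.
have es (u : nat -> R) (v w : nat -> R) : \sum_(n < N) u n * (v n - w n) =
  \sum_(n < N) u n * v n - \sum_(n < N) u n * w n.
  by rewrite -sumrB; apply: eq_bigr => n _; ring.
have /= e1 := es (fun n => aF Gk N n.+1 - aF Gk N 0) (fun n => Pk (p ^+ n.+1.*2) c) (fun n => Pk (p ^+ n.+1.*2) c').
have /= e2 := es (fun n => bF Gk N n - bF Gk N 0) (fun n => Pk (p ^+ n.*2.+1) c) (fun n => Pk (p ^+ n.*2.+1) c').
have /= e3 := es (fun n => Gk N.*2.+1%:Z) (fun n => Pk (p ^+ n.*2.+1) c) (fun n => Pk (p ^+ n.*2.+1) c').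
rewrite e1 e2 e3.
by ring.
Qed.

End Fixed.
End DoubleSum.

Section RealTools.
Variable R : realType.
Implicit Types (f g : R -> R) (x y a b : R).

Lemma pos_of_neq0 f : continuous f -> (forall x, f x != 0) -> 0 < f 0 -> forall x, 0 < f x.
Proof.
move=> cf f0 p0 x; rewrite lt_neqAle eq_sym f0 /= leNgt; apply/negP => fx.
have h y z : y <= z -> f y * f z < 0 -> False.
  move=> yz hyz.
  have [c _ hc] : exists2 c, c \in `[y, z]%R & f c = 0.
    apply: IVT => //; first exact: continuous_subspaceT.
    rewrite ge_min le_max; have := f0 y; have := f0 z; move: hyz.
    have [h1|h1|h1] := ltgtP (f y) 0; have [h2|h2|h2] := ltgtP (f z) 0; nra.
  by have := f0 c; rewrite hc eqxx.
have [x0|x0] := leP 0 x; first by apply: (h _ _ x0); rewrite pmulr_rlt0.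
by apply: (h _ _ (ltW x0)); rewrite nmulr_rlt0.
Qed.

Lemma sin_abs_le x : `|sin x| <= `|x|.
Proof.
wlog x0 : x / 0 <= x.
  move=> h; have [|x0] := leP 0 x; first exact: h.
  have := h (- x); rewrite oppr_ge0 (ltW x0) sinN !normrN; exact.
rewrite (ger0_norm x0) ler_norml sin_le_id// andbT.
have [x1|x1] := leP x 1; last by have := sin_geN1 x; lra.
apply: (@le_trans _ _ 0); first by rewrite oppr_le0.
by apply: sin_ge0_pi; rewrite x0 /=; have := @pi_ge2 R; lra.
Qed.

End RealTools.

(** * Change of sign of p, and duplication of the series *)

Section TrigSeries.
Variable R : realType.
Implicit Types (x p c q : R) (n N : nat).

Lemma XrN q c : Xr (- q) c = Xr q (- c).
Proof. by rewrite /Xr /den; congr (_ / _ ^+ 2); ring. Qed.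

Lemma odds_opp p c : odds (- p) c = odds p (- c).
Proof.
congr gsum; apply/funext => n; rewrite -XrN; congr Xr.
by rewrite exprNn -signr_odd /= oddM /= expr1 mulN1r.
Qed.

Lemma evens_opp p c : evens (- p) c = evens p c.
Proof. by rewrite /evens sqrrN. Qed.

Lemma Xr_double q c : den q c != 0 -> den (- q) c != 0 ->
  Xr q c + Xr (- q) c = 4 * Xr (q ^+ 2) (2 * c ^+ 2 - 1).
Proof.
move=> h1 h2; have e : den (q ^+ 2) (2 * c ^+ 2 - 1) = den q c * den (- q) c.
  by rewrite /den; ring.
rewrite /Xr e; move: h1 h2; rewrite /den => h1 h2.
by field; rewrite h1 h2.
Qed.

Lemma sum_even_odd (u : nat -> R) N :
  \sum_(k < N.*2) u k = \sum_(k < N) u k.*2 + \sum_(k < N) u k.*2.+1.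
Proof.
elim: N => [|N IH]; first by rewrite !big_ord0 addr0.
rewrite doubleS !big_ord_recr /= IH; ring.
Qed.

Lemma Xr_at1 q : `|q| < 1 -> Xr q 1 = 2 * q / (1 - q) ^+ 2.
Proof.
move=> h; have h1 : 1 - q != 0.
  by rewrite subr_eq0 eq_sym; apply: contraTneq h => ->; rewrite normr1 ltxx.
rewrite /Xr /den (_ : 1 - 2 * q * 1 + q ^+ 2 = (1 - q) ^+ 2); last by ring.
by field.
Qed.

Section Double.
Variable p : R.
Hypothesis p1 : -1 < p < 1.

Let np : `|p| < 1. Proof. by rewrite ltr_norml. Qed.

(** The duplication formula for wp: the terms at q and - q combine into one term at q^2 with the
    doubled angle, and the even and odd powers of p together run through all powers. *)
Lemma series_double c : `|c| <= 1 ->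
  evens p c + evens p (- c) + odds p c + odds (- p) c = 4 * evens p (2 * c ^+ 2 - 1).
Proof.
move=> hc; have hc' : `|- c| <= 1 by rewrite normrN.
have p1' : -1 < - p < 1 by move: p1; lra.
have hc2 : `|2 * c ^+ 2 - 1| <= 1.
  have := sqr_ge0 c; have : c ^+ 2 <= 1 by rewrite -real_normK ?num_real// expr_le1.
  by rewrite ler_norml => *; apply/andP; split; lra.
have e1 := evens_cvg p1 hc; have e2 := evens_cvg p1 hc'.
have e3 := odds_cvg p1 hc; have e4 := odds_cvg p1' hc.
have e5 : (fun N => series (fun n => Xr ((p ^+ 2) ^+ n.+1) (2 * c ^+ 2 - 1)) N.*2) @ \oo --> evens p (2 * c ^+ 2 - 1).
  apply: cvg_comp (evens_cvg p1 hc2).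
  by move=> A [n _ hn]; exists n => // m /= nm; apply: hn => /=; rewrite (leq_trans nm)// -addnn leq_addr.
have h1 : (fun N => 4 * series (fun n => Xr ((p ^+ 2) ^+ n.+1) (2 * c ^+ 2 - 1)) N.*2) @ \oo --> 4 * evens p (2 * c ^+ 2 - 1).
  by apply: (@cvgM _ _ _ _ (fun=> 4)) => //; exact: cvg_cst.
have h2 : series (fun n => Xr ((p ^+ 2) ^+ n.+1) c) +
     series (fun n => Xr ((p ^+ 2) ^+ n.+1) (- c)) +
     series (fun n => Xr (p ^+ (2 * n).+1) c) +
     series (fun n => Xr ((- p) ^+ (2 * n).+1) c) @ \oo -->
     evens p c + evens p (- c) + odds p c + odds (- p) c.
  by apply: cvgD e4; apply: cvgD e3; apply: cvgD e1 e2.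
rewrite -(cvg_lim _ h1)//; apply/esym/cvg_lim => //.
apply: cvg_trans h2; apply: near_eq_cvg; near=> N.
rewrite !fctE !series_ord.
rewrite (sum_even_odd (fun k => Xr ((p ^+ 2) ^+ k.+1) (2 * c ^+ 2 - 1))).
rewrite mulrDr !mulr_sumr -!big_split /=; apply: eq_bigr => k _.
have dn n : den (p ^+ n.+1) c != 0 /\ den (- p ^+ n.+1) c != 0.
  have r01 := normp_lt1 p1.
  have hn : `|p ^+ n.+1| <= `|p|.
    by rewrite normrX -[leRHS]expr1; apply: ler_wiXn2l; rewrite ?(ltW np).
  have hc3 : `|c| <= 1 + (1 - `|p|) ^+ 2 / 4 by have := dl_gt0 r01; lra.
  by split; rewrite gt_eqF// (den_gt0 r01)// normrN.
have d (n : nat) : 4 * Xr ((p ^+ 2) ^+ n.+1) (2 * c ^+ 2 - 1) = Xr (p ^+ n.+1) c + Xr (p ^+ n.+1) (- c).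
  have [d1 d2] := dn n; rewrite -XrN Xr_double//; congr (4 * Xr _ _).
  by rewrite -!exprM mulnC.
rewrite !d; have -> : (p ^+ 2) ^+ k.+1 = p ^+ k.*2.+2 by rewrite -exprM mulnS mul2n.
have -> : Xr ((- p) ^+ (2 * k).+1) c = Xr (p ^+ k.*2.+1) (- c).
  by rewrite -XrN mul2n exprNn -signr_odd /= odd_double expr1 mulN1r.
rewrite mul2n; ring.
Unshelve. all: by end_near. Qed.

End Double.
End TrigSeries.

(** * The differential equation of t from its duplication formula *)

Section Doubling.
Variables (R : realType) (t u : R -> R) (a b : R).
Hypotheses (a0 : 0 < a) (b0 : 0 < b) (su : smooth u) (u_gt0 : forall x, 0 < u x)
  (u0 : u 0 = (pi ^+ 2)^-1) (tu : forall x, t x = sin (pi * x) ^+ 2 * u x)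
  (t_half : t 2^-1 = a^-1)
  (t_shift : forall x, a * t (x + 2^-1) * (1 - b * t x) = 1 - a * t x)
  (t_double : forall x, sin (pi * x) != 0 -> cos (pi * x) != 0 ->
    4 / t (2 * x) = (t x)^-1 + (t (x + 2^-1))^-1 + a * b * (t x + t (x + 2^-1))).

Lemma doubling_smooth : smooth t.
Proof.
have -> : t = fun x => sin (pi * x) ^+ 2 * u x by apply/funext => x; exact: tu.
by apply: smoothM => //; apply: smoothX; exact: smooth_sin.
Qed.

Lemma doubling_ge0 x : 0 <= t x.
Proof. by rewrite tu; apply: mulr_ge0; [exact: sqr_ge0|exact: ltW]. Qed.

Lemma doubling_gt0 x : sin (pi * x) != 0 -> 0 < t x.
Proof. by move=> h; rewrite tu; apply: mulr_gt0 => //; rewrite exprn_even_gt0. Qed.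

Lemma doubling_eq0 x : sin (pi * x) = 0 -> t x = 0.
Proof. by move=> h; rewrite tu h expr0n mul0r. Qed.

Lemma sin_half_shift (x : R) : sin (pi * (x + 2^-1)) = cos (pi * x).
Proof. by rewrite mulrDr -sinDpihalf. Qed.

Lemma sin_dyadic n : sin (pi * 2^-1 ^+ n.+1) != 0 :> R.
Proof.
rewrite gt_eqF// sin_gt0_pi//; have := @pi_gt0 R; move: (pi : R) => q q0.
have h : 0 < (2^-1 : R) ^+ n.+1 by rewrite exprn_gt0.
have h2 : (2^-1 : R) ^+ n.+1 <= 2^-1.
  rewrite exprS ler_piMr//; apply: exprn_ile1 => //; lra.
by apply/andP; split; nra.
Qed.

Lemma cos_dyadic n : cos (pi * 2^-1 ^+ n.+2) != 0 :> R.
Proof.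
have h := sin_dyadic n; apply: contraNneq h => h.
rewrite (_ : pi * 2^-1 ^+ n.+1 = pi * 2^-1 ^+ n.+2 + pi * 2^-1 ^+ n.+2).
  by rewrite sinD h mulr0 mul0r addr0.
rewrite [in RHS]exprS; move: (pi : R) (2^-1 ^+ n.+1 : R) => q r; by field.
Qed.

(** If a = b, descending through the duplication formula forces t = 1 / a at every 2^-n, against the
    continuity of t and t 0 = 0. *)
Lemma doubling_neq : a <> b.
Proof.
move=> ab.
have key n : a * t (2^-1 ^+ n.+1) = 1.
  elim: n => [|n IH]; first by rewrite expr1 t_half divff ?gt_eqF.
  set x := 2^-1 ^+ n.+2 in IH *.
  have xx : 2 * x = 2^-1 ^+ n.+1 by rewrite /x [in LHS]exprS mulrA divff ?mul1r// pnatr_eq0.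
  apply/eqP; rewrite eq_sym -subr_eq0; apply/negP => /negP h.
  have h1 := t_shift x; rewrite -ab in h1.
  have h2 : a * t (x + 2^-1) = 1 by apply: (mulIf h); rewrite h1 mul1r.
  have sx : sin (pi * x) != 0 by exact: sin_dyadic.
  have tp := doubling_gt0 sx.
  have h3 := t_double sx (cos_dyadic n); rewrite xx in h3.
  have t2p : 0 < t (2^-1 ^+ n.+1) by apply: doubling_gt0; exact: sin_dyadic.
  have a' : a != 0 by rewrite gt_eqF.
  have h4 : t (x + 2^-1) = a^-1 by apply: (mulfI a'); rewrite h2 divff.
  have h5 : t (2^-1 ^+ n.+1) = a^-1 by apply: (mulfI a'); rewrite IH divff.
  move: h3; rewrite h4 h5 -ab !invrK => h3.
  have h6 : (1 - a * t x) ^+ 2 = 0.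
    have -> : (1 - a * t x) ^+ 2 = t x * ((t x)^-1 + a + a * a * (t x + a^-1) - 4 * a).
      by field; rewrite !gt_eqF.
    by rewrite -h3; ring.
  by move/eqP: h6; rewrite sqrf_eq0 (negPf h).
have ct : t x @[x --> (0 : R)] --> t 0 by apply: (smooth_cont doubling_smooth).
rewrite (doubling_eq0 (x := 0)) ?mulr0 ?sin0// in ct.
have hl : (fun n => t (2^-1 ^+ n.+1)) @ \oo --> (0 : R).
  have hg : (fun n => (2^-1 : R) ^+ n.+1) @ \oo --> (0 : R).
    rewrite (cvg_shiftS (fun n => (2^-1 : R) ^+ n)); apply: cvg_expr.
    by rewrite ger0_norm; lra.
  exact: (cvg_comp _ _ hg ct).
move/cvgrPdist_lt : hl => h; have ai : 0 < a^-1 by rewrite invr_gt0.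
have [N _ /(_ N (leqnn N))/=] := h _ ai.
have -> : t (2^-1 ^+ N.+1) = a^-1.
  have a' : a != 0 by rewrite gt_eqF.
  by apply: (mulfI a'); rewrite key divff.
by rewrite sub0r normrN gtr0_norm// ltxx.
Qed.

(** At a zero of 1 - b t, [t_shift] makes 1 - a t vanish too, so a = b; the sign is then the one at
    0. *)
Lemma doubling_bt x : 0 < 1 - b * t x.
Proof.
apply: (@pos_of_neq0 _ (fun x => 1 - b * t x)) => [|y|].
- apply: smooth_cont; apply: smoothB; first exact: smooth_cst.
  by apply: smoothZ; exact: doubling_smooth.
- apply/eqP => h; have := t_shift y; rewrite h mulr0 => h1.
  apply: doubling_neq.
  have ty : t y != 0 by apply/eqP => ty; move: h; rewrite ty; lra.
  by apply: (mulIf ty); lra.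
- by rewrite (doubling_eq0 (x := 0)) ?mulr0 ?sin0// subr0.
Qed.

Lemma doubling_lt : b < a.
Proof. by have := doubling_bt 2^-1; rewrite t_half subr_gt0 ltr_pdivrMr// mul1r. Qed.

Lemma doubling_at x :
  1 - a * t x = cos (pi * x) ^+ 2 * (a * (1 - b * t x) * u (x + 2^-1)).
Proof. by rewrite -t_shift (tu (x + 2^-1)) sin_half_shift; ring. Qed.

Lemma doubling_at_ge0 x : 0 <= 1 - a * t x.
Proof.
rewrite doubling_at; apply: mulr_ge0; first exact: sqr_ge0.
apply: mulr_ge0; last exact: ltW.
by apply: mulr_ge0; apply: ltW => //; exact: doubling_bt.
Qed.

Lemma doubling_M x : 0 < 1 - a * b * t x ^+ 2.
Proof.
have h1 := doubling_bt x; have h2 := doubling_at_ge0 x; have h3 := doubling_ge0 x.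
rewrite (_ : _ - _ = 1 - a * t x * (b * t x)); last by ring.
have h4 : 0 <= b * t x by rewrite mulr_ge0// ltW.
nra.
Qed.

(** [t_double] with [t (x + 2^-1)] eliminated by [t_shift]. Cleared of denominators it holds also at
    the zeros of sin and cos. *)
Lemma doubling_formula x :
  t (2 * x) * (1 - a * b * t x ^+ 2) ^+ 2 = 4 * t x * (1 - a * t x) * (1 - b * t x).
Proof.
have s2 : sin (pi * (2 * x)) = 2 * sin (pi * x) * cos (pi * x).
  rewrite (_ : pi * (2 * x) = pi * x + pi * x); last by move: (pi : R) => q; ring.
  by rewrite sinD; ring.
have [sx|sx] := eqVneq (sin (pi * x)) 0.
  have -> : t (2 * x) = 0 by apply: doubling_eq0; rewrite s2 sx; ring.
  by rewrite (doubling_eq0 sx); ring.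
have [cx|cx] := eqVneq (cos (pi * x)) 0.
  have -> : t (2 * x) = 0 by apply: doubling_eq0; rewrite s2 cx; ring.
  by rewrite doubling_at cx; ring.
have tx := doubling_gt0 sx; have bt := doubling_bt x.
have at0 : 0 < 1 - a * t x.
  rewrite doubling_at; apply: mulr_gt0; first by rewrite exprn_even_gt0.
  by apply: mulr_gt0 => //; apply: mulr_gt0.
have t2 : 0 < t (2 * x) by apply: doubling_gt0; rewrite s2 !mulf_neq0// pnatr_eq0.
have h := t_double sx cx.
have ts : t (x + 2^-1) = (1 - a * t x) / (a * (1 - b * t x)).
  by rewrite -t_shift; field; rewrite !gt_eqF.
have : 4 / t (2 * x) = (1 - a * b * t x ^+ 2) ^+ 2 / (t x * (1 - a * t x) * (1 - b * t x)).
  by rewrite h ts; field; rewrite !gt_eqF.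
move=> h5; apply: (mulIf (x := (t (2 * x))^-1 * (t x * (1 - a * t x) * (1 - b * t x))^-1)).
  by rewrite gt_eqF// divr_gt0 ?invr_gt0// !mulr_gt0.
rewrite [LHS](_ : _ = (1 - a * b * t x ^+ 2) ^+ 2 / (t x * (1 - a * t x) * (1 - b * t x))).
  by rewrite -h5; field; rewrite !gt_eqF.
by field; rewrite !gt_eqF.
Qed.

Let t1 := derive1 t.
Let G x := t1 x ^+ 2 - 4 * t x * (1 - a * t x) * (1 - b * t x).
(** If [doubling_formula] is read as t (2 x) = R (t x), then [D x] is R' (t x) / 4; it equals 1
    where t vanishes. *)
Let D x := ((1 - 2 * (a + b) * t x + 3 * a * b * t x ^+ 2) * (1 - a * b * t x ^+ 2)
  + 4 * a * b * t x * (t x * (1 - a * t x) * (1 - b * t x))) / (1 - a * b * t x ^+ 2) ^+ 3.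

Lemma doubling_derive x : t1 (2 * x) = 2 * D x * t1 x.
Proof.
have d1 y : der y t (t1 y) by apply: smooth_isd; exact: doubling_smooth.
have d2 : der x (fun y => t (2 * y)) (t1 (2 * x) * (2 * 1)).
  apply: isd_comp; last exact: d1.
  by apply: isd_eq (isdM (isdC 2 x) (isdI x)) _; ring.
have dM : der x (fun y => 1 - a * b * t y ^+ 2) (- (a * b * (2 * t x * t1 x))).
  apply: isd_eq (isdB (isdC 1 x) (isdM (isdC (a * b) x) (isdX 2 (d1 x)))) _.
  by rewrite /= expr1; ring.
have dL := isdM d2 (isdX 2 dM).
have dR : der x (fun y => 4 * t y * (1 - a * t y) * (1 - b * t y))
    (4 * (1 - 2 * (a + b) * t x + 3 * a * b * t x ^+ 2) * t1 x).
  apply: isd_eq (isdM (isdM (isdM (isdC 4 x) (d1 x)) (isdB (isdC 1 x) (isdM (isdC a x) (d1 x))))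
     (isdB (isdC 1 x) (isdM (isdC b x) (d1 x)))) _.
  by ring.
have e : (fun y => t (2 * y) * (1 - a * b * t y ^+ 2) ^+ 2) =
    (fun y => 4 * t y * (1 - a * t y) * (1 - b * t y)).
  by apply/funext => y; exact: doubling_formula.
rewrite e in dL; have h := isd_uniq dL dR.
have Mx := doubling_M x; have f := doubling_formula x.
have M0 : 1 - a * b * t x ^+ 2 != 0 by rewrite gt_eqF.
apply: (mulIf (x := 2 * (1 - a * b * t x ^+ 2) ^+ 3)).
  by rewrite mulf_neq0// expf_neq0.
rewrite [RHS](_ : _ = t1 x * (4 * (1 - 2 * (a + b) * t x + 3 * a * b * t x ^+ 2) * (1 - a * b * t x ^+ 2)
   + 4 * a * b * t x * (4 * t x * (1 - a * t x) * (1 - b * t x)))); last by rewrite /D; field.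
rewrite -f; move: h; rewrite /= expr1.
move: (t1 (2 * x)) (t (2 * x)) (t x) (t1 x) => A B C E h.
rewrite [RHS](_ : _ = (1 - a * b * C ^+ 2) * (4 * (1 - 2 * (a + b) * C + 3 * a * b * C ^+ 2) * E)
   + 4 * a * b * C * E * (B * (1 - a * b * C ^+ 2) ^+ 2)); last by ring.
by rewrite -h; ring.
Qed.

Lemma doubling_G x : G (2 * x) = 4 * D x ^+ 2 * G x.
Proof.
have M0 : 1 - a * b * t x ^+ 2 != 0 by rewrite gt_eqF// doubling_M.
have f := doubling_formula x.
have e : t (2 * x) = 4 * t x * (1 - a * t x) * (1 - b * t x) / (1 - a * b * t x ^+ 2) ^+ 2.
  by rewrite -f; field.
rewrite /G doubling_derive e /D; move: (t x) (t1 x) M0 => A B M0.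
by field.
Qed.

Lemma doubling_small : exists2 e, 0 < e & forall x, `|x| < e -> 0 <= D x <= 1.
Proof.
have ct : t x @[x --> (0 : R)] --> t 0 by apply: (smooth_cont doubling_smooth).
rewrite (doubling_eq0 (x := 0)) ?mulr0 ?sin0// in ct.
have k0 : 0 < (10 * a)^-1 by rewrite invr_gt0 mulr_gt0.
move/cvgrPdist_lt/(_ _ k0)/nbhs_ballP : ct => [e /= e0 he]; exists e => // x xe.
have := he x; rewrite /ball /= !sub0r !normrN => /(_ xe).
rewrite ger0_norm ?doubling_ge0// => tx.
have t0 := doubling_ge0 x; have M0 := doubling_M x; have ba := doubling_lt.
have h1 : a * t x <= 10^-1.
  rewrite (_ : 10^-1 = a * (10 * a)^-1); first by rewrite ler_wpM2l ?ltW.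
  by field; rewrite gt_eqF.
have h2 : b * t x <= 10^-1 by apply: le_trans h1; rewrite ler_wpM2r// ltW.
have h3 : 0 <= a * t x by rewrite mulr_ge0// ltW.
have h4 : 0 <= b * t x by rewrite mulr_ge0// ltW.
rewrite /D; set A := a * t x in h1 h3; set B := b * t x in h2 h4.
have eM : 1 - a * b * t x ^+ 2 = 1 - A * B by rewrite /A /B; ring.
rewrite eM in M0 *.
rewrite (_ : _ + _ = (1 - 2 * (A + B) + 3 * A * B) * (1 - A * B) + 4 * A * B * (1 - A) * (1 - B)); last first.
  by rewrite /A /B; ring.
have AB0 : 0 <= A * B by exact: mulr_ge0.
have AB1 : A * B <= 10^-1 * A by rewrite mulrC ler_wpM2r.
apply/andP; split.
  apply: divr_ge0; last by apply: exprn_ge0; exact: ltW.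
  apply: addr_ge0; first by apply: mulr_ge0; lra.
  by apply: mulr_ge0; [apply: mulr_ge0|]; lra.
rewrite ler_pdivrMr ?exprn_gt0// mul1r -subr_ge0.
rewrite [leRHS](_ : _ = 2 * (A + B) - 9 * (A * B) + 2 * (A * B) * (A + B) + (A * B) ^+ 2 * (2 - A * B)); last by ring.
apply: addr_ge0; last by apply: mulr_ge0; [exact: sqr_ge0|lra].
by apply: addr_ge0; [lra|apply: mulr_ge0; lra].
Qed.

(** The normalization u 0 = pi^-2 is exactly what makes the factor B vanish at 0, so that G x = o
    (x^2). *)
Lemma doubling_G_bound : exists B : R -> R, [/\ {for 0, continuous B}, B 0 = 0 &
  forall x, `|G x| <= pi ^+ 2 * x ^+ 2 * `|B x| ].
Proof.
pose u1 := derive1 u.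
pose B x := (2 * pi * cos (pi * x) * u x + sin (pi * x) * u1 x) ^+ 2
   - 4 * u x * (1 - a * t x) * (1 - b * t x).
have sB : smooth B.
  apply: smoothB.
    apply: smoothX; apply: smoothD.
      by apply: smoothM => //; apply: smoothZ; exact: smooth_cos.
    by apply: smoothM; [exact: smooth_sin|exact: smooth_derive1].
  apply: smoothM; first apply: smoothM.
  - exact: smoothZ.
  - by apply: smoothB; [exact: smooth_cst|apply: smoothZ; exact: doubling_smooth].
  - by apply: smoothB; [exact: smooth_cst|apply: smoothZ; exact: doubling_smooth].
exists B; split; first exact: smooth_cont.
  rewrite /B (doubling_eq0 (x := 0)) ?mulr0 ?sin0// cos0 u0.
  have := @pi_gt0 R; move: (pi : R) => q q0.
  by field; rewrite gt_eqF.
move=> x; have e : G x = sin (pi * x) ^+ 2 * B x.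
  have -> : G x = t1 x ^+ 2 - 4 * t x * (1 - a * t x) * (1 - b * t x) by [].
  have -> : t1 x = 2 * sin (pi * x) * (pi * cos (pi * x)) * u x + sin (pi * x) ^+ 2 * u1 x.
    have d := isdM (isdX 2 (isd_sin_lin pi x)) (smooth_isd x su).
    have e : (fun x => sin (pi * x) ^+ 2 * u x) = t by apply/funext => y; rewrite tu.
    rewrite e in d; rewrite /t1 (isd_derive1 d) /= expr1 /u1; ring.
  by rewrite /B [in 4 * t x]tu; move: (pi : R) => q; ring.
rewrite e normrM; apply: ler_wpM2r => //.
rewrite normrX -exprMn -[leRHS](ger0_norm (sqr_ge0 _)) normrX.
by rewrite lerXn2r ?nnegrE//; exact: sin_abs_le.
Qed.

(** Near 0 one has |G (2 x)| <= 4 |G x|, hence |G y| <= 4^n |G (y / 2^n)|; the growth 4^n is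
    compensated by the square of y / 2^n, and the remaining factor tends to 0. So G = 0 near 0, and
    [doubling_G] carries this to every x by repeated doubling. *)
Lemma doubling_ode x : t1 x ^+ 2 = 4 * t x * (1 - a * t x) * (1 - b * t x).
Proof.
suff : G x = 0 by move/eqP; rewrite subr_eq0 => /eqP.
have [e e0 hD] := doubling_small; have [B [cB B0 hB]] := doubling_G_bound.
have small y : `|y| < e -> G y = 0.
  move=> ye.
  have he n : `|y * 2^-1 ^+ n| < e.
    apply: le_lt_trans ye; rewrite normrM ler_piMr// ger0_norm ?exprn_ge0//.
    by apply: exprn_ile1 => //; lra.
  have step n : `|G y| <= 4 ^+ n * `|G (y * 2^-1 ^+ n)|.
    elim: n => [|n IH]; first by rewrite !expr0 mul1r mulr1.
    apply: (le_trans IH); rewrite exprSr -mulrA ler_wpM2l ?exprn_ge0//.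
    have -> : y * 2^-1 ^+ n = 2 * (y * 2^-1 ^+ n.+1).
      by rewrite exprS; move: (2^-1 ^+ n : R) => r; field.
    rewrite doubling_G; have /andP[h1 h2] := hD _ (he n.+1).
    rewrite normrM ler_wpM2r// ger0_norm; last by apply: mulr_ge0 => //; exact: sqr_ge0.
    by rewrite -[leRHS]mulr1 ler_wpM2l// expr_le1.
  have bound n : `|G y| <= pi ^+ 2 * y ^+ 2 * `|B (y * 2^-1 ^+ n)|.
    apply: (le_trans (step n)); apply: (le_trans (ler_wpM2l _ (hB _))).
      by rewrite exprn_ge0.
    rewrite mulrA; apply: ler_wpM2r => //.
    rewrite [leLHS](_ : _ = pi ^+ 2 * y ^+ 2 * (4 * (2^-1 * 2^-1)) ^+ n).
      by rewrite (_ : 4 * _ = 1) ?expr1n ?mulr1//; field.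
    move: (pi : R) => q; rewrite !exprMn.
    by move: (2^-1 ^+ n : R) => r; ring.
  have lim : (fun n => pi ^+ 2 * y ^+ 2 * `|B (y * 2^-1 ^+ n)|) @ \oo --> (0 : R).
    rewrite -[X in _ --> X](mulr0 (pi ^+ 2 * y ^+ 2)); apply: (@cvgM _ _ _ _ (fun=> pi ^+ 2 * y ^+ 2)).
      exact: cvg_cst.
    rewrite -(@normr0 _ R) -B0; apply: cvg_norm.
    have h : (fun n => y * 2^-1 ^+ n) @ \oo --> (0 : R).
      rewrite -[X in _ --> X](mulr0 y); apply: (@cvgM _ _ _ _ (fun=> y)); first exact: cvg_cst.
      by apply: cvg_expr; rewrite ger0_norm; lra.
    exact: (cvg_comp _ _ h cB).
  apply/eqP; rewrite -normr_le0.
  rewrite -(cvg_lim _ lim)//; apply: limr_ge; first by apply/cvg_ex; exists 0.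
  by near=> n; exact: bound.
have [n hn] : exists n, `|x * 2^-1 ^+ n| < e.
  have h : (fun n => x * 2^-1 ^+ n) @ \oo --> (0 : R).
    rewrite -[X in _ --> X](mulr0 x); apply: (@cvgM _ _ _ _ (fun=> x)); first exact: cvg_cst.
    by apply: cvg_expr; rewrite ger0_norm; lra.
  move/cvgrPdist_lt/(_ _ e0) : h => [N _ /(_ N (leqnn N))/=].
  by rewrite sub0r normrN => h; exists N.
elim: n x hn => [|n IH] x hn; first by apply: small; rewrite expr0 mulr1 in hn.
have -> : x = 2 * (x * 2^-1) by field.
rewrite doubling_G IH ?mulr0//; by rewrite -mulrA -exprS.
Unshelve. all: by end_near. Qed.

End Doubling.

(** * The function 1 / (wp - e_3) for 0 < p < 1 *)

Section Core.
Variables (R : realType) (p : R).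
Hypothesis p01 : 0 < p < 1.

Let p1 : -1 < p < 1. Proof. by case/andP: p01 => h1 h2; rewrite h2 andbT; lra. Qed.
Let c (x : R) := cos (2 * pi * x).

Lemma Xr_at1_ge0 (q : R) : 0 <= q -> 0 <= Xr q 1.
Proof.
move=> q0; rewrite /Xr; apply: divr_ge0; last exact: sqr_ge0.
rewrite (_ : (1 + q ^+ 2) * 1 - 2 * q = (1 - q) ^+ 2); last by ring.
by apply: mulr_ge0; [lra|exact: sqr_ge0].
Qed.

Lemma Xr_atN1_le0 (q : R) : 0 <= q -> Xr q (-1) <= 0.
Proof.
move=> q0; rewrite -oppr_ge0 /Xr -mulNr; apply: divr_ge0; last exact: sqr_ge0.
rewrite [leRHS](_ : _ = 2 * q * ((1 + q) ^+ 2)); last by ring.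
by apply: mulr_ge0; [lra|exact: sqr_ge0].
Qed.

Lemma odds_at1_gt0 : 0 < odds p 1.
Proof.
case/andP: p01 => q0 q1.
have h : (fun N => series (fun n => Xr (p ^+ (2 * n).+1) 1) N) @ \oo --> odds p 1.
  by apply: (odds_cvg p1); rewrite normr1.
apply: (@lt_le_trans _ _ (Xr p 1)).
  rewrite Xr_at1 ?gtr0_norm//; apply: divr_gt0; first by lra.
  by rewrite exprn_gt0// subr_gt0.
rewrite -(cvg_lim _ h)//; apply: limr_ge; first by apply/cvg_ex; exists (odds p 1).
near=> N; have : (0 < N)%N by near: N; exists 1%N.
case: (N) => // M _; rewrite series_ord big_ord_recl /= lerDl; apply: sumr_ge0 => i _.
by apply: Xr_at1_ge0; rewrite exprn_ge0// ltW.
Unshelve. all: by end_near. Qed.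

Lemma odds_atN1_le0 : odds p (-1) <= 0.
Proof.
case/andP: p01 => q0 q1.
have h : (fun N => series (fun n => Xr (p ^+ (2 * n).+1) (-1)) N) @ \oo --> odds p (-1).
  by apply: (odds_cvg p1); rewrite normrN normr1.
rewrite -(cvg_lim _ h)//; apply: limr_le; first by apply/cvg_ex; exists (odds p (-1)).
near=> N; rewrite series_ord; apply: sumr_le0 => i _.
by apply: Xr_atN1_le0; rewrite exprn_ge0// ltW.
Unshelve. all: by end_near. Qed.

Lemma evens_atN1_le0 : evens p (-1) <= 0.
Proof.
have h : (fun N => series (fun n => Xr ((p ^+ 2) ^+ n.+1) (-1)) N) @ \oo --> evens p (-1).
  by apply: (evens_cvg p1); rewrite normrN normr1.
rewrite -(cvg_lim _ h)//; apply: limr_le; first by apply/cvg_ex; exists (evens p (-1)).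
near=> N; rewrite series_ord; apply: sumr_le0 => i _.
by apply: Xr_atN1_le0; rewrite exprn_ge0// sqr_ge0.
Unshelve. all: by end_near. Qed.

(** With the factor 4 pi^2 these become e_1 - e_3 and e_2 - e_3. *)
Definition core_a0 := odds p 1 - (2^-1 * Xr 1 (-1) + evens p (-1)).
Definition core_b0 := odds p 1 - odds p (-1).
Definition core_a := 4 * pi ^+ 2 * core_a0.
Definition core_b := 4 * pi ^+ 2 * core_b0.
(** The product of sin^2 (pi x) and wp - e_3, with the pole at the integers removed; [core_t] is
    thus 1 / (wp - e_3). *)
Definition core_Q x := pi ^+ 2 + sin (pi * x) ^+ 2 * (4 * pi ^+ 2 * (odds p 1 - evens p (c x))).
Definition core_u x := (core_Q x)^-1.
Definition core_t x := sin (pi * x) ^+ 2 * core_u x.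

Let k0 : 0 < 4 * pi ^+ 2 :> R.
Proof. by rewrite mulr_gt0// exprn_gt0// pi_gt0. Qed.

Let a00 : 0 < core_a0.
Proof.
rewrite /core_a0 subr_gt0; apply: le_lt_trans odds_at1_gt0.
have := evens_atN1_le0; have := @Xr_atN1_le0 1 ler01; lra.
Qed.

Let b00 : 0 < core_b0.
Proof. by rewrite /core_b0 subr_gt0; apply: le_lt_trans odds_at1_gt0; exact: odds_atN1_le0. Qed.

Lemma core_a_gt0 : 0 < core_a. Proof. exact: mulr_gt0. Qed.
Lemma core_b_gt0 : 0 < core_b. Proof. exact: mulr_gt0. Qed.

Let c_range x : -1 <= c x <= 1.
Proof. by rewrite cos_geN1 cos_le1. Qed.

Let T0 x := 2^-1 * Xr 1 x + evens p x.

Lemma T0_sin x : sin (pi * x) != 0 -> T0 (c x) = evens p (c x) - (4 * sin (pi * x) ^+ 2)^-1.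
Proof.
move=> h; rewrite /T0 Xr1 ?cos_neq1// cos_double_sin; by field.
Qed.

Lemma core_odds x : sin (pi * x) != 0 ->
  (odds p 1 - T0 (c x)) * (odds p 1 - odds p (c x)) = core_a0 * core_b0.
Proof.
move=> h; have p0 : p != 0 by case/andP: p01 => h1 _; rewrite gt_eqF.
have h1 : -1 <= c x < 1 by case/andP: (c_range x) => g1 g2; rewrite g1 lt_neqAle cos_neq1 h.
have h2 : -1 <= (-1 : R) < 1 by rewrite lexx; lra.
have := even_odd_product p0 p1 h1 h2; rewrite /= -/(T0 (c x)) -/(T0 (-1)) => e.
rewrite /core_a0 /core_b0 -/(T0 (-1)).
move: e; move: (odds p 1) (T0 (c x)) (odds p (c x)) (T0 (-1)) (odds p (-1)) => A B C D E e.
rewrite [LHS](_ : _ = A ^+ 2 + (B * C - A * B - A * C)); last by ring.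
by rewrite e; ring.
Qed.

Lemma core_Q_odds x :
  core_Q x * (odds p 1 - odds p (c x)) = 4 * pi ^+ 2 * core_a0 * core_b0 * sin (pi * x) ^+ 2.
Proof.
have [h|h] := eqVneq (sin (pi * x)) 0.
  have -> : c x = 1 by apply/eqP; move: (cos_neq1 x); rewrite h eqxx /= => /negbFE.
  by rewrite subrr h; ring.
rewrite -[4 * pi ^+ 2 * _ * _]mulrA -(core_odds h) T0_sin// /core_Q.
move: (pi : R) (sin (pi * x)) h (evens p (c x)) (odds p (c x)) (odds p 1) => q s s0 E O A.
by field.
Qed.

(** The sign is not read off the series. By [core_Q_odds] a zero of Q would be a zero of sin (pi x),
    but there Q equals pi^2; so Q keeps the sign it has at 0. *)
Lemma core_Q_gt0 x : 0 < core_Q x.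
Proof.
apply: pos_of_neq0 => [|y|].
- apply: smooth_cont; apply: smoothD; first exact: smooth_cst.
  apply: smoothM; first by apply: smoothX; exact: smooth_sin.
  by apply: smoothZ; apply: smoothB; [exact: smooth_cst|exact: smooth_evens].
- apply/eqP => h; have := core_Q_odds y; rewrite h mul0r => /esym/eqP.
  have kk : 4 * pi ^+ 2 * core_a0 * core_b0 != 0.
    by rewrite gt_eqF// (mulr_gt0 (mulr_gt0 k0 a00) b00).
  rewrite mulf_eq0 (negPf kk) /= expf_eq0 => /eqP h2.
  move: h; rewrite /core_Q h2 expr0n mul0r addr0 => /eqP; by rewrite gt_eqF// exprn_gt0// pi_gt0.
- by rewrite /core_Q mulr0 sin0 expr0n mul0r addr0 exprn_gt0// pi_gt0.
Qed.

Lemma core_u_gt0 x : 0 < core_u x.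
Proof. by rewrite invr_gt0 core_Q_gt0. Qed.

Lemma smooth_core_u : smooth core_u.
Proof.
apply: smoothV; first exact: core_Q_gt0.
apply: smoothD; first exact: smooth_cst.
apply: smoothM; first by apply: smoothX; exact: smooth_sin.
by apply: smoothZ; apply: smoothB; [exact: smooth_cst|exact: smooth_evens].
Qed.

Lemma core_u0 : core_u 0 = (pi ^+ 2)^-1.
Proof. by rewrite /core_u /core_Q mulr0 sin0 expr0n mul0r addr0. Qed.

Lemma core_uN x : core_u (- x) = core_u x.
Proof. by rewrite /core_u /core_Q /c !mulrN cosN sinN sqrrN. Qed.

Lemma cos_per x : c (x + 1) = c x.
Proof.
rewrite /c; have -> : 2 * pi * (x + 1) = 2 * pi * x + pi *+ 2 :> R.
  by rewrite -[pi *+ 2]mulr_natl; move: (pi : R) => q; ring.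
by rewrite cosD2pi.
Qed.

Lemma sin2_per (x : R) : sin (pi * (x + 1)) ^+ 2 = sin (pi * x) ^+ 2.
Proof. by rewrite mulrDr mulr1 sinDpi sqrrN. Qed.

Lemma cos_half x : c (x + 2^-1) = - c x.
Proof.
rewrite /c; have -> : 2 * pi * (x + 2^-1) = 2 * pi * x + pi :> R.
  by move: (pi : R) => q; field.
by rewrite cosDpi.
Qed.

Lemma core_u_per x : core_u (x + 1) = core_u x.
Proof. by rewrite /core_u /core_Q sin2_per cos_per. Qed.

Lemma core_t_odds x : 4 * pi ^+ 2 * (odds p 1 - odds p (c x)) = core_a * core_b * core_t x.
Proof.
have Q0 : core_Q x != 0 by rewrite gt_eqF// core_Q_gt0.
apply: (mulIf Q0); rewrite -[LHS]mulrA [X in _ * X = _]mulrC core_Q_odds /core_t /core_u /core_a /core_b.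
by move: (pi : R) => q; field.
Qed.

Lemma core_t_gt0 x : sin (pi * x) != 0 -> 0 < core_t x.
Proof. by move=> h; rewrite mulr_gt0 ?core_u_gt0// exprn_even_gt0. Qed.

Lemma core_tV x : sin (pi * x) != 0 ->
  (core_t x)^-1 = pi ^+ 2 / sin (pi * x) ^+ 2 - 4 * pi ^+ 2 * evens p (c x) + 4 * pi ^+ 2 * odds p 1.
Proof.
move=> h; rewrite /core_t /core_u invfM invrK /core_Q.
by move: (pi : R) (sin (pi * x)) h => q s s0; field.
Qed.

Lemma core_tV_T0 x : sin (pi * x) != 0 -> (core_t x)^-1 = 4 * pi ^+ 2 * (odds p 1 - T0 (c x)).
Proof.
move=> h; rewrite core_tV// T0_sin//.
by move: (pi : R) (sin (pi * x)) h => q s s0; field.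
Qed.

Let Apos : core_a != 0. Proof. by rewrite gt_eqF// core_a_gt0. Qed.
Let Bpos : core_b != 0. Proof. by rewrite gt_eqF// core_b_gt0. Qed.

Lemma core_t_half : core_t 2^-1 = core_a^-1.
Proof.
have h := core_t_odds 2^-1.
have e : c 2^-1 = -1 by rewrite /c -mulrA mulrCA divff ?pnatr_eq0// mulr1 cospi.
apply: (mulfI (mulf_neq0 Apos Bpos)); rewrite -h e -/core_b0 -/core_b; by field.
Qed.

(** Comes from the product identity for - p: its odd series is [odds p (- c)], which belongs to
    omega_2 and, by [core_t_odds], to t at x + 1/2. *)
Lemma core_shift x : core_a * core_t (x + 2^-1) * (1 - core_b * core_t x) = 1 - core_a * core_t x.
Proof.
have [h|h] := eqVneq (sin (pi * x)) 0.
  have c1 : c x = 1 by apply/eqP; move: (cos_neq1 x); rewrite h eqxx /= => /negbFE.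
  have := core_t_odds (x + 2^-1); rewrite cos_half c1 -/core_b0 -/core_b => e.
  have -> : core_t x = 0 by rewrite /core_t h expr0n mul0r.
  rewrite !mulr0 !subr0 mulr1; apply: (mulIf Bpos); rewrite mul1r [RHS]e; ring.
have p0 : - p != 0 by case/andP: p01 => h1 _; rewrite oppr_eq0 gt_eqF.
have p1' : -1 < - p < 1 by move: p1; lra.
have h1 : -1 <= c x < 1 by case/andP: (c_range x) => g1 g2; rewrite g1 lt_neqAle cos_neq1 h.
have h2 : -1 <= (-1 : R) < 1 by rewrite lexx; lra.
have := even_odd_product p0 p1' h1 h2; rewrite /= !evens_opp !odds_opp opprK -/(T0 (c x)) -/(T0 (-1)) => e.
have e1 := core_tV_T0 h; have e2 := core_t_odds (x + 2^-1); rewrite cos_half in e2.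
have ea : core_a = 4 * pi ^+ 2 * (odds p 1 - T0 (-1)) by [].
have eb : core_b = 4 * pi ^+ 2 * (odds p 1 - odds p (-1)) by [].
have t0 := core_t_gt0 h.
have k' : 4 * pi ^+ 2 != 0 :> R by rewrite gt_eqF.
move: e e1 e2 ea eb k' t0 Bpos Apos.
move: (4 * pi ^+ 2 : R) (odds p 1) (T0 (c x)) (T0 (-1)) (odds p (- c x)) (odds p (-1))
  (core_t x) (core_t (x + 2^-1)) core_a core_b => k A T Tm O' B t t' a b e e1 e2 ea eb k' t0 b' a'.
have eT : T = A - (k * t)^-1.
  apply: (mulfI k'); rewrite mulrBr; apply/eqP; rewrite -subr_eq0; apply/eqP.
  rewrite [LHS](_ : _ = - (k * (A - T)) + k * (k * t)^-1); last by ring.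
  by rewrite -e1; field; rewrite k' gt_eqF.
have eO : O' = A - a * b * t' / k by rewrite -e2; field.
have eB : B = A - b / k by rewrite eb; field.
have eTm : Tm = A - a / k by rewrite ea; field.
move: e; rewrite eT eO eB eTm => e.
have e3 : (k * b * t - k) * (1 - a * t') = k * (b - a) * t.
  apply: (mulfI (mulf_neq0 b' (invr_neq0 (mulf_neq0 (mulf_neq0 k' k') (mulf_neq0 k' (lt0r_neq0 t0)))))).
  apply/eqP; rewrite -subr_eq0; apply/eqP; move/eqP: e; rewrite -subr_eq0 => /eqP e.
  rewrite -[RHS]e; by field; rewrite k' gt_eqF.
apply: (mulfI k'); apply/eqP; rewrite -subr_eq0; apply/eqP.
move/eqP: e3; rewrite -subr_eq0 => /eqP e3; rewrite -[RHS]e3; ring.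
Qed.

Lemma core_double x : sin (pi * x) != 0 -> cos (pi * x) != 0 ->
  4 / core_t (2 * x) = (core_t x)^-1 + (core_t (x + 2^-1))^-1
    + core_a * core_b * (core_t x + core_t (x + 2^-1)).
Proof.
move=> sx cx.
have s2 : sin (pi * (2 * x)) = 2 * sin (pi * x) * cos (pi * x).
  rewrite (_ : pi * (2 * x) = pi * x + pi * x); last by move: (pi : R) => q; ring.
  by rewrite sinD; ring.
have s2n : sin (pi * (2 * x)) != 0 by rewrite s2 !mulf_neq0// pnatr_eq0.
have ss : sin (pi * (x + 2^-1)) = cos (pi * x) by rewrite mulrDr -sinDpihalf.
have c2 : c (2 * x) = 2 * c x ^+ 2 - 1.
  rewrite /c (_ : 2 * pi * (2 * x) = (2 * pi * x) *+ 2); last first.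
    by rewrite -[RHS]mulr_natl; move: (pi : R) => q; ring.
  by rewrite cos_mulr2n -mulr_natl; ring.
have hc : `|c x| <= 1 by rewrite ler_norml.
have := series_double p1 hc; rewrite odds_opp -c2 => e.
rewrite mulrDr -!core_t_odds !core_tV// ?ss// cos_half s2.
have sc : cos (pi * x) ^+ 2 = 1 - sin (pi * x) ^+ 2 by rewrite cos2sin2.
have -> : evens p (c (2 * x)) = (evens p (c x) + evens p (- c x) + odds p (c x) + odds p (- c x)) / 4.
  by rewrite e; field.
move: sx cx sc.
move: (pi : R) (sin (pi * x)) (cos (pi * x)) (evens p (c x)) (evens p (- c x)) (odds p (c x))
  (odds p (- c x)) (odds p 1) => q s co E E' O O' A s0 c0 sc.
rewrite (_ : (2 * s * co) ^+ 2 = 4 * s ^+ 2 * co ^+ 2); last by ring.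
have e2 : q ^+ 2 / s ^+ 2 + q ^+ 2 / co ^+ 2 = 4 * (q ^+ 2 / (4 * s ^+ 2 * co ^+ 2)).
  rewrite [LHS](_ : _ = q ^+ 2 * (co ^+ 2 + s ^+ 2) / (s ^+ 2 * co ^+ 2)); last by field; rewrite s0 c0.
  by rewrite {1}sc subrK; field; rewrite s0 c0.
rewrite [LHS](_ : _ = 4 * (q ^+ 2 / (4 * s ^+ 2 * co ^+ 2)) - 4 * (4 * q ^+ 2 * ((E + E' + O + O') / 4)) + 4 * (4 * q ^+ 2 * A)); last first.
  by ring.
by rewrite -e2; field; rewrite s0 c0.
Qed.

Let tu x : core_t x = sin (pi * x) ^+ 2 * core_u x. Proof. by []. Qed.

Lemma core_bt x : 0 < 1 - core_b * core_t x.
Proof. exact: (doubling_bt core_a_gt0 smooth_core_u core_u_gt0 tu core_t_half core_shift core_double). Qed.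

Lemma core_ba : core_b < core_a.
Proof. exact: (doubling_lt core_a_gt0 smooth_core_u core_u_gt0 tu core_t_half core_shift core_double). Qed.

Lemma core_ode x : derive1 core_t x ^+ 2 =
  4 * core_t x * (1 - core_a * core_t x) * (1 - core_b * core_t x).
Proof.
exact: (doubling_ode core_a_gt0 core_b_gt0 smooth_core_u core_u_gt0 core_u0 tu core_t_half core_shift core_double).
Qed.

End Core.

(** * The uniformizer *)

(* The functions wp (x + omega_k) all become Moebius functions of the uniformizer t,
   which has a double zero at the integers and vanishes nowhere else;
   1 - a t plays the same role at the half-integers. *)
Record uniformizer (R : realType) (p : R) (t u v : R -> R) (a b : R) : Prop := {
  un_a : 0 < a;
  un_ba : b < a;
  un_su : smooth u;
  un_sv : smooth v;
  un_u : forall x, 0 < u x;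
  un_v : forall x, 0 < v x;
  un_uN : forall x, u (- x) = u x;
  un_vN : forall x, v (- x) = v x;
  un_uP : forall x, u (x + 1) = u x;
  un_vP : forall x, v (x + 1) = v x;
  un_t : forall x, t x = sin (pi * x) ^+ 2 * u x;
  un_at : forall x, 1 - a * t x = cos (pi * x) ^+ 2 * v x;
  un_bt : forall x, 0 < 1 - b * t x;
  un_ode : forall x, derive1 t x ^+ 2 = 4 * t x * (1 - a * t x) * (1 - b * t x);
  un_wp0 : forall x, sin (pi * x) != 0 -> wp p 0 x = wp_e p 2 + (t x)^-1;
  un_wp1 : forall x, cos (pi * x) != 0 ->
    wp p 1 x = wp_e p 2 + a + a * (a - b) * t x / (1 - a * t x);
  un_wp2 : forall x, wp p 2 x = wp_e p 2 + a * b * t x;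
  un_wp3 : forall x, wp p 3 x = wp_e p 2 + b + b * (b - a) * t x / (1 - b * t x);
  un_e1 : wp_e p 1 = wp_e p 2 + a;
  un_e3 : wp_e p 3 = wp_e p 2 + b }.

Section Existence.
Variable R : realType.

Lemma uniformizer_at0 : exists t u v a b, uniformizer (0 : R) t u v a b.
Proof.
have p1 : -1 < (0 : R) < 1 by lra.
have [K hK] := wp_series p1.
have ev c : evens (0 : R) c = 0.
  rewrite /evens -[RHS]gsum0; congr gsum; apply/funext => n.
  by rewrite expr0n /= exprS mul0r Xr0.
have od c : odds (0 : R) c = 0.
  by rewrite -[RHS]gsum0; congr gsum; apply/funext => n; rewrite exprS mul0r Xr0.
have q0 := @pi_gt0 R.
have h0 x : sin (pi * x) != 0 -> wp (0 : R) 0 x = K + pi ^+ 2 / sin (pi * x) ^+ 2.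
  by move=> h; have [/(_ h) -> _ _] := hK x; rewrite ev mulr0 subr0.
have h2 x : wp (0 : R) 2 x = K by have [_ -> _] := hK x; rewrite oppr0 od mulr0 subr0.
have h3 x : wp (0 : R) 3 x = K by have [_ _ ->] := hK x; rewrite od mulr0 subr0.
have e2 : wp_e (0 : R) 2 = K by rewrite /wp_e h2.
have e3 : wp_e (0 : R) 3 = K by rewrite /wp_e h3.
have sh x : sin (pi * (x + 2^-1)) = cos (pi * x) :> R by exact: sin_half_shift.
have h1 x : cos (pi * x) != 0 -> wp (0 : R) 1 x = K + pi ^+ 2 / cos (pi * x) ^+ 2.
  by move=> h; rewrite wp_1 h0 sh.
have e1 : wp_e (0 : R) 1 = K + pi ^+ 2.
  by rewrite /wp_e h1 ?mulr0 cos0 ?oner_eq0// expr1n divr1.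
pose t (x : R) := sin (pi * x) ^+ 2 * (pi ^+ 2)^-1.
have qn : pi != 0 :> R by rewrite gt_eqF.
have at1 x : 1 - pi ^+ 2 * t x = cos (pi * x) ^+ 2 * 1.
  rewrite /t mulr1 cos2sin2; move: (sin (pi * x)) qn; move: (pi : R) => q s qn; by field.
exists t, (fun=> (pi ^+ 2)^-1), (fun=> 1), (pi ^+ 2), 0; split.
- by rewrite exprn_gt0.
- by rewrite exprn_gt0.
- exact: smooth_cst.
- exact: smooth_cst.
- by move=> x; rewrite invr_gt0 exprn_gt0.
- by move=> x; exact: ltr01.
- by [].
- by [].
- by [].
- by [].
- by [].
- exact: at1.
- by move=> x; rewrite mul0r subr0.
- move=> x; rewrite mul0r subr0 mulr1 -mulrA at1 mulr1.
  have d := isdM (isdX 2 (isd_sin_lin pi x)) (isdC (pi ^+ 2)^-1 x).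
  rewrite (isd_derive1 d) /= /t expr1; move: (sin (pi * x)) (cos (pi * x)) qn; move: (pi : R) => q s c qn.
  by field.
- move=> x h; rewrite h0// e2 /t; move: (sin (pi * x)) h qn; move: (pi : R) => q s h qn.
  by field; rewrite h qn.
- move=> x h; rewrite h1// e2 subr0 at1 mulr1 /t.
  have := cos2sin2 (pi * x); move: (sin (pi * x)) (cos (pi * x)) h qn; move: (pi : R) => q s c h qn e.
  have e' : 1 = s ^+ 2 + c ^+ 2 by rewrite e; ring.
  rewrite [LHS](_ : _ = K + q ^+ 2 * 1 / c ^+ 2); last by rewrite mulr1.
  by rewrite e'; field; rewrite h qn.
- by move=> x; rewrite h2 e2 mulr0 mul0r addr0.
- by move=> x; rewrite h3 e2 !mul0r !addr0.
- by rewrite e1 e2.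
- by rewrite e3 e2 addr0.
Qed.

Variable p : R.

Section Positive.
Hypothesis p01 : 0 < p < 1.
Local Notation a := (core_a p).
Local Notation b := (core_b p).
Local Notation T := (core_t p).
Local Notation c x := (cos (2 * pi * x)).

Let at0 x : 1 - a * T x = cos (pi * x) ^+ 2 * (a * (1 - b * T x) * core_u p (x + 2^-1)).
Proof.
by rewrite -(core_shift p01) /core_t (sin_half_shift x); ring.
Qed.

Let sT : smooth T.
Proof. by apply: smoothM; [apply: smoothX; exact: smooth_sin|exact: smooth_core_u]. Qed.

Let su' : smooth (fun x => core_u p (x + 2^-1)).
Proof. by apply: smooth_shift; exact: smooth_core_u. Qed.

Let TN x : T (- x) = T x.
Proof. by rewrite /core_t core_uN mulrN sinN sqrrN. Qed.

Let TP x : T (x + 1) = T x.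
Proof. by rewrite /core_t core_u_per sin2_per. Qed.

Let uN' x : core_u p (- x + 2^-1) = core_u p (x + 2^-1).
Proof.
rewrite -core_uN -(core_u_per p (- (- x + 2^-1))).
by congr core_u; field.
Qed.

Let uP' x : core_u p (x + 1 + 2^-1) = core_u p (x + 2^-1).
Proof. by rewrite addrAC core_u_per. Qed.

Let smoothbt : smooth (fun x => 1 - b * T x).
Proof. by apply: smoothB; [exact: smooth_cst|apply: smoothZ]. Qed.

Let a0 := core_a_gt0 p01.
Let b0 := core_b_gt0 p01.

Let Cs x : cos (pi * x) != 0 -> 0 < 1 - a * T x.
Proof.
move=> h; rewrite at0; apply: mulr_gt0; first by rewrite exprn_even_gt0.
by apply: mulr_gt0; [apply: mulr_gt0 => //; exact: core_bt|exact: core_u_gt0].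
Qed.

Let shift x : T (x + 2^-1) = (1 - a * T x) / (a * (1 - b * T x)).
Proof.
have h := core_bt p01 x; rewrite -(core_shift p01); field.
by rewrite !gt_eqF.
Qed.

Let c0 : cos (2 * pi * 0) = 1 :> R. Proof. by rewrite mulr0 cos0. Qed.
Let sh x : sin (pi * (x + 2^-1)) = cos (pi * x) :> R. Proof. exact: sin_half_shift. Qed.
Let T0 : T 0 = 0. Proof. by rewrite /core_t mulr0 sin0 expr0n mul0r. Qed.

Let odds_T x K : K - 4 * pi ^+ 2 * odds p (c x) = K - 4 * pi ^+ 2 * odds p 1 + a * b * T x.
Proof. by rewrite -(core_t_odds p01); ring. Qed.

Let odds_TN x K : K - 4 * pi ^+ 2 * odds p (- c x) =
  K - 4 * pi ^+ 2 * odds p 1 + b * (1 - a * T x) / (1 - b * T x).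
Proof.
have h := core_bt p01 x; have := core_t_odds p01 (x + 2^-1); rewrite cos_half => e.
rewrite (_ : K - _ = K - 4 * pi ^+ 2 * odds p 1 + 4 * pi ^+ 2 * (odds p 1 - odds p (- c x))).
  by rewrite e shift; congr (_ + _); field; rewrite !gt_eqF.
by ring.
Qed.

(** Passing from p to - p exchanges omega_2 and omega_3 modulo the lattice, so [core_t], based at
    e_3 for p, is already based at e_2 for - p. *)
Lemma uniformizer_of_core_neg : exists t u v a b, uniformizer (- p) t u v a b.
Proof.
have p1 : -1 < - p < 1 by case/andP: p01 => *; apply/andP; split; lra.
have [K hK] := wp_series p1.
have h2 x : wp (- p) 2 x = K - 4 * pi ^+ 2 * odds p 1 + a * b * T x.
  by have [_ -> _] := hK x; rewrite opprK -odds_T.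
have e2 : wp_e (- p) 2 = K - 4 * pi ^+ 2 * odds p 1 by rewrite /wp_e h2 T0 mulr0 addr0.
have h3 x : wp (- p) 3 x = wp_e (- p) 2 + b * (1 - a * T x) / (1 - b * T x).
  by have [_ _ ->] := hK x; rewrite odds_opp odds_TN e2.
have h0 x : sin (pi * x) != 0 -> wp (- p) 0 x = wp_e (- p) 2 + (T x)^-1.
  move=> h; have [/(_ h) -> _ _] := hK x; rewrite e2 core_tV// evens_opp.
  by move: (pi ^+ 2 / sin (pi * x) ^+ 2); move: (pi : R) => q r; ring.
have h1 x : cos (pi * x) != 0 ->
   wp (- p) 1 x = wp_e (- p) 2 + a + a * (a - b) * T x / (1 - a * T x).
  move=> h; rewrite wp_1 h0 ?sh// shift; have := Cs h; have := core_bt p01 x; move=> g1 g2.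
  by field; rewrite !gt_eqF.
have e1 : wp_e (- p) 1 = wp_e (- p) 2 + a.
  by rewrite /wp_e h1 ?mulr0 ?cos0 ?oner_eq0// T0 mulr0 mul0r addr0.
exists T, (core_u p),
  (fun x => a * (1 - b * T x) * core_u p (x + 2^-1)), a, b; split.
- exact: a0.
- exact: core_ba.
- exact: smooth_core_u.
- by apply: smoothM; [apply: smoothZ; exact: smoothbt|exact: su'].
- exact: core_u_gt0.
- by move=> x; apply: mulr_gt0; [apply: mulr_gt0 => //; exact: core_bt|exact: core_u_gt0].
- exact: core_uN.
- by move=> x; rewrite TN uN'.
- exact: core_u_per.
- by move=> x; rewrite TP uP'.
- by move=> x; rewrite /core_t.
- exact: at0.
- exact: core_bt.
- exact: core_ode.
- exact: h0.
- exact: h1.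
- by move=> x; rewrite h2 e2.
- by move=> x; rewrite h3; have h := core_bt p01 x; field; rewrite gt_eqF.
- exact: e1.
- by rewrite /wp_e h3 T0 !mulr0 !subr0 divr1 mulr1 -/(wp_e (- p) 2).
Qed.

(** Here the base point has to move from e_3 to e_2: if T = 1 / (wp - e_3) and b = e_2 - e_3, then T
    / (1 - b T) = 1 / (wp - e_2), and (a, b) becomes (a - b, - b). *)
Lemma uniformizer_of_core_pos : exists t u v a b, uniformizer p t u v a b.
Proof.
have p1 : -1 < p < 1 by case/andP: p01 => *; apply/andP; split; lra.
have [K hK] := wp_series p1.
pose e3 := K - 4 * pi ^+ 2 * odds p 1.
have h3 x : wp p 3 x = e3 + a * b * T x by have [_ _ ->] := hK x; rewrite odds_T.
have e3E : wp_e p 3 = e3 by rewrite /wp_e h3 T0 mulr0 addr0.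
have h2' x : wp p 2 x = e3 + b * (1 - a * T x) / (1 - b * T x).
  by have [_ -> _] := hK x; rewrite odds_opp odds_TN.
have e2 : wp_e p 2 = e3 + b by rewrite /wp_e h2' T0 !mulr0 !subr0 mulr1 divr1.
have h0' x : sin (pi * x) != 0 -> wp p 0 x = e3 + (T x)^-1.
  move=> h; have [/(_ h) -> _ _] := hK x; rewrite core_tV// /e3.
  by move: (pi ^+ 2 / sin (pi * x) ^+ 2); move: (pi : R) => q r; ring.
have h1' x : cos (pi * x) != 0 -> wp p 1 x = e3 + a * (1 - b * T x) / (1 - a * T x).
  move=> h; rewrite wp_1 h0' ?sh// shift; have := Cs h; have := core_bt p01 x; move=> g1 g2.
  by field; rewrite !gt_eqF.
have e1 : wp_e p 1 = e3 + a.
  by rewrite /wp_e h1' ?mulr0 ?cos0 ?oner_eq0// T0 !mulr0 subr0 divr1 mulr1.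
pose t x := T x / (1 - b * T x).
have bt x := core_bt p01 x.
have bn x : 1 - b * T x != 0 by rewrite gt_eqF.
have ba := core_ba p01.
have at1 x : 1 - (a - b) * t x = (1 - a * T x) / (1 - b * T x).
  by rewrite /t; move: (bn x) => h; field.
have bt1 x : 1 - - b * t x = (1 - b * T x)^-1.
  by rewrite /t; move: (bn x) => h; field.
exists t, (fun x => core_u p x * (1 - b * T x)^-1),
  (fun x => a * core_u p (x + 2^-1)), (a - b), (- b); split.
- by rewrite subr_gt0.
- by move: a0 ba; move: b0; lra.
- by apply: smoothM; [exact: smooth_core_u|apply: smoothV; [exact: bt|exact: smoothbt]].
- by apply: smoothZ; exact: su'.
- by move=> x; apply: mulr_gt0; [exact: core_u_gt0|rewrite invr_gt0].
- by move=> x; apply: mulr_gt0; [exact: a0|exact: core_u_gt0].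
- by move=> x; rewrite core_uN TN.
- by move=> x; rewrite uN'.
- by move=> x; rewrite core_u_per TP.
- by move=> x; rewrite uP'.
- by move=> x; rewrite /t /core_t -mulrA.
- by move=> x; rewrite at1 at0; move: (bn x) => h; field.
- by move=> x; rewrite bt1 invr_gt0.
- move=> x; rewrite -mulrA -mulrA at1 bt1.
  have d1 := smooth_isd x sT; have ode := core_ode p01 x.
  have d := isdM d1 (isdV (f := fun y => 1 - b * T y) (bn x) (isdB (isdC 1 x) (isdM (isdC b x) d1))).
  rewrite (isd_derive1 d) /t; move: (bn x) => h.
  rewrite [X in X ^+ 2](_ : _ = derive1 T x / (1 - b * T x) ^+ 2); last by field.
  by rewrite expr_div_n ode; field.
- move=> x h; rewrite (h0' x h) e2 /t; have tp := core_t_gt0 p01 h; move: (T x) tp (bn x) => y y0 z0.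
  by field; rewrite z0 gt_eqF.
- move=> x h; rewrite h1'// e2 at1 /t; have := Cs h; move: (bn x) => h4 h5.
  by field; rewrite h4 gt_eqF.
- by move=> x; rewrite h2' e2 /t; move: (bn x) => h; field.
- by move=> x; rewrite h3 e2 bt1 invrK /t; move: (bn x) => h; field.
- by rewrite e1 e2; ring.
- by rewrite e3E e2; ring.
Qed.

End Positive.
End Existence.

Lemma uniformizer_exists (R : realType) (p : R) : -1 < p < 1 ->
  exists t u v a b, uniformizer p t u v a b.
Proof.
case/andP => h1 h2; have [h|h|->] := ltgtP p 0; last exact: uniformizer_at0.
- by rewrite -(opprK p); apply: uniformizer_of_core_neg; apply/andP; split; lra.
- by apply: uniformizer_of_core_pos; rewrite h.
Qed.

(** * Integrals of continuous functions *)

Section Integrals.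
Variable R : realType.
Implicit Types (f g F : R -> R) (a b c x k : R).
Local Notation mu := (@lebesgue_measure R).

Definition J a b f : R := \int[mu]_(x in `[a, b]) f x.

Lemma contD f g : continuous f -> continuous g -> continuous (fun x => f x + g x).
Proof. by move=> cf cg x; apply: cvgD; [exact: cf|exact: cg]. Qed.
Lemma contM f g : continuous f -> continuous g -> continuous (fun x => f x * g x).
Proof. by move=> cf cg x; apply: cvgM; [exact: cf|exact: cg]. Qed.
Lemma contN f : continuous f -> continuous (fun x => - f x).
Proof. by move=> cf x; apply: cvgN; exact: cf. Qed.
Lemma contB f g : continuous f -> continuous g -> continuous (fun x => f x - g x).
Proof. by move=> cf cg; apply: contD => //; exact: contN. Qed.
Lemma contC k : continuous (fun _ : R => k).
Proof. by move=> x; exact: cvg_cst. Qed.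
Lemma contZ k f : continuous f -> continuous (fun x => k * f x).
Proof. by move=> cf; apply: contM => //; exact: contC. Qed.
Lemma cont_ext f g : f =1 g -> continuous f -> continuous g.
Proof. by move=> /funext ->. Qed.
Lemma contX f n : continuous f -> continuous (fun x => f x ^+ n).
Proof.
move=> cf; elim: n => [|n IH].
  by apply: (cont_ext (f := fun=> 1)) => [x /=|]; [rewrite expr0|exact: contC].
by apply: (cont_ext (f := fun x => f x * f x ^+ n)) => [x /=|]; [rewrite exprS|exact: contM].
Qed.

Lemma cont_sum n (F : 'I_n -> R -> R) : (forall i, continuous (F i)) ->
  continuous (fun x => \sum_(i < n) F i x).
Proof.
elim: n F => [|n IH] F cF.
  by apply: (cont_ext (f := fun=> 0)) => [x /=|]; [rewrite big_ord0|exact: contC].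
apply: (cont_ext (f := fun x => F ord0 x + \sum_(i < n) F (lift ord0 i) x)) => [x /=|].
  by rewrite big_ord_recl.
by apply: contD => //; apply: IH.
Qed.

Lemma contW f a b : continuous f -> {within `[a, b], continuous f}.
Proof. exact: continuous_subspaceT. Qed.

Lemma itv_cont f a b : (forall x, a <= x <= b -> {for x, continuous f}) -> {within `[a, b], continuous f}.
Proof.
by move=> h; apply: continuous_in_subspaceT => x; rewrite inE/= in_itv/=; exact: h.
Qed.

Lemma J_integrable f a b : {within `[a, b], continuous f} -> mu.-integrable `[a, b] (EFin \o f).
Proof.
by move=> cf; apply: continuous_compact_integrable => //; exact: segment_compact.
Qed.

Lemma J_FTC a b f F : a <= b -> (forall x, a <= x <= b -> {for x, continuous F}) ->
  (forall x, a < x < b -> der x F (f x)) -> {within `[a, b], continuous f} -> J a b f = F b - F a.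
Proof.
rewrite le_eqVlt => /predU1P[<- _ _ _|ab cF dF cf].
  by rewrite /J set_itv1 Rintegral_set1 subrr.
rewrite /J /Rintegral (continuous_FTC2 ab cf (F := F)) //.
  split.
  - by move=> x; rewrite in_itv/= => h; apply: isd_derivable (dF _ h).
  - by apply: cvg_at_right_filter; apply: cF; rewrite lexx ltW.
  - by apply: cvg_at_left_filter; apply: cF; rewrite lexx ltW.
by move=> x; rewrite in_itv/= => h; exact: (isd_derive1 (dF _ h)).
Qed.

Lemma primitive f a b : continuous f -> exists F, forall x, a <= x <= b -> der x F (f x).
Proof.
move=> cf; exists (fun y => \int[mu]_(t in `[a - 1, y]) f t) => x /andP[ax xb].
have [] := @continuous_FTC1_closed _ f (a - 1) x (b + 1) _ _ _ (cf x).
- by lra.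
- by apply: J_integrable; exact: contW.
- by lra.
- by move=> dF dE; have := derivable_isd dF; rewrite dE.
Qed.

Lemma J_prim a b f F : continuous f -> a <= b -> (forall x, a <= x <= b -> der x F (f x)) ->
  J a b f = F b - F a.
Proof.
move=> cf ab dF; apply: J_FTC => //.
- by move=> x h; apply: isd_cont (dF _ h).
- by move=> x /andP[h1 h2]; apply: dF; rewrite !ltW.
- exact: contW.
Qed.

Lemma JD a b f g : {within `[a, b], continuous f} -> {within `[a, b], continuous g} ->
  J a b (fun x => f x + g x) = J a b f + J a b g.
Proof. by move=> cf cg; apply: RintegralD => //; exact: J_integrable. Qed.

Lemma JB a b f g : {within `[a, b], continuous f} -> {within `[a, b], continuous g} ->
  J a b (fun x => f x - g x) = J a b f - J a b g.
Proof. by move=> cf cg; apply: RintegralB => //; exact: J_integrable. Qed.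

Lemma JZ a b k f : {within `[a, b], continuous f} -> J a b (fun x => k * f x) = k * J a b f.
Proof. by move=> cf; apply: RintegralZl => //; exact: J_integrable. Qed.

Lemma eq_J a b f g : (forall x, a <= x <= b -> f x = g x) -> J a b f = J a b g.
Proof. by move=> h; apply: eq_Rintegral => x; rewrite inE/= in_itv/=; exact: h. Qed.

Lemma J_le a b f g : {within `[a, b], continuous f} -> {within `[a, b], continuous g} ->
  (forall x, a <= x <= b -> f x <= g x) -> J a b f <= J a b g.
Proof. by move=> cf cg h; apply: le_Rintegral => //; exact: J_integrable. Qed.

Lemma J_ge0 a b f : (forall x, a <= x <= b -> 0 <= f x) -> 0 <= J a b f.
Proof. by move=> h; apply: Rintegral_ge0 => x /=; rewrite in_itv/=; exact: h. Qed.

Lemma J_abs a b f : {within `[a, b], continuous f} -> `|J a b f| <= J a b (fun x => `|f x|).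
Proof. by move=> cf; apply: le_normr_Rintegral => //; exact: J_integrable. Qed.

Lemma J_sum a b n (F : 'I_n -> R -> R) : (forall i, continuous (F i)) ->
  J a b (fun x => \sum_(i < n) F i x) = \sum_(i < n) J a b (F i).
Proof.
move=> cF; elim: n F cF => [|n IH] F cF.
  rewrite big_ord0 (_ : (fun x => _) = (fun=> 0 * 0)); first by rewrite JZ ?mul0r//; exact/contW/contC.
  by apply/funext => x; rewrite big_ord0 mul0r.
rewrite big_ord_recl -IH // -JD; last 2 first.
- exact: contW.
- by apply: contW; apply: cont_sum => i; exact: cF.
by apply: eq_J => x _; rewrite big_ord_recl.
Qed.

Lemma J_cat a b c f : continuous f -> a <= b -> b <= c -> J a b f + J b c f = J a c f.
Proof.
move=> cf ab bc; have [F dF] := primitive a c cf.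
rewrite !(J_prim (F := F))//; first ring.
- exact: le_trans bc.
- by move=> x /andP[h1 h2]; apply: dF; rewrite h2 (le_trans ab).
- by move=> x /andP[h1 h2]; apply: dF; rewrite h1 (le_trans h2).
Qed.

(** Transfers bounds to [0, h] from compact subintervals, the only place where integrands divided by
    the weight G can be handled. *)
Lemma J_exhaust h k f : 0 < h -> continuous f -> (forall a b, 0 < a -> a < b -> b < h -> J a b f <= k) ->
  J 0 h f <= k.
Proof.
move=> h0 cf hk; have [F dF] := primitive 0 h cf.
rewrite (J_prim (F := F))// ?(ltW h0)//.
rewrite leNgt; apply/negP => hlt.
pose e := (F h - F 0 - k) / 3.
have e0 : 0 < e by rewrite divr_gt0// subr_gt0.
have c0 : {for 0, continuous F} by apply: isd_cont (dF _ _); rewrite lexx ltW.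
have ch : {for h, continuous F} by apply: isd_cont (dF _ _); rewrite lexx ltW.
move/cvgrPdist_lt/(_ _ e0)/nbhs_ballP : c0 => [d /= d0 hd].
move/cvgrPdist_lt/(_ _ e0)/nbhs_ballP : ch => [d' /= d0' hd'].
pose r := Num.min (Num.min d d') h / 3.
have r0 : 0 < r by rewrite divr_gt0// !lt_min d0 d0' h0.
have r1 : r < d by rewrite ltr_pdivrMr//; apply: (@le_lt_trans _ _ d); [rewrite !ge_min lexx|lra].
have r2 : r < d'.
  by rewrite ltr_pdivrMr//; apply: (@le_lt_trans _ _ d'); [rewrite !ge_min lexx orbT|lra].
have r3 : r <= h / 3 by rewrite ler_pM2r// ge_min lexx orbT.
have := hd r; rewrite /ball /= sub0r normrN (ger0_norm (ltW r0)) => /(_ r1) g1.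
have := hd' (h - r); rewrite /ball /= opprB addrC subrK (ger0_norm (ltW r0)) => /(_ r2) g2.
have hr : r < h - r by lra.
have hr2 : h - r < h by lra.
have := hk r (h - r) r0 hr hr2; rewrite (J_prim (F := F))// ?(ltW hr)//; last first.
  by move=> x /andP[y1 y2]; apply: dF; apply/andP; split; lra.
move: g1 g2; rewrite !ltr_norml /e => /andP[g1 _] /andP[_ g2]; move: g1 g2 hlt.
move: (F 0) (F r) (F h) (F (h - r)) => A B C D; lra.
Qed.

Lemma J_eq0 a b f : continuous f -> (forall x, a <= x <= b -> 0 <= f x) -> J a b f = 0 ->
  forall x, a < x < b -> f x = 0.
Proof.
move=> cf f0 Jf x /andP[ax xb]; have ab := ltW (lt_trans ax xb).
have [F dF] := primitive a b cf.
have mono y z : a <= y -> y <= z -> z <= b -> F y <= F z.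
  move=> ay yz zb; rewrite -subr_ge0 -(J_prim (f := f))//.
    by apply: J_ge0 => w /andP[h1 h2]; apply: f0; rewrite (le_trans ay)//= (le_trans h2).
  by move=> w /andP[h1 h2]; apply: dF; rewrite (le_trans ay)//= (le_trans h2).
have e : F b = F a by apply/eqP; rewrite -subr_eq0 -(J_prim cf ab dF) Jf.
have cst y : a <= y <= b -> F y = F a.
  move=> /andP[h1 h2]; apply/eqP; rewrite eq_le (mono _ _ (lexx a) h1 h2) andbT -e.
  exact: mono.
have d1 : der x F (f x) by apply: dF; rewrite !ltW.
have d2 : der x F 0.
  apply: (@isd_near _ (fun=> F a)); last exact: isdC.
  near=> y; rewrite cst//; apply/andP; split; apply: ltW; near: y.
    exact: lt_nbhsr.
  exact: lt_nbhsl.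
exact: (isd_uniq d1 d2).
Unshelve. all: by end_near. Qed.

(* Off a finite set the derivative is nonnegative; continuity bridges the exceptional points. *)
Lemma nondecreasing_off (s : seq R) F f a b : a <= b ->
  (forall x, a <= x <= b -> {for x, continuous F}) ->
  (forall x, a < x < b -> x \notin s -> der x F (f x) /\ 0 <= f x) -> F a <= F b.
Proof.
elim: s a b => [|z s IH] a b ab cF dF.
  move: ab; rewrite le_eqVlt => /predU1P[->//|ab].
  have := @ger0_derive1_le_cc _ F a b; apply.
  - by move=> x; rewrite in_itv/= => h; have [d _] := dF x h isT; exact: isd_derivable d.
  - by move=> x; rewrite in_itv/= => h; have [d f0] := dF x h isT; rewrite (isd_derive1 d).
  - exact: itv_cont.
  - by rewrite in_itv/= lexx ltW.
  - by rewrite in_itv/= lexx ltW.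
  - exact: ltW.
have [/andP[az zb]|zn] := boolP (a < z < b).
  apply: (@le_trans _ _ (F z)); apply: IH; rewrite ?ltW//.
  - by move=> x /andP[h1 h2]; apply: cF; rewrite h1 (le_trans h2) ?ltW.
  - move=> x /andP[h1 h2] xs; apply: dF; first by rewrite h1 (lt_trans h2).
    by rewrite inE negb_or xs andbT lt_eqF.
  - by move=> x /andP[h1 h2]; apply: cF; rewrite h2 andbT (le_trans _ h1) ?ltW.
  - move=> x /andP[h1 h2] xs; apply: dF; first by rewrite h2 andbT (lt_trans az).
    by rewrite inE negb_or xs andbT gt_eqF.
apply: IH => // x h xs; apply: dF => //; rewrite inE negb_or xs andbT.
by apply: contraNneq zn => <-.
Qed.

End Integrals.

(** * The singular Sturm-Liouville operator *)

Section Linear.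
Variable R : realType.
Implicit Types f w phi : R -> R.

Lemma derive1B f w : smooth f -> smooth w ->
  derive1 (fun x => f x - w x) = fun x => derive1 f x - derive1 w x.
Proof. by move=> sf sw; apply/funext => x; apply: isd_derive1; apply: isdB; exact: smooth_isd. Qed.

Lemma derive1Z f (c : R) : smooth f -> derive1 (fun x => c * f x) = fun x => c * derive1 f x.
Proof.
move=> sf; apply/funext => x; apply: isd_derive1.
by apply: isd_eq (isdM (isdC c x) (smooth_isd x sf)) _; rewrite mul0r add0r.
Qed.

Lemma lin_approx f z d e : der z f d -> 0 < e ->
  \forall x \near z, `|f x - f z - d * (x - z)| <= e * `|x - z|.
Proof.
move=> df e0.
have h : (fun t => t^-1 *: (f (t *: 1 + z) - f z)) @ 0^' --> d.
  have dv := isd_derivable df; have e1 := isd_derive1 df.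
  by rewrite -e1 derive1E; exact: dv.
move/cvgrPdist_le/(_ _ e0)/nbhs_ballP : h => [r /= r0 hr].
apply/nbhs_ballP; exists r => //= x; rewrite /ball /= distrC => xr.
have [->|xz] := eqVneq x z; first by rewrite !subrr mulr0 subrr !normr0 mulr0.
have xz0 : x - z != 0 by rewrite subr_eq0.
have := hr (x - z); rewrite /ball /= sub0r normrN => /(_ xr xz0).
rewrite [_ *: 1](_ : _ = x - z); last by rewrite /GRing.scale /= mulr1.
rewrite subrK /GRing.scale /= => h.
rewrite (_ : f x - f z - d * (x - z) = - ((d - (x - z)^-1 * (f x - f z)) * (x - z))); last by field.
by rewrite normrN normrM ler_wpM2r.
Qed.

(** At a simple zero of phi which is also a zero of w, the quotient w / phi stays bounded while W
    tends to 0. *)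
Lemma cont_quotient w phi (W : R -> R) z d d' : der z w d -> der z phi d' -> d' != 0 ->
  w z = 0 -> phi z = 0 -> {for z, continuous W} -> W z = 0 ->
  {for z, continuous (fun x => w x * W x / phi x)}.
Proof.
move=> dw dp d0 w0 p0 cW W0.
have e0 : 0 < `|d'| / 2 by rewrite divr_gt0// normr_gt0.
have h1 := lin_approx dp e0; have h2 := lin_approx dw (ltr01).
apply/cvgrPdist_le => e ep.
pose M := (`|d| + 1) / (`|d'| / 2).
have M0 : 0 < M by rewrite divr_gt0// ltr_wpDl.
have e1 : 0 < e / M by rewrite divr_gt0.
move/cvgrPdist_le/(_ _ e1) : cW => h3; near=> x.
rewrite /= w0 !mul0r sub0r normrN.
have [->|xz] := eqVneq x z; first by rewrite w0 !mul0r normr0 ltW.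
have b1 : `|phi x - phi z - d' * (x - z)| <= `|d'| / 2 * `|x - z| by near: x.
have b2 : `|w x - w z - d * (x - z)| <= 1 * `|x - z| by near: x.
have b3 : `|W z - W x| <= e / M by near: x.
rewrite W0 sub0r normrN in b3; rewrite p0 subr0 in b1; rewrite w0 subr0 mul1r in b2.
have n0 : 0 < `|x - z| by rewrite normr_gt0 subr_eq0.
have l1 : `|d'| / 2 * `|x - z| <= `|phi x|.
  have h := ler_normD (d' * (x - z) - phi x) (phi x).
  rewrite subrK normrM (distrC (d' * (x - z)) (phi x)) in h.
  by move: h b1; move: `|_ - _| `|phi x| `|d'| `|x - z| => A B C D h b1; lra.
have l2 : `|w x| <= (`|d| + 1) * `|x - z|.
  have := ler_normD (w x - d * (x - z)) (d * (x - z)); rewrite subrK normrM => h.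
  by apply: (le_trans h); rewrite mulrDl mul1r addrC lerD2l.
have p1 : 0 < `|phi x| by apply: lt_le_trans l1; rewrite mulr_gt0.
rewrite !normrM normfV ler_pdivrMr//.
apply: (@le_trans _ _ (((`|d| + 1) * `|x - z|) * (e / M))); first by apply: ler_pM.
rewrite [leLHS](_ : _ = e * (`|d'| / 2 * `|x - z|)); last first.
  have n1 : `|d| + 1 != 0 by rewrite gt_eqF// ltr_wpDl.
  by rewrite /M; field; rewrite n1 normr_eq0 d0.
by rewrite ler_wpM2l// ltW.
Unshelve. all: by end_near. Qed.

End Linear.

Section SturmLiouville.
Variables (R : realType) (h : R) (G G1 q : R -> R).
Hypotheses (h0 : 0 < h) (cG : continuous G) (cG1 : continuous G1) (cq : continuous q)
  (G_gt0 : forall x, 0 < x < h -> 0 < G x) (G0 : G 0 = 0) (Gh : G h = 0)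
  (dG : forall x, 0 < x < h -> der x G (G1 x)).
Implicit Types u v w : R -> R.

(* G times the operator w |-> - G^-1 (G w')' + q w *)
Definition K w (x : R) : R :=
  - (G1 x * derive1 w x) - G x * derive1 (derive1 w) x + G x * q x * w x.

Lemma G_ge0 x : 0 <= x <= h -> 0 <= G x.
Proof.
case/andP; rewrite le_eqVlt => /predU1P[<- _|x0]; first by rewrite G0.
rewrite le_eqVlt => /predU1P[->|xh]; first by rewrite Gh.
by apply: ltW; apply: G_gt0; rewrite x0.
Qed.

Lemma cont_K w : smooth w -> continuous (K w).
Proof.
move=> sw; have c0 := smooth_cont sw; have c1 := smooth_cont (smooth_derive1 sw).
have c2 := smooth_cont (smooth_derive1 (smooth_derive1 sw)).
apply: contD; last by apply: contM => //; exact: contM.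
by apply: contB; [apply: contN|]; exact: contM.
Qed.

Lemma KB u v : smooth u -> smooth v -> K (fun x => u x - v x) = fun x => K u x - K v x.
Proof.
move=> su sv; apply/funext => x; rewrite /K (derive1B su sv) (derive1B (smooth_derive1 su) (smooth_derive1 sv)).
move: (derive1 u x) (derive1 v x) (derive1 (derive1 u) x) (derive1 (derive1 v) x) => a b c d.
ring.
Qed.

Lemma KZ (c : R) u : smooth u -> K (fun x => c * u x) = fun x => c * K u x.
Proof.
move=> su; apply/funext => x; rewrite /K (derive1Z c su) (derive1Z c (smooth_derive1 su)); ring.
Qed.

Lemma dGw w x : smooth w -> 0 < x < h ->
  der x (fun y => G y * derive1 w y) (G x * q x * w x - K w x).
Proof.
move=> sw hx; apply: isd_eq (isdM (dG hx) (smooth_isd x (smooth_derive1 sw))) _.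
by rewrite /K; ring.
Qed.

Definition wronskian u v x := G x * (u x * derive1 v x - derive1 u x * v x).

Lemma cont_wronskian u v : smooth u -> smooth v -> continuous (wronskian u v).
Proof.
move=> su sv; have c0 := smooth_cont su; have c1 := smooth_cont (smooth_derive1 su).
have c2 := smooth_cont sv; have c3 := smooth_cont (smooth_derive1 sv).
by apply: contM => //; apply: contB; exact: contM.
Qed.

Lemma d_wronskian u v x : smooth u -> smooth v -> 0 < x < h ->
  der x (wronskian u v) (K u x * v x - u x * K v x).
Proof.
move=> su sv hx.
have d := isdB (isdM (smooth_isd x su) (dGw sv hx)) (isdM (dGw su hx) (smooth_isd x sv)).
rewrite (_ : wronskian u v = (fun t => u t * (G t * derive1 v t) - G t * derive1 u t * v t)).
  by apply: isd_eq d _; ring.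
by apply/funext => y; rewrite /wronskian; ring.
Qed.

(** G vanishes at 0 while u and v are smooth there, so the only boundary term is the one at x. *)
Lemma green u v x : smooth u -> smooth v -> 0 <= x <= h ->
  J 0 x (fun y => K u y * v y - u y * K v y) = wronskian u v x.
Proof.
move=> su sv /andP[x0 xh]; rewrite (J_FTC (F := wronskian u v))//.
- by rewrite /wronskian G0 mul0r subr0.
- by move=> y _; exact: cont_wronskian.
- by move=> y /andP[y0 yx]; apply: d_wronskian => //; rewrite y0 (lt_le_trans yx).
- by apply: contW; apply: contB; apply: contM; try exact: cont_K; exact: smooth_cont.
Qed.

Lemma green_sym u v : smooth u -> smooth v ->
  J 0 h (fun y => K u y * v y) = J 0 h (fun y => u y * K v y).
Proof.
move=> su sv; apply/eqP; rewrite -subr_eq0 -JB.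
- by rewrite green// ?lexx ?ltW// /wronskian Gh mul0r.
- by apply: contW; apply: contM; [exact: cont_K|exact: smooth_cont].
- by apply: contW; apply: contM; [exact: smooth_cont|exact: cont_K].
Qed.

(* Picone: (K w - E G w) w = G phi^2 ((w / phi)')^2 - Psi' with Psi = w G (w' - w phi' / phi),
   and Psi extends continuously by 0 to the zeros of phi. *)
Lemma picone (s : seq R) (E : R) phi w : smooth phi -> smooth w ->
  (forall x, 0 < x < h -> K phi x = E * G x * phi x) ->
  (forall x, 0 <= x <= h -> x \notin s -> phi x != 0) ->
  (forall z, z \in s -> [/\ phi z = 0, derive1 phi z != 0 & w z = 0]) ->
  0 <= J 0 h (fun x => (K w x - E * G x * w x) * w x).
Proof.
move=> sp sw eig nz zs.
have cw := smooth_cont sw; have cp := smooth_cont sp.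
have cI : continuous (fun x => (K w x - E * G x * w x) * w x).
  by apply: contM => //; apply: contB; [exact: cont_K|apply: contM => //; exact: contZ].
have [F dF] := primitive 0 h cI.
rewrite (J_prim cI (ltW h0) dF) subr_ge0.
pose W := wronskian phi w.
pose Psi x := w x * W x / phi x.
have -> : F 0 = F 0 + Psi 0 by rewrite /Psi /W /wronskian G0 mul0r mulr0 mul0r addr0.
have -> : F h = F h + Psi h by rewrite /Psi /W /wronskian Gh mul0r mulr0 mul0r addr0.
pose f x := G x * ((phi x * derive1 w x - derive1 phi x * w x) / phi x) ^+ 2.
apply: (@nondecreasing_off _ s (fun x => F x + Psi x) f); first exact: ltW.
  move=> x hx; apply: cvgD; first exact: isd_cont (dF _ hx).
  have [xs|xs] := boolP (x \in s).
    have [p0 d0 w0] := zs _ xs.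
    have W0 : W x = 0 by rewrite /W /wronskian p0 w0 mul0r mulr0 subrr mulr0.
    apply: cont_quotient (smooth_isd x sw) (smooth_isd x sp) d0 w0 p0 _ W0.
    exact: cont_wronskian.
  apply: cvgM; first by apply: cvgM; [exact: cw|exact: cont_wronskian].
  by apply: cvgV; [exact: nz|exact: cp].
move=> x hx xs.
have hx' : 0 <= x <= h by case/andP: hx => *; rewrite !ltW.
have p0 := nz _ hx' xs.
split; last by apply: mulr_ge0; [exact: G_ge0|exact: sqr_ge0].
have d := isdD (dF _ hx') (isdM (isdM (smooth_isd x sw) (d_wronskian sp sw hx))
   (isdV p0 (smooth_isd x sp))).
apply: isd_eq d _; rewrite eig// /f /W /wronskian.
move: (phi x) (K w x) (derive1 phi x) (w x) (derive1 w x) (G x) p0 => P k p' a a' g p0.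
by field.
Qed.

Section Eigenbasis.
Variables (n : nat) (phi : 'I_n -> R -> R) (E : 'I_n -> R) (top : 'I_n) (s : seq R).
Hypotheses (sphi : forall i, smooth (phi i))
  (eig : forall i x, 0 <= x <= h -> K (phi i) x = E i * G x * phi i x)
  (orth : forall i j, J 0 h (fun x => G x * phi i x * phi j x) = (i == j)%:R)
  (Etop : forall i, E i <= E top)
  (nz : forall x, 0 <= x <= h -> x \notin s -> phi top x != 0)
  (zs : forall z, z \in s -> phi top z = 0 /\ derive1 (phi top) z != 0)
  (interp : forall val : R -> R, exists c : 'I_n -> R,
     forall z, z \in s -> \sum_(i < n) c i * phi i z = val z).

Lemma J_lin (c : 'I_n -> R) (f : R -> R) : continuous f ->
  J 0 h (fun x => f x * \sum_(i < n) c i * phi i x) =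
  \sum_(i < n) c i * J 0 h (fun x => f x * phi i x).
Proof.
move=> cf; have cp (i : 'I_n) : continuous (phi i) := @smooth_cont R (phi i) (@sphi i).
rewrite (_ : (fun x => _) = (fun x => \sum_(i < n) c i * (f x * phi i x))); last first.
  by apply/funext => x; rewrite mulr_sumr; apply: eq_bigr => i _; ring.
rewrite J_sum; last by move=> i; apply: contZ; exact: contM.
by apply: eq_bigr => i _; rewrite JZ//; apply: contW; exact: contM.
Qed.

Lemma K_phi u i : smooth u ->
  J 0 h (fun x => K u x * phi i x) = E i * J 0 h (fun x => G x * u x * phi i x).
Proof.
move=> su; rewrite (green_sym su (@sphi i)).
rewrite -JZ; last by apply: contW; apply: contM; [apply: contM cG _|]; [exact: (smooth_cont su)|exact: (@smooth_cont R (phi i) (@sphi i))].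
by apply: eq_J => x hx; rewrite eig//; ring.
Qed.

Let comb (c : 'I_n -> R) x := \sum_(i < n) c i * phi i x.

Lemma smooth_comb c : smooth (comb c).
Proof. by apply: smooth_sum => i; exact: smoothZ. Qed.

Lemma comb_coef c i : J 0 h (fun x => G x * comb c x * phi i x) = c i.
Proof.
rewrite (_ : (fun x => _) = (fun x => (G x * phi i x) * comb c x)); last first.
  by apply/funext => x; ring.
rewrite J_lin; last by apply: contM => //; exact: smooth_cont.
by rewrite (bigD1 i)//= big1 ?addr0 ?orth ?eqxx ?mulr1// => j ji; rewrite orth eq_sym (negPf ji) mulr0.
Qed.

Lemma comb_orth c u : continuous u -> (forall i, J 0 h (fun x => G x * u x * phi i x) = 0) ->
  J 0 h (fun x => G x * comb c x * u x) = 0.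
Proof.
move=> cu ou; rewrite (_ : (fun x => _) = (fun x => (G x * u x) * comb c x)); last first.
  by apply/funext => x; ring.
by rewrite J_lin ?big1//; [move=> i _; rewrite ou mulr0|exact: contM].
Qed.

Lemma K_comb_orth c u : smooth u -> (forall i, J 0 h (fun x => G x * u x * phi i x) = 0) ->
  J 0 h (fun x => K (comb c) x * u x) = 0.
Proof.
move=> su ou; rewrite (green_sym (@smooth_comb c) su).
rewrite (_ : (fun x => _) = (fun x => K u x * comb c x)); last by apply/funext => x; ring.
by rewrite J_lin ?big1//; [move=> i _; rewrite K_phi// ou !mulr0|exact: cont_K].
Qed.

Lemma orthogonal_lower_bound u : smooth u ->
  (forall i, J 0 h (fun x => G x * u x * phi i x) = 0) ->
  E top * J 0 h (fun x => G x * u x * u x) <= J 0 h (fun x => K u x * u x).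
Proof.
move=> su ou; have [c hc] := interp u; have cu := smooth_cont su.
pose y := comb c; have sy : smooth y by exact: smooth_comb.
pose w x := u x - y x; have sw : smooth w by exact: smoothB.
have cy := smooth_cont sy; have cw := smooth_cont sw.
have : 0 <= J 0 h (fun x => (K w x - E top * G x * w x) * w x).
  apply: (@picone s (E top) (phi top) w (@sphi top) sw _ nz).
    by move=> x /andP[h1 h2]; apply: eig; rewrite !ltW.
  by move=> z zsz; have [p0 p1] := zs zsz; split; [exact: p0|exact: p1|]; rewrite /w /y /comb hc// subrr.
have cwK : continuous (fun x => K w x - E top * G x * w x).
  by apply: contB; [exact: cont_K|apply: contM => //; exact: contZ].
have cuK : continuous (fun x => K u x - E top * G x * u x).
  by apply: contB; [exact: cont_K|apply: contM => //; exact: contZ].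
have cyK : continuous (fun x => K y x - E top * G x * y x).
  by apply: contB; [exact: cont_K|apply: contM => //; exact: contZ].
(* For w = u - y the form of K - E top splits without cross terms, as u is orthogonal to the span
   that contains y. The part of y equals - \sum (E top - E i) c_i^2 <= 0, so the form at u dominates
   the form at w, which is nonnegative by [picone]. *)
have e1 : J 0 h (fun x => (K w x - E top * G x * w x) * w x) =
    J 0 h (fun x => (K w x - E top * G x * w x) * u x) -
    J 0 h (fun x => (K w x - E top * G x * w x) * y x).
  rewrite -JB; [by apply: eq_J => x _; rewrite mulrBr|by apply: contW; exact: contM|by apply: contW; exact: contM].
have e2 : J 0 h (fun x => (K w x - E top * G x * w x) * u x) =
    J 0 h (fun x => (K u x - E top * G x * u x) * u x) -
    J 0 h (fun x => (K y x - E top * G x * y x) * u x).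
  rewrite -JB; [|by apply: contW; exact: contM..].
  by apply: eq_J => x _; rewrite KB// /w; ring.
have e3 : J 0 h (fun x => (K y x - E top * G x * y x) * u x) = 0.
  rewrite (_ : (fun x => _) = (fun x => K y x * u x - E top * (G x * y x * u x))); last first.
    by apply/funext => x; ring.
  rewrite JB; last 2 first.
  - by apply: contW; apply: contM => //; exact: cont_K.
  - by apply: contW; apply: contZ; apply: contM => //; exact: contM.
  rewrite JZ; last by apply: contW; apply: contM => //; exact: contM.
  by rewrite K_comb_orth// comb_orth// mulr0 subrr.
have e4 : J 0 h (fun x => (K u x - E top * G x * u x) * u x) =
   J 0 h (fun x => K u x * u x) - E top * J 0 h (fun x => G x * u x * u x).
  rewrite -JZ; last by apply: contW; apply: contM => //; exact: contM.
  rewrite -JB; first by apply: eq_J => x _; ring.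
  - by apply: contW; apply: contM => //; exact: cont_K.
  - by apply: contW; apply: contZ; apply: contM => //; exact: contM.
have e5 i : J 0 h (fun x => (K w x - E top * G x * w x) * phi i x) = (E top - E i) * c i.
  have cp : continuous (phi i) := @smooth_cont R (phi i) (@sphi i).
  have wi : J 0 h (fun x => G x * w x * phi i x) = - c i.
    rewrite (_ : (fun x => _) = (fun x => G x * u x * phi i x - G x * y x * phi i x)).
      rewrite JB; [|by apply: contW; apply: contM => //; exact: contM..].
      by rewrite ou comb_coef sub0r.
    by apply/funext => x; rewrite /w; ring.
  rewrite (_ : (fun x => _) = (fun x => K w x * phi i x - E top * (G x * w x * phi i x))); last first.
    by apply/funext => x; ring.
  rewrite JB; last 2 first.
  - by apply: contW; apply: contM => //; exact: cont_K.
  - by apply: contW; apply: contZ; apply: contM => //; exact: contM.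
  rewrite JZ; last by apply: contW; apply: contM => //; exact: contM.
  by rewrite K_phi// wi; ring.
have e6 : J 0 h (fun x => (K w x - E top * G x * w x) * y x) = \sum_(i < n) (E top - E i) * c i ^+ 2.
  by rewrite J_lin//; apply: eq_bigr => i _; rewrite e5; ring.
rewrite e1 e2 e3 e4 e6 subr0.
have : 0 <= \sum_(i < n) (E top - E i) * c i ^+ 2.
  by apply: sumr_ge0 => i _; apply: mulr_ge0; [rewrite subr_ge0|exact: sqr_ge0].
lra.
Qed.

End Eigenbasis.
End SturmLiouville.

Lemma isd_exp_lin (R : realType) (k x : R) : der x (fun t => expR (k * t)) (k * expR (k * x)).
Proof.
have d : der x (fun t => k * t) k by apply: isd_eq (isdM (isdC k x) (isdI x)) _; ring.
have e : der (k * x) (@expR R) (expR (k * x)) := is_derive_expR (k * x).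
by apply: isd_eq (isd_comp d e) _; ring.
Qed.

(** Cauchy-Schwarz in additive form, between the weights 1 / G and G. The free parameter lam is
    fixed at each use so that both summands become small together, or so that one of them is
    absorbed. *)
Lemma amgm (R : realType) (lam g d c : R) : 0 < lam -> 0 < g ->
  `|d * c| <= lam * (d ^+ 2 / g) + lam^-1 * (g * c ^+ 2).
Proof.
move=> l0 g0; rewrite normrM -(real_normK (num_real d)) -(real_normK (num_real c)).
have := normr_ge0 d; have := normr_ge0 c; move: `|d| `|c| => x y y0 x0.
rewrite -subr_ge0 [leRHS](_ : _ = ((lam * x) ^+ 2 + (g * y) ^+ 2 - (lam * x) * (g * y)) / (lam * g)).
  apply: divr_ge0; last by rewrite mulr_ge0// ltW.
  have : 0 <= lam * x by rewrite mulr_ge0// ltW.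
  have : 0 <= g * y by rewrite mulr_ge0// ltW.
  move: (lam * x) (g * y) => X Y; nra.
by field; rewrite !gt_eqF.
Qed.

Lemma sqr_add3 (R : realType) (x y z : R) : (x + y + z) ^+ 2 <= 3 * (x ^+ 2 + y ^+ 2 + z ^+ 2).
Proof.
rewrite -subr_ge0 [leRHS](_ : _ = (x - y) ^+ 2 + (y - z) ^+ 2 + (x - z) ^+ 2); last by ring.
by rewrite !addr_ge0// sqr_ge0.
Qed.

Lemma sqr_add2 (R : realType) (x y : R) : (x + y) ^+ 2 <= 2 * (x ^+ 2 + y ^+ 2).
Proof.
rewrite -subr_ge0 [leRHS](_ : _ = (x - y) ^+ 2); last by ring.
by rewrite sqr_ge0.
Qed.

(** * Stability of the Cauchy problem on compact subintervals *)

Section Sequences.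
Variables (R : realType) (h : R) (G G1 q : R -> R).
Hypotheses (h0 : 0 < h) (cG : continuous G) (cG1 : continuous G1) (cq : continuous q)
  (G_gt0 : forall x, 0 < x < h -> 0 < G x) (G0 : G 0 = 0) (Gh : G h = 0)
  (dG : forall x, 0 < x < h -> der x G (G1 x)).
Implicit Types (f w chi : R -> R) (a b x y : R).
Local Notation K := (K G G1 q).
Variable E0 : R.

Let Gpos x : 0 <= x <= h -> 0 <= G x.
Proof. exact: (G_ge0 G_gt0 G0 Gh). Qed.

Let cK w : smooth w -> continuous (K w).
Proof. exact: (cont_K cG cG1 cq). Qed.

Lemma J_sub f a b : continuous f -> (forall x, 0 <= x <= h -> 0 <= f x) ->
  0 <= a -> a <= b -> b <= h -> J a b f <= J 0 h f.
Proof.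
move=> cf f0 a0 ab bh.
have ah := le_trans ab bh.
rewrite -(J_cat cf a0 ah) -(J_cat cf ab bh).
have h1 : 0 <= J 0 a f.
  by apply: J_ge0 => x /andP[x0 xa]; apply: f0; rewrite x0 (le_trans xa).
have h2 : 0 <= J b h f.
  by apply: J_ge0 => x /andP[bx xh]; apply: f0; rewrite xh (le_trans a0)// (le_trans ab).
lra.
Qed.

Let cinG f a b : continuous f -> 0 < a -> b < h -> {within `[a, b], continuous (fun x => f x / G x)}.
Proof.
move=> cf a0 bh; apply: itv_cont => x /andP[ax xb].
apply: cvgM; first exact: cf.
apply: cvgV; last exact: cG.
by rewrite gt_eqF// G_gt0// (lt_le_trans a0)//= (le_lt_trans xb).
Qed.

Section Gronwall.
Variables (w r : R -> R) (a b x0 C eta : R).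
Hypotheses (sw : smooth w) (cr : continuous r) (a0 : 0 < a) (ab : a < b) (ax : a <= x0) (xb : x0 <= b)
  (bh : b < h) (wr : forall x, a <= x <= b -> K w x - E0 * G x * w x = r x)
  (hC : forall x, a <= x <= b -> (G x)^-1 + `|G x * (q x - E0)| + G x <= C)
  (heta : forall x y, a <= x -> x < y -> y <= b -> J x y (fun t => r t ^+ 2 / G t) <= eta)
  (w0 : w x0 = 0).

(** In the variables w and p = G w' the equation becomes a first-order system in which G is not
    differentiated; Gronwall's inequality is applied to e = w^2 + p^2. *)
Let p x := G x * derive1 w x.
Let e x := w x ^+ 2 + p x ^+ 2.
Let de x := 2 * w x * derive1 w x + 2 * p x * (G x * q x * w x - K w x).

Let inside x : a <= x <= b -> 0 < x < h.
Proof. by case/andP => h1 h2; rewrite (lt_le_trans a0)//= (le_lt_trans h2). Qed.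

Let d_e x : a <= x <= b -> der x e (de x).
Proof.
move=> hx; have d1 := smooth_isd x sw; have d2 := dGw q dG sw (inside hx).
apply: isd_eq (isdD (isdX 2 d1) (isdX 2 d2)) _.
by rewrite /de /p /= !expr1; move: (derive1 w x) (K w x) => A B; ring.
Qed.

Let cp : continuous p.
Proof. by apply: contM => //; exact: (smooth_cont (smooth_derive1 sw)). Qed.

Let ce : continuous e.
Proof. by apply: contD; apply: contX => //; exact: (smooth_cont sw). Qed.

Let cde : continuous de.
Proof.
have cw := smooth_cont sw; have cw1 := smooth_cont (smooth_derive1 sw).
apply: contD; first by apply: contM => //; exact: contZ.
apply: contM; first exact: contZ.
apply: contB; last exact: cK.
by apply: contM => //; exact: contM.
Qed.

Let de_bound x : a <= x <= b -> `|de x| <= C * e x + r x ^+ 2 / G x.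
Proof.
move=> hx; have g0 := G_gt0 (inside hx).
have e0 : 0 <= e x by apply: addr_ge0; exact: sqr_ge0.
have -> : de x = 2 * (w x * p x) / G x + 2 * (p x * w x) * (G x * (q x - E0)) - 2 * (p x * r x).
  have gn : G x != 0 by rewrite gt_eqF.
  rewrite -wr// /de /p; move: (derive1 w x) (K w x) (G x) gn => A B g gn; by field.
have m : `|2 * (w x * p x)| <= e x.
  rewrite /e; move: (w x) (p x) => A B; have := sqr_ge0 (A - B); have := sqr_ge0 (A + B).
  rewrite ler_norml => h1 h2; apply/andP; split; rewrite -subr_ge0.
    by rewrite [leRHS](_ : _ = (A + B) ^+ 2)//; ring.
  by rewrite [leRHS](_ : _ = (A - B) ^+ 2)//; ring.
apply: (le_trans (ler_normB _ _)).
have h1 : `|2 * (w x * p x) / G x| <= (G x)^-1 * e x.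
  by rewrite normrM mulrC normfV (gtr0_norm g0) ler_wpM2l// invr_ge0 ltW.
have h2 : `|2 * (p x * w x) * (G x * (q x - E0))| <= `|G x * (q x - E0)| * e x.
  by rewrite normrM mulrC ler_wpM2l// [p x * w x]mulrC.
have h3 : `|2 * (p x * r x)| <= G x * e x + r x ^+ 2 / G x.
  have hp : G x * p x ^+ 2 <= G x * e x by rewrite ler_wpM2l ?(ltW g0)// /e lerDr sqr_ge0.
  apply: le_trans (lerD hp (lexx _)); move: (p x) (r x) (G x) g0 => A B g g0.
  have i0 : 0 <= g^-1 by rewrite invr_ge0 ltW.
  rewrite ler_norml; apply/andP; split; rewrite -subr_ge0.
    rewrite [leRHS](_ : _ = g^-1 * (g * A + B) ^+ 2); last by field; rewrite gt_eqF.
    by apply: mulr_ge0 => //; exact: sqr_ge0.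
  rewrite [leRHS](_ : _ = g^-1 * (g * A - B) ^+ 2); last by field; rewrite gt_eqF.
  by apply: mulr_ge0 => //; exact: sqr_ge0.
have h4 := ler_wpM2r e0 (hC hx); rewrite !mulrDl in h4.
have := ler_normD (2 * (w x * p x) / G x) (2 * (p x * w x) * (G x * (q x - E0))).
by move: h1 h2 h3 h4; lra.
Qed.

Let C0 : 0 <= C.
Proof.
have hx : a <= x0 <= b by rewrite ax.
apply: le_trans (hC hx); have := G_gt0 (inside hx) => g.
by rewrite !addr_ge0// ?invr_ge0 ltW.
Qed.

Let eta0 : 0 <= eta.
Proof.
apply: le_trans (heta (lexx a) ab (lexx b)); apply: J_ge0 => t ht.
by apply: mulr_ge0; [exact: sqr_ge0|rewrite invr_ge0 ltW// G_gt0// inside].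
Qed.

(* The two signs of k treat the two directions of integration. *)
Let growth k x y : a <= x -> x < y -> y <= b ->
  expR (k * y) * e y - expR (k * x) * e x = J x y (fun t => expR (k * t) * (de t + k * e t)).
Proof.
move=> h1 h2 h3; apply/esym; apply: (J_prim (F := fun t => expR (k * t) * e t)); last 2 first.
- exact: ltW.
- move=> t /andP[t1 t2]; have ht : a <= t <= b by rewrite (le_trans h1)//= (le_trans t2).
  by apply: isd_eq (isdM (isd_exp_lin k t) (d_e ht)) _; ring.
apply: contM; last by apply: contD => //; exact: contZ.
move=> t; apply: continuous_comp; last exact: continuous_expR.
by apply: cvgM; [exact: cvg_cst|exact: cvg_id].
Qed.

Let bound x : a <= x <= b -> e x <= expR (C * h) * (e x0 + eta).
Proof.
move=> hx; have e0 t : 0 <= e t by apply: addr_ge0; exact: sqr_ge0.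
have ex1 : 1 <= expR (C * h) by rewrite -expR0 ler_expR; apply: mulr_ge0 => //; exact: ltW.
case/andP: (hx) => x1 x2.
have cex (k : R) : continuous (fun t : R => expR (k * t)).
  move=> t; apply: continuous_comp; last exact: continuous_expR.
  by apply: cvgM; [exact: cvg_cst|exact: cvg_id].
have cI (k : R) : continuous (fun t : R => expR (k * t) * (de t + k * e t)).
  by apply: contM => //; apply: contD => //; exact: contZ.
have cr2 : continuous (fun t : R => r t ^+ 2) by exact: contX.
have [xx|xx|<-] := ltgtP x0 x; last first.
- by rewrite -[leLHS]mul1r; apply: ler_pM => //; rewrite lerDl eta0.
- have hF := growth C x1 xx xb.
  have lb : - (expR (C * h) * eta) <= J x x0 (fun t => expR (C * t) * (de t + C * e t)).
    rewrite -mulNr mulrC; apply: (@le_trans _ _ (J x x0 (fun t => - expR (C * h) * (r t ^+ 2 / G t)))).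
      rewrite JZ; last by apply: cinG => //; [exact: lt_le_trans x1|exact: le_lt_trans bh].
      by rewrite mulrC ler_wnM2l ?oppr_le0 ?expR_ge0//; exact: heta.
    apply: J_le.
    + apply: itv_cont => t ht; apply: cvgM; first exact: cvg_cst.
      case/andP: ht => t1 t2; have g : 0 < G t by apply/G_gt0/inside; rewrite (le_trans x1)//= (le_trans t2).
      by apply: cvgM; [exact: cr2|apply: cvgV; [rewrite gt_eqF|exact: cG]].
    + exact: contW.
    + move=> t /andP[t1 t2]; have ht : a <= t <= b by rewrite (le_trans x1)//= (le_trans t2).
      have := de_bound ht; rewrite ler_norml => /andP[h1 _].
      have g : 0 < G t by apply/G_gt0/inside.
      have r0 : 0 <= r t ^+ 2 / G t by apply: divr_ge0; [exact: sqr_ge0|exact: ltW].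
      apply: (@le_trans _ _ (expR (C * t) * - (r t ^+ 2 / G t))).
        rewrite mulNr mulrN lerN2 ler_wpM2r// ler_expR ler_wpM2l//.
        by case/andP: (inside ht) => _ /ltW.
      by rewrite ler_wpM2l ?expR_ge0//; lra.
  have u1 : expR (C * x0) <= expR (C * h).
    by rewrite ler_expR ler_wpM2l// (le_trans xb) ?ltW.
  have u2 : 1 <= expR (C * x).
    by rewrite -expR0 ler_expR; apply: mulr_ge0 => //; case/andP: (inside hx) => /ltW.
  have := ler_wpM2r (e0 x0) u1; have := ler_wpM2r (e0 x) u2; rewrite mul1r [expR (C * h) * (_ + _)]mulrDr.
  by move: hF lb; lra.
- have hF := growth (- C) ax xx x2.
  have ub : J x0 x (fun t => expR (- C * t) * (de t + - C * e t)) <= eta.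
    apply: (@le_trans _ _ (J x0 x (fun t => r t ^+ 2 / G t))); last exact: heta.
    apply: J_le.
    + exact: contW.
    + by apply: cinG => //; [exact: lt_le_trans ax|exact: le_lt_trans bh].
    + move=> t /andP[t1 t2]; have ht : a <= t <= b by rewrite (le_trans ax)//= (le_trans t2).
      have := de_bound ht; rewrite ler_norml => /andP[_ h1].
      have g : 0 < G t by apply/G_gt0/inside.
      have r0 : 0 <= r t ^+ 2 / G t by apply: divr_ge0; [exact: sqr_ge0|exact: ltW].
      have x1' : expR (- C * t) <= 1.
        rewrite -expR0 ler_expR mulNr oppr_le0; apply: mulr_ge0 => //.
        by case/andP: (inside ht) => /ltW.
      apply: (@le_trans _ _ (expR (- C * t) * (r t ^+ 2 / G t))).
        by rewrite ler_wpM2l ?expR_ge0//; lra.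
      by rewrite -[leRHS]mul1r ler_wpM2r.
  have u1 : expR (- C * x0) <= 1.
    rewrite -expR0 ler_expR mulNr oppr_le0; apply: mulr_ge0 => //.
    by apply: le_trans ax; exact: ltW.
  have l1 : expR (- C * x) * e x <= e x0 + eta.
    by have := ler_wpM2r (e0 x0) u1; rewrite mul1r; move: hF ub; lra.
  rewrite -[leLHS]mul1r -[X in X * e x](_ : expR (C * x) * expR (- C * x) = 1); last first.
    by rewrite -expRD mulNr subrr expR0.
  rewrite -mulrA; apply: ler_pM.
  - exact: expR_ge0.
  - by apply: mulr_ge0; [exact: expR_ge0|exact: e0].
  - by rewrite ler_expR ler_wpM2l// (le_trans x2) ?ltW.
  - exact: l1.
Qed.

Lemma gronwall x : a <= x <= b -> w x ^+ 2 <= expR (C * h) * ((G x0 * derive1 w x0) ^+ 2 + eta).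
Proof.
move=> hx; have := bound hx; rewrite {2}/e w0 expr0n add0r; apply: le_trans.
by rewrite /e lerDl sqr_ge0.
Qed.

End Gronwall.
End Sequences.

(** * Limits of approximate eigenfunctions *)

Section Limits.
Variables (R : realType) (h : R) (G G1 q : R -> R).
Hypotheses (h0 : 0 < h) (cG : continuous G) (cG1 : continuous G1) (cq : continuous q)
  (G_gt0 : forall x, 0 < x < h -> 0 < G x) (G0 : G 0 = 0) (Gh : G h = 0)
  (dG : forall x, 0 < x < h -> der x G (G1 x)).
Implicit Types (f w chi : R -> R) (a b x y e lam : R).
Local Notation K := (K G G1 q).

Variables (n : nat) (phi : 'I_n -> R -> R) (E : 'I_n -> R).
Hypotheses (sphi : forall i, smooth (phi i))
  (eig : forall i x, 0 <= x <= h -> K (phi i) x = E i * G x * phi i x)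
  (orth : forall i j, J 0 h (fun x => G x * phi i x * phi j x) = (i == j)%:R).

(* (v, eta) describes a sequence in the domain which is Cauchy and on which the
   operator minus E0 tends to 0, in L^2(G). *)
Variables (E0 : R) (v : nat -> R -> R) (eta : nat -> R).
Hypotheses (sv : forall m, smooth (v m))
  (H1 : forall e, 0 < e -> exists N, forall m m', (N <= m)%N -> (N <= m')%N ->
     J 0 h (fun x => G x * (v m x - v m' x) ^+ 2) <= e)
  (H2 : forall m a b, 0 < a -> a < b -> b < h ->
     J a b (fun x => (K (v m) x - E0 * G x * v m x) ^+ 2 / G x) <= eta m)
  (H3 : forall e, 0 < e -> exists N, forall m, (N <= m)%N -> eta m <= e).

Local Notation D m := (fun x => K (v m) x - E0 * G x * v m x).

Let Gpos x : 0 <= x <= h -> 0 <= G x.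
Proof. exact: (G_ge0 G_gt0 G0 Gh). Qed.
Let cK w : smooth w -> continuous (K w).
Proof. exact: (cont_K cG cG1 cq). Qed.
Let cv m : continuous (v m) := @smooth_cont R (v m) (@sv m).
Let cphi i : continuous (phi i) := @smooth_cont R (phi i) (@sphi i).
Let cD m : continuous (D m).
Proof. by apply: contB; [exact/cK/sv|apply: contM => //; exact: contZ]. Qed.
Let cGf f : continuous f -> continuous (fun x => G x * f x ^+ 2).
Proof. by move=> cf; apply: contM => //; exact: contX. Qed.
Let Gf0 f x : 0 <= x <= h -> 0 <= G x * f x ^+ 2.
Proof. by move=> hx; apply: mulr_ge0; [exact: Gpos|exact: sqr_ge0]. Qed.

Let eta_ge0 m : 0 <= eta m.
Proof.
have hh := h0; have a0 : 0 < h / 3 by apply: divr_gt0.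
apply: le_trans (@H2 m (h / 3) (h / 2) a0 _ _); [|by move: hh; lra|by move: hh; lra].
apply: J_ge0 => x /andP[x1 x2]; apply: divr_ge0; first exact: sqr_ge0.
by apply: Gpos; apply/andP; split; move: hh a0 x1 x2; lra.
Qed.

(** The residual is small in the norm with weight 1 / G, but it can be integrated against a
    continuous function up to the endpoints, since the weight 1 / G is paired with the weight G of
    chi. *)
Lemma residual m chi lam x : continuous chi -> 0 < lam -> 0 <= x <= h ->
  `|J 0 x (fun t => D m t * chi t)| <= lam * eta m + lam^-1 * J 0 h (fun t => G t * chi t ^+ 2).
Proof.
move=> cc l0 /andP[x0 xh]; have c1 : continuous (fun t => D m t * chi t) by exact: contM.
have c2 : continuous (fun t => `|D m t * chi t|).
  by move=> t; apply: cvg_norm; exact: c1.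
apply: (le_trans (J_abs (contW c1))).
apply: (@le_trans _ _ (J 0 h (fun t => `|D m t * chi t|))); first by apply: J_sub.
apply: J_exhaust => // a b a0 ab bh.
have ins t : a <= t <= b -> 0 < t < h.
  by case/andP => t1 t2; rewrite (lt_le_trans a0)//= (le_lt_trans t2).
have cD2 : continuous (fun t => D m t ^+ 2) by apply: contX; exact: cD.
have c3 : {within `[a, b], continuous (fun t => D m t ^+ 2 / G t)}.
  apply: itv_cont => t ht; apply: cvgM; first exact: cD2.
  by apply: cvgV; [rewrite gt_eqF// G_gt0// ins|exact: cG].
apply: (@le_trans _ _ (J a b (fun t => lam * (D m t ^+ 2 / G t) + lam^-1 * (G t * chi t ^+ 2)))).
  apply: J_le; first exact: contW.
    apply: itv_cont => t ht; apply: cvgD.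
      apply: cvgM; first exact: cvg_cst.
      apply: cvgM; first exact: cD2.
      by apply: cvgV; [rewrite gt_eqF// G_gt0// ins|exact: cG].
    by apply: cvgM; [exact: cvg_cst|exact: cGf].
  by move=> t ht; apply: amgm => //; apply: G_gt0; exact: ins.
rewrite JD; last 2 first.
- apply: itv_cont => t ht; apply: cvgM; first exact: cvg_cst.
  apply: cvgM; first exact: cD2.
  by apply: cvgV; [rewrite gt_eqF// G_gt0// ins|exact: cG].
- by apply: contW; apply: contZ; exact: cGf.
rewrite JZ// JZ; last by apply: contW; exact: cGf.
apply: lerD; first by rewrite ler_wpM2l ?(ltW l0)//; exact: H2.
rewrite ler_wpM2l ?invr_ge0 ?(ltW l0)//; apply: J_sub => //.
- exact: cGf.
- exact: Gf0.
- exact: ltW.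
- exact: ltW.
- exact: ltW.
Qed.

Let coef m i := J 0 h (fun x => G x * v m x * phi i x).

Let D_phi m i : J 0 h (fun x => D m x * phi i x) = (E i - E0) * coef m i.
Proof.
rewrite (_ : (fun x => _) = (fun x => K (v m) x * phi i x - E0 * (G x * v m x * phi i x))); last first.
  by apply/funext => x; ring.
rewrite JB; last 2 first.
- by apply: contW; apply: contM => //; apply: cK; exact: sv.
- by apply: contW; apply: contZ; apply: contM => //; exact: contM.
rewrite JZ; last by apply: contW; apply: contM => //; exact: contM.
by rewrite (K_phi h0 cG cG1 cq G0 Gh dG sphi eig i (@sv m)) /coef; ring.
Qed.

Let norm_phi i : J 0 h (fun x => G x * phi i x ^+ 2) = 1.
Proof.
rewrite -[RHS](_ : (i == i)%:R = 1); last by rewrite eqxx.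
by rewrite -orth; apply: eq_J => x _; ring.
Qed.

Lemma coef_small i : E i != E0 -> forall e, 0 < e ->
  exists N, forall m, (N <= m)%N -> `|coef m i| <= e.
Proof.
move=> Ei e e0; have g0 : 0 < `|E i - E0| by rewrite normr_gt0 subr_eq0.
set g := `|E i - E0| in g0.
have eg : 0 < e * g by exact: mulr_gt0.
(* With this lam both summands of [residual] are at most e * g / 2. *)
pose lam := 2 / (e * g); have l0 : 0 < lam by exact: divr_gt0.
have [N hN] := H3 (divr_gt0 (divr_gt0 eg (ltr0Sn R 1)) l0).
exists N => m /hN em.
have := @residual m (phi i) lam h (@cphi i) l0; rewrite lexx ltW// => /(_ isT).
rewrite D_phi norm_phi mulr1 normrM -/g => hr.
rewrite -(ler_pM2l g0); apply: (le_trans hr).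
have h1 : lam * eta m <= e * g / 2 by rewrite mulrC -ler_pdivlMr.
have h2 : lam^-1 = e * g / 2 by rewrite /lam invf_div.
by rewrite h2; lra.
Qed.

Section Lower.
Variables (top : 'I_n).
Hypotheses (lower : forall u, smooth u -> (forall i, J 0 h (fun x => G x * u x * phi i x) = 0) ->
    E top * J 0 h (fun x => G x * u x * u x) <= J 0 h (fun x => K u x * u x))
  (E0top : E0 <= E top) (E0n : forall i, E i != E0).

Lemma off_spectrum e : 0 < e ->
  exists N, forall m, (N <= m)%N -> J 0 h (fun x => G x * v m x ^+ 2) <= e.
Proof.
move=> e0.
pose y m x := \sum_(i < n) coef m i * phi i x.
have sy m : smooth (y m) by exact: (smooth_comb sphi).
pose u m x := v m x - y m x.
have su m : smooth (u m) by apply: smoothB; [exact: sv|exact: sy].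
have cu m : continuous (u m) := @smooth_cont R (u m) (@su m).
have cy m : continuous (y m) := @smooth_cont R (y m) (@sy m).
have ou m i : J 0 h (fun x => G x * u m x * phi i x) = 0.
  rewrite (_ : (fun x => _) = (fun x => G x * v m x * phi i x - G x * y m x * phi i x)); last first.
    by apply/funext => x; rewrite /u; ring.
  rewrite JB; [|by apply: contW; apply: contM => //; exact: contM..].
  by rewrite (comb_coef cG sphi orth (coef m)) subrr.
have split m : J 0 h (fun x => G x * v m x ^+ 2) =
    J 0 h (fun x => G x * u m x ^+ 2) + \sum_(i < n) coef m i ^+ 2.
  have e1 : J 0 h (fun x => G x * y m x * u m x) = 0 by exact: comb_orth.
  have e2 : J 0 h (fun x => G x * y m x * y m x) = \sum_(i < n) coef m i ^+ 2.
    rewrite (J_lin h sphi (coef m) (f := fun x => G x * y m x)); last exact: contM.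
    by apply: eq_bigr => i _; rewrite (comb_coef cG sphi orth (coef m)) expr2.
  have c1 : continuous (fun x => G x * y m x * u m x) by apply: contM => //; exact: contM.
  have c2 : continuous (fun x => G x * y m x * y m x) by apply: contM => //; exact: contM.
  have c3 : continuous (fun x => G x * u m x ^+ 2) by exact: cGf.
  rewrite (_ : (fun x => G x * v m x ^+ 2) = (fun x => G x * u m x ^+ 2 +
      2 * (G x * y m x * u m x) + G x * y m x * y m x)); last first.
    by apply/funext => x; rewrite /u; ring.
  rewrite JD; [|apply: contW; apply: contD => //; exact: contZ|exact: contW].
  rewrite JD; [|exact: contW|apply: contW; exact: contZ].
  by rewrite JZ; [rewrite e1 e2 mulr0 addr0|exact: contW].
have g0 : 0 < E top - E0 by rewrite subr_gt0 lt_neqAle E0top andbT eq_sym.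
set g := E top - E0 in g0.
have ubound m : J 0 h (fun x => G x * u m x ^+ 2) <= 4 / g / g * eta m.
  have e3 : J 0 h (fun x => D m x * u m x) =
      J 0 h (fun x => K (u m) x * u m x) - E0 * J 0 h (fun x => G x * u m x * u m x).
    have e1 : J 0 h (fun x => G x * y m x * u m x) = 0 by exact: comb_orth.
    have e2 : J 0 h (fun x => K (y m) x * u m x) = 0.
      exact: (K_comb_orth h0 cG cG1 cq G0 Gh dG sphi eig (coef m) (@su m)).
    have cKu : continuous (fun x => K (u m) x * u m x) by apply: contM => //; exact/cK/su.
    have cKy : continuous (fun x => K (y m) x * u m x) by apply: contM => //; exact/cK/sy.
    have cuu : continuous (fun x => G x * u m x * u m x) by apply: contM => //; exact: contM.
    have cyu : continuous (fun x => G x * y m x * u m x) by apply: contM => //; exact: contM.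
    rewrite (_ : (fun x => D m x * u m x) = (fun x => (K (u m) x * u m x + K (y m) x * u m x) -
       (E0 * (G x * u m x * u m x) + E0 * (G x * y m x * u m x)))); last first.
      apply/funext => x; have -> : K (u m) x = K (v m) x - K (y m) x by rewrite /u (KB _ _ _ (@sv m) (@sy m)).
      by rewrite /u; ring.
    rewrite JB; [|by apply: contW; apply: contD => //; exact: contZ..].
    rewrite !JD; try by apply: contW => //; exact: contZ.
    by rewrite !JZ; try exact: contW; rewrite e1 e2 mulr0 !addr0.
  have B0 : 0 <= J 0 h (fun x => G x * u m x ^+ 2) by apply: J_ge0 => x; exact: Gf0.
  have eB : J 0 h (fun x => G x * u m x * u m x) = J 0 h (fun x => G x * u m x ^+ 2).
    by apply: eq_J => x _; ring.
  have := lower (@su m) (ou m); rewrite eB => lo.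
  (* For lam = 2 / g the second summand of [residual] is half of the spectral gap term and is
     absorbed by it. *)
  have l0 : 0 < 2 / g by exact: divr_gt0.
  have := @residual m (u m) (2 / g) h (@cu m) l0; rewrite lexx ltW// => /(_ isT).
  rewrite e3 eB invf_div ler_norml => /andP[_ hi].
  move: lo hi B0; move: (J 0 h (fun x => K (u m) x * u m x)) (J 0 h (fun x => G x * u m x ^+ 2)) => A B lo hi B0.
  have h1 : g * B <= 2 / g * eta m + g / 2 * B by move: lo hi; rewrite /g; lra.
  have h2 : B <= 2 / g * (2 / g * eta m).
    rewrite -(ler_pM2l g0) (_ : g * (2 / g * _) = 2 * (2 / g * eta m)); last by field; rewrite gt_eqF.
    by move: h1; lra.
  by apply: (le_trans h2); rewrite le_eqVlt; apply/orP; left; apply/eqP; field; rewrite gt_eqF.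
have [N1 hN1] : exists N, forall m, (N <= m)%N -> J 0 h (fun x => G x * u m x ^+ 2) <= e / 2.
  have c0 : 0 < 4 / g / g by apply: divr_gt0 => //; exact: divr_gt0.
  have e2 : 0 < e / 2 by lra.
  have [N hN] := H3 (divr_gt0 e2 c0); exists N => m /hN em.
  by apply: (le_trans (ubound m)); rewrite mulrC -ler_pdivlMr.
have [N2 hN2] : exists N, forall m, (N <= m)%N -> \sum_(i < n) coef m i ^+ 2 <= e / 2.
  pose d := Num.min 1 (e / 2 / n.+1%:R).
  have d0 : 0 < d by rewrite lt_min ltr01 !divr_gt0.
  have [N hN] := choice (fun i => coef_small (E0n i) d0).
  exists (\max_i N i)%N => m hm.
  apply: (@le_trans _ _ (\sum_(i < n) (e / 2 / n.+1%:R))).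
    apply: ler_sum => i _; have := hN i m; rewrite (leq_trans _ hm) ?leq_bigmax// => /(_ isT) hc.
    rewrite -(real_normK (num_real _)) expr2.
    apply: (@le_trans _ _ (1 * d)).
      by apply: ler_pM => //; apply: le_trans hc _; rewrite ge_min lexx.
    by rewrite mul1r ge_min lexx orbT.
  rewrite sumr_const card_ord -[X in X <= _]mulr_natr mulrAC ler_pdivrMr ?ltr0Sn//.
  by rewrite ler_pM2l ?divr_gt0// ler_nat leqnSn.
exists (maxn N1 N2) => m; rewrite geq_max => /andP[/hN1 h1 /hN2 h2].
by rewrite split; lra.
Qed.

End Lower.


Section AtEigenvalue.
Variable i0 : 'I_n.
Hypothesis Ei0 : E i0 = E0.
Local Notation ph := (phi i0).

Lemma mass_inside : exists a b x0, [/\ 0 < a, a < b, b < h, a <= x0 <= b &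
  ph x0 != 0 /\ 0 < J a b (fun x => G x * ph x ^+ 2)].
Proof.
have [[a [b [a0 ab bh h1]]]|no] := pselect (exists a b, [/\ 0 < a, a < b, b < h &
    0 < J a b (fun x => G x * ph x ^+ 2)]); last first.
  have : J 0 h (fun x => G x * ph x ^+ 2) <= 0.
    apply: J_exhaust => //; first exact: cGf.
    by move=> a b a0 ab bh; rewrite leNgt; apply/negP => hp; apply: no; exists a, b.
  by rewrite norm_phi ler10.
have [[x0 [hx0 p0]]|no] := pselect (exists x0, a <= x0 <= b /\ ph x0 != 0).
  by exists a, b, x0; split.
exfalso; move: h1; rewrite (_ : J a b _ = 0) ?ltxx//.
rewrite (eq_J (g := fun x => 0 * (fun=> 0) x)); first by rewrite JZ ?mul0r//; exact/contW/contC.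
move=> x hx; have [->|p0] := eqVneq (ph x) 0; first by rewrite expr0n mulr0 mul0r.
by exfalso; apply: no; exists x.
Qed.

Variables (xs : R) (a0' b0' : R).
Hypotheses (as0 : 0 < a0') (asb : a0' < b0') (bsh : b0' < h) (axb : a0' <= xs <= b0')
  (pxs : ph xs != 0) (mass : 0 < J a0' b0' (fun x => G x * ph x ^+ 2)).

(** The multiple of ph is chosen so that [w m] vanishes at xs; of its Cauchy data at xs only the
    derivative remains to be estimated. *)
Let c m := v m xs / ph xs.
Let w m x := v m x - c m * ph x.

Let sw m : smooth (w m).
Proof. by apply: smoothB; [exact: sv|apply: smoothZ; exact: sphi]. Qed.

Let xs_in : 0 < xs < h.
Proof. by case/andP: axb => h1 h2; rewrite (lt_le_trans as0)//= (le_lt_trans h2). Qed.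

Let Kw m x : 0 <= x <= h -> K (w m) x - E0 * G x * w m x = D m x.
Proof.
move=> hx; rewrite /w (KB G G1 q (@sv m) (@smoothZ R ph (c m) (@sphi i0))) (KZ G G1 q (c m) (@sphi i0)).
by rewrite eig// Ei0; ring.
Qed.

Let w_xs m : w m xs = 0.
Proof. by rewrite /w /c divfK// subrr. Qed.

(** Green's identity on [0, xs] against ph: since [w m] vanishes at xs, the boundary term is - G w'
    ph at xs, and it equals the integral of the residual against ph. *)
Let dw_small e : 0 < e -> exists N, forall m, (N <= m)%N -> (G xs * derive1 (w m) xs) ^+ 2 <= e.
Proof.
move=> e0.
have p2 : 0 < ph xs ^+ 2 by rewrite exprn_even_gt0.
have key m lam : 0 < lam -> `|G xs * derive1 (w m) xs * ph xs| <= lam * eta m + lam^-1.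
  move=> l0; have hx : 0 <= xs <= h by case/andP: xs_in => *; rewrite !ltW.
  have := @residual m ph lam xs (@cphi i0) l0 hx; rewrite norm_phi mulr1.
  have := green cG cG1 cq G0 dG (@sw m) (@sphi i0) hx; rewrite /wronskian w_xs mul0r sub0r => hg.
  have -> : J 0 xs (fun t => D m t * ph t) = J 0 xs (fun y => K (w m) y * ph y - w m y * K ph y).
    apply: eq_J => y /andP[y0 y1]; have hy : 0 <= y <= h by rewrite y0 (le_trans y1)// ltW//; case/andP: xs_in.
    by rewrite -Kw// (eig i0 hy) Ei0; ring.
  by rewrite hg mulrN normrN mulrA.
have se : 0 < Num.sqrt (e * ph xs ^+ 2) by rewrite sqrtr_gt0 mulr_gt0.
set r := Num.sqrt _ in se.
pose lam := 2 / r; have l0 : 0 < lam by exact: divr_gt0.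
have [N hN] := H3 (divr_gt0 (divr_gt0 se (ltr0Sn R 1)) l0).
exists N => m /hN em.
have h1 : lam * eta m <= r / 2 by rewrite mulrC -ler_pdivlMr.
have h2 : lam^-1 = r / 2 by rewrite /lam invf_div.
have h3 : `|G xs * derive1 (w m) xs * ph xs| <= r.
  by apply: (le_trans (key m lam l0)); rewrite h2; lra.
rewrite -(ler_pM2r p2) -exprMn -(real_normK (num_real _)) -(sqr_sqrtr (ltW (mulr_gt0 e0 p2))) -/r.
by rewrite lerXn2r ?nnegrE// ltW.
Qed.

Let w_small a b e : 0 < a -> a < b -> a <= xs <= b -> b < h -> 0 < e ->
  exists N, forall m x, (N <= m)%N -> a <= x <= b -> w m x ^+ 2 <= e.
Proof.
move=> a0 ab /andP[ax xb] bh e0.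
have ins x : a <= x <= b -> 0 < x < h.
  by case/andP => h1 h2; rewrite (lt_le_trans a0)//= (le_lt_trans h2).
have [C hC] : exists C, forall x, a <= x <= b -> (G x)^-1 + `|G x * (q x - E0)| + G x <= C.
  pose F x := (G x)^-1 + `|G x * (q x - E0)| + G x.
  have cF : {within `[a, b], continuous F}.
    apply: itv_cont => x hx; apply: cvgD; last exact: cG.
    apply: cvgD; first by apply: cvgV; [rewrite gt_eqF// G_gt0// ins|exact: cG].
    apply: cvg_norm; apply: (contM cG (f := G) (g := fun x => q x - E0)).
    by apply: contB => //; exact: contC.
  have [x _ hx] := EVT_max (ltW ab) cF; exists (F x) => y hy.
  by apply: hx; rewrite in_itv.
pose k := expR (C * h).
have k0 : 0 < k by exact: expR_gt0.
have e2 : 0 < e / k / 2 by apply: divr_gt0 => //; exact: divr_gt0.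
have [N1 hN1] := dw_small e2; have [N2 hN2] := H3 e2.
exists (maxn N1 N2) => m x; rewrite geq_max => /andP[/hN1 h1 /hN2 h2] hx.
have hK y : a <= y <= b -> K (w m) y - E0 * G y * w m y = D m y.
  by move=> /ins /andP[y0 y1]; apply: Kw; rewrite !ltW.
have hE y z : a <= y -> y < z -> z <= b -> J y z (fun t => (D m t) ^+ 2 / G t) <= eta m.
  by move=> y1 y2 y3; apply: H2 => //; [exact: lt_le_trans y1|exact: le_lt_trans bh].
have := gronwall h0 cG cG1 cq G_gt0 dG (@sw m) (@cD m) a0 ab ax xb bh hK hC hE (w_xs m) hx.
rewrite -/k => hg; apply: (le_trans hg).
by rewrite mulrC -ler_pdivlMr//; lra.
Qed.

Let JG_small a b f e : 0 <= e -> 0 < a -> a < b -> b < h -> continuous f ->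
  (forall x, a <= x <= b -> f x ^+ 2 <= e) -> J a b (fun x => G x * f x ^+ 2) <= e * J 0 h G.
Proof.
move=> e0 a0 ab bh cf hf.
apply: (@le_trans _ _ (J a b (fun x => e * G x))).
  apply: J_le; [exact/contW/cGf|by apply: contW; exact: contZ|].
  move=> x hx; rewrite mulrC ler_wpM2r ?hf// ltW// G_gt0//.
  by case/andP: hx => h1 h2; rewrite (lt_le_trans a0)//= (le_lt_trans h2).
rewrite JZ; last exact: contW.
by apply: ler_wpM2l => //; apply: J_sub => //; exact: ltW.
Qed.

(** On a compact subinterval [w m] tends to 0 uniformly, so the Cauchy property of v together with
    the positive mass of ph makes c a Cauchy sequence. [w_small] gives nothing up to the endpoints;
    there v m is compared in L^2(G) with one fixed v M, whose integral outside a large subinterval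
    is small. *)
Lemma at_eigenvalue : exists c0 : R, forall e, 0 < e ->
  exists N, forall m, (N <= m)%N -> J 0 h (fun x => G x * (v m x - c0 * ph x) ^+ 2) <= e.
Proof.
have cw m : continuous (w m) := @smooth_cont R (w m) (@sw m).
have JG0 : 0 <= J 0 h G by apply: J_ge0 => x; exact: Gpos.
have JG1 : 0 < J 0 h G + 1 by rewrite ltr_wpDl.
have cauchy e : 0 < e -> exists N, forall m m', (N <= m)%N -> (N <= m')%N -> (c m - c m') ^+ 2 <= e.
  move=> e0; pose M := J a0' b0' (fun x => G x * ph x ^+ 2); have mass' : 0 < M := mass.
  have eM : 0 < e * M / 9 by rewrite !mulr_gt0.
  have eM2 : 0 < e * M / 9 / (J 0 h G + 1) by exact: divr_gt0.
  have [N1 hN1] := H1 eM; have [N2 hN2] := w_small as0 asb axb bsh eM2.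
  exists (maxn N1 N2) => m m'; rewrite !geq_max => /andP[m1 m2] /andP[m1' m2'].
  have wb k : (N2 <= k)%N -> J a0' b0' (fun x => G x * w k x ^+ 2) <= e * M / 9.
    move=> hk; apply: (le_trans (JG_small (ltW eM2) as0 asb bsh (@cw k) (fun x => hN2 k x hk))).
    by rewrite mulrAC ler_pdivrMr// ler_pM2l// lerDl.
  rewrite -(ler_pM2r mass) -/M.
  have -> : (c m - c m') ^+ 2 * M = J a0' b0' (fun x => G x * ((c m - c m') * ph x) ^+ 2).
    by rewrite /M -JZ; [apply: eq_J => x _; rewrite exprMn mulrCA|apply: contW; exact: cGf].
  have cvv : continuous (fun x => v m x - v m' x) by exact: contB.
  apply: (@le_trans _ _ (J a0' b0' (fun x => 3 * (G x * (v m x - v m' x) ^+ 2 + G x * w m x ^+ 2 + G x * w m' x ^+ 2)))).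
    apply: J_le.
    - by apply: contW; apply: cGf; exact: contZ.
    - by apply: contW; apply: contZ; apply: contD; [apply: contD|]; exact: cGf.
    - move=> x /andP[x1 x2].
      have g : 0 <= G x by apply: Gpos; rewrite (le_trans _ x1) ?ltW//= (le_lt_trans x2).
      have := ler_wpM2l g (sqr_add3 (v m x - v m' x) (- w m x) (w m' x)).
      rewrite sqrrN (_ : _ - w m x + w m' x = (c m - c m') * ph x); last by rewrite /w; ring.
      by move=> hle; apply: (le_trans hle); rewrite le_eqVlt; apply/orP; left; apply/eqP; ring.
  rewrite JZ; last by apply: contW; apply: contD; [apply: contD|]; exact: cGf.
  rewrite JD; [|by apply: contW; apply: contD; exact: cGf|by apply: contW; exact: cGf].
  rewrite JD; [|by apply: contW; exact: cGf..].
  have b1 : J a0' b0' (fun x => G x * (v m x - v m' x) ^+ 2) <= e * M / 9.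
    apply: le_trans (hN1 m m' m1 m1'); apply: J_sub; [exact: cGf|exact: Gf0|exact: ltW..].
  by have := wb m m2; have := wb m' m2'; lra.
have cc : cvgn c.
  apply/cauchy_cvgP/cauchy_exP => e e0.
  have e2 : 0 < (e / 2) ^+ 2 by rewrite exprn_gt0// divr_gt0.
  have [N hN] := cauchy _ e2; exists (c N); exists N => // m /= hm.
  rewrite /ball /=; apply: (@le_lt_trans _ _ (e / 2)); last by lra.
  have := hN _ _ (leqnn N) hm; rewrite -[leLHS]real_normK ?num_real//.
  by rewrite ler_pXn2r ?nnegrE// ltW// divr_gt0.
move/cvg_ex : cc => [c0 hc0]; exists c0 => e e0.
have csmall d : 0 < d -> exists N, forall m, (N <= m)%N -> (c m - c0) ^+ 2 <= d.
  move=> d0; have sd : 0 < Num.sqrt d by rewrite sqrtr_gt0.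
  have hc := hc0; move/cvgrPdist_le/(_ _ sd) : hc => [N _ hN]; exists N => m hm.
  have := hN m hm; rewrite /= distrC => hd.
  rewrite -(real_normK (num_real _)) -(sqr_sqrtr (ltW d0)).
  by rewrite lerXn2r ?nnegrE// ltW.
have cdiff m : continuous (fun x => v m x - c0 * ph x) by apply: contB => //; exact: contZ.
have inner a b d : 0 < a -> a < b -> a <= xs <= b -> b < h -> 0 < d ->
   exists N, forall m, (N <= m)%N -> J a b (fun x => G x * (v m x - c0 * ph x) ^+ 2) <= d.
  move=> a0 ab hxs bh d0; have d4 : 0 < d / 4 by lra.
  have d5 : 0 < d / 4 / (J 0 h G + 1) by exact: divr_gt0.
  have [N1 hN1] := csmall _ d4; have [N2 hN2] := w_small a0 ab hxs bh d5.
  exists (maxn N1 N2) => m; rewrite geq_max => /andP[/hN1 g1 m2].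
  have g2 : J a b (fun x => G x * w m x ^+ 2) <= d / 4.
    apply: (le_trans (JG_small (ltW d5) a0 ab bh (@cw m) (fun x => hN2 m x m2))).
    by rewrite mulrAC ler_pdivrMr// ler_pM2l// lerDl.
  have g3 : J a b (fun x => G x * ph x ^+ 2) <= 1.
    rewrite -(norm_phi i0); apply: J_sub; [exact: cGf|exact: Gf0|exact: ltW..].
  apply: (@le_trans _ _ (J a b (fun x => 2 * (G x * w m x ^+ 2 + (c m - c0) ^+ 2 * (G x * ph x ^+ 2))))).
    apply: J_le.
    - by apply: contW; exact: cGf.
    - by apply: contW; apply: contZ; apply: contD; [|apply: contZ]; exact: cGf.
    - move=> x /andP[x1 x2].
      have g : 0 <= G x by apply: Gpos; rewrite (le_trans _ x1) ?(ltW a0)//= (le_trans x2)// ltW.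
      have := ler_wpM2l g (sqr_add2 (w m x) ((c m - c0) * ph x)).
      rewrite (_ : w m x + _ = v m x - c0 * ph x); last by rewrite /w; ring.
      by move=> hle; apply: (le_trans hle); rewrite le_eqVlt; apply/orP; left; apply/eqP; ring.
  rewrite JZ; last by apply: contW; apply: contD; [|apply: contZ]; exact: cGf.
  rewrite JD; [|by apply: contW; exact: cGf|by apply: contW; apply: contZ; exact: cGf].
  rewrite JZ; last by apply: contW; exact: cGf.
  have g4 : 0 <= J a b (fun x => G x * ph x ^+ 2).
    apply: J_ge0 => x /andP[x1 x2]; apply: Gf0; rewrite (le_trans _ x1) ?(ltW a0)//=.
    by rewrite (le_trans x2)// ltW.
  by have := ler_pM (sqr_ge0 (c m - c0)) g4 g1 g3; rewrite mulr1; lra.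
have e8 : 0 < e / 8 by lra.
have [M hM] := H1 e8.
pose g0 x := G x * (v M x - c0 * ph x) ^+ 2.
have cg0 : continuous g0 by exact: cGf.
have [a [b [a0 ab bh hab hxs]]] : exists a b, [/\ 0 < a, a < b, b < h,
    J 0 h g0 - J a b g0 <= e / 8 & a <= xs <= b].
  have [[a [b [a0 ab bh hab]]]|no] := pselect (exists a b, [/\ 0 < a, a < b, b < h &
      J 0 h g0 - J a b g0 <= e / 8]); last first.
    have : J 0 h g0 <= J 0 h g0 - e / 8.
      apply: J_exhaust => // a b a0 ab bh; rewrite leNgt; apply/negP => hp; apply: no.
      by exists a, b; split => //; lra.
    lra.
  case/andP: (xs_in) => xs0 xsh.
  exists (Num.min a xs), (Num.max b xs); split.
  - by rewrite lt_min a0.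
  - by rewrite gt_min !lt_max ab.
  - by rewrite gt_max bh.
  - apply: le_trans hab; rewrite lerD2l lerN2.
    have m1 : Num.min a xs <= a by rewrite ge_min lexx.
    have m2 : b <= Num.max b xs by rewrite le_max lexx.
    rewrite -(J_cat cg0 m1 (le_trans (ltW ab) m2)) -(J_cat cg0 (ltW ab) m2).
    have Jp y z : 0 <= y -> z <= h -> 0 <= J y z g0.
      move=> y0 zh; apply: J_ge0 => x /andP[x1 x2]; apply: (@Gf0 (fun t => v M t - c0 * ph t)).
      by rewrite (le_trans y0 x1) (le_trans x2 zh).
    have p1 : 0 <= J (Num.min a xs) a g0.
      by apply: Jp; [rewrite le_min !ltW|exact: ltW (lt_trans ab bh)].
    have p2 : 0 <= J b (Num.max b xs) g0.
      by apply: Jp; [exact: ltW (lt_trans a0 ab)|rewrite ge_max !ltW].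
    lra.
  - by rewrite ge_min le_max lexx !orbT.
have e2 : 0 < e / 2 by lra.
have [N hN] := inner a b (e / 2) a0 ab hxs bh e2.
exists (maxn M N) => m; rewrite geq_max => /andP[mM /hN mN].
pose f x := G x * (v m x - c0 * ph x) ^+ 2.
pose k x := G x * (v m x - v M x) ^+ 2.
have cf : continuous f by exact: cGf.
have ck : continuous k by apply: cGf; exact: contB.
have hk : J 0 h k <= e / 8 by exact: hM.
(* As d >= 0, its integral over [a, b] is at most the one over [0, h]; this bounds the mass of f
   outside [a, b] by twice the masses of k and g0 there, each at most e / 8. *)
pose d x := 2 * (k x + g0 x) - f x.
have cd : continuous d by apply: contB => //; apply: contZ; exact: contD.
have d0 x : 0 <= x <= h -> 0 <= d x.
  move=> hx; rewrite subr_ge0; have := ler_wpM2l (Gpos hx) (sqr_add2 (v m x - v M x) (v M x - c0 * ph x)).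
  rewrite (_ : v m x - v M x + _ = v m x - c0 * ph x); last by ring.
  by move=> hle; apply: (le_trans hle); rewrite le_eqVlt; apply/orP; left; apply/eqP; rewrite /k /g0; ring.
have Jd x y : J x y d = 2 * (J x y k + J x y g0) - J x y f.
  rewrite JB; [|by apply: contW; apply: contZ; exact: contD|exact: contW].
  rewrite JZ; last by apply: contW; exact: contD.
  by rewrite JD; [|exact: contW..].
have := J_sub cd d0 (ltW a0) (ltW ab) (ltW bh); rewrite !Jd.
have kk : 0 <= J a b k.
  by apply: J_ge0 => x /andP[x1 x2]; apply: (@Gf0 (fun t => v m t - v M t)); rewrite (le_trans _ x1) ?(ltW a0)//= (le_trans x2)// ltW.
by move: mN hab hk kk; rewrite -/f; move: (J 0 h f) (J a b f) (J 0 h k) (J a b k) (J 0 h g0) (J a b g0) => A B C D F H; lra.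
Qed.

End AtEigenvalue.
End Limits.

(** * Eigenpolynomials *)

Section SymmetricEigenbasis.
Variable R : realType.

(* A complex eigenvector of a real matrix which is symmetric for a positive definite
   form yields a real one: its real or its imaginary part. *)
Lemma sym_eigenvector m (N Gam : 'M[R]_m) : (0 < m)%N -> Gam^T = Gam ->
  (N *m Gam)^T = N *m Gam -> (forall x : 'rV[R]_m, x != 0 -> 0 < (x *m Gam *m x^T) 0 0) ->
  exists (y : 'rV[R]_m) (lam : R), y != 0 /\ y *m N = lam *: y.
Proof.
move=> m0 sG sN pos.
have [lam] := @eigenvalue_closed R[i] m (map_mx (real_complex R) N) m0.
case/eigenvalueP => z hz z0.
pose x := map_mx (@complex.Re R) z; pose y := map_mx (@complex.Im R) z.
have re : x *m N = complex.Re lam *: x - complex.Im lam *: y.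
  apply/rowP => j; have := congr1 (fun M : 'rV[R[i]]_m => complex.Re (M 0 j)) hz; rewrite !mxE.
  rewrite raddf_sum /= => e; rewrite -[RHS](_ : complex.Re (lam * z 0 j) = _).
    by rewrite -e; apply: eq_bigr => i _; rewrite !mxE; case: (z 0 i) => u w /=; rewrite mulr0 subr0.
  by case: (lam) (z 0 j) => u w [u' w'].
have im : y *m N = complex.Re lam *: y + complex.Im lam *: x.
  apply/rowP => j; have := congr1 (fun M : 'rV[R[i]]_m => complex.Im (M 0 j)) hz; rewrite !mxE.
  rewrite raddf_sum /= => e; rewrite -[RHS](_ : complex.Im (lam * z 0 j) = _).
    by rewrite -e; apply: eq_bigr => i _; rewrite !mxE; case: (z 0 i) => u w /=; rewrite mulr0 add0r mulrC.
  by case: (lam) (z 0 j) => u w [u' w'] /=; rewrite [w * u']mulrC mulrC.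
pose B (s r : 'rV[R]_m) := (s *m Gam *m r^T) 0 0.
have Bsym s r : B s r = B r s.
  by rewrite /B -[in LHS](trmxK (s *m Gam *m r^T)) [LHS]mxE !trmx_mul trmxK sG mulmxA.
have BN : B (x *m N) y = B x (y *m N).
  by rewrite /B trmx_mul -(mulmxA x N) -sN trmx_mul sG !mulmxA.
have Blin c1 c2 s r w : B (c1 *: s + c2 *: r) w = c1 * B s w + c2 * B r w.
  by rewrite /B !mulmxDl -!scalemxAl mxE !(mxE _ _ 0 0).
have z_xy : x != 0 \/ y != 0.
  have [x0|] := eqVneq x 0; last by left.
  right; apply: contraNneq z0 => y0; apply/eqP/rowP => j; rewrite !mxE.
  have := congr1 (fun M : 'rV_m => M 0 j) x0; have := congr1 (fun M : 'rV_m => M 0 j) y0.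
  by rewrite !mxE; case: (z 0 j) => u w /= -> ->.
have Bge s : 0 <= B s s.
  have [->|s0] := eqVneq s 0; first by rewrite /B !mul0mx mxE.
  exact/ltW/pos.
have mu0 : complex.Im lam = 0.
  move: BN; rewrite re im -scaleNr Blin Bsym [B x _]Bsym Blin (Bsym y x) => e.
  have : complex.Im lam * (B x x + B y y) = 0.
    by move: e; move: (B x y) (B x x) (B y y) => b1 b2 b3; lra.
  have p0 : 0 < B x x + B y y.
    case: z_xy => h; first by rewrite ltr_pwDl ?Bge//; exact: pos.
    by rewrite ltr_wpDl ?Bge//; exact: pos.
  by move/eqP; rewrite mulf_eq0 (gt_eqF p0) orbF => /eqP.
rewrite mu0 !scale0r subr0 addr0 in re im.
by case: z_xy => h; [exists x, (complex.Re lam)|exists y, (complex.Re lam)].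
Qed.

(** M is self-adjoint for the form Gam, so it preserves the Gam-orthogonal complement W of the
    eigenvectors already found; [sym_eigenvector], applied to M in a basis of W, supplies the next
    one. *)
Lemma sym_eigenbasis n (M Gam : 'M[R]_n) : Gam^T = Gam -> (M *m Gam)^T = M *m Gam ->
  (forall x : 'rV[R]_n, x != 0 -> 0 < (x *m Gam *m x^T) 0 0) ->
  exists (X : 'M[R]_n) (D : 'rV[R]_n), X *m M = diag_mx D *m X /\ X *m Gam *m X^T = 1%:M.
Proof.
move=> sG sM pos.
suff key k : (k <= n)%N -> exists (X : 'M[R]_(k, n)) (D : 'rV[R]_k),
    X *m M = diag_mx D *m X /\ X *m Gam *m X^T = 1%:M by exact: key.
elim: k => [_|k IH kn].
  by exists 0, 0; split; [rewrite !mul0mx mulmx0|apply/matrixP => -[]].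
have [X [D [XM XX]]] := IH (ltnW kn).
pose W := kermx (Gam *m X^T).
have rW : (0 < \rank W)%N.
  by rewrite mxrank_ker subn_gt0 (leq_ltn_trans (rank_leq_col _)).
have [B [eB fB]] : exists B : 'M[R]_(\rank W, n), (B :=: W)%MS /\ row_free B.
  by exists (row_base W); split; [exact: eq_row_base|exact: row_base_free].
have BW : B *m (Gam *m X^T) = 0.
  by apply/sub_kermxP; rewrite eB.
have [N hN] : exists N, B *m M = N *m B.
  apply/submxP; rewrite eB; apply/sub_kermxP.
  have e : M *m Gam = Gam *m M^T by rewrite -sM trmx_mul sG.
  rewrite !mulmxA -(mulmxA B) e -!mulmxA -trmx_mul XM trmx_mul !mulmxA.
  by move: BW; rewrite !mulmxA => ->; rewrite mul0mx.
have [y [lam [y0 yN]]] : exists (y : 'rV[R]_(\rank W)) (lam : R), y != 0 /\ y *m N = lam *: y.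
  apply: (@sym_eigenvector _ N (B *m Gam *m B^T)) => //.
  - rewrite trmx_mul trmxK trmx_mul sG.
    by rewrite mulmxA.
  - rewrite !mulmxA.
    rewrite -hN !trmx_mul trmxK.
    by rewrite -(mulmxA B M Gam) -sM trmx_mul !mulmxA sG.
  - move=> x x0; have := pos (x *m B); rewrite !trmx_mul !mulmxA; apply.
    by apply: contraNneq x0 => h; rewrite -(mulmx_free_eq0 x fB) h.
pose w := y *m B.
have w0 : w != 0 by rewrite mulmx_free_eq0.
have wM : w *m M = lam *: w by rewrite /w -mulmxA hN mulmxA yN scalemxAl.
have wX : w *m Gam *m X^T = 0 by rewrite /w -!mulmxA BW mulmx0.
clearbody w.
have Xw : X *m Gam *m w^T = 0.
  by apply: trmx_inj; rewrite trmx0 !trmx_mul trmxK sG mulmxA wX.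
have b0 := pos w w0; set bb := (_ *m _) 0 0 in b0.
pose s := (Num.sqrt bb)^-1; pose w1 := s *: w.
have ss : s * s * bb = 1.
  have q0 : 0 < Num.sqrt bb by rewrite sqrtr_gt0.
  rewrite /s -[X in _ * X](sqr_sqrtr (ltW b0)) expr2; by field; rewrite gt_eqF.
have ww : w1 *m Gam *m w1^T = 1%:M.
  rewrite [LHS]mx11_scalar; congr _%:M.
  have -> : w1 *m Gam *m w1^T = (s * s) *: (w *m Gam *m w^T).
    by rewrite /w1 linearZ /= -!scalemxAl -scalemxAr scalerA.
  by rewrite mxE -/bb ss.
have e1 : (k + 1 = k.+1)%N by rewrite addn1.
suff [X' [D' h]] : exists (X : 'M[R]_(k + 1, n)) (D : 'rV[R]_(k + 1)),
    X *m M = diag_mx D *m X /\ X *m Gam *m X^T = 1%:M by rewrite -addn1; exists X', D'.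
exists (col_mx X w1), (row_mx D lam%:M); split.
  rewrite mul_col_mx XM /w1 -scalemxAl wM diag_mx_row mul_block_col !mul0mx addr0 add0r.
  congr col_mx; rewrite scalerA mulrC -scalerA.
  have -> : (lam%:M : 'rV[R]_1) = const_mx lam.
    by apply/matrixP => i j; rewrite !ord1 !mxE eqxx.
  by rewrite diag_const_mx mul_scalar_mx.
rewrite tr_col_mx mul_col_mx mul_col_row XX ww.
rewrite /w1 linearZ /= -!scalemxAr Xw -scalemxAl -scalemxAl wX !scaler0.
by rewrite -scalar_mx_block.
Qed.

End SymmetricEigenbasis.

(** * Interpolation, and zeros of polynomial solutions of second-order equations *)

Section Polynomials.
Variable R : realType.
Implicit Types (p P Q : {poly R}) (x y : R).

Lemma lagrange (s : seq R) (f : R -> R) : uniq s ->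
  exists P, (size P <= size s)%N /\ forall x, x \in s -> P.[x] = f x.
Proof.
elim: s => [_|x s IH /= /andP[xs us]]; first by exists 0; rewrite size_poly0.
have [P [sP hP]] := IH us.
pose Z := \prod_(y <- s) ('X - y%:P).
have Zx : Z.[x] != 0.
  rewrite horner_prod prodf_seq_neq0; apply/allP => y ys /=.
  by rewrite !hornerE subr_eq0; apply: contraNneq xs => ->.
exists (P + ((f x - P.[x]) / Z.[x]) *: Z); split.
  apply: (leq_trans (size_polyD _ _)); rewrite geq_max (leq_trans sP)//=.
  by apply: (leq_trans (size_scale_leq _ _)); rewrite size_prod_XsubC.
move=> y; rewrite inE => /predU1P[->|ys].
  by rewrite !hornerE divfK// addrC subrK.
rewrite hornerD hornerZ (_ : Z.[y] = 0) ?mulr0 ?addr0; first exact: hP.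
by apply/eqP; rewrite -rootE /Z root_prod_XsubC.
Qed.

Lemma finite_zeros (Z : R -> Prop) n :
  (forall s : seq R, uniq s -> (forall x, x \in s -> Z x) -> (size s <= n)%N) ->
  exists s : seq R, [/\ uniq s, (size s <= n)%N & forall x, x \in s <-> Z x].
Proof.
move=> hn.
pose Pr k := `[< exists s : seq R, [/\ uniq s, forall x, x \in s -> Z x & size s = k] >].
have e0 : exists k, Pr k by exists 0%N; apply/asboolP; exists [::].
have eb k : Pr k -> (k <= n)%N by move/asboolP => [s [us hs <-]]; exact: hn.
case: (ex_maxnP e0 eb) => k /asboolP[s [us hs sk]] hmax.
exists s; split => //; first exact: hn.
move=> x; split; first exact: hs.
move=> zx; apply: contrapT => xs.
have /hmax : Pr k.+1.
  apply/asboolP; exists (x :: s); split => /=; [by rewrite us andbT; apply/negP| |by rewrite sk].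
  by move=> y; rewrite inE => /predU1P[->//|/hs].
by rewrite ltnn.
Qed.

Section SecondOrder.
Variables (T S Q0 P : {poly R}).
Hypotheses (P0 : P != 0) (ode : T * P^`()^`() + S * P^`() + Q0 * P = 0).

(* Comparison of the lowest powers of 'X - x in the equation *)
Let factor x : exists m Q, ~~ root Q x /\ P = Q * ('X - x%:P) ^+ m.
Proof. by have [m [Q h e]] := multiplicity_XsubC P x; exists m, Q; rewrite P0 in h. Qed.

Let dXm x m : (('X - x%:P) ^+ m.+1)^`() = ('X - x%:P) ^+ m *+ m.+1 :> {poly R}.
Proof. by rewrite deriv_exp derivXsubC mul1r. Qed.

(** At a zero of order m + 2 the term T P'' has order exactly m, whereas the two other terms have
    order at least m + 1. *)
Lemma ode_simple_root x : T.[x] != 0 -> P.[x] = 0 -> P^`().[x] != 0.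
Proof.
move=> Tx Px; apply/eqP => P1x.
have [m [Q [Qx eP]]] := factor x.
case: m eP => [|[|m]] eP.
- by move: Px; rewrite eP expr0 mulr1 => /eqP; apply/negP.
- move: P1x; rewrite eP expr1 derivM derivXsubC !hornerE subrr mulr0 add0r.
  by move/eqP; apply/negP.
pose Y := 'X - x%:P : {poly R}.
have d1 : P^`() = Y ^+ m.+1 * (Q^`() * Y + Q *+ m.+2).
  by rewrite eP derivM dXm exprS -/Y; ring.
have d2 : P^`()^`() = Y ^+ m * ((Q^`() * Y + Q *+ m.+2) *+ m.+1 + Y * (Q^`() * Y + Q *+ m.+2)^`()).
  by rewrite d1 derivM dXm exprS -/Y; ring.
have : Y ^+ m * (T * ((Q^`() * Y + Q *+ m.+2) *+ m.+1 + Y * (Q^`() * Y + Q *+ m.+2)^`())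
   + Y * (S * (Q^`() * Y + Q *+ m.+2) + Q0 * Q * Y)) = 0.
  by rewrite -[RHS]ode d2 d1 [in Q0 * P]eP -/Y !exprS; ring.
have Yx : Y.[x] = 0 by rewrite hornerXsubC subrr.
set A := Q^`() * Y + Q *+ m.+2.
have Ax : A.[x] = Q.[x] *+ m.+2 by rewrite hornerD hornerM Yx mulr0 add0r hornerMn.
move/eqP; rewrite mulf_eq0 expf_eq0 polyXsubC_eq0 andbF /= => /eqP/(congr1 (fun p => p.[x])).
rewrite hornerD hornerM [(Y * _).[x]]hornerM Yx mul0r addr0 hornerD hornerMn.
rewrite [(Y * _).[x]]hornerM Yx mul0r addr0 Ax horner0 => /eqP.
by rewrite mulf_eq0 (negPf Tx) !mulrn_eq0 /= -rootE (negPf Qx).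
Qed.

(** The indicial equation: a zero of order m + 1 at x requires m T1 (x) + S (x) = 0, which is
    impossible when T1 (x) and S (x) have the same sign. *)
Lemma ode_regular_singular x T1 : T = T1 * ('X - x%:P) -> 0 < T1.[x] * S.[x] -> P.[x] != 0.
Proof.
move=> eT TS; apply/eqP => Px.
have [m [Q [Qx eP]]] := factor x.
case: m eP => [|m] eP.
  by move: Px; rewrite eP expr0 mulr1 => /eqP; apply/negP.
pose Y := 'X - x%:P : {poly R}.
have d1 : P^`() = Y ^+ m * (Q^`() * Y + Q *+ m.+1).
  by rewrite eP derivM dXm exprS -/Y; ring.
have d2 : Y * P^`()^`() = Y ^+ m * ((Q^`() * Y + Q *+ m.+1) *+ m + Y * (Q^`() * Y + Q *+ m.+1)^`()).
  rewrite d1 derivM; case: (m) => [|k]; first by rewrite expr0 derivC; ring.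
  by rewrite dXm exprS -/Y; ring.
have : Y ^+ m * (T1 * ((Q^`() * Y + Q *+ m.+1) *+ m + Y * (Q^`() * Y + Q *+ m.+1)^`())
   + S * (Q^`() * Y + Q *+ m.+1) + Q0 * Q * Y) = 0.
  transitivity (T1 * (Y * P^`()^`()) + S * P^`() + Q0 * P).
    by rewrite d2 d1 [in Q0 * P]eP -/Y !exprS; ring.
  by rewrite -[RHS]ode eT -/Y; ring.
have Yx : Y.[x] = 0 by rewrite hornerXsubC subrr.
set A := Q^`() * Y + Q *+ m.+1.
have Ax : A.[x] = Q.[x] *+ m.+1 by rewrite hornerD hornerM Yx mulr0 add0r hornerMn.
move/eqP; rewrite mulf_eq0 expf_eq0 polyXsubC_eq0 andbF /= => /eqP/(congr1 (fun p => p.[x])).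
rewrite hornerD [(_ * Y).[x]]hornerM Yx mulr0 addr0 hornerD [(S * _).[x]]hornerM hornerM hornerD hornerMn.
rewrite [(Y * _).[x]]hornerM Yx mul0r addr0 Ax horner0 => e.
have : (T1.[x] *+ m + S.[x]) * (Q.[x] *+ m.+1) = 0.
  by rewrite -[RHS]e mulrDl mulrnAl mulrnAr.
move/eqP; rewrite mulf_eq0 mulrn_eq0 /= -rootE (negPf Qx) orbF => /eqP h.
have : T1.[x] * (T1.[x] *+ m + S.[x]) = 0 by rewrite h mulr0.
rewrite mulrDr mulrnAr => e2; have := mulrn_wge0 m (sqr_ge0 T1.[x]).
by rewrite expr2; move: e2 TS; lra.
Qed.

End SecondOrder.
End Polynomials.

Section PowerTools.
Variable R : realType.
Implicit Types (f : R -> R) (r x y : R).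

Lemma powR_pred y r : 0 < y -> y `^ (r - 1) = y `^ r / y.
Proof.
move=> y0; have yn : y != 0 by rewrite gt_eqF.
by rewrite powRB ?yn ?implybT// powRr1// ltW.
Qed.

Lemma cont_powR f r : 0 < r -> (forall x, 0 <= f x) -> continuous f -> continuous (fun x => f x `^ r).
Proof.
move=> r0 f0 cf x; have [fx|fx] := eqVneq (f x) 0; last first.
  have fp : 0 < f x by rewrite lt_neqAle eq_sym fx f0.
  apply: (@cvg_comp _ _ _ f (fun y => y `^ r) _ _ _ (cf x)).
  exact: (isd_cont (isd_powR r (f := fun z => z) fp (isdI _))).
apply/cvgrPdist_le => e e0; rewrite fx powR0 ?gt_eqF//.
have ep : 0 < e `^ r^-1 by exact: powR_gt0.
have hcf := cf x; move/cvgrPdist_le/(_ _ ep) : hcf; rewrite fx => hcf; near=> y.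
have : `|0 - f y| <= e `^ r^-1 by near: y.
rewrite !sub0r !normrN !ger0_norm ?powR_ge0// => h.
have := ge0_ler_powR (ltW r0) (f0 y) (ltW ep) h.
by rewrite -powRrM mulVf ?gt_eqF// powRr1// ltW.
Unshelve. all: by end_near. Qed.

Lemma isd_horner (P : {poly R}) f x c : der x f c -> der x (fun y => P.[f y]) (P^`().[f x] * c).
Proof.
move=> df; elim/poly_ind: P => [|P k IH].
  rewrite (_ : (fun y => _) = (fun=> 0)); last by apply/funext => y; rewrite horner0.
  by apply: isd_eq (isdC 0 x) _; rewrite deriv0 horner0 mul0r.
rewrite (_ : (fun y => _) = (fun y => P.[f y] * f y + k)); last first.
  by apply/funext => y; rewrite !hornerE.
apply: isd_eq (isdD (isdM IH df) (isdC k x)) _.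
by rewrite derivD derivM derivX derivC !hornerE; ring.
Qed.

Lemma smooth_horner (P : {poly R}) f : smooth f -> smooth (fun y => P.[f y]).
Proof.
move=> sf; elim/poly_ind: P => [|P k IH].
  by rewrite (_ : (fun y => _) = (fun=> 0)); [exact: smooth_cst|apply/funext => y; rewrite horner0].
rewrite (_ : (fun y => _) = (fun y => P.[f y] * f y + k)); last first.
  by apply/funext => y; rewrite !hornerE.
by apply: smoothD; [exact: smoothM|exact: smooth_cst].
Qed.

Lemma poly_ext (P Q : {poly R}) : (forall x, P.[x] = Q.[x]) -> P = Q.
Proof.
move=> h; apply/eqP; rewrite -subr_eq0; apply/negPn/negP => n0.
have us : uniq [seq (i%:R : R) | i <- iota 0 (size (P - Q))].
  by rewrite map_inj_uniq ?iota_uniq //; apply: mulrIn; rewrite oner_eq0.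
have := max_poly_roots n0 _ us; rewrite size_map size_iota ltnn => h2.
suff : false by []; apply: h2; apply/allP => x _.
by rewrite rootE hornerD hornerN h subrr.
Qed.

End PowerTools.

(** * The Heun operator on polynomials in t *)

Section Concrete.
Variables (R : realType) (p : R) (t u v : R -> R) (a b l0 l1 l2 l3 a2 a3 : R) (d : nat).
Hypotheses (hun : uniformizer p t u v a b) (hl0 : 0 < l0) (hl1 : 0 < l1)
  (ha2 : a2 = - l2 \/ a2 = l2 + 1) (ha3 : a3 = - l3 \/ a3 = l3 + 1)
  (hd : d%:R = - ((l0 + l1) / 2) - 1 - (a2 + a3) / 2).
Implicit Types (x y : R) (P Q : {poly R}).

Definition regular x := (sin (pi * x) != 0) && (cos (pi * x) != 0).

Lemma regular_half x : 0 < x < 2^-1 -> regular x.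
Proof.
case/andP => x0 x1; have q0 := @pi_gt0 R; apply/andP; split; rewrite gt_eqF//.
  by apply: sin_gt0_pi; move: q0; move: (pi : R) => q q0; apply/andP; split; nra.
by apply: cos_gt0_pihalf; move: q0; move: (pi : R) => q q0; apply/andP; split; nra.
Qed.

Lemma smooth_t : smooth t.
Proof.
rewrite (_ : t = fun x => sin (pi * x) ^+ 2 * u x); last by apply/funext => x; rewrite (un_t hun).
by apply: smoothM; [apply: smoothX; exact: smooth_sin|exact: (un_su hun)].
Qed.

Lemma t_ge0 x : 0 <= t x.
Proof. by rewrite (un_t hun) mulr_ge0 ?sqr_ge0// ltW// (un_u hun). Qed.
Lemma at_ge0 x : 0 <= 1 - a * t x.
Proof. by rewrite (un_at hun) mulr_ge0 ?sqr_ge0// ltW// (un_v hun). Qed.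
Lemma t_gt0 x : regular x -> 0 < t x.
Proof. by case/andP => s _; rewrite (un_t hun) mulr_gt0 ?exprn_even_gt0// (un_u hun). Qed.
Lemma at_gt0 x : regular x -> 0 < 1 - a * t x.
Proof. by case/andP => _ c; rewrite (un_at hun) mulr_gt0 ?exprn_even_gt0// (un_v hun). Qed.
Lemma bt_gt0 x : 0 < 1 - b * t x. Proof. exact: (un_bt hun). Qed.

Lemma t_0 : t 0 = 0. Proof. by rewrite (un_t hun) mulr0 sin0 expr0n mul0r. Qed.
Lemma t_half : a * t 2^-1 = 1.
Proof.
apply/eqP; rewrite eq_sym -subr_eq0 (un_at hun).
by rewrite cos_pihalf expr0n mul0r.
Qed.

Definition tauh : {poly R} := (1%:P - a%:P * 'X) * (1%:P - b%:P * 'X).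
Definition tauP : {poly R} := 'X * tauh.
(** The quotient gP / tauP is the logarithmic derivative in t of the weight t^(l0+1) (1 - a
    t)^(l1+1) (1 - b t)^a3. *)
Definition gP : {poly R} := (l0 + 1)%:P * tauh - (a * (l1 + 1))%:P * 'X * (1%:P - b%:P * 'X)
  - (a3 * b)%:P * 'X * (1%:P - a%:P * 'X).
(** The polynomial q0 + q1 t is what remains of the potential once the gauge exponents have
    cancelled its poles in t ([potential_formula]). In q1 the degree relation has been used to write
    the coefficient through d and a2. *)
Definition q0 : R := let al0 := (l0 + 1) / 2 in let al1 := (l1 + 1) / 2 in let al3 := a3 / 2 in
  wp_e p 2 * (l0 * (l0 + 1) + l1 * (l1 + 1) + l2 * (l2 + 1) + l3 * (l3 + 1)) +
  l1 * (l1 + 1) * a + l3 * (l3 + 1) * b + l0 * (l0 + 1) * (a + b) + 2 * al0 * (a + b) +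
  2 * a * al1 + 2 * b * al3 + 8 * a * al0 * al1 + 8 * b * al0 * al3.
Definition q1 : R := - (a * b * (2 * d%:R * (2 * d%:R + 2 * a2 - 1))).
Definition qP : {poly R} := q0%:P + q1%:P * 'X.
(** The operator w |-> - G^-1 (G w')' + q w in the variable t, obtained from t'^2 = 4 tauP (t), t''
    = 2 tauP' (t) and G' / G = t' gP / tauP. *)
Definition Lop P : {poly R} :=
  - 4%:P * (tauP * P^`()^`()) - (4%:P * gP + 2%:P * tauP^`()) * P^`() + qP * P.

Lemma tauP_horner y : tauP.[y] = y * (1 - a * y) * (1 - b * y).
Proof. by rewrite /tauP /tauh !(hornerM, hornerD, hornerN, hornerX, hornerC, hornerXn, horner0); ring. Qed.

Lemma dtauP_horner y : tauP^`().[y] = 1 - 2 * (a + b) * y + 3 * a * b * y ^+ 2.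
Proof. by rewrite /tauP /tauh !(derivM, derivB, derivX, derivC) !(hornerM, hornerD, hornerN, hornerX, hornerC, hornerXn, horner0); ring. Qed.

Lemma gP_horner y : gP.[y] = (l0 + 1) * ((1 - a * y) * (1 - b * y)) - a * (l1 + 1) * y * (1 - b * y)
  - a3 * b * y * (1 - a * y).
Proof. by rewrite /gP /tauh !(hornerM, hornerD, hornerN, hornerX, hornerC, hornerXn, horner0); ring. Qed.

Lemma qP_horner y : qP.[y] = q0 + q1 * y.
Proof. by rewrite /qP !(hornerM, hornerD, hornerN, hornerX, hornerC, hornerXn, horner0). Qed.

Lemma Lop_horner P y : (Lop P).[y] = - 4 * (tauP.[y] * P^`()^`().[y]) -
  (4 * gP.[y] + 2 * tauP^`().[y]) * P^`().[y] + qP.[y] * P.[y].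
Proof. by rewrite /Lop !(hornerD, hornerM, hornerN, hornerC). Qed.

Lemma LopD P Q : Lop (P + Q) = Lop P + Lop Q.
Proof. by rewrite /Lop !derivD; ring. Qed.
Lemma LopZ k P : Lop (k *: P) = k *: Lop P.
Proof. by rewrite /Lop !derivZ -!mul_polyC; ring. Qed.

Lemma size_lin (c1 c2 : R) : (size ((c1%:P + c2%:P * 'X)%R : {poly R}) <= 2)%N.
Proof.
apply: (leq_trans (size_polyD _ _)); rewrite geq_max (leq_trans (size_polyC_leq1 _))//=.
by rewrite mul_polyC (leq_trans (size_scale_leq _ _))// size_polyX.
Qed.

Lemma size_quad (c0 c1 c2 : R) : (size ((c0%:P + c1%:P * 'X + c2%:P * 'X^2)%R : {poly R}) <= 3)%N.
Proof.
apply: (leq_trans (size_polyD _ _)); rewrite geq_max (leq_trans (size_lin _ _))//=.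
by rewrite mul_polyC (leq_trans (size_scale_leq _ _))// size_polyXn.
Qed.

Lemma size_mul_le P Q m n : (size P <= m.+1)%N -> (size Q <= n)%N -> (size (P * Q)%R <= m + n)%N.
Proof.
move=> hP hQ; apply: (leq_trans (size_polyMleq _ _)).
by have := leq_add hP hQ; rewrite addSn; case: (size P + size Q)%N.
Qed.

Lemma size_LopX n : (n <= d)%N -> (size (Lop 'X^n) <= d.+1)%N.
Proof.
move=> nd.
(* A n, B n and C n are the coefficients of t^(n-1), t^n and t^(n+1) in the image of t^n. The degree
   relation enters as C d = 0: it stops the raising of degrees at d. *)
pose C n : R := - 4 * n%:R * (n%:R - 1) * (a * b) - n%:R * (4 * ((l0 + 1) + (l1 + 1) + a3) * (a * b) + 6 * (a * b)) + q1.
pose B n : R := 4 * n%:R * (n%:R - 1) * (a + b) + n%:R * (4 * ((l0 + 1) * (a + b) + a * (l1 + 1) + a3 * b) + 4 * (a + b)) + q0.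
pose A n : R := - 4 * n%:R * (n%:R - 1) - n%:R * (4 * (l0 + 1) + 2).
have Cd : C d = 0.
  have e : l0 = - l1 - 2 - a2 - a3 - 2 * d%:R by rewrite hd; field.
  by rewrite /C /q1 e; ring.
case: n nd => [_|n nd].
  have -> : Lop 'X^0 = (B 0%N)%:P + (C 0%N)%:P * 'X.
    apply: poly_ext => y; rewrite Lop_horner expr0 -polyC1 !derivC /B /C qP_horner !(hornerM, hornerD, hornerN, hornerX, hornerC, hornerXn, horner0); ring.
  case: (d) Cd => [Cd|d' _]; last exact: leq_trans (size_lin _ _) _.
  by rewrite Cd mul0r addr0 size_polyC_leq1.
have e : Lop 'X^(n.+1) = 'X^n * ((A n.+1)%:P + (B n.+1)%:P * 'X + (C n.+1)%:P * 'X^2).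
  apply: poly_ext => y; rewrite Lop_horner tauP_horner dtauP_horner gP_horner qP_horner.
  have ez : y * (y ^+ n.-1 *+ n) = n%:R * y ^+ n.
    by rewrite mulr_natl; case: (n) => [|k]; rewrite ?mulr0n ?mulr0// mulrnAr -exprS.
  rewrite !derivXn derivMn derivXn -pred_Sn !(hornerM, hornerD, hornerC, hornerX, hornerXn, hornerMn).
  move: (y ^+ n.-1 *+ n) ez => z ez; apply/eqP; rewrite -subr_eq0; apply/eqP.
  transitivity (- 4 * (n%:R + 1) * (1 - a * y) * (1 - b * y) * (y * z - n%:R * y ^+ n)).
    rewrite /A /B /C [y ^+ n.+1]exprS -[z *+ _]mulr_natl -[y ^+ n *+ _]mulr_natl -(natr1 n).
    by move: (y ^+ n) (n%:R : R) => Y N; ring.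
  by rewrite ez subrr mulr0.
rewrite e; move: nd; rewrite leq_eqVlt => /predU1P[nd|nd].
  have -> : C n.+1 = 0 by rewrite nd.
  rewrite mul0r addr0; apply: (@leq_trans (n + 2)%N); last by rewrite -nd addn2.
  by apply: size_mul_le; [rewrite size_polyXn|exact: size_lin].
apply: (@leq_trans (n + 3)%N); last by rewrite addn3.
by apply: size_mul_le; [rewrite size_polyXn|exact: size_quad].
Qed.

Lemma size_Lop P : (size P <= d.+1)%N -> (size (Lop P) <= d.+1)%N.
Proof.
move=> sP; rewrite -(coefK P) poly_def.
have hs (s : seq 'I_(size P)) : (size (Lop (\sum_(i <- s) P`_i *: 'X^i)) <= d.+1)%N.
  elim: s => [|i s IH].
    by rewrite big_nil -(scale0r (0 : {poly R})) LopZ scale0r size_poly0.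
  rewrite big_cons LopD LopZ; apply: (leq_trans (size_polyD _ _)).
  rewrite geq_max IH andbT; apply: (leq_trans (size_scale_leq _ _)); apply: size_LopX.
  by rewrite -ltnS (leq_trans (ltn_ord i)).
exact: hs.
Qed.

(** The weight divided by tauP (t). Its exponents l0 and l1 are still positive, so that both the
    weight [wG] and its derivative [wG1] are continuous and vanish at the zeros of sin and cos. *)
Definition rho x := t x `^ l0 * (1 - a * t x) `^ l1 * (1 - b * t x) `^ (a3 - 1).
Definition wG x := rho x * tauP.[t x].
Definition wG1 x := rho x * gP.[t x] * derive1 t x.
Definition qf x := qP.[t x].

Lemma cont_t : continuous t. Proof. exact: (smooth_cont smooth_t). Qed.

Lemma cont_horner P : continuous (fun x => P.[t x]).
Proof. by apply: (smooth_cont (f := fun x => P.[t x])); exact: smooth_horner smooth_t. Qed.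

Lemma cont_rho : continuous rho.
Proof.
apply: contM; first apply: contM.
- exact: cont_powR hl0 t_ge0 cont_t.
- apply: cont_powR hl1 at_ge0 _.
  by apply: contB; [exact: contC|apply: contZ; exact: cont_t].
- apply: (smooth_cont (f := fun x => (1 - b * t x) `^ (a3 - 1))).
  apply: smooth_powR; first exact: bt_gt0.
  by apply: smoothB; [exact: smooth_cst|apply: smoothZ; exact: smooth_t].
Qed.

Lemma cont_wG : continuous wG.
Proof. by apply: contM; [exact: cont_rho|exact: cont_horner]. Qed.
Lemma cont_wG1 : continuous wG1.
Proof.
apply: contM; last exact: (smooth_cont (smooth_derive1 smooth_t)).
by apply: contM; [exact: cont_rho|exact: cont_horner].
Qed.
Lemma cont_qf : continuous qf. Proof. exact: cont_horner. Qed.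

Lemma tauP_gt0 x : regular x -> 0 < tauP.[t x].
Proof. by move=> h; rewrite tauP_horner !mulr_gt0 ?t_gt0 ?at_gt0 ?bt_gt0. Qed.

Lemma rho_gt0 x : regular x -> 0 < rho x.
Proof. by move=> h; rewrite /rho !mulr_gt0// powR_gt0 ?t_gt0 ?at_gt0 ?bt_gt0. Qed.

Lemma wG_gt0 x : regular x -> 0 < wG x.
Proof. by move=> h; rewrite /wG mulr_gt0 ?rho_gt0 ?tauP_gt0. Qed.

Lemma rho_0 x : ~~ regular x -> rho x = 0.
Proof.
rewrite negb_and !negbK => /orP[/eqP h|/eqP h].
  have -> : rho x = 0 `^ l0 * (1 - a * t x) `^ l1 * (1 - b * t x) `^ (a3 - 1).
    by rewrite /rho (un_t hun) h expr0n mul0r.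
  by rewrite powR0 ?gt_eqF// !mul0r.
have -> : rho x = t x `^ l0 * 0 `^ l1 * (1 - b * t x) `^ (a3 - 1).
  by rewrite /rho (un_at hun) h expr0n mul0r.
by rewrite powR0 ?gt_eqF// mulr0 mul0r.
Qed.

Lemma wG_0 : wG 0 = 0.
Proof. by rewrite /wG rho_0 ?mul0r// /regular mulr0 sin0 eqxx. Qed.
Lemma wG_half : wG 2^-1 = 0.
Proof. by rewrite /wG rho_0 ?mul0r// /regular cos_pihalf eqxx andbF. Qed.

Lemma d_wG x : regular x -> der x wG (wG1 x).
Proof.
move=> hx; have t0 := t_gt0 hx; have at0 := at_gt0 hx; have bt0 := bt_gt0 x.
have dt := smooth_isd x smooth_t.
have d1 := isd_powR l0 t0 dt.
have d2 := isd_powR l1 (f := fun y => 1 - a * t y) at0 (isdB (isdC 1 x) (isdM (isdC a x) dt)).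
have d3 := isd_powR (a3 - 1) (f := fun y => 1 - b * t y) bt0 (isdB (isdC 1 x) (isdM (isdC b x) dt)).
have dd := isdM (isdM (isdM d1 d2) d3) (isd_horner tauP dt).
apply: isd_eq dd _; rewrite /wG1 /rho !powR_pred// gP_horner tauP_horner dtauP_horner.
move: (derive1 t x) (t x `^ l0) ((1 - a * t x) `^ l1) ((1 - b * t x) `^ a3) (t x) t0 at0 bt0.
move=> t' X Y Z T h1 h2 h3; field.
by rewrite !gt_eqF.
Qed.

Lemma dt_neq0 x : regular x -> derive1 t x != 0.
Proof.
move=> hx; rewrite -sqrf_eq0 (un_ode hun) gt_eqF// -!mulrA mulr_gt0//.
by have := tauP_gt0 hx; rewrite tauP_horner mulrA.
Qed.

Lemma dt_sqr x : derive1 t x ^+ 2 = 4 * tauP.[t x].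
Proof. by rewrite (un_ode hun) tauP_horner; ring. Qed.

Lemma d2t x : regular x -> derive1 (derive1 t) x = 2 * tauP^`().[t x].
Proof.
move=> hx; have d1 := smooth_isd x smooth_t; have d2 := smooth_isd x (smooth_derive1 smooth_t).
have e : (fun y => derive1 t y ^+ 2) = (fun y => 4 * tauP.[t y]).
  by apply/funext => y; exact: dt_sqr.
have dL := isdX 2 d2; rewrite e in dL.
have dR := isdM (isdC 4 x) (isd_horner tauP d1).
have := isd_uniq dL dR; rewrite /= expr1 mul0r add0r => h.
apply: (mulfI (dt_neq0 hx)); apply: (mulfI (x := 2)); first by rewrite pnatr_eq0.
move: h; move: (derive1 t x) (derive1 (derive1 t) x) (tauP^`().[t x]) => A B C h.
by rewrite mulrA h; ring.
Qed.

Lemma derive1_horner P : derive1 (fun y => P.[t y]) = fun x => P^`().[t x] * derive1 t x.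
Proof. by apply/funext => x; apply: isd_derive1; apply: isd_horner; exact: (smooth_isd x smooth_t). Qed.

Lemma K_poly P x : K wG wG1 qf (fun y => P.[t y]) x = wG x * (Lop P).[t x].
Proof.
rewrite /K derive1_horner.
have d1 := smooth_isd x smooth_t; have d2 := smooth_isd x (smooth_derive1 smooth_t).
rewrite (isd_derive1 (isdM (isd_horner P^`() d1) d2)).
have [hx|hx] := boolP (regular x); last by rewrite /wG /wG1 rho_0// !mul0r; ring.
rewrite d2t// Lop_horner /wG /wG1 /qf.
have := dt_sqr x.
move: (derive1 t x) (P^`()^`().[t x]) (P^`().[t x]) (P.[t x]) (rho x) (gP.[t x]) (qP.[t x])
  (tauP^`().[t x]) (tauP.[t x]) => t' p2 p1 p0 r g q T' T e.
rewrite [LHS](_ : _ = r * (- g * p1 * t' ^+ 2 - T * (p2 * t' ^+ 2 + p1 * (2 * T')) + T * q * p0)); last by ring.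
by rewrite e; ring.
Qed.

End Concrete.

(** * Conjugation of the Hamiltonian into Sturm-Liouville form *)

Section PointwiseHamiltonian.
Variables (R : realType) (p : R) (t u v : R -> R) (a b l0 l1 l2 l3 a2 a3 : R) (d : nat).
Hypotheses (hun : uniformizer p t u v a b) (hl0 : 0 < l0) (hl1 : 0 < l1)
  (ha2 : a2 = - l2 \/ a2 = l2 + 1) (ha3 : a3 = - l3 \/ a3 = l3 + 1)
  (hd : d%:R = - ((l0 + l1) / 2) - 1 - (a2 + a3) / 2).
Implicit Types (x y : R) (w r : R -> R).
Local Notation G := (wG t a b l0 l1 a3).
Local Notation G1 := (wG1 t a b l0 l1 a3).
Local Notation q := (qf p t a b l0 l1 l2 l3 a2 a3 d).
Local Notation gauge := (gauge l0 l1).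
Local Notation pot := (potential l0 l1 l2 l3 p).

(** [theta] is the square root of the weight. The gauge contributes its factors |sin| and |cos|, and
    [hh] the remaining ones, which are smooth and positive. *)
Definition hh x := u x `^ ((l0 + 1) / 2) * v x `^ ((l1 + 1) / 2) * (1 - b * t x) `^ (a3 / 2).

Lemma hh_gt0 x : 0 < hh x.
Proof. by rewrite /hh !mulr_gt0// powR_gt0 ?(un_u hun) ?(un_v hun) ?(un_bt hun). Qed.

Lemma smooth_hh : smooth hh.
Proof.
apply: smoothM; first apply: smoothM.
- exact: smooth_powR (un_u hun) (un_su hun).
- exact: smooth_powR (un_v hun) (un_sv hun).
- apply: (@smooth_powR _ (fun x => 1 - b * t x)); first exact: (un_bt hun).
  by apply: smoothB; [exact: smooth_cst|apply: smoothZ; exact: smooth_t hun].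
Qed.

Lemma tN x : t (- x) = t x.
Proof. by rewrite !(un_t hun) (un_uN hun) mulrN sinN sqrrN. Qed.
Lemma tper x : t (x + 1) = t x.
Proof. by rewrite !(un_t hun) (un_uP hun) sin2_per. Qed.
Lemma hhN x : hh (- x) = hh x.
Proof. by rewrite /hh (un_uN hun) (un_vN hun) tN. Qed.
Lemma hhper x : hh (x + 1) = hh x.
Proof. by rewrite /hh (un_uP hun) (un_vP hun) tper. Qed.

Lemma norm_powR2 x (r : R) : `|x| `^ r = (x ^+ 2) `^ (r / 2).
Proof.
have h : `|x| ^+ 2 = `|x| `^ 2%:R by rewrite powR_mulrn.
by rewrite -(real_normK (num_real x)) h -powRrM; congr (_ `^ _); field.
Qed.

Definition theta x := t x `^ ((l0 + 1) / 2) * (1 - a * t x) `^ ((l1 + 1) / 2) *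
  (1 - b * t x) `^ (a3 / 2).

Lemma gauge_hh x : gauge x * hh x = theta x.
Proof.
rewrite /Defs.gauge /hh /theta !norm_powR2.
have e0 : t x `^ ((l0 + 1) / 2) = (sin (pi * x) ^+ 2) `^ ((l0 + 1) / 2) * u x `^ ((l0 + 1) / 2).
  by rewrite (un_t hun x) (powRM _ (sqr_ge0 _) (ltW (un_u hun x))).
have e1 : (1 - a * t x) `^ ((l1 + 1) / 2) = (cos (pi * x) ^+ 2) `^ ((l1 + 1) / 2) * v x `^ ((l1 + 1) / 2).
  by rewrite (un_at hun x) (powRM _ (sqr_ge0 _) (ltW (un_v hun x))).
rewrite e0 e1; move: (_ `^ _) (_ `^ _) (_ `^ _) (_ `^ _) (_ `^ _) => X Y Z T U; ring.
Qed.

Lemma theta_sqr x : theta x ^+ 2 = G x.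
Proof.
have sq (y r : R) : 0 <= y -> (y `^ (r / 2)) ^+ 2 = y `^ r.
  by move=> y0; rewrite -powR_mulrn ?powR_ge0// -powRrM; congr (_ `^ _); field.
have t0 := t_ge0 hun x; have at0 := at_ge0 hun x; have bt0 := ltW (un_bt hun x).
have e0 := mulr_powRB1 t0 (addr_gt0 hl0 ltr01); rewrite addrK in e0.
have e1 := mulr_powRB1 at0 (addr_gt0 hl1 ltr01); rewrite addrK in e1.
have e3 : (1 - b * t x) * (1 - b * t x) `^ (a3 - 1) = (1 - b * t x) `^ a3.
  by rewrite powR_pred ?(un_bt hun)// mulrC divfK// gt_eqF// (un_bt hun).
rewrite /theta !exprMn !sq// /wG /rho tauP_horner -e0 -e1 -e3; ring.
Qed.

Lemma gauge_neq0 x : regular x -> gauge x != 0.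
Proof.
by case/andP => hs hc; rewrite /Defs.gauge mulf_neq0// gt_eqF// powR_gt0// normr_gt0.
Qed.

Lemma regular_near x : regular x -> \forall y \near x, regular y.
Proof.
move=> /andP[hs hc].
have c1 : continuous (fun y : R => sin (pi * y)) by apply: smooth_cont; exact: smooth_sin.
have c2 : continuous (fun y : R => cos (pi * y)) by apply: smooth_cont; exact: smooth_cos.
near=> y; apply/andP; split; near: y.
  by apply: (cvgr_neq0 _ (c1 x)).
by apply: (cvgr_neq0 _ (c2 x)).
Unshelve. all: by end_near. Qed.

(** The logarithmic derivative of [theta] with respect to t; [omt] is the derivative of [om] with
    respect to t. *)
Let om x := (l0 + 1) / 2 / t x - a * ((l1 + 1) / 2) / (1 - a * t x) - b * (a3 / 2) / (1 - b * t x).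
Let omt x := - ((l0 + 1) / 2 / t x ^+ 2) - a ^+ 2 * ((l1 + 1) / 2) / (1 - a * t x) ^+ 2
  - b ^+ 2 * (a3 / 2) / (1 - b * t x) ^+ 2.

Let d_theta x : regular x -> der x theta (theta x * (derive1 t x * om x)).
Proof.
move=> hx; have t0 := t_gt0 hun hx; have at0 := at_gt0 hun hx; have bt0 := bt_gt0 hun x.
have dt := smooth_isd x (smooth_t hun).
have d1 := isd_powR ((l0 + 1) / 2) t0 dt.
have d2 := isd_powR ((l1 + 1) / 2) (f := fun y => 1 - a * t y) at0 (isdB (isdC 1 x) (isdM (isdC a x) dt)).
have d3 := isd_powR (a3 / 2) (f := fun y => 1 - b * t y) bt0 (isdB (isdC 1 x) (isdM (isdC b x) dt)).
apply: isd_eq (isdM (isdM d1 d2) d3) _; rewrite /theta /om !powR_pred//.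
move: (derive1 t x) (t x `^ ((l0 + 1) / 2)) ((1 - a * t x) `^ ((l1 + 1) / 2)) ((1 - b * t x) `^ (a3 / 2)) (t x) t0 at0 bt0.
by move=> t' X Y Z T h1 h2 h3; field; rewrite !gt_eqF.
Qed.

Let d_om x : regular x -> der x om (derive1 t x * omt x).
Proof.
move=> hx; have t0 := t_gt0 hun hx; have at0 := at_gt0 hun hx; have bt0 := bt_gt0 hun x.
have tn : t x != 0 by rewrite gt_eqF.
have an : 1 - a * t x != 0 by rewrite gt_eqF.
have bn : 1 - b * t x != 0 by rewrite gt_eqF.
have dt := smooth_isd x (smooth_t hun).
have d1 := isdM (isdC ((l0 + 1) / 2) x) (isdV tn dt).
have d2 := isdM (isdC (a * ((l1 + 1) / 2)) x) (isdV (f := fun y => 1 - a * t y) an (isdB (isdC 1 x) (isdM (isdC a x) dt))).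
have d3 := isdM (isdC (b * (a3 / 2)) x) (isdV (f := fun y => 1 - b * t y) bn (isdB (isdC 1 x) (isdM (isdC b x) dt))).
apply: isd_eq (isdB (isdB d1 d2) d3) _; rewrite /omt.
move: (derive1 t x) (t x) tn an bn => t' T h1 h2 h3.
by field; rewrite h1 h2 h3.
Qed.

(** By t'^2 = 4 tauP (t) and t'' = 2 tauP' (t) the right-hand side is theta'' / theta + q. Both
    choices of a2 satisfy a2 (a2 - 1) = l2 (l2 + 1), and likewise for a3, which is why the two cases
    are treated together. *)
Lemma potential_formula x : regular x ->
  pot x = 4 * (tauP a b).[t x] * (om x ^+ 2 + omt x) + 2 * (tauP a b)^`().[t x] * om x + q x.
Proof.
move=> hx; have t0 := t_gt0 hun hx; have at0 := at_gt0 hun hx; have bt0 := bt_gt0 hun x.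
case/andP: (hx) => hs hc.
rewrite /potential (un_wp0 hun hs) (un_wp1 hun hc) (un_wp2 hun) (un_wp3 hun).
have e2 : l2 * (l2 + 1) = a2 * (a2 - 1) by case: ha2 => ->; ring.
have e3 : l3 * (l3 + 1) = a3 * (a3 - 1) by case: ha3 => ->; ring.
rewrite /qf qP_horner tauP_horner dtauP_horner /q0 /q1 /om /omt e2 e3.
have ed : a2 = - l0 - l1 - 2 - a3 - 2 * d%:R by rewrite hd; field.
rewrite ed; move: (t x) (wp_e p 2) t0 at0 bt0 => T e h1 h2 h3.
by field; rewrite !gt_eqF.
Qed.

Definition hamr r x := (gauge x)^-1 * (- derive1 (derive1 (fun y => gauge y * r y)) x + pot x * (gauge x * r x)).

Lemma hamiltonian_components f x : hamiltonian l0 l1 l2 l3 p f x =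
  hamr (fun y => complex.Re (f y)) x +i* hamr (fun y => complex.Im (f y)) x.
Proof.
rewrite /hamiltonian /cderive1 /hamr.
have -> : (fun y => complex.Re ((gauge y)%:C * f y)) = fun y => gauge y * complex.Re (f y).
  by apply/funext => y; case: (f y) => r i /=; rewrite mul0r subr0.
have -> : (fun y => complex.Im ((gauge y)%:C * f y)) = fun y => gauge y * complex.Im (f y).
  by apply/funext => y; case: (f y) => r i /=; rewrite mul0r addr0.
case: (f x) => r i /=; apply/eqP; rewrite eq_complex /=; apply/andP; split; apply/eqP; ring.
Qed.

Lemma hamr_hh w x : smooth w -> regular x ->
  hamr (fun y => hh y * w y) x = hh x * (K G G1 q w x / G x).
Proof.
move=> sw hx; rewrite /hamr.
have -> : (fun y => gauge y * (hh y * w y)) = fun y => theta y * w y.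
  by apply/funext => y; rewrite mulrA gauge_hh.
have dt1 := smooth_isd x (smooth_derive1 (smooth_t hun)).
have dw := smooth_isd x sw; have dw1 := smooth_isd x (smooth_derive1 sw).
have e1 : \forall y \near x, theta y * (derive1 t y * om y * w y + derive1 w y) = derive1 (fun z => theta z * w z) y.
  have hn := regular_near hx; near=> y.
  have hy : regular y by near: y.
  rewrite (isd_derive1 (isdM (d_theta hy) (smooth_isd y sw))).
  by move: (derive1 t y) (derive1 w y) => X Y; ring.
have D := isdM (d_theta hx) (isdD (isdM (isdM dt1 (d_om hx)) dw) dw1).
rewrite (isd_derive1 (isd_near e1 D)) (d2t hun hx) (potential_formula hx).
have gn := gauge_neq0 hx.
have hg : theta x = gauge x * hh x by rewrite gauge_hh.
have tp := tauP_gt0 hun hx; have rp : 0 < rho t a b l0 l1 a3 x by apply: rho_gt0 hun _ hx.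
have e4 := dt_sqr hun x.
have eg : om x = (gP a b l0 l1 a3).[t x] / (2 * (tauP a b).[t x]).
  rewrite /om gP_horner tauP_horner.
  have t0 := t_gt0 hun hx; have at0 := at_gt0 hun hx; have bt0 := bt_gt0 hun x.
  by move: (t x) t0 at0 bt0 => T h1 h2 h3; field; rewrite !gt_eqF.
have eK : K G G1 q w x / G x = - (2 * om x * derive1 t x * derive1 w x) - derive1 (derive1 w) x + q x * w x.
  rewrite /K /wG1 eg /wG.
  move: (derive1 t x) (derive1 w x) (derive1 (derive1 w) x) (rho _ _ _ _ _ _ x) rp (tauP _ _).[t x] tp
    (gP _ _ _ _ _).[t x] (q x) => t' w1 w2 r r0 T T0 g Q.
  by field; rewrite !gt_eqF.
have alg (t' w0 w1 w2 H T o ot Q T' g : R) : g != 0 -> t' ^+ 2 = 4 * T ->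
  g^-1 * (- (g * H * (t' * o) * (t' * o * w0 + w1) + g * H * ((2 * T' * o + t' * (t' * ot)) * w0
    + t' * o * w1 + w2)) + (4 * T * (o ^+ 2 + ot) + 2 * T' * o + Q) * (g * (H * w0))) =
  H * (- (2 * o * t' * w1) - w2 + Q * w0).
  move=> g0 e; rewrite [LHS](_ : _ = H * (- ((t' ^+ 2) * (o ^+ 2 + ot) * w0 + 2 * T' * o * w0 + 2 * o * t' * w1 + w2)
    + (4 * T * (o ^+ 2 + ot) + 2 * T' * o + Q) * w0)); last by field.
  by rewrite e; ring.
by rewrite eK hg; exact: (alg _ _ _ _ _ _ _ _ _ _ _ gn e4).
Unshelve. all: by end_near. Qed.

End PointwiseHamiltonian.

(** * Orthonormal eigenpolynomials and the lower bound on their complement *)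

Section Eigensystem.
Variables (R : realType) (p : R) (t u v : R -> R) (a b l0 l1 l2 l3 a2 a3 : R) (d : nat).
Hypotheses (hun : uniformizer p t u v a b) (hl0 : 0 < l0) (hl1 : 0 < l1)
  (hd : d%:R = - ((l0 + l1) / 2) - 1 - (a2 + a3) / 2).
Implicit Types (x y : R) (P Q : {poly R}).
Local Notation G := (wG t a b l0 l1 a3).
Local Notation G1 := (wG1 t a b l0 l1 a3).
Local Notation q := (qf p t a b l0 l1 l2 l3 a2 a3 d).
Local Notation L := (Lop p a b l0 l1 l2 l3 a2 a3 d).
Local Notation h := (2^-1 : R).

Let h0 : 0 < h. Proof. by rewrite invr_gt0. Qed.
Let cG : continuous G := cont_wG hun hl0 hl1.
Let cG1 : continuous G1 := cont_wG1 hun hl0 hl1.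
Let cq : continuous q. Proof. by apply: cont_qf; exact: hun. Qed.
Let G_gt0 x : 0 < x < h -> 0 < G x.
Proof. by move=> hx; apply: (wG_gt0 _ _ _ hun); exact: regular_half. Qed.
Let G0 : G 0 = 0. Proof. exact: wG_0 hun hl0 hl1. Qed.
Let Gh : G h = 0. Proof. exact: wG_half hun hl0 hl1. Qed.
Let dG x : 0 < x < h -> der x G (G1 x).
Proof. by move=> hx; apply: (d_wG _ _ _ hun); exact: regular_half. Qed.

Let cP P : continuous (fun x => P.[t x]). Proof. by apply: cont_horner; exact: hun. Qed.
Let sP P : smooth (fun x => P.[t x]). Proof. by apply: smooth_horner; exact: (smooth_t hun). Qed.

Definition ip P Q := J 0 h (fun x => G x * P.[t x] * Q.[t x]).

Let cPQ P Q : continuous (fun x => G x * P.[t x] * Q.[t x]).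
Proof. by apply: contM; [apply: contM; [exact: cG|exact: cP]|exact: cP]. Qed.

Lemma ipC P Q : ip P Q = ip Q P.
Proof. by apply: eq_J => x _; ring. Qed.

Lemma ipDl P P' Q : ip (P + P') Q = ip P Q + ip P' Q.
Proof.
rewrite /ip -JD; [|exact/contW/cPQ..].
by apply: eq_J => x _; rewrite hornerD; ring.
Qed.

Lemma ipZl (c : R) P Q : ip (c *: P) Q = c * ip P Q.
Proof.
rewrite /ip -JZ; last exact/contW/cPQ.
by apply: eq_J => x _; rewrite hornerZ; ring.
Qed.

Lemma ip_suml n (c : 'I_n -> R) (F : 'I_n -> {poly R}) Q :
  ip (\sum_(i < n) c i *: F i) Q = \sum_(i < n) c i * ip (F i) Q.
Proof.
elim: n c F => [|n IH] c F; last by rewrite !big_ord_recl ipDl ipZl IH.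
by rewrite !big_ord0 -(scale0r (0 : {poly R})) ipZl mul0r.
Qed.

Lemma t_inj x y : 0 < x < h -> 0 < y < h -> t x = t y -> x = y.
Proof.
wlog xy : x y / x < y.
  move=> hw hx hy e; have [xy|xy|//] := ltgtP x y; first exact: hw.
  by apply/esym; apply: hw.
move=> hx hy e; exfalso.
have [z hz dz] : exists2 z, z \in `]x, y[%R & is_derive z 1 t 0.
  apply: Rolle => //.
  - by move=> z _; exact: isd_derivable (smooth_isd z (smooth_t hun)).
  - by apply: continuous_subspaceT; exact: cont_t hun.
have rz : regular z.
  apply: regular_half; move: hz hx hy; rewrite in_itv/= => /andP[z1 z2] /andP[x1 _] /andP[_ y2].
  by rewrite (lt_trans x1)//= (lt_trans z2).
have := dt_neq0 hun rz; rewrite (isd_derive1 (dz : der z t 0)).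
by rewrite eqxx.
Qed.

Lemma ip_gt0 P : P != 0 -> 0 < ip P P.
Proof.
move=> P0; have ge x : 0 <= x <= h -> 0 <= G x * P.[t x] * P.[t x].
  move=> hx; rewrite -mulrA -expr2; apply: mulr_ge0; last exact: sqr_ge0.
  exact: (G_ge0 G_gt0 G0 Gh).
have i0 : 0 <= ip P P by exact: J_ge0.
rewrite lt_neqAle i0 andbT eq_sym; apply/eqP => /(J_eq0 (@cPQ P P) ge) hz.
have root x : 0 < x < h -> root P (t x).
  move=> hx; have := hz x hx; rewrite rootE -mulrA -expr2 => /eqP.
  by rewrite mulf_eq0 gt_eqF ?G_gt0//= sqrf_eq0.
(* Starting at 1 / 3 keeps all these points inside ]0, 1/2[, where t is injective; so the polynomial
   has more roots than its degree allows. *)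
pose z (i : nat) : R := (i.+3%:R)^-1.
have zin i : 0 < z i < h.
  by rewrite invr_gt0 ltr0n /= ltf_pV2 ?posrE ?ltr0n// ltr_nat.
have us : uniq [seq t (z i) | i <- iota 0 (size P)].
  rewrite map_inj_in_uniq ?iota_uniq// => i j _ _ e.
  have := t_inj (zin i) (zin j) e; move/invr_inj/eqP.
  by rewrite eqr_nat => /eqP[].
have := max_poly_roots P0 _ us; rewrite size_map size_iota ltnn => h2.
suff : false by []; apply: h2; apply/allP => _ /mapP[i _ ->].
exact: root.
Qed.

Lemma ip_sym P Q : ip (L P) Q = ip P (L Q).
Proof.
have eK P' : K G G1 q (fun y => P'.[t y]) = fun x => G x * (L P').[t x].
  by apply/funext => x; exact: (K_poly l2 l3 a2 a3 d hun hl0 hl1).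
have := green_sym h0 cG cG1 cq G0 Gh dG (@sP P) (@sP Q); rewrite !eK => e.
rewrite /ip e; apply: eq_J => x _; ring.
Qed.

Lemma eigenpolynomials : exists (F : 'I_d.+1 -> {poly R}) (E : 'I_d.+1 -> R),
  [/\ forall i, (size (F i) <= d.+1)%N, forall i, L (F i) = E i *: F i,
      forall i j, ip (F i) (F j) = (i == j)%:R &
      forall P, (size P <= d.+1)%N -> exists c : 'I_d.+1 -> R, P = \sum_(i < d.+1) c i *: F i].
Proof.
pose n := d.+1.
(* [Gam] is the Gram matrix of the monomials and [M] the operator on row vectors of coefficients;
   the symmetry of the operator reads: [M *m Gam] is symmetric. *)
pose Gam : 'M[R]_n := \matrix_(i, j) ip 'X^i 'X^j.
pose M : 'M[R]_n := \matrix_i poly_rV (L 'X^i).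
have rV (x : 'rV[R]_n) : rVpoly x = \sum_(i < n) x 0 i *: 'X^i.
  rewrite /rVpoly poly_def; apply: eq_bigr => i _.
  by case: insubP => [j _ /val_inj ->//|]; rewrite ltn_ord.
have L0 : L 0 = 0 by rewrite -[X in L X](scale0r (0 : {poly R})) LopZ scale0r.
have Lsum m (c : 'I_m -> R) (F : 'I_m -> {poly R}) :
    L (\sum_(i < m) c i *: F i) = \sum_(i < m) c i *: L (F i).
  elim: m c F => [|m IH] c F; first by rewrite !big_ord0.
  by rewrite !big_ord_recl LopD LopZ IH.
have sX (i : 'I_n) : (size ('X^i : {poly R}) <= d.+1)%N by rewrite size_polyXn ltnS -ltnS.
have xM (x : 'rV[R]_n) : rVpoly (x *m M) = L (rVpoly x).
  rewrite (rV x) Lsum mulmx_sum_row linear_sum /=; apply: eq_bigr => i _.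
  rewrite linearZ /= rowK; congr (_ *: _); apply: poly_rV_K.
  exact: (size_Lop p a b l2 l3 hd (sX i)).
have xG (x y : 'rV[R]_n) : (x *m Gam *m y^T) 0 0 = ip (rVpoly x) (rVpoly y).
  rewrite (rV x) ip_suml mxE.
  have -> : \sum_j (x *m Gam) 0 j * y^T j 0 = \sum_j \sum_i x 0 i * (Gam i j * y 0 j).
    by apply: eq_bigr => j _; rewrite !mxE mulr_suml; apply: eq_bigr => i _; rewrite mulrA.
  rewrite exchange_big /=; apply: eq_bigr => i _; rewrite -mulr_sumr; congr (_ * _).
  by rewrite (rV y) ipC ip_suml; apply: eq_bigr => j _; rewrite mxE mulrC ipC.
have symG : Gam^T = Gam by apply/matrixP => i j; rewrite !mxE ipC.
have MG i j : (M *m Gam) i j = ip (L 'X^i) 'X^j.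
  have -> : (M *m Gam) i j = (row i M *m Gam *m (delta_mx 0 j : 'rV[R]_n)^T) 0 0.
    by rewrite -row_mul trmx_delta -colE !mxE.
  rewrite xG rowK poly_rV_K; last exact: (size_Lop p a b l2 l3 hd (sX i)).
  congr ip; rewrite rV (bigD1 j)//= big1 ?addr0 => [|k kj]; rewrite mxE eqxx /=.
    by rewrite eqxx scale1r.
  by rewrite (negPf kj) scale0r.
have symM : (M *m Gam)^T = M *m Gam.
  by apply/matrixP => i j; rewrite [LHS]mxE !MG ip_sym ipC.
have rV0 (x : 'rV[R]_n) : rVpoly x = 0 -> x = 0.
  by move=> e; rewrite -(rVpolyK x) e linear0.
have pos (x : 'rV[R]_n) : x != 0 -> 0 < (x *m Gam *m x^T) 0 0.
  by move=> x0; rewrite xG ip_gt0//; apply: contra_neq x0; exact: rV0.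
have [X [D [XM XX]]] := sym_eigenbasis symG symM pos.
exists (fun i => rVpoly (row i X)), (fun i => D 0 i); split.
- by move=> i; rewrite /rVpoly (leq_trans (size_poly _ _)).
- move=> i; rewrite -xM -row_mul XM -linearZ; congr rVpoly.
  by apply/rowP => j; rewrite mul_diag_mx !mxE.
- move=> i j; rewrite -xG; transitivity ((X *m Gam *m X^T) i j); last by rewrite XX mxE.
  by rewrite -row_mul [LHS]mxE [RHS]mxE; apply: eq_bigr => k _; rewrite !mxE.
- move=> P sPd; pose c : 'rV[R]_n := poly_rV P *m (Gam *m X^T).
  exists (fun i => c 0 i).
  have e : P = rVpoly (c *m X).
    have XX' : Gam *m X^T *m X = 1%:M by apply: mulmx1C; rewrite mulmxA.
    by rewrite /c -mulmxA XX' mulmx1 poly_rV_K.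
  by rewrite {1}e mulmx_sum_row linear_sum /=; apply: eq_bigr => i _; rewrite linearZ.
Qed.

Lemma eigensystem : exists (F : 'I_d.+1 -> {poly R}) (E : 'I_d.+1 -> R) (top : 'I_d.+1),
  [/\ [/\ forall i, (size (F i) <= d.+1)%N, forall i, L (F i) = E i *: F i,
      forall i j, ip (F i) (F j) = (i == j)%:R &
      forall P, (size P <= d.+1)%N -> exists c : 'I_d.+1 -> R, P = \sum_(i < d.+1) c i *: F i],
    forall i, E i <= E top &
    forall w, smooth w -> (forall i, J 0 h (fun x => G x * w x * (F i).[t x]) = 0) ->
    E top * J 0 h (fun x => G x * w x * w x) <= J 0 h (fun x => K G G1 q w x * w x)].
Proof.
have [F [E [sF LF orth span]]] := eigenpolynomials.
have [top Etop] : exists top, forall i, E i <= E top.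
  by case: (@arg_maxP _ _ _ ord0 xpredT E isT) => i _ hi; exists i => j; exact: hi.
exists F, E, top; split => //.
set P := F top.
have P0 : P != 0.
  apply/eqP => e; have := orth top top; rewrite eqxx -/P e -(scale0r (0 : {poly R})) ipZl mul0r.
  by move/esym/eqP; rewrite oner_eq0.
pose T : {poly R} := 4%:P * tauP a b.
pose S : {poly R} := 4%:P * gP a b l0 l1 a3 + 2%:P * (tauP a b)^`().
pose Q0 : {poly R} := (E top)%:P - qP p a b l0 l1 l2 l3 a2 a3 d.
have ode : T * P^`()^`() + S * P^`() + Q0 * P = 0.
  have := LF top; rewrite -/P /Lop -mul_polyC => e.
  rewrite [LHS](_ : _ = (E top)%:P * P - (- 4%:P * (tauP a b * P^`()^`()) -
    (4%:P * gP a b l0 l1 a3 + 2%:P * (tauP a b)^`()) * P^`() + qP p a b l0 l1 l2 l3 a2 a3 d * P)).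
    by rewrite e subrr.
  by rewrite /T /S /Q0; ring.
have a0 := un_a hun; have ba := un_ba hun.
have an : a != 0 by rewrite gt_eqF.
(* At t = 0 and at t = 1 / a the exponents of the equation are 0 and a negative number, so P
   vanishes at neither end of [0, 1/2]. Its zeros there are thus interior and simple, as [picone]
   requires. *)
have nz0 : P.[0] != 0.
  apply: (ode_regular_singular P0 ode (T1 := 4%:P * tauh a b)).
    by rewrite /T /tauP subr0; ring.
  rewrite /S hornerD !hornerM !hornerC gP_horner dtauP_horner /tauh.
  rewrite !(hornerM, hornerD, hornerN, hornerX, hornerC); move: hl0; nra.
have nzh : P.[a^-1] != 0.
  apply: (ode_regular_singular P0 ode (T1 := (- 4 * a)%:P * 'X * (1%:P - b%:P * 'X))).
    apply: poly_ext => y; rewrite /T hornerM tauP_horner.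
    by rewrite !(hornerM, hornerD, hornerN, hornerX, hornerC); field.
  rewrite /S hornerD !hornerM !hornerC gP_horner dtauP_horner.
  rewrite !(hornerM, hornerD, hornerN, hornerX, hornerC).
  have ba' : 0 < 1 - b / a by rewrite subr_gt0 ltr_pdivrMr// mul1r.
  rewrite [ltRHS](_ : _ = (1 - b / a) ^+ 2 * (4 * (4 * (l1 + 1) + 2))); last by field.
  by apply: mulr_gt0; [rewrite exprn_gt0|move: hl1; lra].
pose Z z := 0 < z < h /\ P.[t z] = 0.
have bound s : uniq s -> (forall z, z \in s -> Z z) -> (size s <= d)%N.
  move=> us hs; have us' : uniq [seq t z | z <- s].
    by rewrite map_inj_in_uniq// => x y /hs[hx _] /hs[hy _]; exact: t_inj.
  have := max_poly_roots P0 _ us'; rewrite size_map => hm.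
  rewrite -ltnS; apply: leq_trans (sF top); apply: hm.
  by apply/allP => _ /mapP[z /hs[_ hz] ->]; rewrite rootE hz.
have [s [us ss hs]] := finite_zeros bound.
have us' : uniq [seq t z | z <- s].
  by rewrite map_inj_in_uniq// => x y /hs[hx _] /hs[hy _]; exact: t_inj.
have eigs i x : 0 <= x <= h -> K G G1 q (fun y => (F i).[t y]) x = E i * G x * (F i).[t x].
  by move=> _; rewrite (K_poly l2 l3 a2 a3 d hun hl0 hl1) LF hornerZ; ring.
apply: (@orthogonal_lower_bound _ _ _ _ _ h0 cG cG1 cq G_gt0 G0 Gh dG _ (fun i x => (F i).[t x]) E top s) => //.
- move=> x /andP[]; rewrite le_eqVlt => /predU1P[<- _ _|x0]; first by rewrite (t_0 hun).
  rewrite le_eqVlt => /predU1P[-> _|xh xs].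
    by rewrite (_ : t h = a^-1)//; apply: (mulfI an); rewrite (t_half hun) divff.
  by apply: contra_notN (_ : ~ Z x) => [/eqP e|/hs]; [split => //; rewrite x0|apply/negP].
- move=> z /hs[hz Pz]; split => //.
  have dz : derive1 t z != 0 := dt_neq0 hun (regular_half hz).
  rewrite (derive1_horner hun) /=; apply: mulf_neq0 dz.
  apply: (ode_simple_root P0 ode) => //.
  rewrite /T hornerM hornerC mulf_neq0 ?pnatr_eq0// gt_eqF//.
  by have := tauP_gt0 hun (regular_half hz).
(* The zeros of P are at most d in number and t separates them, so a Lagrange polynomial in t of
   degree at most d interpolates [val]. The index converts a value t z back into z. *)
- move=> val; pose f y := val (nth 0 s (index y [seq t z | z <- s])).
  have [Q [sQ hQ]] := lagrange f us'.
  have [|c hc] := span Q; first by rewrite (leq_trans sQ)// size_map ltnW.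
  exists c => z zs; have tz : t z \in [seq t z | z <- s] by exact: map_f.
  transitivity Q.[t z]; first by rewrite hc horner_sum; apply: eq_bigr => i _; rewrite hornerZ.
  rewrite hQ// /f; congr val; have [hz _] := (hs z).1 zs.
  have zi : (index (t z) [seq t z | z <- s] < size s)%N by rewrite -(size_map t) index_mem.
  have [hz' _] := (hs _).1 (mem_nth 0 zi).
  by apply: t_inj => //; rewrite -(nth_map _ 0)// nth_index.
Qed.

End Eigensystem.

(** * The finite dimensional space *)

Section FiniteSpace.
Variables (R : realType) (p : R) (t u v : R -> R) (a b l0 l1 l2 l3 a2 a3 : R) (d : nat).
Hypotheses (hun : uniformizer p t u v a b) (hl0 : 0 < l0) (hl1 : 0 < l1)
  (ha2 : a2 = - l2 \/ a2 = l2 + 1) (ha3 : a3 = - l3 \/ a3 = l3 + 1)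
  (hd : d%:R = - ((l0 + l1) / 2) - 1 - (a2 + a3) / 2).
Implicit Types (x y r : R).
Local Notation e2 := (wp_e p 2).
Local Notation h_ := (hh t u v b l0 l1 a3).

Lemma sqrt_powR y r : 0 <= y -> Num.sqrt y `^ r = y `^ (r / 2).
Proof. by move=> y0; rewrite -powR12_sqrt// -powRrM mulrC. Qed.

Lemma sg_sqrt x y : Num.sg x * Num.sqrt y * x = Num.sqrt (x ^+ 2 * y).
Proof.
by rewrite sqrtrM ?sqr_ge0// sqrtr_sqr normrEsg; ring.
Qed.

Lemma g2E x : regular x -> g2 p x = Num.sqrt (u x)^-1.
Proof.
move=> hx; case/andP: (hx) => hs hc; have t0 := t_gt0 hun hx; have u0 := un_u hun x.
rewrite /g2 /sigma_ratio /= mulr1 sg_sqrt (un_wp0 hun hs); congr Num.sqrt.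
rewrite addrC addKr (un_t hun); by field; rewrite hs gt_eqF.
Qed.

Lemma g3E x : regular x -> g3 p x = Num.sqrt ((1 - b * t x) / u x).
Proof.
move=> hx; case/andP: (hx) => hs hc; have t0 := t_gt0 hun hx; have u0 := un_u hun x.
rewrite /g3 /sigma_ratio /= mulr1 sg_sqrt (un_wp0 hun hs) (un_e3 hun); congr Num.sqrt.
rewrite (_ : _ - _ = (1 - b * t x) / t x); last by field; rewrite gt_eqF.
by rewrite [in X in _ * (_ / X)](un_t hun); field; rewrite hs gt_eqF.
Qed.

Lemma g1E x : regular x -> g1 p x = Num.sqrt (v x / u x).
Proof.
move=> hx; case/andP: (hx) => hs hc; have t0 := t_gt0 hun hx; have u0 := un_u hun x.
rewrite /g1 /sigma_ratio /= (un_wp0 hun hs) (un_e1 hun).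
rewrite (_ : _ + _ - _ = (1 - a * t x) / t x); last by field; rewrite gt_eqF.
have sgq (s c y : R) : Num.sg (s * c) * y * s / c = Num.sg (s / c) * y * (s / c).
  by rewrite !sgrM sgrV; ring.
rewrite sgq sg_sqrt (un_at hun); congr Num.sqrt.
by rewrite (un_t hun); field; rewrite hs hc gt_eqF.
Qed.

Lemma tV_basis_hh n x : regular x ->
  tV_basis l1 p a2 a3 d n x = h_ x * (t x ^+ d * (e2 + (t x)^-1) ^+ n).
Proof.
move=> hx; case/andP: (hx) => hs hc; have t0 := t_gt0 hun hx; have u0 := un_u hun x.
have v0 := un_v hun x; have bt0 := un_bt hun x.
rewrite /tV_basis g1E// g2E// g3E// (un_wp0 hun hs).
rewrite !sqrt_powR ?invr_ge0 ?(ltW u0)// ?divr_ge0 ?(ltW u0) ?(ltW v0) ?(ltW bt0)//.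
rewrite !powRM ?invr_ge0 ?(ltW u0) ?(ltW v0) ?(ltW bt0)//.
have uV r : (u x)^-1 `^ r = u x `^ (- r).
  by rewrite -powR_inv1 ?(ltW u0)// -powRrM mulN1r.
have un r : (r == 0) ==> (u x != 0) by rewrite (gt_eqF u0) implybT.
have eS : sin (pi * x) ^+ (2 * d) = t x ^+ d * u x `^ (- d%:R).
  have u0n : u x ^+ d != 0 by rewrite expf_neq0// gt_eqF.
  rewrite exprM (powR_invn d (ltW u0)) (un_t hun x) [X in X / _]exprMn; apply/esym; exact: mulfK.
(* The degree relation [hd] is exactly the agreement of the exponents of u on both sides. *)
have eU : u x `^ ((l0 + 1) / 2) = u x `^ (- d%:R) * u x `^ (- ((l1 + 1) / 2)) *
    u x `^ (- (a2 / 2)) * u x `^ (- (a3 / 2)).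
  by rewrite -!powRD ?un//; congr (_ `^ _); rewrite hd; field.
rewrite /hh eU eS !uV; ring.
Qed.

(** As wp = e_2 + 1 / t, this polynomial in t is t^d wp^n with denominators cleared, which requires
    n <= d. *)
Definition Bpol n : {poly R} := 'X^(d - n) * (1%:P + e2%:P * 'X) ^+ n.

Lemma Bpol_horner n y : (n <= d)%N -> y != 0 -> (Bpol n).[y] = y ^+ d * (e2 + y^-1) ^+ n.
Proof.
move=> nd y0; rewrite /Bpol hornerM hornerXn horner_exp hornerD hornerC hornerM hornerC hornerX.
rewrite -{2}(subnK nd) exprD -mulrA -exprMn; congr (_ * _ ^+ _).
by rewrite mulrDr divff// addrC mulrC.
Qed.

Lemma size_Bpol n : (n <= d)%N -> (size (Bpol n) <= d.+1)%N.
Proof.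
move=> nd; have -> : (d.+1 = (d - n) + n.+1)%N by rewrite addnS subnK.
apply: size_mul_le; first by rewrite size_polyXn.
apply: (leq_trans (size_poly_exp_leq _ _)); rewrite ltnS.
have : ((size (1%:P + e2%:P * 'X : {poly R})%R).-1 <= 1)%N.
  by have := size_lin 1 e2; case: (size _).
by move=> h; apply: (leq_trans (leq_mul h (leqnn n))); rewrite mul1n.
Qed.

Lemma tV_basis_Bpol (n : 'I_d.+1) x : regular x ->
  tV_basis l1 p a2 a3 d n x = h_ x * (Bpol n).[t x].
Proof.
move=> hx; have t0 := t_gt0 hun hx.
have nd : (n <= d)%N by rewrite -ltnS.
by rewrite tV_basis_hh// Bpol_horner ?gt_eqF.
Qed.

(** For P of degree at most d, t^-d P (t) is a polynomial in 1 / t = wp - e_2, hence in wp; Q is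
    that polynomial. *)
Lemma Bpol_span (P : {poly R}) : (size P <= d.+1)%N ->
  exists c : 'I_d.+1 -> R, P = \sum_(n < d.+1) c n *: Bpol n.
Proof.
move=> sP.
pose Q : {poly R} := \sum_(k < d.+1) P`_k *: ('X - e2%:P) ^+ (d - k).
exists (fun n => Q`_n).
have sQ : (size Q <= d.+1)%N.
  apply: (leq_trans (size_sum _ _ _)); apply/bigmax_leqP => k _.
  by apply: (leq_trans (size_scale_leq _ _)); rewrite size_exp_XsubC ltnS leq_subr.
(* Multiplying by 'X makes the comparison trivial at 0, where [Bpol_horner] does not apply. *)
apply: (mulfI (_ : 'X != 0 :> {poly R})); first by rewrite polyX_eq0.
apply: poly_ext => y; rewrite !hornerM hornerX.
have [->|y0] := eqVneq y 0; first by rewrite !mul0r.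
congr (_ * _); rewrite horner_sum.
transitivity (y ^+ d * Q.[e2 + y^-1]).
  rewrite /Q horner_sum mulr_sumr -{1}(coefK P) horner_poly (big_ord_widen d.+1 (fun k => P`_k * y ^+ k))//.
  rewrite big_mkcond /=; apply: eq_bigr => k _; rewrite hornerZ horner_exp hornerXsubC addrC addKr.
  have kd : (k <= d)%N by rewrite -ltnS.
  case: ifPn => [_|]; last by rewrite -leqNgt => /leq_sizeP/(_ _ (leqnn _)) ->; rewrite mul0r mulr0.
  rewrite mulrCA; congr (_ * _); have -> : y ^+ d = y ^+ k * y ^+ (d - k) by rewrite -exprD subnKC.
  by rewrite -mulrA -exprMn divff// expr1n mulr1.
rewrite -{1}(coefK Q) horner_poly (big_ord_widen d.+1 (fun k => Q`_k * (e2 + y^-1) ^+ k))//.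
rewrite big_mkcond /= mulr_sumr; apply: eq_bigr => k _.
have kd : (k <= d)%N by rewrite -ltnS.
rewrite hornerZ (Bpol_horner kd y0).
case: ifPn => [_|]; first by rewrite mulrCA.
by rewrite -leqNgt => /leq_sizeP/(_ _ (leqnn _)) ->; rewrite mul0r mulr0.
Qed.

End FiniteSpace.

(** * Eigenfunctions of the closure *)

Section MeasureTools.
Variable R : realType.
Local Notation mu := (@lebesgue_measure R).
Implicit Types (A B D : set R).

(* The integral of a nonnegative function is a supremum over simple functions below it,
   so monotonicity does not require measurability. *)
Lemma le_integral_any A B (f g : R -> \bar R) : A `<=` B ->
  (forall x, A x -> (0 <= f x)%E) -> (forall x, B x -> (0 <= g x)%E) ->
  (forall x, A x -> (f x <= g x)%E) -> (\int[mu]_(x in A) f x <= \int[mu]_(x in B) g x)%E.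
Proof.
move=> AB f0 g0 fg; rewrite !ge0_integralE//.
apply: le_ereal_sup => _ [k hk <-]; exists k => // x; apply: (le_trans (hk x)).
rewrite /patch; case: ifPn => xA; last by case: ifPn => // /set_mem; exact: g0.
by have xB : x \in B := mem_set (AB _ (set_mem xA)); rewrite xB; exact: fg (set_mem xA).
Qed.

Definition shift1 (x : measurableTypeR R) : measurableTypeR R := (x + 1 : R).

Lemma measurable_shift1 : measurable_fun setT shift1.
Proof.
have h : measurable_fun setT (fun x : R => x + 1).
  by apply: continuous_measurable_fun; apply: contD; [move=> x; exact: cvg_id|exact: contC].
exact: h.
Qed.

HB.instance Definition _ := isMeasurableFun.Build _ _ _ _ shift1 measurable_shift1.

(** Translation invariance from uniqueness: the push-forward agrees with the Lebesgue measure on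
    intervals. *)
Lemma lebesgue_measure_shift1 A : measurable A -> pushforward mu shift1 A = mu A.
Proof.
move=> mA; apply/esym/lebesgue_measure_unique => //= _ [[a b]] _ <-.
rewrite /pushforward (_ : shift1 @^-1` _ = `]a - 1, b - 1]%classic).
  by rewrite !lebesgue_measure_itv/= !lte_fin ltrD2r -!EFinB opprB addrA subrK.
by apply/seteqP; split => x; rewrite /= !in_itv/= /shift1 ltrBlDr lerBrDr.
Qed.

Lemma negligible_shift1 A : mu.-negligible A -> mu.-negligible [set x | A (x + 1)].
Proof.
move=> [B [mB B0 AB]]; exists (shift1 @^-1` B); split.
- by rewrite -[X in measurable X]setTI; exact: measurable_shift1.
- by have := lebesgue_measure_shift1 mB; rewrite /pushforward B0.
- by move=> x; exact: AB.
Qed.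

Lemma negligible_opp A : mu.-negligible A -> mu.-negligible [set x | A (- x)].
Proof.
move=> [B [mB B0 AB]]; exists ((-%R : R -> measurableTypeR R) @^-1` B); split.
- have mN : measurable_fun setT (-%R : R -> measurableTypeR R) by exact: oppr_measurable.
  by rewrite -[X in measurable X]setTI; exact: mN.
- by have := lebesgue_measureN mB; rewrite /pushforward B0.
- by move=> x; exact: AB.
Qed.

Lemma negligible_shiftN1 A : mu.-negligible A -> mu.-negligible [set x | A (x - 1)].
Proof.
move=> nA; have := negligible_opp (negligible_shift1 (negligible_opp nA)).
by apply: negligibleS => x /=; rewrite opprD opprK.
Qed.

Lemma negligible_pt (a : R) : mu.-negligible [set x | x = a].
Proof. by exists [set a]; split => //; exact: lebesgue_measure_set1. Qed.

(** Evenness carries the equality to [-1/2, 1/2] and periodicity from one integer to the next; both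
    are known only up to null sets, and translates, reflections and countable unions of null sets
    are null. *)
Lemma ae_extend (f g : R -> R[i]) : ae_eq_fun (fun x => f (x + 1)) f -> ae_eq_fun (fun x => f (- x)) f ->
  (forall x, g (x + 1) = g x) -> (forall x, g (- x) = g x) ->
  {ae mu, forall x, 0 < x < 2^-1 -> f x = g x} -> ae_eq_fun f g.
Proof.
move=> N1 N2 gP gN N0.
pose B (n : R) := [set x | f x <> g x /\ `|x - n| <= 2^-1].
have B0 : mu.-negligible (B 0).
  apply: negligibleS (negligibleU (negligibleU N2 (negligibleU N0 (negligible_opp N0)))
     (negligibleU (negligible_pt 0) (negligibleU (negligible_pt 2^-1) (negligible_pt (- 2^-1))))).
  move=> x [fg]; rewrite subr0 => hx.
  have [x0|x0|x0] := ltgtP x 0; last by right; left.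
    have [x1|x1] := eqVneq x (- 2^-1); first by right; right; right.
    have [e|e] := pselect (f (- x) = f x); last by left; left.
    left; right; right => /= h; apply: fg; rewrite -e -gN; apply: h.
    move: hx; rewrite ltr0_norm// => hx; rewrite oppr_gt0 x0 /= lt_neqAle hx andbT.
    by rewrite eqr_oppLR.
  have [x1|x1] := eqVneq x 2^-1; first by right; right; left.
  left; right; left => /= h; apply: fg; apply: h.
  by rewrite x0 /= lt_neqAle x1; move: hx; rewrite gtr0_norm.
have Bp (n : nat) : mu.-negligible (B n%:R).
  elim: n => [//|n IH]; apply: negligibleS (negligibleU (negligible_shiftN1 IH) (negligible_shiftN1 N1)).
  move=> x [fg hx]; have [e|e] := pselect (f (x - 1 + 1) = f (x - 1)); last by right.
  left; split; last by move: hx; rewrite -(natr1 n) (_ : x - 1 - n%:R = x - (n%:R + 1))//; ring.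
  by move=> e2; apply: fg; rewrite -(subrK 1 x) e e2 gP.
have Bn (n : nat) : mu.-negligible (B (- n%:R)).
  elim: n => [|n IH]; first by rewrite oppr0.
  apply: negligibleS (negligibleU (negligible_shift1 IH) N1).
  move=> x [fg hx]; have [e|e] := pselect (f (x + 1) = f x); last by right.
  left; split; last by move: hx; rewrite -(natr1 n) !opprK addrA [x + 1 + _]addrAC.
  by move=> e2; apply: fg; rewrite -e e2 gP.
have := negligibleU (negligible_bigcup Bp) (negligible_bigcup Bn).
apply: negligibleS => x fg.
have := floorD1_gt (x + 2^-1); have := floor_le (x + 2^-1).
case: (Num.floor (x + 2^-1)) => n; rewrite ?NegzE => h1 h2.
  left; exists n => //; split => //; rewrite ler_norml.
  by move: h1 h2; rewrite rmorphD /= => h1 h2; apply/andP; split; lra.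
right; exists n.+1 => //; split => //; rewrite ler_norml.
by move: h1 h2; rewrite rmorphD rmorphN /= => h1 h2; apply/andP; split; lra.
Qed.

End MeasureTools.

(** * Comparison of integrals and null limits *)

Section IntegralBounds.
Variable R : realType.
Local Notation mu := (@lebesgue_measure R).
Implicit Types (A : set R) (X P Q : R -> R) (a b e s : R).

Lemma EFin_J a b X : {within `[a, b], continuous X} ->
  (J a b X)%:E = (\int[mu]_(x in `[a, b]) (X x)%:E)%E.
Proof.
move=> cX; rewrite /J /Rintegral fineK//.
exact: (integrable_fin_num _ (J_integrable cX)).
Qed.

(* [P] need not be measurable: it is replaced by the smaller function [max 0 (X - Q)]. *)
Lemma le_integral_add A X P Q : measurable A -> measurable_fun A X -> measurable_fun A Q ->
  (forall x, A x -> 0 <= P x) -> (forall x, A x -> 0 <= Q x) -> (forall x, A x -> 0 <= X x <= P x + Q x) ->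
  (\int[mu]_(x in A) (X x)%:E <= \int[mu]_(x in A) (P x)%:E + \int[mu]_(x in A) (Q x)%:E)%E.
Proof.
move=> mA mX mQ P0 Q0 XPQ.
pose Z x := Num.max 0 (X x - Q x).
have mZ : measurable_fun A Z.
  by apply: measurable_maxr; [exact: measurable_cst|exact: measurable_funB].
have Z0 x : 0 <= Z x by rewrite /Z le_max lexx.
apply: (@le_trans _ _ (\int[mu]_(x in A) ((Z x)%:E + (Q x)%:E))%E).
  apply: le_integral_any => // x xA; rewrite ?lee_fin; first by case/andP: (XPQ x xA).
    exact: addr_ge0 (Z0 x) (Q0 x xA).
  by rewrite -lerBlDr /Z le_max lexx orbT.
rewrite ge0_integralD//; first last.
- exact/measurable_EFinP.
- exact/measurable_EFinP.
- by move=> x _; rewrite lee_fin.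
apply: leeD => //; apply: le_integral_any => // x xA; rewrite lee_fin ?P0//.
by rewrite /Z ge_max P0// lerBlDr; case/andP: (XPQ x xA).
Qed.

Lemma J_le_add a b A X P Q s s' : {within `[a, b], continuous X} -> `[a, b]%classic `<=` A ->
  measurable_fun `[a, b] Q -> (forall x, A x -> 0 <= P x) -> (forall x, A x -> 0 <= Q x) ->
  (forall x, a <= x <= b -> 0 <= X x <= P x + Q x) ->
  (\int[mu]_(x in A) (P x)%:E <= s%:E)%E -> (\int[mu]_(x in A) (Q x)%:E <= s'%:E)%E ->
  J a b X <= s + s'.
Proof.
move=> cX abA mQ P0 Q0 XPQ Ps Qs; rewrite -lee_fin EFin_J//.
have mX : measurable_fun `[a, b] X by exact: subspace_continuous_measurable_fun.
apply: le_trans (@le_integral_add `[a, b]%classic X P Q (measurable_itv _) mX mQ _ _ _) _.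
- by move=> x /abA; exact: P0.
- by move=> x /abA; exact: Q0.
- by move=> x /=; rewrite in_itv/=; exact: XPQ.
rewrite EFinD leeD//.
  by apply: le_trans Ps; apply: le_integral_any => // x /abA; exact: P0.
by apply: le_trans Qs; apply: le_integral_any => // x /abA; exact: Q0.
Qed.

Lemma ae_zero_of_small A X : measurable A -> measurable_fun A X -> (forall x, A x -> 0 <= X x) ->
  (forall e, 0 < e -> (\int[mu]_(x in A) (X x)%:E <= e%:E)%E) ->
  {ae mu, forall x, A x -> X x = 0}.
Proof.
move=> mA mX X0 small.
have I0 : (\int[mu]_(x in A) `|(X x)%:E| = 0)%E.
  apply/eqP; rewrite eq_le integral_ge0 ?andbT; last by move=> x _; exact: abse_ge0.
  apply/lee_addgt0Pr => e e0; rewrite add0e; apply: le_trans (small e e0).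
  by rewrite le_eqVlt; apply/orP; left; apply/eqP; apply: eq_integral => x /set_mem xA; rewrite gee0_abs// lee_fin X0.
have mEX : measurable_fun A (EFin \o X) by exact/measurable_EFinP.
by have := (ae_eq_integral_abs mu mA mEX).1 I0; apply: filterS => x h xA; have := h xA => /= -[].
Qed.

Lemma ecvg0 (M : nat -> \bar R) : (forall n, (0 <= M n)%E) -> M @ \oo --> (0 : \bar R)%E ->
  forall e, 0 < e -> exists N, forall n, (N <= n)%N -> (M n <= e%:E)%E.
Proof.
move=> M0 /fine_cvgP[fM cM] e e0.
have [N _ hN] := filterI fM (cvgr0_norm_le _ cM e e0).
exists N => n /hN[/= fn ne].
by rewrite -(fineK fn) lee_fin (le_trans _ ne)// ler_norm.
Qed.

End IntegralBounds.

(** * From the graph closure to smooth real sequences on [0, 1/2] *)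

Section Closure.
Variables (R : realType) (p : R) (t u v : R -> R) (a b l0 l1 l2 l3 a2 a3 : R) (d : nat).
Hypotheses (hun : uniformizer p t u v a b) (hl0 : 0 < l0) (hl1 : 0 < l1)
  (ha2 : a2 = - l2 \/ a2 = l2 + 1) (ha3 : a3 = - l3 \/ a3 = l3 + 1)
  (hd : d%:R = - ((l0 + l1) / 2) - 1 - (a2 + a3) / 2).
Implicit Types (x y e lam : R) (f g : R -> R[i]) (s : bool).
Local Notation mu := (@lebesgue_measure R).
Local Notation G := (wG t a b l0 l1 a3).
Local Notation G1 := (wG1 t a b l0 l1 a3).
Local Notation q := (qf p t a b l0 l1 l2 l3 a2 a3 d).
Local Notation h := (2^-1 : R).
Local Notation h_ := (hh t u v b l0 l1 a3).
Local Notation ga := (Defs.gauge l0 l1).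
Local Notation hm := (hamr p l0 l1 l2 l3).
Local Notation ham := (hamiltonian l0 l1 l2 l3 p).

Definition comp s (z : R[i]) : R := if s then complex.Re z else complex.Im z.

Lemma comp_le s (z : R[i]) : comp s z ^+ 2 <= sqnormc z.
Proof. by rewrite /sqnormc /comp; case: s; rewrite ?lerDl ?lerDr sqr_ge0. Qed.

Lemma compB s (z z' : R[i]) : comp s (z - z') = comp s z - comp s z'.
Proof. by case: s z z' => -[x y] [x' y']. Qed.

Lemma compZ s lam (z : R[i]) : comp s (lam%:C * z) = lam * comp s z.
Proof. by case: s z => -[x y]; rewrite /comp /=; ring. Qed.

Lemma comp_ham s f x : comp s (ham f x) = hm (fun y => comp s (f y)) x.
Proof. by rewrite hamiltonian_components; case: s. Qed.

Lemma cont_gauge : continuous ga.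
Proof.
apply: contM; apply: cont_powR; rewrite ?addr_gt0//.
  by move=> x; apply: cvg_norm; apply: (smooth_cont (f := fun y : R => sin (pi * y))); exact: smooth_sin.
by move=> x; apply: cvg_norm; apply: (smooth_cont (f := fun y : R => cos (pi * y))); exact: smooth_cos.
Qed.

Definition dens f x : R := sqnormc (f x) * ga x ^+ 2.

Lemma dens_ge0 f x : 0 <= dens f x.
Proof. by rewrite mulr_ge0 ?sqr_ge0// addr_ge0 ?sqr_ge0. Qed.

Lemma comp_dens s f x : (ga x * comp s (f x)) ^+ 2 <= dens f x.
Proof. by rewrite exprMn mulrC ler_wpM2r ?sqr_ge0 ?comp_le. Qed.

Lemma meas_cont (f : R -> R) (A : set R) : continuous f -> measurable_fun A f.
Proof. by move=> cf; apply: measurable_funTS; exact: continuous_measurable_fun. Qed.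

Lemma meas_dens f (A : set R) : cmeasurable f -> measurable_fun A (dens f).
Proof.
move=> [m1 m2]; apply: measurable_funTS; apply: measurable_funM.
  by apply: measurable_funD; apply: measurable_funX.
by apply: measurable_funX; apply: meas_cont; exact: cont_gauge.
Qed.

Lemma cmeasurableB f g : cmeasurable f -> cmeasurable g -> cmeasurable (fun x => f x - g x).
Proof.
move=> [f1 f2] [g1 g2]; split.
  rewrite (_ : (fun x => _) = fun x => complex.Re (f x) - complex.Re (g x)); first exact: measurable_funB.
  by apply/funext => x; exact: (compB true).
rewrite (_ : (fun x => _) = fun x => complex.Im (f x) - complex.Im (g x)); first exact: measurable_funB.
by apply/funext => x; exact: (compB false).
Qed.

Lemma meas_comp s f (A : set R) : cmeasurable f -> measurable_fun A (fun x => comp s (f x)).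
Proof. by move=> [f1 f2]; apply: measurable_funTS; case: s. Qed.

Lemma wG_sqr x w : G x * w ^+ 2 = (ga x * (h_ x * w)) ^+ 2.
Proof. by rewrite mulrA (gauge_hh l0 l1 a3 hun) exprMn (theta_sqr a3 hun hl0 hl1). Qed.

Lemma half_sqrB x y : 2^-1 * (x - y) ^+ 2 <= x ^+ 2 + y ^+ 2.
Proof. by have := sqr_ge0 (x + y); nra. Qed.

Let hh0 x : 0 < h_ x := hh_gt0 l0 l1 a3 hun x.
Let hn0 x : h_ x != 0. Proof. by rewrite gt_eqF. Qed.
Let cG : continuous G := cont_wG hun hl0 hl1.
Let cG1 : continuous G1 := cont_wG1 hun hl0 hl1.
Let cq : continuous q. Proof. by apply: cont_qf; exact: hun. Qed.
Let ch : continuous h_. Proof. by apply: (smooth_cont (f := h_)); exact: smooth_hh hun. Qed.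

Lemma le_half_unit : [set` `[0, h]] `<=` [set` `[0%R, 1%R]].
Proof.
move=> x /=; rewrite !in_itv/= => /andP[-> xh]; apply: (le_trans xh).
by rewrite invf_le1// ler1n.
Qed.

Lemma smooth_div w : smooth w -> smooth (fun x => w x / h_ x).
Proof. by move=> sw; apply: smoothM => //; apply: smoothV => //; exact: smooth_hh hun. Qed.

Lemma operator_residual w lam x : smooth w -> regular x ->
  (K G G1 q (fun y => w y / h_ y) x - lam * G x * (w x / h_ x)) ^+ 2 / G x = (ga x * (hm w x - lam * w x)) ^+ 2.
Proof.
move=> sw hx; have Gx : 0 < G x := wG_gt0 l0 l1 a3 hun hx.
have := hamr_hh hun ha2 ha3 hd (smooth_div sw) hx.
rewrite (_ : (fun y => h_ y * (w y / h_ y)) = w); last by apply/funext => y; rewrite mulrC divfK.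
set k := K _ _ _ _ _ => ->.
have -> : ga x * (h_ x * (k / G x) - lam * w x) = ga x * (h_ x * (k / G x - lam * (w x / h_ x))).
  by congr (_ * _); field; rewrite hn0 gt_eqF.
by rewrite -wG_sqr; field; rewrite hn0 gt_eqF.
Qed.

Lemma comp_residual s lam f g x :
  2^-1 * (ga x * (hm (fun y => comp s (g y)) x - lam * comp s (g x))) ^+ 2 <=
  dens (fun y => ham g y - lam%:C * f y) x + lam ^+ 2 * dens (fun y => g y - f y) x.
Proof.
have e : ga x * (hm (fun y => comp s (g y)) x - lam * comp s (g x)) =
    ga x * comp s (ham g x - lam%:C * f x) - lam * (ga x * comp s (g x - f x)).
  by rewrite !compB compZ comp_ham; ring.
rewrite e; apply: (le_trans (half_sqrB _ _)); apply: lerD; first exact: (comp_dens s (fun y => ham g y - lam%:C * f y)).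
by rewrite exprMn ler_wpM2l ?sqr_ge0//; exact: (comp_dens s (fun y => g y - f y)).
Qed.

(** As lam is real, the real and imaginary parts can be treated separately; division by [hh] turns
    the norm of H into that of L^2(G). The density of the residual is put in the place of P in
    [J_le_add], where no measurability is asked. *)
Lemma approximating_sequence s lam f : ham_closure l0 l1 l2 l3 p f (fun x => lam%:C * f x) ->
  exists (w : nat -> R -> R) (eta : nat -> R), [/\ forall m, smooth (w m),
   forall e, 0 < e -> exists N, forall m m', (N <= m)%N -> (N <= m')%N ->
     J 0 h (fun x => G x * (w m x - w m' x) ^+ 2) <= e,
   forall m x y, 0 < x -> x < y -> y < h ->
     J x y (fun r => (K G G1 q (w m) r - lam * G r * w m r) ^+ 2 / G r) <= eta m,
   forall e, 0 < e -> exists N, forall m, (N <= m)%N -> eta m <= e &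
   forall psi, continuous psi ->
     (forall e, 0 < e -> exists N, forall m, (N <= m)%N -> J 0 h (fun x => G x * (w m x - psi x) ^+ 2) <= e) ->
     {ae mu, forall x, 0 < x < h -> comp s (f x) = h_ x * psi x}].
Proof.
move=> [[mf _ _ _] _ [g [gdom N_0 M_0]]].
pose NN n := sqnormH l0 l1 (fun x => g n x - f x).
pose MM n := sqnormH l0 l1 (fun x => ham (g n) x - lam%:C * f x).
have NN0 n : (0 <= NN n)%E by apply: integral_ge0 => x _; rewrite lee_fin; exact: (dens_ge0 (fun x => g n x - f x)).
have MM0 n : (0 <= MM n)%E.
  by apply: integral_ge0 => x _; rewrite lee_fin; exact: (dens_ge0 (fun x => ham (g n) x - lam%:C * f x)).
have [n1 hn1] := ecvg0 NN0 N_0 ltr01; have [n2 hn2] := ecvg0 MM0 M_0 ltr01.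
(* Dropping the first terms makes all norms at most 1, hence finite, so that [fine] loses
   nothing. *)
pose k m := (m + (n1 + n2))%N.
have fin (M : \bar R) : (0 <= M)%E -> (M <= 1%:E)%E -> M = (fine M)%:E.
  by move=> M0 M1; rewrite fineK// ge0_fin_numE// (le_lt_trans M1)// ltry.
have fN m : NN (k m) = (fine (NN (k m)))%:E.
  by apply: fin => //; apply: hn1; rewrite /k addnCA leq_addr.
have fM m : MM (k m) = (fine (MM (k m)))%:E.
  by apply: fin => //; apply: hn2; rewrite /k addnA leq_addl.
have km n m : (n <= m)%N -> (n <= k m)%N by move=> h'; rewrite (leq_trans h')// leq_addr.
pose r m x := comp s (g (k m) x).
have sr m : smooth (r m) by case: (gdom (k m)) => _ [s1 s2]; rewrite /r; case: (s).
have mg m : cmeasurable (g (k m)) by case: (gdom (k m)) => -[].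
have cw m : continuous (fun x => r m x / h_ x).
  by apply: (smooth_cont (f := fun x => r m x / h_ x)); exact: smooth_div.
have gaN m e : (NN (k m) <= e%:E)%E -> (\int[mu]_(x in `[0%R, 1%R]) (dens (fun y => g (k m) y - f y) x)%:E <= e%:E)%E by [].
have mD m A : measurable_fun A (dens (fun y => g (k m) y - f y)).
  by apply: meas_dens; apply: cmeasurableB.
(* The residual in w is that of the graph limit minus lam times the error of the function; the
   factor 2 undoes the 2^-1 of [half_sqrB]. *)
exists (fun m x => r m x / h_ x), (fun m => 2 * (fine (MM (k m)) + lam ^+ 2 * fine (NN (k m)))).
split.
- by move=> m; exact: smooth_div.
- move=> e e0; have [n hn] := ecvg0 NN0 N_0 (divr_gt0 e0 (ltr0Sn R 3)).
  exists n => m m' nm nm'.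
  have c1 : continuous (fun x => G x * (r m x / h_ x - r m' x / h_ x) ^+ 2).
    by apply: contM => //; apply: contX; apply: contB.
  have : J 0 h (fun x => 2^-1 * (G x * (r m x / h_ x - r m' x / h_ x) ^+ 2)) <= e / 4 + e / 4.
    apply: (J_le_add _ le_half_unit (@mD m' _) (fun x _ => dens_ge0 (fun y => g (k m) y - f y) x)
      (fun x _ => dens_ge0 (fun y => g (k m') y - f y) x) _ (gaN _ _ (hn _ (km _ _ nm))) (gaN _ _ (hn _ (km _ _ nm')))).
      by apply: contW; exact: contZ.
    move=> x _; rewrite wG_sqr; apply/andP; split; first by rewrite mulr_ge0// sqr_ge0.
    have -> : ga x * (h_ x * (r m x / h_ x - r m' x / h_ x)) =
        ga x * comp s (g (k m) x - f x) - ga x * comp s (g (k m') x - f x).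
      by rewrite !compB /r; field.
    apply: (le_trans (half_sqrB _ _)); apply: lerD; first exact: (comp_dens s (fun y => g (k m) y - f y)).
    exact: (comp_dens s (fun y => g (k m') y - f y)).
  rewrite JZ; last exact: contW.
  by move: (J 0 h _) => j; lra.
- move=> m x y x0 xy yh.
  have reg (z : R) : x <= z <= y -> regular z.
    by move=> /andP[xz zy]; apply: regular_half; rewrite (lt_le_trans x0 xz) (le_lt_trans zy yh).
  have cK' : continuous (K G G1 q (fun z => r m z / h_ z)) by apply: cont_K => //; exact: smooth_div.
  have cD : continuous (fun z => (K G G1 q (fun z => r m z / h_ z) z - lam * G z * (r m z / h_ z)) ^+ 2).
    by apply: contX; apply: contB => //; apply: contM => //; exact: contZ.
  have cX : {within `[x, y], continuous (fun z => (K G G1 q (fun z => r m z / h_ z) z - lam * G z * (r m z / h_ z)) ^+ 2 / G z)}.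
    apply: itv_cont => z /reg hz; apply: cvgM; first exact: cD.
    by apply: cvgV; [rewrite gt_eqF// (wG_gt0 l0 l1 a3 hun hz)|exact: cG].
  have unit_xy : [set` `[x, y]] `<=` [set` `[0%R, 1%R]].
    move=> z /=; rewrite !in_itv/= => /andP[xz zy]; rewrite (le_trans (ltW x0) xz) (le_trans zy)// (le_trans (ltW yh))//.
    by rewrite invf_le1// ler1n.
  have iQ : (\int[mu]_(x in `[0%R, 1%R]) (lam ^+ 2 * dens (fun y => g (k m) y - f y) x)%:E <=
      (lam ^+ 2 * fine (NN (k m)))%:E)%E.
    under eq_integral do rewrite EFinM.
    rewrite ge0_integralZl_EFin//; first by rewrite (EFinM (lam ^+ 2) (fine _)) -fN.
    - by move=> z _; rewrite lee_fin; exact: dens_ge0.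
    - by apply/measurable_EFinP; exact: mD.
    - exact: sqr_ge0.
  have iP : (\int[mu]_(x in `[0%R, 1%R]) (dens (fun y => ham (g (k m)) y - lam%:C * f y) x)%:E <= (fine (MM (k m)))%:E)%E.
    by rewrite -fM.
  have : J x y (fun z => 2^-1 * ((K G G1 q (fun z => r m z / h_ z) z - lam * G z * (r m z / h_ z)) ^+ 2 / G z)) <=
      fine (MM (k m)) + lam ^+ 2 * fine (NN (k m)).
    apply: (J_le_add _ unit_xy _ _ _ _ iP iQ).
    + by move=> z; apply: cvgM; [exact: cvg_cst|exact: cX].
    + by apply: measurable_funM; [exact: measurable_cst|exact: mD].
    + by move=> z _; exact: dens_ge0.
    + by move=> z _; rewrite mulr_ge0 ?sqr_ge0//; exact: dens_ge0.
    + move=> z /reg hz; rewrite (operator_residual _ (sr m) hz); apply/andP; split.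
        by rewrite mulr_ge0// sqr_ge0.
      exact: comp_residual.
  rewrite JZ//.
  by move: (J x y _) => j; lra.
- move=> e e0; have L0 : 0 < 4 * (1 + lam ^+ 2) by rewrite mulr_gt0// ltr_wpDr// sqr_ge0.
  have [n hn] := ecvg0 NN0 N_0 (divr_gt0 e0 L0).
  have [n' hn'] := ecvg0 MM0 M_0 (divr_gt0 e0 (ltr0Sn R 3)).
  exists (n + n')%N => m nm.
  have h1 : fine (NN (k m)) * (4 * (1 + lam ^+ 2)) <= e.
    by rewrite -ler_pdivlMr// -lee_fin -fN; exact: hn _ (km _ _ (leq_trans (leq_addr _ _) nm)).
  have h2 : fine (MM (k m)) <= e / 4.
    by rewrite -lee_fin -fM; exact: hn' _ (km _ _ (leq_trans (leq_addl _ _) nm)).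
  have x0 : 0 <= fine (NN (k m)) by exact: fine_ge0.
  move: h1 h2 x0 (sqr_ge0 lam); move: (fine _) (fine _) (lam ^+ 2) => x y z; nra.
- move=> psi cpsi hpsi.
  pose X x := 2^-1 * (ga x * (comp s (f x) - h_ x * psi x)) ^+ 2.
  have mX : measurable_fun `[0, h] X.
    apply: measurable_funM; first exact: measurable_cst.
    apply: measurable_funX; apply: measurable_funM; first by apply: meas_cont; exact: cont_gauge.
    by apply: measurable_funB; [exact: meas_comp|apply: meas_cont; exact: contM].
  have X0 x : 0 <= X x by rewrite mulr_ge0// sqr_ge0.
  have small e : 0 < e -> (\int[mu]_(x in `[0%R, h]) (X x)%:E <= e%:E)%E.
    move=> e0; have e2 : 0 < e / 2 by exact: divr_gt0.
    have [n hn] := ecvg0 NN0 N_0 e2; have [n' hn'] := hpsi _ e2.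
    pose m := (n + n')%N.
    have := hn _ (km _ m (leq_addr _ _)) => /gaN h1; have := hn' m (leq_addl _ _) => h2.
    have c2 : continuous (fun x => G x * (r m x / h_ x - psi x) ^+ 2).
      by apply: contM => //; apply: contX; exact: contB.
    apply: le_trans (@le_integral_add _ `[0, h]%classic X (dens (fun y => g (k m) y - f y))
      (fun x => G x * (r m x / h_ x - psi x) ^+ 2) (measurable_itv _) mX (meas_cont c2) _ _ _) _.
    + by move=> x _; exact: dens_ge0.
    + by move=> x _; rewrite wG_sqr sqr_ge0.
    + move=> x _; rewrite X0 /= /X wG_sqr.
      have -> : ga x * (comp s (f x) - h_ x * psi x) =
         ga x * (h_ x * (r m x / h_ x - psi x)) - ga x * comp s (g (k m) x - f x).
        by rewrite compB /r; field.
      apply: (le_trans (half_sqrB _ _)); rewrite addrC lerD2r.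
      exact: (comp_dens s (fun y => g (k m) y - f y)).
    rewrite (splitr e) EFinD; apply: leeD.
      apply: le_trans h1; apply: le_integral_any => [|x _|x _|x _]; rewrite ?lee_fin ?dens_ge0//.
      exact: le_half_unit.
    by rewrite -EFin_J ?lee_fin//; exact: contW.
  have := ae_zero_of_small (measurable_itv _) mX (fun x _ => X0 x) small.
  apply: negligibleS => x /= nx hx; apply: nx => hxh.
  have := hx _; rewrite /= in_itv/= !ltW ?(andP hxh).1 ?(andP hxh).2//= => /(_ isT)/eqP.
  rewrite mulf_eq0 invr_eq0 pnatr_eq0 /= sqrf_eq0 mulf_eq0.
  by rewrite (negbTE (gauge_neq0 l0 l1 (regular_half hxh))) /= subr_eq0 => /eqP.
Qed.

End Closure.

Section AlmostEverywhere.
Variable R : realType.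
Local Notation mu := (@lebesgue_measure R).

Lemma ae_imp2 (P Q S : R -> Prop) : {ae mu, forall x, P x} -> {ae mu, forall x, Q x} ->
  (forall x, P x -> Q x -> S x) -> {ae mu, forall x, S x}.
Proof.
move=> hP hQ PQS; apply: negligibleS (negligibleU hP hQ) => x /= nS.
by have [Px|] := pselect (P x); [right => Qx; apply: nS; exact: PQS|left].
Qed.

Lemma ae_imp (P S : R -> Prop) : {ae mu, forall x, P x} -> (forall x, P x -> S x) -> {ae mu, forall x, S x}.
Proof. by move=> hP PS; apply: (ae_imp2 hP hP) => x Px _; exact: PS. Qed.

Lemma ae_all (P : R -> Prop) : (forall x, P x) -> {ae mu, forall x, P x}.
Proof. by move=> hP; exact: aeW. Qed.

Lemma regularN (x : R) : regular (- x) = regular x.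
Proof. by rewrite /regular !mulrN sinN cosN oppr_eq0. Qed.

Lemma regularP1 (x : R) : regular (x + 1) = regular x.
Proof. by rewrite /regular mulrDr mulr1 sinDpi cosDpi !oppr_eq0. Qed.

Lemma regular_ae : {ae mu, forall x, regular x}.
Proof.
(* The indicator function of the regular points is even and 1-periodic and equals 1 on ]0, 1/2[, so
   [ae_extend] applies to it. *)
pose f (x : R) : R[i] := (regular x)%:R.
have : ae_eq_fun f (fun=> 1).
  apply: ae_extend => //.
  - by apply: ae_all => x; rewrite /f regularP1.
  - by apply: ae_all => x; rewrite /f regularN.
  - by apply: ae_all => x hx; rewrite /f regular_half.
move/ae_imp; apply => x; rewrite /f; case: regular => // /eqP.
by rewrite eq_sym oner_eq0.
Qed.

End AlmostEverywhere.

(** * Eigenfunctions with eigenvalue at most E top *)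

Section LowSpectrum.
Variables (R : realType) (p : R) (t u v : R -> R) (a b l0 l1 l2 l3 a2 a3 : R) (d : nat).
Hypotheses (hun : uniformizer p t u v a b) (hl0 : 0 < l0) (hl1 : 0 < l1)
  (ha2 : a2 = - l2 \/ a2 = l2 + 1) (ha3 : a3 = - l3 \/ a3 = l3 + 1)
  (hd : d%:R = - ((l0 + l1) / 2) - 1 - (a2 + a3) / 2).
Implicit Types (x lam : R) (f g : R -> R[i]) (s : bool).
Local Notation mu := (@lebesgue_measure R).
Local Notation G := (wG t a b l0 l1 a3).
Local Notation G1 := (wG1 t a b l0 l1 a3).
Local Notation q := (qf p t a b l0 l1 l2 l3 a2 a3 d).
Local Notation L := (Lop p a b l0 l1 l2 l3 a2 a3 d).
Local Notation h := (2^-1 : R).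
Local Notation h_ := (hh t u v b l0 l1 a3).
Local Notation ga := (Defs.gauge l0 l1).
Local Notation hm := (hamr p l0 l1 l2 l3).
Local Notation ham := (hamiltonian l0 l1 l2 l3 p).

Variables (F : 'I_d.+1 -> {poly R}) (E : 'I_d.+1 -> R) (top : 'I_d.+1).
Hypotheses (LF : forall i, L (F i) = E i *: F i)
  (orth : forall i j, ip t a b l0 l1 a3 (F i) (F j) = (i == j)%:R)
  (Etop : forall i, E i <= E top)
  (lower : forall w, smooth w -> (forall i, J 0 h (fun x => G x * w x * (F i).[t x]) = 0) ->
    E top * J 0 h (fun x => G x * w x * w x) <= J 0 h (fun x => K G G1 q w x * w x)).

Definition Phi i x : R[i] := (h_ x * (F i).[t x])%:C.
Definition Psi (c : 'I_d.+1 -> R[i]) x : R[i] := \sum_i c i * Phi i x.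
Definition cpol s (c : 'I_d.+1 -> R[i]) : {poly R} := \sum_i comp s (c i) *: F i.

Lemma comp_ext (z z' : R[i]) : (forall s, comp s z = comp s z') -> z = z'.
Proof. by move=> e; have := e true; have := e false; case: z {e} => x y; case: z' => x' y' /= -> ->. Qed.

Lemma comp_Psi s c x : comp s (Psi c x) = h_ x * (cpol s c).[t x].
Proof.
have cD (z z' : R[i]) : comp s (z + z') = comp s z + comp s z' by case: (s) z z' => -[? ?] [? ?].
have c0 : comp s (0 : R[i]) = 0 by case: (s).
rewrite /Psi /cpol (big_morph (comp s) cD c0) horner_sum mulr_sumr.
by apply: eq_bigr => i _; rewrite mulrC compZ hornerZ; ring.
Qed.

Let hh0 x : 0 < h_ x := hh_gt0 l0 l1 a3 hun x.
Let hn0 x : h_ x != 0. Proof. by rewrite gt_eqF. Qed.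
Let cG : continuous G := cont_wG hun hl0 hl1.
Let cG1 : continuous G1 := cont_wG1 hun hl0 hl1.
Let cq : continuous q. Proof. by apply: cont_qf; exact: hun. Qed.
Let h0 : 0 < h. Proof. by rewrite invr_gt0. Qed.
Let G_gt0 x : 0 < x < h -> 0 < G x.
Proof. by move=> hx; apply: (wG_gt0 _ _ _ hun); exact: regular_half. Qed.
Let G0 : G 0 = 0. Proof. exact: wG_0 hun hl0 hl1. Qed.
Let Gh : G h = 0. Proof. exact: wG_half hun hl0 hl1. Qed.
Let dG x : 0 < x < h -> der x G (G1 x).
Proof. by move=> hx; apply: (d_wG _ _ _ hun); exact: regular_half. Qed.
Let cP P : continuous (fun x => P.[t x]). Proof. by apply: cont_horner; exact: hun. Qed.
Let sP (P : {poly R}) : smooth (fun x => P.[t x]). Proof. by apply: smooth_horner; exact: (smooth_t hun). Qed.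
Let shP (P : {poly R}) : smooth (fun x => h_ x * P.[t x]).
Proof. by apply: smoothM; [exact: smooth_hh hun|exact: sP]. Qed.

Lemma Psi_indep c : ae_eq_fun (Psi c) (fun=> 0) -> forall i, c i = 0.
Proof.
move=> ae0 i; apply: comp_ext => s; rewrite [RHS](_ : _ = 0); last by case: (s).
have cPP : continuous (fun x => G x * (cpol s c).[t x] * (cpol s c).[t x]).
  by apply: contM => //; exact: contM.
have ip0 : ip t a b l0 l1 a3 (cpol s c) (cpol s c) = 0.
  have : ((ip t a b l0 l1 a3 (cpol s c) (cpol s c))%:E = 0)%E; last by move=> [].
  rewrite /ip EFin_J; last exact: contW.
  rewrite (ae_eq_integral (cst 0%E)) ?integral0//.
  - by apply/measurable_EFinP; exact: meas_cont.
  - apply: (ae_imp ae0) => x e _ /=; have := comp_Psi s c x; rewrite e.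
    rewrite [LHS](_ : _ = 0); last by case: (s).
    by move/esym/eqP; rewrite mulf_eq0 (negbTE (hn0 x)) /= => /eqP ->; rewrite mulr0.
have P0 : cpol s c = 0.
  by apply/eqP/negPn/negP => /(ip_gt0 a3 hun hl0 hl1); rewrite ip0 ltxx.
have := ip_suml a3 hun hl0 hl1 (fun j => comp s (c j)) F (F i).
rewrite -/(cpol s c) P0 -(scale0r (0 : {poly R})) (ipZl _ hun hl0 hl1) mul0r.
rewrite (bigD1 i)//= orth eqxx mulr1 big1 ?addr0; first by move=> <-.
by move=> j /negbTE ji; rewrite orth ji mulr0.
Qed.

Lemma ham_Psi c x : regular x -> ham (Psi c) x = Psi (fun i => c i * (E i)%:C) x.
Proof.
move=> hx; apply: comp_ext => s; rewrite comp_ham comp_Psi.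
have -> : (fun y => comp s (Psi c y)) = fun y => h_ y * (cpol s c).[t y].
  by apply/funext => y; rewrite comp_Psi.
rewrite (hamr_hh hun ha2 ha3 hd (@sP _) hx) (K_poly l2 l3 a2 a3 d hun hl0 hl1).
have Gx : G x != 0 by rewrite gt_eqF// (wG_gt0 l0 l1 a3 hun hx).
rewrite [G x * _]mulrC mulfK//; congr (_ * _.[_]).
have LS (P : 'I_d.+1 -> {poly R}) : L (\sum_i P i) = \sum_i L (P i).
  apply: (big_morph L (LopD p a b l0 l1 l2 l3 a2 a3 d)).
  by rewrite -[X in L X](scale0r (0 : {poly R})) LopZ scale0r.
rewrite /cpol LS; apply: eq_bigr => i _; rewrite LopZ LF scalerA; congr (_ *: _).
by rewrite [c i * _]mulrC compZ mulrC.
Qed.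

Lemma Psi_per c x : Psi c (x + 1) = Psi c x.
Proof. by apply: eq_bigr => i _; rewrite /Phi (hhper l0 l1 a3 hun) (tper hun). Qed.
Lemma Psi_even c x : Psi c (- x) = Psi c x.
Proof. by apply: eq_bigr => i _; rewrite /Phi (hhN l0 l1 a3 hun) (tN hun). Qed.

Lemma Psi_comp s c : (fun x => comp s (Psi c x)) = fun x => h_ x * (cpol s c).[t x].
Proof. by apply/funext => x; rewrite comp_Psi. Qed.

Lemma Psi_dom c : ham_dom l0 l1 (Psi c).
Proof.
have cm s : continuous (fun x => h_ x * (cpol s c).[t x]).
  by apply: (smooth_cont (f := fun x => h_ x * (cpol s c).[t x])); exact: shP.
split; last by split; [rewrite [X in smooth X](Psi_comp true c)|rewrite [X in smooth X](Psi_comp false c)]; exact: shP.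
split.
- split; [rewrite [X in measurable_fun _ X](Psi_comp true c)|rewrite [X in measurable_fun _ X](Psi_comp false c)];
  exact: meas_cont.
- by apply: ae_all => x; rewrite Psi_per.
- by apply: ae_all => x; rewrite Psi_even.
- have -> : sqnormH l0 l1 (Psi c) = (\int[mu]_(x in `[0%R, 1%R])
      (G x * (cpol true c).[t x] ^+ 2 + G x * (cpol false c).[t x] ^+ 2)%:E)%E.
    apply: eq_integral => x _; congr (_%:E); rewrite /sqnormc.
    have /= -> := comp_Psi true c x; have /= -> := comp_Psi false c x.
    by rewrite !(wG_sqr _ hun hl0 hl1); ring.
  rewrite -EFin_J ?ltry//; apply: contW.
  by apply: contD; apply: contM => //; apply: contX; exact: cP.
Qed.

Lemma Phi_Psi i : Phi i = Psi (fun j => (i == j)%:R).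
Proof.
apply/funext => x; rewrite /Psi (bigD1 i)//= eqxx mul1r big1 ?addr0// => j /negbTE ji.
by rewrite eq_sym ji mul0r.
Qed.

Lemma Phi_neq0 i : ~ ae_eq_fun (Phi i) (fun=> 0).
Proof. by rewrite Phi_Psi => /Psi_indep/(_ i)/eqP; rewrite eqxx oner_eq0. Qed.

Lemma ham_Phi i x : regular x -> ham (Phi i) x = (E i)%:C * Phi i x.
Proof.
move=> hx; rewrite {1}Phi_Psi ham_Psi// /Psi (bigD1 i)//= eqxx mul1r big1 ?addr0// => j /negbTE ji.
by rewrite eq_sym ji !mul0r.
Qed.

Lemma gauge_eq0 x : ~~ regular x -> ga x = 0.
Proof.
rewrite /regular negb_and !negbK /Defs.gauge => /orP[] /eqP ->; rewrite normr0 powR0 ?mul0r ?mulr0//.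
  by rewrite gt_eqF// addr_gt0.
by rewrite gt_eqF// addr_gt0.
Qed.

Lemma Phi_eigen i : eigenfunH l0 l1 l2 l3 p (E i)%:C (Phi i).
Proof.
have dom := Psi_dom (fun j => (i == j)%:R); rewrite -Phi_Psi in dom.
have sq0 f : (forall x, regular x -> f x = 0) -> sqnormH l0 l1 f = 0%E.
  move=> f0; apply: integral0_eq => x _; congr (_%:E).
  have [hx|hx] := boolP (regular x); last by rewrite gauge_eq0// expr0n mulr0.
  by rewrite f0// /sqnormc /= expr0n addr0 mul0r.
split; first exact: Phi_neq0.
split; first by case: dom.
  have -> : (fun x => (E i)%:C * Phi i x) = Psi (fun j => (E i)%:C * (i == j)%:R).
    by apply/funext => x; rewrite {1}Phi_Psi /Psi mulr_sumr; apply: eq_bigr => j _; rewrite mulrA.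
  by case: (Psi_dom (fun j => (E i)%:C * (i == j)%:R)).
exists (fun=> Phi i); split => //.
  by rewrite [X in X @ _ --> _](_ : _ = fun=> 0%E); [exact: cvg_cst|apply/funext => n; apply: sq0 => x _; rewrite subrr].
rewrite [X in X @ _ --> _](_ : _ = fun=> 0%E); first exact: cvg_cst.
by apply/funext => n; apply: sq0 => x hx; rewrite ham_Phi// subrr.
Qed.

Lemma eigen_low lam f : lam <= E top -> eigenfunH l0 l1 l2 l3 p lam%:C f ->
  exists i c, E i = lam /\ ae_eq_fun f (fun x => c * Phi i x).
Proof.
move=> lt [fn0 hf].
have sphi i : smooth (fun x => (F i).[t x]) by exact: sP.
have eig i x : 0 <= x <= h -> K G G1 q (fun x => (F i).[t x]) x = E i * G x * (F i).[t x].
  by move=> _; rewrite (K_poly l2 l3 a2 a3 d hun hl0 hl1) LF hornerZ; ring.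
have f_per : ae_eq_fun (fun x => f (x + 1)) f by case: hf => -[].
have f_even : ae_eq_fun (fun x => f (- x)) f by case: hf => -[].
have [[i Ei]|no] := pselect (exists i, E i = lam).
  have [al [be [x0 [al0 albe beh hx0 [px0 mass]]]]] := mass_inside h0 cG sphi orth i.
  (* The two components of f are real multiples of the same function; the two factors make up one
     complex coefficient. *)
  have lim s : exists c : R, {ae mu, forall x, 0 < x < h -> comp s (f x) = h_ x * (c * (F i).[t x])}.
    have [w [eta [sw H1 H2 H3 H4]]] := approximating_sequence hun hl0 hl1 ha2 ha3 hd s hf.
    have [c hc] := at_eigenvalue h0 cG cG1 cq G_gt0 G0 Gh dG sphi eig orth sw H1 H2 H3 Ei al0 albe beh hx0 px0 mass.
    by exists c; apply: H4 hc; exact: contZ.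
  have [c1 h1] := lim true; have [c2 h2] := lim false.
  exists i, (c1 +i* c2); split => //; apply: ae_extend => //.
  - by move=> x; have := Psi_per (fun j => (i == j)%:R) x; rewrite -Phi_Psi => ->.
  - by move=> x; have := Psi_even (fun j => (i == j)%:R) x; rewrite -Phi_Psi => ->.
  - apply: (ae_imp2 h1 h2) => x e1 e2 hx.
    apply: comp_ext => s; rewrite mulrC compZ.
    by case: s; [rewrite e1//|rewrite e2//]; rewrite /comp /=; ring.
case: fn0.
have lim s : {ae mu, forall x, 0 < x < h -> comp s (f x) = h_ x * 0}.
  have [w [eta [sw H1 H2 H3 H4]]] := approximating_sequence hun hl0 hl1 ha2 ha3 hd s hf.
  apply: H4; first exact: contC.
  move=> e e0; have E0n i : E i != lam by apply/eqP => Ei; apply: no; exists i.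
  have [N hN] := off_spectrum h0 cG cG1 cq G_gt0 G0 Gh dG sphi eig orth sw H2 H3 lower lt E0n e0.
  exists N => m /hN; congr (_ <= _); apply: eq_J => x _; by rewrite subr0.
apply: ae_extend => //.
apply: (ae_imp2 (lim true) (lim false)) => x e1 e2 hx.
by apply: comp_ext => s; case: s; [rewrite e1//|rewrite e2//]; rewrite mulr0.
Qed.

End LowSpectrum.

(** * Counting eigenvalues *)

Section Counting.
Variables (R : realType) (p : R) (t u v : R -> R) (a b l0 l1 l2 l3 a2 a3 : R) (d : nat).
Hypotheses (hun : uniformizer p t u v a b) (hl0 : 0 < l0) (hl1 : 0 < l1)
  (ha2 : a2 = - l2 \/ a2 = l2 + 1) (ha3 : a3 = - l3 \/ a3 = l3 + 1)
  (hd : d%:R = - ((l0 + l1) / 2) - 1 - (a2 + a3) / 2).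
Implicit Types (x lam : R) (f g : R -> R[i]).
Local Notation G := (wG t a b l0 l1 a3).
Local Notation G1 := (wG1 t a b l0 l1 a3).
Local Notation q := (qf p t a b l0 l1 l2 l3 a2 a3 d).
Local Notation L := (Lop p a b l0 l1 l2 l3 a2 a3 d).
Local Notation h := (2^-1 : R).
Local Notation h_ := (hh t u v b l0 l1 a3).
Local Notation ham := (hamiltonian l0 l1 l2 l3 p).

Variables (F : 'I_d.+1 -> {poly R}) (E : 'I_d.+1 -> R) (top : 'I_d.+1).
Hypotheses (sF : forall i, (size (F i) <= d.+1)%N) (LF : forall i, L (F i) = E i *: F i)
  (orth : forall i j, ip t a b l0 l1 a3 (F i) (F j) = (i == j)%:R)
  (span : forall P : {poly R}, (size P <= d.+1)%N -> exists c : 'I_d.+1 -> R, P = \sum_(i < d.+1) c i *: F i)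
  (Etop : forall i, E i <= E top)
  (lower : forall w, smooth w -> (forall i, J 0 h (fun x => G x * w x * (F i).[t x]) = 0) ->
    E top * J 0 h (fun x => G x * w x * w x) <= J 0 h (fun x => K G G1 q w x * w x)).
Local Notation Phi := (Phi t u v b l0 l1 a3 F).
Local Notation Psi := (Psi t u v b l0 l1 a3 F).

(** H(p) is local and the regular points form an open set. *)
Lemma ham_regular f g x : (forall y, regular y -> f y = g y) -> regular x -> ham f x = ham g x.
Proof.
move=> fg hx; rewrite !hamiltonian_components.
have loc (r r' : R -> R) : (forall y, regular y -> r y = r' y) ->
    hamr p l0 l1 l2 l3 r x = hamr p l0 l1 l2 l3 r' x.
  move=> rr.
  have dloc (f1 f2 : R -> R) y : (forall z, regular z -> f1 z = f2 z) -> regular y -> derive1 f1 y = derive1 f2 y.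
    move=> f12 hy; rewrite 2!derive1E; apply: near_eq_derive; near=> z; apply: f12; near: z; exact: regular_near.
  rewrite /hamr (rr _ hx) (dloc _ (derive1 (fun y => Defs.gauge l0 l1 y * r' y)) _ _ hx)// => y hy.
  by apply: dloc hy => z hz; rewrite rr.
by congr (_ +i* _); apply: loc => y /fg ->.
Unshelve. all: by end_near. Qed.

Lemma in_tV_Psi f : in_tV l1 p a2 a3 d f -> exists c, forall x, regular x -> f x = Psi c x.
Proof.
move=> [c fc].
have /choice[B hB] : forall n : 'I_d.+1, exists B : 'I_d.+1 -> R, Bpol p d n = \sum_i B i *: F i.
  by move=> n; apply: span; apply: size_Bpol; rewrite -ltnS.
exists (fun i => \sum_n c n * (B n i)%:C) => x hx; rewrite fc /Psi.
under [RHS]eq_bigr do rewrite mulr_suml.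
rewrite exchange_big; apply: eq_bigr => n _.
rewrite (tV_basis_Bpol hun hd n hx) hB horner_sum mulr_sumr rmorph_sum mulr_sumr.
apply: eq_bigr => i _; rewrite -mulrA -rmorphM; congr (_ * _%:C).
by rewrite hornerZ mulrCA.
Qed.

Lemma eigenvalue_tV_E (z : R[i]) : eigenvalue_tV l0 l1 l2 l3 p a2 a3 d z <-> exists i, z = (E i)%:C.
Proof.
have reg := @regular_ae R.
split=> [[f [/in_tV_Psi[c fc] fn0 ev]]|[i ->]].
  have zero i : c i * (E i)%:C - z * c i = 0.
    apply: (Psi_indep hun hl0 hl1 orth (c := fun i => c i * (E i)%:C - z * c i)).
    apply: (ae_imp2 reg ev) => x hx; rewrite (ham_regular fc hx).
    rewrite (ham_Psi hun hl0 hl1 ha2 ha3 hd LF c hx) (fc _ hx) => e.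
    rewrite -[RHS](subrr (z * Psi c x)) -{1}e /Psi mulr_sumr -sumrB; apply: eq_bigr => j _.
    by rewrite mulrBl -[z * _ * _]mulrA.
  have [[i ci]|no] := pselect (exists i, c i != 0).
    exists i; apply: (mulIf ci); apply/esym/eqP; rewrite -subr_eq0 [_%:C * _]mulrC.
    by rewrite zero.
  case: fn0; apply: (ae_imp reg) => x hx; rewrite fc// /Psi big1// => i _.
  have [->|ci] := eqVneq (c i) 0; first by rewrite mul0r.
  by case: no; exists i.
have [c hc] := Bpol_span p (sF i).
pose f x : R[i] := \sum_n (c n)%:C * (tV_basis l1 p a2 a3 d n x)%:C.
have fP x : regular x -> f x = Phi i x.
  move=> hx; rewrite /f /Phi hc horner_sum mulr_sumr rmorph_sum; apply: eq_bigr => n _.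
  by rewrite (tV_basis_Bpol hun hd n hx) -rmorphM; congr (_%:C); rewrite hornerZ mulrCA.
exists f; split.
- by exists (fun n => (c n)%:C).
- move=> f0; apply: (Phi_neq0 hun hl0 hl1 orth (i := i)).
  by apply: (ae_imp2 reg f0) => x hx <-; rewrite fP.
- apply: (ae_imp reg) => x hx.
  by rewrite (ham_regular fP hx) (ham_Phi hun hl0 hl1 ha2 ha3 hd LF i hx) fP.
Qed.

Lemma mult_ge_of_card (pr : pred R) m : (m <= #|[pred i | pr (E i)]|)%N ->
  mult_ge l0 l1 l2 l3 p (fun r => pr r) m.
Proof.
move=> hm; pose io (k : 'I_m) := enum_val (widen_ord hm k).
have io_inj : injective io by move=> k k' /enum_val_inj/(congr1 val)/= ?; exact: val_inj.
exists (fun k => E (io k)), (fun k => Phi (io k)); split.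
  move=> k; split; first by have := enum_valP (widen_ord hm k).
  exact: (Phi_eigen hun hl0 hl1 ha2 ha3 hd LF orth).
move=> c c0 k.
pose c' i : R[i] := \sum_(k | io k == i) c k.
have -> : c k = c' (io k).
  by rewrite /c' (big_pred1 k)// => k'; rewrite (inj_eq io_inj).
apply: (Psi_indep hun hl0 hl1 orth (c := c')); apply: (ae_imp c0) => x <-.
rewrite /Psi /c'; under eq_bigr do rewrite mulr_suml big_mkcond/=.
rewrite exchange_big; apply: eq_bigr => j _.
by rewrite -big_mkcond (big_pred1 (io j))// => i; rewrite eq_sym.
Qed.

(** Each eigenfunction is a multiple of some [Phi i] by [eigen_low], and two eigenfunctions with the
    same index would be proportional; independence therefore makes the choice of index injective. *)
Lemma card_of_mult_ge (pr : pred R) m : (forall r, pr r -> r <= E top) ->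
  mult_ge l0 l1 l2 l3 p (fun r => pr r) m -> (m <= #|[pred i | pr (E i)]|)%N.
Proof.
move=> pr_top [E' [F' [ev indep]]].
have /choice[io /choice[cc hio]] : forall k, exists i c, E i = E' k /\ ae_eq_fun (F' k) (fun x => c * Phi i x).
  move=> k; have [hk fk] := ev k.
  exact: (eigen_low hun hl0 hl1 ha2 ha3 hd LF orth lower (pr_top _ hk) fk).
have io_inj : injective io.
  move=> k l kl; apply/eqP/negPn/negP => nkl.
  (* The relation cc l F'_k - cc k F'_l = 0. Independence gives cc l = 0, so F'_l would vanish
     almost everywhere. *)
  pose c j : R[i] := if j == k then cc l else if j == l then - cc k else 0.
  have c0 : forall j, c j = 0.
    apply: indep; apply: (ae_imp2 (hio k).2 (hio l).2) => x ek el.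
    rewrite (bigD1 k)//= (bigD1 l)/=; last by rewrite eq_sym.
    rewrite big1 => [|j /andP[jk jl]]; last by rewrite /c (negbTE jk) (negbTE jl) mul0r.
    by rewrite /c eqxx [l == k]eq_sym (negbTE nkl) eqxx ek el kl; ring.
  have := c0 k; rewrite /c eqxx => ccl; case: (ev l) => _ [] + _; apply.
  by apply: (ae_imp (hio l).2) => x ->; rewrite ccl mul0r.
rewrite -{1}(card_ord m) -(card_codom io_inj); apply: subset_leq_card.
by apply/fintype.subsetP => i /codomP[k ->]; rewrite inE (hio k).1; case: (ev k).
Qed.

(** Up to E top multiplicities on H are cardinalities of sets of indices, so the numbering of
    eigenvalues becomes a count. The value m = 0 is harmless: [mult_ge] always holds at 0, so no
    number is a 0-th eigenvalue. *)
Lemma spectrum_bottom :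
  [set z : R[i] | eigenvalue_tV l0 l1 l2 l3 p a2 a3 d z] =
    [set z : R[i] | exists (m : nat) (e : R),
       [/\ (m <= d.+1)%N, mth_eigenvalueH l0 l1 l2 l3 p m e & z = e%:C]] /\
  (forall (m : nat) (e : R), mth_eigenvalueH l0 l1 l2 l3 p m e ->
     (eigenvalue_tV l0 l1 l2 l3 p a2 a3 d e%:C <-> (m <= d.+1)%N)).
Proof.
have card_le (pr : pred R) : (#|[pred i | pr (E i)]| <= d.+1)%N.
  by rewrite -[X in (_ <= X)%N]card_ord max_card.
have part2 m e : mth_eigenvalueH l0 l1 l2 l3 p m e ->
     (eigenvalue_tV l0 l1 l2 l3 p a2 a3 d e%:C <-> (m <= d.+1)%N).
  move=> [h1 h2]; have h2' : (#|[pred i | (E i < e)%R]| < m)%N.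
    by rewrite ltnNge; apply/negP => hm; apply: h2; exact: (mult_ge_of_card (pr := fun r => r < e)).
  rewrite eigenvalue_tV_E; have [et|te] := leP e (E top).
    have h1' : (m <= #|[pred i | (E i <= e)%R]|)%N.
      by apply: (card_of_mult_ge (pr := fun r => r <= e)) => // r re; exact: le_trans et.
    split=> [_|_]; first exact: (leq_trans h1' (card_le (fun r => r <= e))).
    (* If e were none of the E i, then equally many E i would be below e and at most e, which [h1']
       and [h2'] exclude. *)
    have [[i Ei]|no] := pselect (exists i, E i = e); first by exists i; rewrite Ei.
    move: h2'; rewrite ltnNge; case/negP; apply: (leq_trans h1'); apply: subset_leq_card.
    apply/fintype.subsetP => i; rewrite !inE le_eqVlt => /orP[/eqP Ei|//].
    by case: no; exists i.
  split=> [[i [ei]]|]; first by move: te; rewrite ei ltNge Etop.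
  have cE : (d.+1 = #|[pred i | (E i < e)%R]|)%N.
    by rewrite -[LHS]card_ord; apply: eq_card => i; rewrite !inE (le_lt_trans (Etop i)).
  by move: h2'; rewrite -cE ltnNge => /negbTE ->.
split => //; apply/seteqP; split => z /=; last first.
  by move=> [m [e [md he ->]]]; apply/(part2 m).
move/eigenvalue_tV_E => [i ->].
(* The largest possible rank of E i: all indices with E j <= E i are counted, and strictly fewer
   satisfy E j < E i. *)
exists #|[pred j | (E j <= E i)%R]|, (E i); split=> [||//]; first exact: (card_le (fun r => r <= E i)).
split.
  exact: (mult_ge_of_card (pr := fun r => r <= E i)).
move=> hlt; have := @card_of_mult_ge (fun r => r < E i) _ (fun r ri => le_trans (ltW ri) (Etop i)) hlt.
apply/negP; rewrite -ltnNge; apply: proper_card; apply/properP; split.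
  by apply/fintype.subsetP => j; rewrite !inE; exact: ltW.
by exists i; rewrite !inE ?lexx ?ltxx.
Qed.

End Counting.

Theorem theorem5p5 (R : realType) (l0 l1 l2 l3 a2 a3 : R) (d : nat) (p : R)
    (hl0 : 0 < l0) (hl1 : 0 < l1)
    (hl : 2^-1 <= l0 \/ 2^-1 <= l1)
    (ha2 : a2 = - l2 \/ a2 = l2 + 1)
    (ha3 : a3 = - l3 \/ a3 = l3 + 1)
    (hd : d%:R = - ((l0 + l1) / 2) - 1 - (a2 + a3) / 2)
    (hp : -1 < p < 1) :
  [set z : R[i] | eigenvalue_tV l0 l1 l2 l3 p a2 a3 d z] =
    [set z : R[i] | exists (m : nat) (E : R),
       [/\ (m <= d.+1)%N, mth_eigenvalueH l0 l1 l2 l3 p m E & z = E%:C]] /\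
  (forall (m : nat) (E : R), mth_eigenvalueH l0 l1 l2 l3 p m E ->
     (eigenvalue_tV l0 l1 l2 l3 p a2 a3 d E%:C <-> (m <= d.+1)%N)).
Proof.
have [t [u [v [a [b hun]]]]] := uniformizer_exists hp.
have [F [E [top [[sF LF orth span] Etop lower]]]] := eigensystem l2 l3 hun hl0 hl1 hd.
exact: (spectrum_bottom hun hl0 hl1 ha2 ha3 hd sF LF orth span Etop lower).
Qed.
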